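(* There exists a Poisson structure $\pi_0$ on $U/K_0$ such that the natural projection $p:(U,\pi_U)\to(U/K_0,\pi_0)$, $u\mapsto uK_0$, is a Poisson map. The symplectic leaves of $\pi_0$ are precisely the images under $p$ of the $G_0$-orbits in $U$, where $G_0$ acts on $U$ from the right as a subgroup of $G$ via $u^g=u_1$ if $ug=bu_1$ with $b\in AN$, $u_1\in U$.
   Context: Let $\mathfrak g_0$ be a real semisimple Lie algebra with complexification $\mathfrak g$ and Cartan decomposition $\mathfrak g_0=\mathfrak k_0+\mathfrak p_0$; let $\mathfrak u=\mathfrak k_0+i\mathfrak p_0$, a compact real form of $\mathfrak g$. Let $G$ be the connected and simply connected Lie group with Lie algebra $\mathfrak g$, and $G_0,K_0,U$ its connected subgroups with Lie algebras $\mathfrak g_0,\mathfrak k_0,\mathfrak u$; then $K_0=G_0\cap U$. Let $\tau,\theta$ be the complex conjugations of $\mathfrak g$ with respect to $\mathfrak g_0$ and $\mathfrak u$. A Borel subalgebra $\mathfrak b$ of $\mathfrak g$ is called Iwasawa relative to $\mathfrak g_0$ if $\mathfrak b\supset\mathfrak a_0'+\mathfrak n_0'$ for some Iwasawa decomposition $\mathfrak g_0=\mathfrak k_0'+\mathfrak a_0'+\mathfrak n_0'$ of $\mathfrak g_0$. Fix an Iwasawa–Borel subalgebra $\mathfrak b$ relative to $\mathfrak g_0$ and a Cartan subalgebra $\mathfrak h\subset\mathfrak b$ of $\mathfrak g$ stable under both $\tau$ and $\theta$. Let $\Delta^+$ be the set of roots of $\mathfrak h$ determined by $\mathfrak b$,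 and $\mathfrak n$ the complex span of the root vectors for roots in $\Delta^+$, so $\mathfrak b=\mathfrak h+\mathfrak n$. Let $\mathfrak a=\{x\in\mathfrak h:\theta(x)=-x\}$, $\mathfrak a_0=\mathfrak a\cap\mathfrak g_0$, $\mathfrak n_0=\mathfrak n\cap\mathfrak g_0$; then $\mathfrak g_0=\mathfrak k_0+\mathfrak a_0+\mathfrak n_0$ is an Iwasawa decomposition. Put $A=\exp\mathfrak a$, $N=\exp\mathfrak n$; every element of $G$ is uniquely of the form $bu_1$ with $b\in AN$, $u_1\in U$. The Poisson structure $\pi_U$ on $U$: let $\ll\cdot,\cdot\gg$ be the Killing form of $\mathfrak g$. For each $\alpha\in\Delta^+$ choose a root vector $E_\alpha$ with $\ll E_\alpha,\theta(E_\alpha)\gg=-1$, and set $E_{-\alpha}=-\theta(E_\alpha)$, $X_\alpha=E_\alpha-E_{-\alpha}$, $Y_\alpha=i(E_\alpha+E_{-\alpha})$ (elements of $\mathfrak u$). Let $\Lambda=\frac14\sum_{\alpha\in\Delta^+}X_\alpha\wedge Y_\alpha\in\mathfrak u\wedge\mathfrak u$ and $\pi_U=\Lambda^r-\Lambda^l$, where $\Lambda^r,\Lambda^l$ are the right and left invariant bivector fields on $U$ with value $\Lambda$ at the identity. Then $\pi_U$ is a Poisson bivector field making $U$ a Poisson–Lie group. *)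

(* Defs.v *)
From HB Require Import structures.
From mathcomp Require Import all_boot all_order all_algebra.
From mathcomp Require Import complex.
From mathcomp Require Import all_classical all_reals all_analysis.
From Stdlib Require Import Relations.
Set Implicit Arguments.
Unset Strict Implicit.
Unset Printing Implicit Defensive.
Import Order.TTheory GRing.Theory Num.Theory.
Import numFieldNormedType.Exports.
Local Open Scope classical_set_scope.
Local Open Scope ring_scope.

HB.mixin Record hasLieBracket (K : fieldType) V of Vector K V := {
  lie : V -> V -> V;
  lie_linearl : forall y : V, linear (fun x => lie x y);
  lie_linearr : forall x : V, linear (lie x);
  liexx : forall x : V, lie x x = 0;
  lie_jacobi : forall x y z : V,
    lie x (lie y z) + lie y (lie z x) + lie z (lie x y) = 0
}.

#[short(type="lieAlgType")]
HB.structure Definition LieAlg (K : fieldType) :=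
  {V of hasLieBracket K V & Vector K V}.

Section LieAlgebra.
Context (K : fieldType) (L : lieAlgType K).
Implicit Types (U V W I b h n : {vspace L}) (x y : L).

Definition liev U V : {vspace L} :=
  <<[seq lie x y | x <- vbasis U, y <- vbasis V]>>%VS.

Definition subalgebra U : Prop := (liev U U <= U)%VS.
Definition ideal I : Prop := (liev fullv I <= I)%VS.

Definition solvable U : Prop :=
  exists m, iter m (fun W => liev W W) U = 0%VS.
Definition nilpotent U : Prop := exists m, iter m (liev U) U = 0%VS.

Definition semisimple : Prop :=
  forall I, ideal I -> solvable I -> I = 0%VS.

Definition borel b : Prop :=
  [/\ subalgebra b, solvable b &
      forall c, subalgebra c -> solvable c -> (b <= c)%VS -> c = b].

Definition cartan_subalgebra h : Prop :=
  [/\ subalgebra h, nilpotent h &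
      forall x, (forall y, y \in h -> lie x y \in h) -> x \in h].

(* The trace of [ad x \o ad y]. *)
Definition killing x y : K :=
  \sum_(i < \dim {:L}) coord (vbasis {:L}) i (lie x (lie y (vbasis {:L})`_i)).

(* [subvs_of h] is the subspace [h] regarded as a vector space of its own, so
   [functional h] is the dual space of [h]. *)
Definition functional h := 'Hom(subvs_of h, K^o).

Definition root_space h (al : functional h) : set L :=
  [set x | forall y : subvs_of h, lie (vsval y) x = (al y : K) *: x].

Definition is_root h (al : functional h) : Prop :=
  al <> 0 /\ exists2 x, root_space al x & x <> 0.

Definition positive_system h (P : set (functional h)) : Prop :=
  [/\ forall al, P al -> is_root al,
      forall al, is_root al -> P al <-> ~ P (- al) &
      forall al be, P al -> P be -> is_root (al + be) -> P (al + be)].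

Definition is_span (S : set L) W : Prop :=
  forall W', (W <= W')%VS <-> (forall x, S x -> x \in W').

Definition is_root_span h (P : set (functional h)) n : Prop :=
  is_span [set x | exists2 al, P al & root_space al x] n.

End LieAlgebra.

Section RealLieAlgebra.
Context (R : realType) (L : lieAlgType R).
Implicit Types (k p a n : {vspace L}).

Definition cartan_decomposition k p : Prop :=
  [/\ (k + p = fullv)%VS /\ directv (k + p),
      [/\ (liev k k <= k)%VS, (liev k p <= p)%VS & (liev p p <= k)%VS],
      forall x, x \in k -> x <> 0 -> killing x x < 0 &
      forall x, x \in p -> x <> 0 -> 0 < killing x x].

Definition maximal_abelian_in p a : Prop :=
  [/\ (a <= p)%VS, liev a a = 0%VS &
      forall c, (c <= p)%VS -> liev c c = 0%VS -> (a <= c)%VS -> c = a].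

Definition iwasawa_decomposition k a n : Prop :=
  (k + a + n = fullv)%VS /\ directv (k + a + n) /\
  exists p, [/\ cartan_decomposition k p, maximal_abelian_in p a &
    exists2 P : set (functional a), positive_system P & is_root_span P n].

End RealLieAlgebra.

Section Complexification.
Context (R : realType).

Definition complexification (g0 : lieAlgType R) (g : lieAlgType R[i])
    (iota : g0 -> g) : Prop :=
  [/\ forall (c : R) x y, iota (c *: x + y) = (c%:C)%C *: iota x + iota y,
      forall x y, iota (lie x y) = lie (iota x) (iota y) &
      forall z, exists! xy : g0 * g0, z = iota xy.1 + ('i)%C *: iota xy.2].

(* [s] is the complex conjugation with respect to the real form [S]. *)
Definition conjugation (g : lieAlgType R[i]) (S : set g) (s : g -> g) : Prop :=
  forall x y, S x -> S y -> s (x + ('i)%C *: y) = x - ('i)%C *: y.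

Definition compact_form (g0 : lieAlgType R) (g : lieAlgType R[i])
    (iota : g0 -> g) (k0 p0 : {vspace g0}) : set g :=
  [set z | exists x y, [/\ x \in k0, y \in p0 & z = iota x + ('i)%C *: iota y]].

Definition iwasawa_borel (g0 : lieAlgType R) (g : lieAlgType R[i])
    (iota : g0 -> g) (b : {vspace g}) : Prop :=
  borel b /\ exists k a n : {vspace g0}, iwasawa_decomposition k a n /\
    forall x, x \in (a + n)%VS -> iota x \in b.

Definition borel_roots (g : lieAlgType R[i]) (h b : {vspace g}) :
    set (functional h) :=
  [set al | is_root al /\ forall x, root_space al x -> x \in b].

End Complexification.

Section Smooth.
Context (R : realType).

(* Existence and continuity of all iterated directional derivatives up to order
   [k] on the open set [O].  This is the class C^k because [V] is only ever a
   finite-dimensional space below. *)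
Fixpoint Ck (V W : normedModType R) (k : nat) (O : set V) (f : V -> W) : Prop :=
  (forall x, O x -> {for x, continuous f}) /\
  match k with
  | 0 => True
  | k'.+1 => forall v, (forall x, O x -> derivable f x v) /\
                       Ck k' O (fun x => 'D_v f x)
  end.

Definition smooth (V W : normedModType R) (O : set V) (f : V -> W) : Prop :=
  forall k, Ck k O f.

(* Only the restriction of [cmap] to [cdom] and that of [cinv] to the image of
   [cmap] are meaningful. *)
Record chart (M : topologicalType) (d : nat) := Chart {
  cdom : set M;
  cmap : M -> 'rV[R]_d;
  cinv : 'rV[R]_d -> M
}.

Section Manifold.
Context (M : topologicalType) (d : nat).
Implicit Types (c : chart M d) (A : set (chart M d)).

Definition cimg c : set 'rV[R]_d := cmap c @` cdom c.

Definition is_chart c : Prop :=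
  [/\ open (cdom c) /\ open (cimg c),
      forall x, cdom c x -> cinv c (cmap c x) = x,
      forall x, cdom c x -> {for x, continuous (cmap c)} &
      forall v, cimg c v -> {for v, continuous (cinv c)}].

Definition manifold A : Prop :=
  [/\ hausdorff_space M /\ @second_countable M,
      forall c, A c -> is_chart c,
      forall x, exists2 c, A c & cdom c x &
      forall c1 c2, A c1 -> A c2 ->
        smooth (cmap c1 @` (cdom c1 `&` cdom c2))
               (fun v => cmap c2 (cinv c1 v))].

Definition smooth_fun A : set (M -> R) :=
  [set f | forall c, A c -> smooth (cimg c) (fun v => f (cinv c v) : R^o)].

Definition derivation A (D : (M -> R) -> M -> R) : Prop :=
  [/\ forall f, smooth_fun A f -> smooth_fun A (D f),
      forall (a : R) f1 f2, smooth_fun A f1 -> smooth_fun A f2 ->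
        forall x, D (fun y => a * f1 y + f2 y) x = a * D f1 x + D f2 x &
      forall f1 f2, smooth_fun A f1 -> smooth_fun A f2 ->
        forall x, D (fun y => f1 y * f2 y) x = f1 x * D f2 x + D f1 x * f2 x].

End Manifold.
End Smooth.

#[short(type="topGroupType")]
HB.structure Definition TopologicalGroup := {G of Group G & Topological G}.

Section LieGroup.
Context (R : realType) (G : topGroupType) (d : nat) (A : set (chart R G d)).

Definition lie_group : Prop :=
  [/\ manifold A,
      continuous (fun x : G * G => (x.1 * x.2)%g),
      continuous (fun x : G => (x^-1)%g),
      forall c1 c2 c3, A c1 -> A c2 -> A c3 ->
        smooth [set v : 'rV[R]_d * 'rV[R]_d | [/\ cimg c1 v.1, cimg c2 v.2 &
                  cdom c3 (cinv c1 v.1 * cinv c2 v.2)%g]]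
               (fun v => cmap c3 (cinv c1 v.1 * cinv c2 v.2)%g) &
      forall c1 c2, A c1 -> A c2 ->
        smooth [set v | cimg c1 v /\ cdom c2 (cinv c1 v)^-1%g]
               (fun v => cmap c2 (cinv c1 v)^-1%g)].

Definition left_invariant (D : (G -> R) -> G -> R) : Prop :=
  forall f, smooth_fun A f ->
    forall u x, D (fun y => f (u * y)%g) x = D f (u * x)%g.

(* [lam] identifies [g], as a real Lie algebra, with the Lie algebra of left
   invariant vector fields on [G]. *)
Definition lie_algebra_iso (g : lieAlgType R[i])
    (lam : g -> (G -> R) -> G -> R) : Prop :=
  [/\ forall x, derivation A (lam x) /\ left_invariant (lam x),
      forall (a : R) x y f, smooth_fun A f ->
        forall u, lam ((a%:C)%C *: x + y) f u = a * lam x f u + lam y f u,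
      forall x y f, smooth_fun A f ->
        forall u, lam (lie x y) f u = lam x (lam y f) u - lam y (lam x f) u,
      forall x, (forall f, smooth_fun A f -> forall u, lam x f u = 0) -> x = 0 &
      forall D, derivation A D -> left_invariant D ->
        exists x, forall f, smooth_fun A f -> forall u, D f u = lam x f u].

(* [t |-> ex (t x)] is the integral curve of [lam x] starting at the identity. *)
Definition exponential_map (g : lieAlgType R[i])
    (lam : g -> (G -> R) -> G -> R) (ex : g -> G) : Prop :=
  ex 0 = 1%g /\
  forall (x : g) (f : G -> R), smooth_fun A f -> forall t : R,
    is_derive t (1 : R) (fun s : R => f (ex ((s%:C)%C *: x)) : R^o)
              (lam x f (ex ((t%:C)%C *: x)) : R^o).

End LieGroup.

Definition simply_connected (R : realType) (T : topologicalType) : Prop :=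
  let I : set R := [set t | 0 <= t <= 1] in
  (forall x y : T, exists c : R -> T,
     [/\ {within I, continuous c}, c 0 = x & c 1 = y]) /\
  (forall c : R -> T, {within I, continuous c} -> c 0 = c 1 ->
     exists H : R * R -> T,
       [/\ {within I `*` I, continuous H},
           forall s, I s -> H (s, 0) = c s,
           forall s, I s -> H (s, 1) = c 0 &
           forall t, I t -> H (0, t) = c 0 /\ H (1, t) = c 0]).

Section Subgroups.
Context (R : realType) (g : lieAlgType R[i]) (G : topGroupType) (ex : g -> G).

Definition subgroup (H : set G) : Prop :=
  H 1%g /\ forall x y, H x -> H y -> H (x * y^-1)%g.

(* The connected Lie subgroup with Lie algebra [S] is generated by the
   exponentials of the elements of [S]. *)
Definition analytic_subgroup (S : set g) : set G :=
  smallest subgroup (ex @` S).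

(* The smooth functions on [H := analytic_subgroup S], given by functions on [G]
   of which only the values on [H] matter.  The smooth structure of [H] is the
   one whose charts are the inverses of the maps [x |-> u * ex x], for [x] near
   0 in [S]; the test is made in linear coordinates on [S]. *)
Definition smooth_on_subgroup (S : set g) : set (G -> R) :=
  [set f | forall u, analytic_subgroup S u ->
     forall m (x : 'I_m -> g), (forall i, S (x i)) ->
       smooth [set: 'rV[R]_m]
         (fun t => f (u * ex (\sum_i ((t 0 i)%:C)%C *: x i))%g : R^o)].

Definition left_coset (H : set G) (u : G) : set G :=
  [set (u * x)%g | x in H].

Definition coset_space (U H : set G) : set (set G) := left_coset H @` U.

(* A function on [U / H], with [U := analytic_subgroup S], is smooth when its
   pullback to [U] is, the projection being a surjective submersion; only the
   values on [coset_space U H] matter. *)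
Definition smooth_on_cosets (S : set g) (H : set G) : set (set G -> R) :=
  [set f | smooth_on_subgroup S (fun u => f (left_coset H u))].

(* The right invariant field is tangent to the curves [t |-> ex (t x) * u], the
   left invariant one to [t |-> u * ex (t x)]. *)
Definition right_inv_field (x : g) (f : G -> R) (u : G) : R :=
  derive1 (fun t : R => f (ex ((t%:C)%C *: x) * u)%g : R^o) 0.
Definition left_inv_field (x : g) (f : G -> R) (u : G) : R :=
  derive1 (fun t : R => f (u * ex ((t%:C)%C *: x))%g : R^o) 0.

End Subgroups.

(* A space is given by the set [M] of its points in an ambient type [T] and the
   set [C] of its smooth functions, represented by functions on [T] of which
   only the values on [M] matter. *)
Section Poisson.
Context (R : realType).
Implicit Type T : Type.

Definition wedge T (D1 D2 : (T -> R) -> T -> R) (f h : T -> R) (x : T) : R :=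
  D1 f x * D2 h x - D2 f x * D1 h x.

Definition poisson_structure T (M : set T) (C : set (T -> R))
    (br : (T -> R) -> (T -> R) -> T -> R) : Prop :=
  [/\ (forall f h, C f -> C h -> C (br f h)) /\
      (forall f f' h h', C f -> C f' -> C h -> C h' ->
         {in M, f =1 f'} -> {in M, h =1 h'} -> {in M, br f h =1 br f' h'}),
      forall (a : R) f1 f2 h, C f1 -> C f2 -> C h ->
        {in M, forall x, br (fun y => a * f1 y + f2 y) h x
                         = a * br f1 h x + br f2 h x},
      forall f h, C f -> C h -> {in M, forall x, br f h x = - br h f x},
      forall f1 f2 h, C f1 -> C f2 -> C h ->
        {in M, forall x, br (fun y => f1 y * f2 y) h x
                         = f1 x * br f2 h x + br f1 h x * f2 x} &
      forall f1 f2 f3, C f1 -> C f2 -> C f3 ->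
        {in M, forall x, br f1 (br f2 f3) x + br f2 (br f3 f1) x
                         + br f3 (br f1 f2) x = 0}].

Definition poisson_map T T' (M : set T) (C : set (T -> R))
    (br : (T -> R) -> (T -> R) -> T -> R)
    (M' : set T') (C' : set (T' -> R))
    (br' : (T' -> R) -> (T' -> R) -> T' -> R) (p : T -> T') : Prop :=
  [/\ forall x, M x -> M' (p x),
      forall f, C' f -> C (f \o p) &
      forall f h, C' f -> C' h ->
        {in M, forall x, br' f h (p x) = br (f \o p) (h \o p) x}].

(* [x] and [y] are joined by an integral curve of the Hamiltonian vector field
   [fun f => br f h]; rescaling [h] normalizes the travel time to 1. *)
Definition hamiltonian_arc T (M : set T) (C : set (T -> R))
    (br : (T -> R) -> (T -> R) -> T -> R) (x y : T) : Prop :=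
  exists h (c : R -> T) (e : R),
    [/\ C h, 0 < e, c 0 = x, c 1 = y &
        forall t, - e < t < 1 + e -> M (c t) /\
          forall f, C f ->
            is_derive t (1 : R) (fun s => f (c s) : R^o) (br f h (c t) : R^o)].

Definition symplectic_leaf T (M : set T) (C : set (T -> R))
    (br : (T -> R) -> (T -> R) -> T -> R) (x : T) : set T :=
  [set y | clos_refl_sym_trans _ (hamiltonian_arc M C br) x y].

Definition symplectic_leaves T (M : set T) (C : set (T -> R))
    (br : (T -> R) -> (T -> R) -> T -> R) : set (set T) :=
  symplectic_leaf M C br @` M.

End Poisson.

Section PoissonU.
Context (R : realType) (g : lieAlgType R[i]) (G : topGroupType) (ex : g -> G).

(* [pi_U f h u] is the value of the bivector [Lambda^r - Lambda^l] at [u] on the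
   pair [(df, dh)].  The root vectors for the negative roots are
   [- theta (E al)], so that [X al] and [Y al] take the form below. *)
Definition pi_U (theta : g -> g) (I : Type) (Dp : seq I) (E : I -> g)
    (f h : G -> R) (u : G) : R :=
  let X al := E al + theta (E al) in
  let Y al := ('i)%C *: (E al - theta (E al)) in
  4^-1 * \sum_(al <- Dp)
    (wedge (right_inv_field ex (X al)) (right_inv_field ex (Y al)) f h u
     - wedge (left_inv_field ex (X al)) (left_inv_field ex (Y al)) f h u).

(* [B] plays the role of [A N]: [u1 = u^x] when [u x = b u1] with [b] in [B]. *)
Definition dressing (B U : set G) (u x u1 : G) : Prop :=
  U u1 /\ exists2 b, B b & (u * x = b * u1)%g.

Definition dressing_orbit (B U G0 : set G) (u : G) : set G :=
  [set u1 | exists2 x, G0 x & dressing B U u x u1].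

End PoissonU.

(* Main.v *)
(* The bracket [pi_0] is [pi_U] of the pullbacks to [U]. The modified Yang-Baxter equation
   makes the Hamiltonian fields on [U / K0] the dressing fields modulo [k0]. A Hamiltonian
   arc stays in the image of one orbit, by Gronwall's inequality for its component
   transverse to the orbit; conversely a dressing curve projects to an arc of a function
   whose differential is prescribed along the curve. *)
Require Import Defs.
From HB Require Import structures.
From mathcomp Require Import all_boot all_order all_algebra.
From mathcomp Require Import complex.
From mathcomp Require Import all_classical all_reals all_analysis.
From mathcomp Require Import ring lra.
Set Implicit Arguments.
Unset Strict Implicit.
Unset Printing Implicit Defensive.
Import Order.TTheory GRing.Theory Num.Theory.
Import numFieldNormedType.Exports.
Local Open Scope classical_set_scope.
Local Open Scope ring_scope.
Import Relation_Operators.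

(** The group is given by charts, left invariant fields and integral curves; the differential of
    [ex] and the structure of [U], [G0], [K0], which are known by generators only, have to be built.
    One formula carries the geometry: the velocity of [c s * e (X s)] ([Vel_mul_exp]), obtained from
    the variation of a flow. Families of group elements are then handled through their Maurer-Cartan
    forms, and local factorizations of [e z] along a splitting of the algebra act as charts of [U],
    of [U / K0] and transversally to the orbits. Linear algebra is done with real matrices in a
    basis where [Ad U] is orthogonal. There the bracket pairs gradients by the matrix
    [Ad(u)^T r Ad(u) - r], with [r] the u-part of multiplication by i. The Iwasawa condition on [b]
    says that the u-part of an element of [g0] lies in [k0]: so [r] maps i p0 into k0, the second
    term vanishes on [K0]-invariant functions, and the first depends on cosets alone. Orbits are
    followed along curves, which is also how leaves are defined. *)

Notation "'exists+' r , P" := (exists2 r, 0 < r & P)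
  (at level 200, r name, right associativity, only parsing).
Notation is_D t := (is_derive t 1) (only parsing).
Notation kf := killing (only parsing).
Ltac fun_mxE := under eq_fun do rewrite mxE.
Ltac complex_ring := apply/eqP; rewrite eq_complex /=; apply/andP; split; apply/eqP; ring.

(** * Differential calculus in finite-dimensional spaces *)

Section EpsilonDelta.
Context {R : realType} {V : normedModType R}.
Implicit Types (O : set V) (x v : V).

Lemma open_ballP O x : open O -> O x -> exists+ r, forall y, `|y - x| < r -> O y.
move=> oO Ox; have /nbhs_ballP[r r0 rO] := open_nbhs_nbhs (conj oO Ox).
by exists r => // y yx; apply: rO; rewrite -ball_normE /= distrC.
Qed.
Lemma open_of_ball O : (forall x, O x -> exists+ r, forall y, `|y - x| < r -> O y) -> open O.
move=> h; rewrite openE => x /h[r r0 rO]; apply/nbhs_ballP; exists r => // y.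
by rewrite -ball_normE /= distrC; apply: rO.
Qed.
Lemma contP (W : normedModType R) (f : V -> W) x : {for x, continuous f} <-> forall e : R, 0 < e -> exists+ r,
    forall y, `|y - x| < r -> `|f y - f x| <= e.
split=> [/cvgrPdist_le h e e0|h].
  have /nbhs_ballP[r r0 rO] := h e e0; exists r => // y yx. by rewrite distrC; apply: rO; rewrite -ball_normE /= distrC.
apply/cvgrPdist_le => e /h[r r0 rO]; apply/nbhs_ballP; exists r => // y.
by rewrite -ball_normE /= distrC => /rO; rewrite distrC.
Qed.

(** Multiplying the difference quotient by [h] gives a form in which [h = 0] is allowed and errors
    can be added; many derivatives below are computed through it. *)
Lemma derP (f : V -> R^o) x v (l : R) : is_derive x v f l <-> forall e : R, 0 < e -> exists+ r,
    forall h : R, `|h| < r -> `|f (x + h *: v) - f x - h * l| <= e * `|h|.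
split=> [[df <-] e e0|h].
  have /cvgrPdist_le/(_ e e0) := df; rewrite -/(derive f x v) => - [r /= r0 rO]. exists r => // h hr; have [->|h0] := eqVneq h 0.
    by rewrite scale0r addr0 subrr mul0r subrr normr0 mulr0.
  have := rO h; rewrite /= sub0r normrN => /(_ hr h0). rewrite -(ler_pM2r (_ : 0 < `|h|)) ?normr_gt0 // -normrM.
  rewrite mulrBl distrC [_ *: v + x]addrC. suff -> : h^-1 *: ((f (x + h *: v) - f x) : R^o) * h
      = f (x + h *: v) - f x by rewrite [X in _ - X]mulrC.
  by rewrite /GRing.scale /= mulrAC mulVf // mul1r.
have cv : (fun h0 : R => h0^-1 *: ((f \o shift x) (h0 *: v) - f x)) @ 0^' --> (l : R^o).
  apply/cvgrPdist_le => e /h[r r0 rO]; exists r => //= h0. rewrite /= sub0r normrN => h0r h00.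
  rewrite -(ler_pM2r (_ : 0 < `|h0|)) ?normr_gt0 // -normrM mulrBl distrC. rewrite [_ *: v + x]addrC.
  suff -> : h0^-1 *: ((f (x + h0 *: v) - f x) : R^o) * h0 = f (x + h0 *: v) - f x by rewrite [X in _ - X]mulrC; apply: rO.
  by rewrite /GRing.scale /= mulrAC mulVf // mul1r.
by split; [apply/cvg_ex; exists l|apply: cvg_lim].
Qed.
End EpsilonDelta.

Section Lines.
Context {R : realType} {V : normedModType R}.
Implicit Types (O : set V) (x v : V).

Lemma derive_line (f : V -> R^o) x v (s l : R) : is_derive (x + s *: v) v f l <-> is_D s (fun t : R => f (x + t *: v) : R^o) l.
have E (h : R) : x + (s + h *: (1 : R^o)) *: v = x + s *: v + h *: v by rewrite -addrA -scalerDl [_ *: (1 : R^o)]mulr1.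
split=> /derP h; apply/derP => e /h[r r0 rO]; exists r => // k /rO; by rewrite E.
Qed.
Lemma derive_line0 (f : V -> R^o) x v (l : R) : is_derive x v f l <-> is_D (0 : R) (fun t : R => f (x + t *: v) : R^o) l.
by rewrite -derive_line scale0r addr0. Qed.
Lemma der_uniq (f : V -> R^o) x v (l l' : R) : is_derive x v f l -> is_derive x v f l' -> l = l'.
by case=> _ <- [_ <-]. Qed.
Lemma derive_cont (f : R -> R^o) (t l : R) : is_D t f l -> {for t, continuous f}.
by move=> [d _]; apply: differentiable_continuous; apply/derivable1_diffP.
Qed.
Lemma is_derive_dirZ (f : V -> R^o) x v (c l : R) : is_derive x v f l -> is_derive x (c *: v) f (c * l : R^o).
move=> /derP D; apply/derP => e e0.
have c1 : 0 < 1 + `|c| by rewrite ltr_pwDl.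
have [r r0 rP] := D _ (divr_gt0 e0 c1).
exists (r / (1 + `|c|)) => [|h hr]; first by rewrite divr_gt0.
have hc : `|h * c| < r.
  rewrite normrM; move: hr; rewrite ltr_pdivlMr // => hr. by apply: le_lt_trans hr; rewrite ler_wpM2l // lerDr.
have := rP _ hc; rewrite scalerA -mulrA => /le_trans; apply.
rewrite normrM -[e / _ * _]mulrA ler_wpM2l ?(ltW e0) //.
by rewrite ler_pdivrMl // mulrC ler_wpM2r // lerDr.
Qed.

Lemma mvt01 (g dg : R -> R) : (forall s : R, 0 <= s <= 1 -> is_D s (g : R -> R^o) (dg s : R^o)) ->
  exists2 c : R, 0 <= c <= 1 & g 1 - g 0 = dg c.
move=> h; have [||c] := @MVT R g dg 0 1 ltr01.
- by move=> x; rewrite in_itv /= => /andP[x0 x1]; apply: h; rewrite !ltW.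
- apply: continuous_in_subspaceT => x; rewrite inE /= in_itv /= => /h. exact: derive_cont.
- rewrite in_itv /= => /andP[c0 c1] ->; exists c; rewrite ?ltW //. by rewrite subr0 mulr1.
Qed.

Lemma mvt_seg (f : V -> R^o) x v : (forall s : R, 0 <= s <= 1 -> derivable f (x + s *: v) v) ->
  exists2 c : R, 0 <= c <= 1 & f (x + v) - f x = 'D_v f (x + c *: v).
move=> h; have [s s01|c c01] := @mvt01 (fun s => f (x + s *: v)) (fun s => 'D_v f (x + s *: v)).
  by apply: (derive_line f x v s _).1; apply: derivableP; apply: h.
by rewrite scale1r scale0r addr0 => ->; exists c.
Qed.
End Lines.

Lemma fin_min_pos (R : realType) (I : finType) (r : R) (s : I -> R) :
  0 < r -> (forall i, 0 < s i) -> exists m, [/\ 0 < m, m <= r & forall i, m <= s i].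
move=> r0 s0; exists (\big[Num.min/r]_i s i); split.
- by apply: lt_bigmin.
- exact: bigmin_le_id.
- by move=> i; exact: bigmin_le_cond.
Qed.

(** The index [i] will run over coordinates or entries: in the maximum norm a common radius is all
    it takes to pass from entries to vectors and matrices. *)
Lemma fin_radius (R : realType) (I : finType) (T : Type) (N : T -> R) (P : I -> T -> Prop) (r0 : R) :
  0 < r0 -> (forall i, exists+ r, forall y, N y < r -> P i y) -> exists r : R, [/\ 0 < r, r <= r0 & forall y, N y < r -> forall i, P i y].
move=> r00 h; have /choice[s sP] : forall i, exists s : R, 0 < s /\ forall y, N y < s -> P i y.
  by move=> i; have [s] := h i; exists s.
have [r [r1 rr rs]] := fin_min_pos r00 (fun i => (sP i).1).
by exists r; split=> // y yr i; apply: (sP i).2; apply: lt_le_trans yr _.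
Qed.

Lemma le_of_eq (R : realType) (x y : R) : x = y -> x <= y. Proof. by move->. Qed.

Section RowNorm.
Context {R : realType} {n : nat}.
Implicit Types x y : 'rV[R]_n.

Lemma coord_le x j : `|x 0 j| <= `|x|.
rewrite [leRHS]/Num.norm /= mx_normrE.
exact: (le_bigmax _ (fun i : 'I_1 * 'I_n => `|x i.1 i.2|) (0, j)).
Qed.
Lemma norm_le x (c : R) : 0 <= c -> (forall j, `|x 0 j| <= c) -> `|x| <= c.
move=> c0 h; rewrite [leLHS]/Num.norm /= mx_normrE.
by apply: bigmax_le => // -[i j] _; rewrite ord1.
Qed.
Lemma norm_lt_coord x (c : R) : 0 < c -> (forall j, `|x 0 j| < c) -> `|x| < c.
move=> c0 h; rewrite [ltLHS]/Num.norm /= mx_normrE.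
by apply: bigmax_lt => // -[i j] _; rewrite ord1.
Qed.
Lemma row_sum x : x = \sum_j x 0 j *: delta_mx 0 j.
exact: row_sum_delta. Qed.
Lemma sum_coord_le x (a : 'I_n -> R) (c : R) : (forall j, `|a j| <= c) -> `|\sum_j a j * x 0 j| <= n%:R * c * `|x|.
move=> h; apply: le_trans (ler_norm_sum _ _ _) _.
apply: (@le_trans _ _ (\sum_(j < n) c * `|x|)).
  by apply: ler_sum => j _; rewrite normrM ler_pM // coord_le.
by rewrite sumr_const card_ord -[leRHS]mulrA [leRHS]mulr_natl.
Qed.
End RowNorm.

Section C1.
Context {R : realType} {n : nat}.
Implicit Types (x y z : 'rV[R]_n) (f : 'rV[R]_n -> R^o).

Definition unitv j : 'rV[R]_n := delta_mx 0 j.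

(* Replace the coordinates of [z] by those of [y] one at a time: in the
   maximum norm all the intermediate points stay in the ball. *)
Lemma C1_approx f x (r e : R) (L : 'I_n -> R) : (forall y, `|y - x| < r -> forall j, derivable f y (unitv j)) ->
  (forall y, `|y - x| < r -> forall j, `|'D_(unitv j) f y - L j| <= e) -> forall y z, `|y - x| < r -> `|z - x| < r ->
  `|f y - f z - \sum_j L j * (y - z) 0 j| <= n%:R * e * `|y - z|.
move=> df De y z yr zr.
pose w k : 'rV[R]_n := \row_j (if (j < k)%N then y 0 j else z 0 j).
have w0 : w 0 = z by apply/rowP => j; rewrite mxE ltn0.
have wn : w n = y by apply/rowP => j; rewrite mxE ltn_ord.
have r0 : 0 < r by apply: le_lt_trans yr.
have wS (j : 'I_n) : w j.+1 = w j + ((y - z) 0 j) *: unitv j.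
  apply/rowP => i; rewrite !mxE eqxx /= ltnS leq_eqVlt. have [->|ij] := eqVneq i j; first by rewrite eqxx ltnn /= mulr1 subrKC.
  by rewrite mulr0 addr0 (_ : (i == j :> nat) = false) //; apply/negbTE.
have seg (j : 'I_n) (s : R) : 0 <= s <= 1 -> `|w j + s *: ((y - z) 0 j *: unitv j) - x| < r.
  move=> /andP[s0 s1]; apply: norm_lt_coord => // i.
  have yi : `|y 0 i - x 0 i| < r by apply: le_lt_trans yr; have := coord_le (y - x) i; rewrite !mxE.
  have zi : `|z 0 i - x 0 i| < r by apply: le_lt_trans zr; have := coord_le (z - x) i; rewrite !mxE.
  rewrite !mxE eqxx /=; have [ij|ij] := eqVneq i j; last first.
    by rewrite !mulr0 addr0; case: ifP.
  rewrite -ij ltnn mulr1 (_ : _ - _ = s * (y 0 i - x 0 i) + (1 - s) * (z 0 i - x 0 i)); last by ring.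
  have [->|s1'] := eqVneq s 1; first by rewrite subrr mul1r mul0r addr0.
  apply: le_lt_trans (ler_normD _ _) _; rewrite !normrM (ger0_norm s0). rewrite (@ger0_norm _ (1 - s)) ?subr_ge0 //.
  have := ler_wpM2l s0 (ltW yi). have : (1 - s) * `|z 0 i - x 0 i| < (1 - s) * r.
    by rewrite ltr_pM2l // subr_gt0 lt_neqAle s1'.
  by move=> *; lra.
have step (j : 'I_n) : `|f (w j.+1) - f (w j) - L j * (y - z) 0 j| <= e * `|y - z|.
  have [s s01|c c01 E] := @mvt01 R (fun s => f (w j + s *: ((y - z) 0 j *: unitv j)))
      (fun s => (y - z) 0 j * 'D_(unitv j) f (w j + s *: ((y - z) 0 j *: unitv j))).
    apply: (derive_line f (w j) ((y - z) 0 j *: unitv j) s _).1. by apply: is_derive_dirZ; apply: derivableP; apply: df; apply: seg.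
  rewrite wS; move: E; rewrite scale1r scale0r addr0 => ->. rewrite mulrC -mulrBl normrM ler_pM //; last exact: coord_le.
  by apply: De; apply: seg.
have tel : f y - f z = \sum_(j < n) (f (w j.+1) - f (w j)) by rewrite -(big_mkord xpredT (fun k => f (w k.+1) - f (w k))) telescope_sumr // wn w0.
rewrite tel -sumrB; apply: le_trans (ler_norm_sum _ _ _) _.
apply: (@le_trans _ _ (\sum_(j < n) e * `|y - z|)); first exact: ler_sum.
by rewrite sumr_const card_ord -[leRHS]mulrA [leRHS]mulr_natl.
Qed.

(** Total differentiability, the differential being given by its coefficients. [Ck] speaks of
    directional derivatives, which by themselves do not support a chain rule. *)
Definition frechet f y (L : 'I_n -> R) := forall e : R, 0 < e -> exists+ r, forall k : 'rV[R]_n, `|k| < r ->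
    `|f (y + k) - f y - \sum_j L j * k 0 j| <= e * `|k|.

Lemma Ck1_uniform f (O : set 'rV[R]_n) x (e : R) : open O -> Ck 1 O f -> O x -> 0 < e ->
  exists+ r, forall y, `|y - x| < r -> O y /\ forall j, derivable f y (unitv j) /\ `|'D_(unitv j) f y - 'D_(unitv j) f x| <= e.
move=> oO [_ dO] Ox e0; have [r r0 rO] := open_ballP oO Ox.
have h j : exists+ s, forall y, `|y - x| < s -> `|'D_(unitv j) f y - 'D_(unitv j) f x| <= e.
  have [_ [c _]] := dO (unitv j). exact: (contP _ _).1 (c _ Ox) _ e0.
have [m [m0 mr mP]] := fin_radius r0 h.
exists m => // y yx; have Oy := rO _ (lt_le_trans yx mr); split => // j; split; last exact: mP.
by case: (dO (unitv j)) => d _; exact: d.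
Qed.

Lemma Ck1_frechet f (O : set 'rV[R]_n) x : open O -> Ck 1 O f -> O x -> frechet f x (fun j => 'D_(unitv j) f x).
move=> oO f1 Ox e e0.
(* The telescoping sum in [C1_approx] costs a factor [n]; the [+ 1] covers [n = 0]. *)
have e'0 : 0 < e / (n%:R + 1) by rewrite divr_gt0 // ltr_wpDl.
have [r r0 rP] := Ck1_uniform oO f1 Ox e'0.
exists r => // k kr.
have := @C1_approx f x r (e / (n%:R + 1)) (fun j => 'D_(unitv j) f x) _ _ (x + k) x.
rewrite subrr normr0 addrAC subrr add0r => H.
apply: le_trans (H _ _ kr r0) _ => [y /rP[_ /(_ _)] h j|y /rP[_ h] j|].
- by case: (h j).
- by case: (h j).
apply: ler_wpM2r => //; rewrite mulrCA ger_pMr //.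
by rewrite ler_pdivrMr ?mul1r ?lerDl // ltr_wpDl.
Qed.
End C1.

(** * Functions of class C^k and the chain rule *)

Section CkBasics.
Context {R : realType} {V W : normedModType R}.
Implicit Types (O : set V) (f g : V -> W).

Lemma Ck_cont k O f : Ck k O f -> forall x, O x -> {for x, continuous f}.
by case: k => [|k] []. Qed.
Lemma CkS k O f : Ck k.+1 O f -> Ck k O f.
elim: k f => [|k IH] f [c h]; split=> // v; have [d D] := h v; split=> //.
exact: IH.
Qed.
Lemma Ck_le k m O f : (m <= k)%N -> Ck k O f -> Ck m O f.
elim: k => [|k IH]; first by rewrite leqn0 => /eqP ->.
by rewrite leq_eqVlt => /predU1P[->//|mk /CkS]; apply: IH.
Qed.
(** All derivatives in [Ck] are taken in the ambient space, at the points of the set; the condition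
    is therefore checked point by point, and any set through the point will do. *)
Lemma Ck_local k O f : (forall x, O x -> exists2 O' : set V, O' x & Ck k O' f) -> Ck k O f.
elim: k f => [|k IH] f h.
  by split=> // x /h [P Px [c _]]; exact: c.
split=> [x /h [P Px [c _]]|v]; first exact: c.
split=> [x /h [P Px [_ /(_ v)[d _]]]|]; first exact: d.
by apply: IH => x /h [P Px [_ /(_ v)[_ D]]]; exists P.
Qed.
Lemma Ck_sub k O O' f : O' `<=` O -> Ck k O f -> Ck k O' f.
by move=> s h; apply: Ck_local => x /s Ox; exists O. Qed.
Lemma Ck_ext k O f g : open O -> {in O, f =1 g} -> Ck k O f -> Ck k O g.
move=> oO; elim: k f g => [|k IH] f g fg [c h]; split=> //.
- move=> x Ox; have Nx : \forall y \near x, f y = g y.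
    by apply: filterS (open_nbhs_nbhs (conj oO Ox)) => y Oy; apply: fg; rewrite inE.
  rewrite /prop_for /continuous_at -(nbhs_singleton Nx). by apply: cvg_trans (c _ Ox); apply: near_eq_cvg.
- move=> x Ox; have Nx : \forall y \near x, f y = g y.
    by apply: filterS (open_nbhs_nbhs (conj oO Ox)) => y Oy; apply: fg; rewrite inE.
  rewrite /prop_for /continuous_at -(nbhs_singleton Nx). by apply: cvg_trans (c _ Ox); apply: near_eq_cvg.
have Nx x : O x -> \forall y \near x, f y = g y by move=> Ox; apply: filterS (open_nbhs_nbhs (conj oO Ox)) => y Oy; apply: fg; rewrite inE.
move=> v; have [d D] := h v; split.
  by move=> x Ox; apply: near_eq_derivable (Nx x Ox) (d x Ox).
apply: IH D => x; rewrite inE => Ox; exact: near_eq_derive (Nx x Ox).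
Qed.
Lemma smooth_derive O f v : smooth O f -> smooth O (fun x => 'D_v f x).
by move=> h k; have [_ /(_ v)[]] := h k.+1. Qed.
Lemma smooth_derivable O f v x : smooth O f -> O x -> derivable f x v.
by move=> h; have [_ /(_ v)[d _]] := h 1%N; exact: d. Qed.
Lemma smooth_der O f v x : smooth O f -> O x -> is_derive x v f ('D_v f x).
by move=> h Ox; apply: derivableP; apply: smooth_derivable Ox. Qed.
Lemma smooth_cont O f x : smooth O f -> O x -> {for x, continuous f}.
by move=> h; apply: (Ck_cont (h 0%N)). Qed.
Lemma smooth_ext O f g : open O -> {in O, f =1 g} -> smooth O f -> smooth O g.
by move=> oO fg h k; apply: Ck_ext fg (h k). Qed.
Lemma smooth_sub O O' f : O' `<=` O -> smooth O f -> smooth O' f.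
by move=> s h k; apply: Ck_sub s (h k). Qed.
Lemma smooth_local O f : (forall x, O x -> exists2 O' : set V, O' x & smooth O' f) -> smooth O f.
by move=> h k; apply: Ck_local => x /h [P Px s]; exists P. Qed.
Lemma Ck_cst k O (c : W) : Ck k O (fun=> c).
elim: k c => [|k IH] c; split=> //; first by move=> x _; exact: cvg_cst.
- by move=> x _; exact: cvg_cst.
move=> v; split=> [x _|]; first exact: derivable_cst.
have -> : (fun x => 'D_v (fun=> c) x) = (fun=> 0 : W); last exact: IH.
by apply/funext => x; rewrite derive_cst.
Qed.
Lemma smooth_cst O (c : W) : smooth O (fun=> c).
by move=> k; exact: Ck_cst. Qed.
Lemma Ck_der k O f (df : V -> V -> W) : (forall x, O x -> {for x, continuous f}) ->
  open O -> (forall v x, O x -> is_derive x v f (df v x)) -> (forall v, Ck k O (df v)) -> Ck k.+1 O f.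
move=> c oO d h; split=> // v; split=> [x /d -/(_ v)[]//|].
apply: Ck_ext (h v) => // x; rewrite inE => Ox; by have [_ ->] := d v x Ox.
Qed.
End CkBasics.

Section CkAlgebra.
Context {R : realType} {V : normedModType R}.
Implicit Types (O : set V) (f g : V -> R^o).

Lemma CkD k O f g : open O -> Ck k O f -> Ck k O g -> Ck k O (fun x => f x + g x).
move=> oO; elim: k f g => [|k IH] f g hf hg.
  split=> // x Ox; apply: (@continuousD _ _ _ f g); first exact: Ck_cont hf _ Ox. exact: Ck_cont hg _ Ox.
apply: (@Ck_der _ _ _ _ _ _ (fun v x => 'D_v f x + 'D_v g x)) => //.
- move=> x Ox; apply: (@continuousD _ _ _ f g); first exact: Ck_cont hf _ Ox. exact: Ck_cont hg _ Ox.
- case: hf hg => _ hf [_ hg] v x Ox. have := derivableP ((hf v).1 x Ox); have := derivableP ((hg v).1 x Ox) => *.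
  exact: (@is_deriveD _ _ _ f g).
- by move=> v; apply: IH; [have [_ /(_ v)[]] := hf|have [_ /(_ v)[]] := hg].
Qed.

Lemma CkM k O f g : open O -> Ck k O f -> Ck k O g -> Ck k O (fun x => f x * g x : R^o).
move=> oO; elim: k f g => [|k IH] f g hf hg.
  split=> // x Ox; apply: (@continuousM _ _ f g); first exact: Ck_cont hf _ Ox. exact: Ck_cont hg _ Ox.
apply: (@Ck_der _ _ _ _ _ _ (fun v x => f x * 'D_v g x + g x * 'D_v f x : R^o)) => //.
- move=> x Ox; apply: (@continuousM _ _ f g); first exact: Ck_cont hf _ Ox. exact: Ck_cont hg _ Ox.
- case: hf hg => _ hf [_ hg] v x Ox. have := derivableP ((hf v).1 x Ox); have := derivableP ((hg v).1 x Ox) => *.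
  exact: (@is_deriveM _ _ f g).
- move=> v; apply: CkD => //; apply: IH.
  + exact: CkS.
  + by have [_ /(_ v)[]] := hg.
  + exact: CkS.
  + by have [_ /(_ v)[]] := hf.
Qed.
Lemma smoothD O f g : open O -> smooth O f -> smooth O g -> smooth O (fun x => f x + g x).
by move=> oO hf hg k; apply: CkD. Qed.
Lemma smoothM O f g : open O -> smooth O f -> smooth O g -> smooth O (fun x => f x * g x : R^o).
by move=> oO hf hg k; apply: CkM. Qed.
Lemma smooth_sum O (I : Type) (r : seq I) (P : pred I) (F : I -> V -> R^o) : open O ->
  (forall i, P i -> smooth O (F i)) -> smooth O (fun x => \sum_(i <- r | P i) F i x).
move=> oO h; elim: r => [|i r IH].
  by under eq_fun do rewrite big_nil; apply: smooth_cst.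
have [Pi|/negbTE Pi] := boolP (P i); under eq_fun do rewrite big_cons Pi; last exact: IH.
by apply: smoothD => //; apply: h.
Qed.

Lemma smooth_prod O (I : Type) (r : seq I) (P : pred I) (F : I -> V -> R^o) : open O -> (forall i, P i -> smooth O (F i)) ->
  smooth O (fun x => (\prod_(i <- r | P i) (F i x : R)) : R^o).
move=> oO h; elim: r => [|i r IH].
  by under eq_fun do rewrite big_nil; apply: smooth_cst.
have [Pi|/negbTE Pi] := boolP (P i); under eq_fun do rewrite big_cons Pi; last exact: IH.
by apply: smoothM => //; apply: h.
Qed.

Lemma smoothN O f : open O -> smooth O f -> smooth O (fun x => - f x).
move=> oO h; have : smooth O (fun x => (- 1 : R^o) * f x : R^o).
  by apply: smoothM => //; apply: smooth_cst.
by apply: smooth_ext => // x _; rewrite mulN1r.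
Qed.
Lemma CkV k O f : open O -> (forall x, O x -> f x != 0) -> Ck k O f -> Ck k O (fun x => (f x)^-1 : R^o).
move=> oO f0; elim: k f f0 => [|k IH] f f0 hf.
  by split=> // x Ox; apply: (@continuousV _ _ f); [exact: f0|exact: Ck_cont hf _ Ox].
apply: (@Ck_der _ _ _ _ _ _ (fun v x => (-1) * ((f x)^-1 * ((f x)^-1 * 'D_v f x)) : R^o)) => //.
- by move=> x Ox; apply: (@continuousV _ _ f); [exact: f0|exact: Ck_cont hf _ Ox].
- case: hf => _ hf v x Ox; have dx := (hf v).1 x Ox. split; first exact: (@derivableV _ _ f _ _ (f0 x Ox)).
  rewrite (@deriveV _ _ f _ _ (f0 x Ox) dx) /GRing.scale /= -exprVn. by rewrite mulN1r mulrA -expr2 mulNr.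
- move=> v; have hS := CkS hf. apply: CkM => //; first exact: Ck_cst. apply: CkM => //; first exact: IH.
  by apply: CkM => //; [exact: IH|have [_ /(_ v)[]] := hf].
Qed.
Lemma smoothV O f : open O -> (forall x, O x -> f x != 0) -> smooth O f -> smooth O (fun x => (f x)^-1 : R^o).
by move=> oO f0 h k; apply: CkV. Qed.
Lemma smooth_linear O (l : V -> R^o) : open O -> linear l -> continuous l -> smooth O l.
move=> oO ll cl [|k]; first by split=> // x _; apply: cl.
apply: (@Ck_der _ _ _ _ _ _ (fun v _ => l v)) => //; first by move=> x _; apply: cl.
- move=> v x _; apply/derP => e e0; exists 1 => // h _. rewrite [x + _]addrC (ll h v x) addrK subrr normr0. by rewrite mulr_ge0 // ltW.
- by move=> v; exact: Ck_cst.
Qed.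
End CkAlgebra.

Section ChainRule.
Context {R : realType} {V : normedModType R} {n : nat}.

Lemma derive_comp (f : 'rV[R]_n -> R^o) (L : 'I_n -> R) (g : V -> 'rV[R]_n) x v (dg : 'rV[R]_n) : frechet f (g x) L ->
  (forall j, is_derive x v (fun y => g y 0 j : R^o) (dg 0 j)) -> is_derive x v (fun y => f (g y)) (\sum_j L j * dg 0 j : R^o).
move=> hf hg; apply/derP => e e0.
pose C := \sum_j `|L j|; have C0 : 0 <= C by apply: sumr_ge0.
(* The bound 1 gives [|k| <= (|dg| + 1) |h|] for the increment [k] of [g]; the other bound keeps the
   error of [g], weighted by the coefficients [L], below half of [e |h|]. *)
pose e1 := Num.min 1 (e / (2 * (C + 1))).
have e10 : 0 < e1 by rewrite lt_min ltr01 divr_gt0 // mulr_gt0 // ltr_wpDl.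
pose e2 := e / (2 * (`|dg| + 1)).
have e20 : 0 < e2 by rewrite divr_gt0 // mulr_gt0 // ltr_wpDl.
have [r r0 rP] := hf _ e20.
have rd0 : 0 < r / (`|dg| + 1) by rewrite divr_gt0 // ltr_wpDl.
have [m [m0 mr mP]] := fin_radius rd0 (fun j => (derP _ _ _ _).1 (hg j) e1 e10).
exists m => // h hm; pose k := g (x + h *: v) - g x.
have dk j : `|k 0 j - h * dg 0 j| <= e1 * `|h| by rewrite !mxE; exact: mP.
have kh : `|k| <= (`|dg| + 1) * `|h|.
  apply: norm_le => [|j]; first by rewrite mulr_ge0 // addr_ge0. rewrite -(subrK (h * dg 0 j) (k 0 j)); apply: le_trans (ler_normD _ _) _.
  rewrite addrC mulrDl lerD //; last first.
    by apply: le_trans (dk j) _; rewrite ler_wpM2r // ge_min lexx.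
  by rewrite normrM mulrC ler_wpM2r // coord_le.
have kr : `|k| < r.
  apply: le_lt_trans kh _; rewrite mulrC -ltr_pdivlMr ?ltr_wpDl //. exact: lt_le_trans hm _.
have := rP _ kr; rewrite /k subrKC -/k => H1.
have H2 : `|\sum_j L j * k 0 j - h * (\sum_j L j * dg 0 j)| <= C * (e1 * `|h|).
  rewrite mulr_sumr -sumrB; apply: le_trans (ler_norm_sum _ _ _) _. rewrite mulr_suml; apply: ler_sum => j _.
  by rewrite mulrCA -mulrBr normrM ler_wpM2l.
rewrite -(subrK (\sum_j L j * k 0 j) (f _ - _)) -addrA.
apply: le_trans (ler_normD _ _) _; rewrite [e]splitr mulrDl lerD //.
  apply: le_trans H1 _; apply: le_trans (ler_wpM2l (ltW e20) kh) _. rewrite mulrA ler_wpM2r // /e2; apply: le_of_eq; field.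
  by rewrite gt_eqF // ltr_wpDl.
apply: le_trans H2 _; rewrite mulrA ler_wpM2r //.
apply: (@le_trans _ _ ((C + 1) * (e / (2 * (C + 1))))).
  by rewrite ler_pM // ?(ltW e10) // ?lerDl // ge_min lexx orbT.
apply: le_of_eq; field.
by rewrite gt_eqF // ltr_wpDl.
Qed.

(** Induction on [k]: the derivative is a sum of products of partial derivatives of [f] composed
    with [g], covered by the induction hypothesis, and of derivatives of [g]. The intermediate space
    consists of row vectors because [frechet] is stated there. *)
Lemma Ck_comp k (O : set V) (O' : set 'rV[R]_n) (f : 'rV[R]_n -> R^o)
    (g : V -> 'rV[R]_n) : open O -> open O' -> (forall x, O x -> O' (g x)) ->
  Ck k O' f -> (forall j, Ck k O (fun x => g x 0 j : R^o)) -> Ck k O (fun x => f (g x)).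
move=> oO oO' gO; have cg (x : V) : O x -> (forall j, {for x, continuous (fun x => g x 0 j : R^o)}) -> {for x, continuous g}.
  move=> Ox c; apply/contP => e e0. have [m [m0 _ mP]] := fin_radius ltr01 (fun j => (contP _ _).1 (c j) e e0).
  exists m => // y ym; apply: norm_le => [|j]; first exact: ltW. by rewrite !mxE; exact: mP.
have cfg (h : 'rV[R]_n -> R^o) j : Ck j O' h -> (forall i, Ck j O (fun x => g x 0 i : R^o)) ->
    forall x, O x -> {for x, continuous (fun x => h (g x))}.
  move=> hf hg x Ox; apply: (@continuous_comp _ _ _ g h).
    by apply: cg => // i; exact: Ck_cont (hg i) _ Ox.
  by apply: Ck_cont hf _ _; apply: gO.
elim: k f => [|k IH] f hf hg; first by split=> //; exact: cfg hf hg.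
apply: (@Ck_der _ _ _ _ _ _ (fun v x => \sum_j 'D_(unitv j) f (g x) * 'D_v (fun x => g x 0 j : R^o) x : R^o)) => //.
- exact: cfg hf hg.
- move=> v x Ox. pose dg : 'rV[R]_n := \row_j 'D_v (fun x => g x 0 j : R^o) x.
  have := @derive_comp f (fun j => 'D_(unitv j) f (g x)) g x v dg. under eq_bigr do rewrite mxE; apply.
    by apply: Ck1_frechet oO' (Ck_le _ hf) _; [|exact: gO].
  move=> j; rewrite mxE; apply: derivableP. by have [_ /(_ v)[d _]] := hg j; exact: d.
move=> v; have : forall j, Ck k O (fun x => 'D_(unitv j) f (g x) * 'D_v (fun x => g x 0 j : R^o) x : R^o).
  move=> j; apply: CkM => //; last by have [_ /(_ v)[]] := hg j.
  by apply: (IH (fun y => 'D_(unitv j) f y)); [have [_ /(_ (unitv j))[]] := hf|move=> i; exact: CkS].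
elim: (index_enum _) => [|i r IHr] h.
  by under eq_fun do rewrite big_nil; apply: Ck_cst.
by under eq_fun do rewrite big_cons; apply: CkD => //; exact: IHr.
Qed.

Lemma smooth_comp (O : set V) (O' : set 'rV[R]_n) (f : 'rV[R]_n -> R^o)
    (g : V -> 'rV[R]_n) : open O -> open O' -> (forall x, O x -> O' (g x)) ->
  smooth O' f -> (forall j, smooth O (fun x => g x 0 j : R^o)) -> smooth O (fun x => f (g x)).
by move=> oO oO' gO hf hg k; apply: Ck_comp oO oO' gO (hf k) _ => j; exact: hg. Qed.
Lemma sm_frechet (f : 'rV[R]_n -> R^o) (O : set 'rV[R]_n) x : open O -> smooth O f -> O x -> frechet f x (fun j => 'D_(unitv j) f x).
by move=> oO sf; apply: Ck1_frechet oO (sf 1%N). Qed.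
End ChainRule.

Section Frechet.
Context {R : realType} {n : nat}.
Implicit Types (f : 'rV[R]_n -> R^o) (O : set 'rV[R]_n) (x v : 'rV[R]_n).

Lemma frechet_is_derive f x L v : frechet f x L -> is_derive x v f (\sum_j L j * v 0 j : R^o).
move=> hf; apply: (@derive_comp _ _ _ f L id) => // j.
apply/derP => e e0; exists 1 => // h _.
by rewrite !mxE [x 0 j + _]addrC addrK subrr normr0 mulr_ge0 // ltW.
Qed.
Lemma smooth_DE f O x v : open O -> smooth O f -> O x -> 'D_v f x = \sum_j 'D_(unitv j) f x * v 0 j.
move=> oO sf Ox.
by have [_ ->] := frechet_is_derive v (sm_frechet oO sf Ox).
Qed.
Lemma coord_cont {m k} (i : 'I_m) (j : 'I_k) : continuous (fun M : 'M[R]_(m, k) => M i j : R^o).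
exact: coord_continuous. Qed.
Lemma smooth_coord {m k} (O : set 'M[R]_(m, k)) i j : open O -> smooth O (fun M : 'M[R]_(m, k) => M i j : R^o).
move=> oO; apply: smooth_linear => //; last exact: coord_cont.
by move=> a u w; rewrite !mxE.
Qed.
End Frechet.

Lemma addlK (V : zmodType) (x y : V) : x + y - x = y.
by rewrite addrC addKr. Qed.

Section MatrixSmooth.
Context {R : realType} {V : normedModType R}.
Implicit Types (O : set V).

Definition smx m n O (F : V -> 'M[R]_(m, n)) := forall i j, smooth O (fun x => F x i j : R^o).

Lemma smx_cst m n O (A : 'M[R]_(m, n)) : smx O (fun=> A).
by move=> i j; exact: smooth_cst. Qed.
Lemma smx_ext m n O (F G : V -> 'M[R]_(m, n)) : open O -> {in O, F =1 G} -> smx O F -> smx O G.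
by move=> oO e h i j; apply: smooth_ext (h i j) => // x Ox; rewrite e. Qed.
Lemma smx_sub m n O O' (F : V -> 'M[R]_(m, n)) : O' `<=` O -> smx O F -> smx O' F.
by move=> s h i j; apply: smooth_sub s (h i j). Qed.
Lemma smxD m n O (F G : V -> 'M[R]_(m, n)) : open O -> smx O F -> smx O G -> smx O (fun x => F x + G x).
by move=> oO hF hG i j; fun_mxE; apply: smoothD.
Qed.
Lemma smxN m n O (F : V -> 'M[R]_(m, n)) : open O -> smx O F -> smx O (fun x => - F x).
by move=> oO hF i j; fun_mxE; apply: smoothN. Qed.
Lemma smxB m n O (F G : V -> 'M[R]_(m, n)) : open O -> smx O F -> smx O G -> smx O (fun x => F x - G x).
by move=> oO hF hG; apply: smxD => //; apply: smxN. Qed.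
Lemma smxM m n p O (F : V -> 'M[R]_(m, n)) (G : V -> 'M[R]_(n, p)) : open O -> smx O F -> smx O G -> smx O (fun x => F x *m G x).
move=> oO hF hG i j; fun_mxE; apply: smooth_sum => // k _.
exact: smoothM.
Qed.
Lemma smxZ m n O (c : V -> R^o) (F : V -> 'M[R]_(m, n)) : open O -> smooth O c -> smx O F -> smx O (fun x => (c x : R) *: F x).
by move=> oO hc hF i j; fun_mxE; apply: smoothM. Qed.
Lemma smooth_det n O (F : V -> 'M[R]_n) : open O -> smx O F -> smooth O (fun x => \det (F x) : R^o).
move=> oO hF; rewrite /determinant; apply: smooth_sum => // s _.
by apply: smoothM => //; [apply: smooth_cst|apply: smooth_prod].
Qed.
Lemma smx_adj n O (F : V -> 'M[R]_n) : open O -> smx O F -> smx O (fun x => \adj (F x)).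
move=> oO hF i j; fun_mxE; rewrite /cofactor.
apply: smoothM => //; first exact: smooth_cst.
apply: smooth_det => // k l; under eq_fun do rewrite !mxE.
exact: hF.
Qed.

Lemma smx_inv n O (F : V -> 'M[R]_n) : open O -> smx O F -> (forall x, O x -> F x \in unitmx) -> smx O (fun x => invmx (F x)).
move=> oO hF u; apply: (@smx_ext _ _ _ (fun x => (\det (F x))^-1 *: \adj (F x))) => //.
  by move=> x; rewrite inE => Ox; rewrite /invmx u.
apply: smxZ => //; last exact: smx_adj.
apply: smoothV => //; last exact: smooth_det.
by move=> x /u; rewrite unitmxE unitfE.
Qed.
End MatrixSmooth.

Section MxComp.
Context {R : realType} {V : normedModType R} {n : nat}.

Lemma smx_comp m p (O : set V) (O' : set 'rV[R]_n) (F : 'rV[R]_n -> 'M[R]_(m, p))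
    (g : V -> 'rV[R]_n) : open O -> open O' -> (forall x, O x -> O' (g x)) -> smx O' F -> smx O g -> smx O (fun x => F (g x)).
move=> oO oO' gO hF hg i j.
exact: (@smooth_comp _ _ _ O O' (fun y => F y i j) g).
Qed.
Lemma smx_id (O : set 'rV[R]_n) : open O -> smx O (fun x : 'rV[R]_n => x).
by move=> oO i j; apply: smooth_coord. Qed.
Lemma mcontinuousP m p (F : V -> 'M[R]_(m, p)) x : (forall i j, {for x, continuous (fun y => F y i j : R^o)}) -> {for x, continuous F}.
move=> h; apply/contP => e e0.
have [d [d0 _ dP]] := fin_radius ltr01 (fun ij : 'I_m * 'I_p => (contP _ _).1 (h ij.1 ij.2) e e0).
exists d => // y yd; rewrite [leLHS]/Num.norm /= mx_normrE.
by apply: bigmax_le => [|ij _]; [exact: ltW|rewrite !mxE; exact: dP].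
Qed.
Lemma smx_cont m p (O : set V) (F : V -> 'M[R]_(m, p)) x : smx O F -> O x -> {for x, continuous F}.
by move=> h Ox; apply: mcontinuousP => i j; apply: smooth_cont (h i j) Ox. Qed.
End MxComp.

Lemma mulmx_le (R : realType) m n (A : 'M[R]_(m, n)) : exists+ C, forall v : 'rV[R]_m, `|v *m A| <= C * `|v|.
exists (m%:R * `|A| + 1) => [|v]; first by rewrite ltr_wpDl // mulr_ge0.
apply: norm_le => [|j]; first by rewrite mulr_ge0 // addr_ge0 // mulr_ge0.
rewrite mxE; under eq_bigr do rewrite mulrC.
apply: le_trans (@sum_coord_le _ _ v (fun k => A k j) `|A| _) _.
  move=> k; rewrite [leRHS]/Num.norm /= mx_normrE. exact: (le_bigmax _ (fun i : 'I_m * 'I_n => `|A i.1 i.2|) (k, j)).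
by rewrite ler_wpM2r // lerDl.
Qed.

Lemma unitmx_of_ker (F : fieldType) n (A : 'M[F]_n) : (forall k : 'rV[F]_n, k *m A = 0 -> k = 0) -> A \in unitmx.
move=> h; rewrite -row_free_unit -kermx_eq0; apply/eqP/row_matrixP => i.
by rewrite row0; apply: h; rewrite -row_mul mulmx_ker row0.
Qed.

(** * The inverse function theorem *)

Section InverseFunction.
Context {R : realType} {n : nat}.
Implicit Types (O : set 'rV[R]_n) (f g : 'rV[R]_n -> 'rV[R]_n) (x y z : 'rV[R]_n).

Definition Bo x (r : R) : set 'rV[R]_n := [set y | `|y - x| < r].

Lemma Bo_open x r : open (Bo x r).
apply: open_of_ball => y yr; exists (r - `|y - x|) => [|z zy]; first by rewrite subr_gt0.
rewrite /Bo /= -(subrK y z) -addrA; apply: le_lt_trans (ler_normD _ _) _.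
by rewrite -ltrBrDr.
Qed.
Lemma ballc_compact x (r : R) : compact [set y | `|y - x| <= r].
apply: bounded_closed_compact.
  exists (r + `|x|); split=> [|M rM y /= yr]; first exact: num_real.
  by rewrite -(subrK x y); apply: le_trans (ler_normD _ _) (le_trans _ (ltW rM)); rewrite lerD2r.
rewrite -[X in closed X]setCK; apply: open_closedC; apply: open_of_ball => z /negP.
rewrite -ltNge => zr; exists (`|z - x| - r) => [|w wz]; first by rewrite subr_gt0.
apply/negP; rewrite -ltNge; have := ler_normD (z - w) (w - x); rewrite subrKA.
by move: wz; rewrite [`|w - z|]distrC; lra.
Qed.

Lemma near_id f O x0 : open O -> smx O f -> O x0 -> (forall i j, 'D_(unitv j) (fun x => f x 0 i : R^o) x0 = (i == j)%:R) ->
  exists+ r, Bo x0 r `<=` O /\ forall y z, `|y - x0| < r -> `|z - x0| < r -> `|f y - f z - (y - z)| <= 2^-1 * `|y - z|.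
move=> oO sf Ox Df.
have e0 : 0 < (2 * (n%:R + 1))^-1 :> R by rewrite invr_gt0 mulr_gt0 // ltr_wpDl.
have [r1 r10 r1P] := open_ballP oO Ox.
have [r [r0 rr rP]] := fin_radius r10 (fun i => Ck1_uniform oO (sf 0 i 1%N) Ox e0).
exists r => //; split=> [y yr|y z yr zr]; first by apply: r1P; apply: lt_le_trans rr.
apply: norm_le => [|i]; first by rewrite mulr_ge0.
have := @C1_approx R n (fun x => f x 0 i : R^o) x0 r (2 * (n%:R + 1))^-1 (fun j => (i == j)%:R).
move=> /(_ _ _ y z yr zr); rewrite !mxE.
rewrite (bigD1 i) //= eqxx mul1r big1 => [|j /negbTE ji]; last by rewrite eq_sym ji mul0r.
rewrite addr0 !mxE => H; apply: le_trans (H _ _) _.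
- by move=> w /rP/(_ i)[_ h] j; case: (h j).
- by move=> w /rP/(_ i)[_ h] j; rewrite -(Df i j); case: (h j).
apply: ler_wpM2r => //; rewrite invfM mulrCA ger_pMr ?invr_gt0 //.
by rewrite ler_pdivrMr ?mul1r ?lerDl // ltr_wpDl.
Qed.

(** The minimum of [|f x - y|] on the compact ball of radius [r / 2] solves the equation: otherwise
    the Newton step [x + (y - f x)] stays in that ball and at least halves the distance to [y]. *)
Lemma lipschitz_surj f x0 (r : R) : 0 < r -> (forall y z, `|y - x0| < r -> `|z - x0| < r -> `|f y - f z - (y - z)| <= 2^-1 * `|y - z|) ->
  forall y, `|y - f x0| < r / 4 -> exists2 x, `|x - x0| <= r / 2 & f x = y.
move=> r0 hf y yr; pose K := [set x | `|x - x0| <= r / 2].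
have rr : r / 2 < r by rewrite ltr_pdivrMr // mulr_natr mulr2n ltrDl.
have x0K : `|x0 - x0| < r by rewrite subrr normr0.
have cK : compact K by exact: ballc_compact.
have K0 : K !=set0 by exists x0; rewrite /K /= subrr normr0 divr_ge0 // ltW.
have Lf u v : `|u - x0| < r -> `|v - x0| < r -> `|f u - f v| <= 2 * `|u - v|.
  move=> ur vr; rewrite -(subrK (u - v) (f u - f v)); apply: le_trans (ler_normD _ _) _.
  have := hf u v ur vr; have := normr_ge0 (u - v); lra.
have ct : {within K, continuous (fun x => `|f x - y|)}.
  apply: continuous_in_subspaceT => x; rewrite inE => Kx. apply/contP => e e0. have s0 : 0 < r / 2 by rewrite divr_gt0.
  exists (Num.min (r / 2) (e / 2)) => [|z]; first by rewrite lt_min s0 divr_gt0. rewrite lt_min => /andP[z1 z2]. have zr : `|z - x0| < r.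
    rewrite -(subrK x z) -addrA; apply: le_lt_trans (ler_normD _ _) _. by rewrite [r]splitr ltr_leD.
  apply: le_trans (ler_dist_dist _ _) _; rewrite opprB addrA subrK. apply: le_trans (Lf _ _ zr (le_lt_trans Kx rr)) _.
  by rewrite mulrC -ler_pdivlMr // ltW.
have [x Kx xm] := EVT_min_rV K0 cK ct; rewrite inE in Kx.
have xr : `|x - x0| < r := le_lt_trans Kx rr.
exists x => //; apply/eqP; rewrite -subr_eq0 -normr_le0 leNgt; apply/negP => m0.
pose x' := x + (y - f x).
have Kx' : K x'.
  rewrite /K /= (_ : x' - x0 = (y - f x0) - (f x - f x0 - (x - x0))).
    apply: le_trans (ler_normB _ _) _; have := hf x x0 xr x0K; rewrite /K /= in Kx. by move=> *; lra.
  rewrite /x'; apply/rowP => j; rewrite !mxE; ring.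
have := xm x'; rewrite inE => /(_ Kx').
have := hf x' x (le_lt_trans Kx' rr) xr.
rewrite {2 3}/x' [x + _]addrC addrK.
rewrite (_ : f x' - f x - (y - f x) = f x' - y); last first.
  by apply/rowP => j; rewrite !mxE; ring.
rewrite [`|y - _|]distrC => *; lra.
Qed.

(** The differential at [x0] is normalized to the identity, so that constants do not depend on an
    inverse matrix. The inverse [g] is Lipschitz, hence differentiable with matrix [Q (g y)], and
    this formula lifts it from class [C^k] to [C^(k+1)]. *)
Theorem inverse_fun f O x0 : open O -> smx O f -> O x0 -> (forall i j, 'D_(unitv j) (fun x => f x 0 i : R^o) x0 = (i == j)%:R) ->
  exists r s : R, exists g, [/\ 0 < r, 0 < s & Bo x0 r `<=` O] /\ [/\ forall y z, Bo x0 r y -> Bo x0 r z -> f y = f z -> y = z,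
        forall y, Bo (f x0) s y -> Bo x0 r (g y) /\ f (g y) = y & smx (Bo (f x0) s) g].
move=> oO sf Ox Df; have [r r0 [rO hf]] := near_id oO sf Ox Df.
have s0 : 0 < r / 4 by rewrite divr_gt0.
have rr : r / 2 < r by rewrite ltr_pdivrMr // mulr_natr mulr2n ltrDl.
have /choice[g gP] : forall y, exists x, `|y - f x0| < r / 4 -> `|x - x0| <= r / 2 /\ f x = y.
  move=> y; have [yr|nyr] := pselect (`|y - f x0| < r / 4); last by exists x0. by have [x xr fx] := lipschitz_surj r0 hf yr; exists x.
have gP' y : Bo (f x0) (r / 4) y -> Bo x0 r (g y) /\ f (g y) = y by move=> /gP[gr fg]; split=> //; apply: le_lt_trans gr _.
have Li u v : Bo x0 r u -> Bo x0 r v -> `|u - v| <= 2 * `|f u - f v|.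
  move=> ur vr; have := hf u v ur vr; rewrite -[`|u - v|]normrN.
  have := ler_normB (f u - f v - (u - v)) (f u - f v); rewrite addrAC subrr add0r normrN. by move=> *; lra.
exists r, (r / 4), g; do 2!split => //.
  by move=> y z yr zr e; apply/eqP; rewrite -subr_eq0 -normr_le0; have := Li y z yr zr; rewrite e subrr normr0 mulr0.
(* Row [j] is the derivative in direction [j]: differentials act on row vectors from the right, here
   and in [jac] below. *)
pose J x : 'M[R]_n := \matrix_(j, i) 'D_(unitv j) (fun x => f x 0 i : R^o) x.
have oB := @Bo_open x0 r.
have sJ : smx (Bo x0 r) J.
  move=> j i; fun_mxE; apply: smooth_derive. exact: smooth_sub rO (sf 0 i).
have frf x : Bo x0 r x -> forall e, 0 < e -> exists+ t, forall k, `|k| < t -> `|f (x + k) - f x - k *m J x| <= e * `|k|.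
  move=> xr e e0. have [t [t0 _ tP]] := fin_radius ltr01 (fun i => sm_frechet oO (sf 0 i) (rO _ xr) e0).
  exists t => // k kt; apply: norm_le => [|i]; first by rewrite mulr_ge0 // ltW.
  by rewrite !mxE; under eq_bigr do rewrite mxE mulrC; exact: tP.
have uJ x : Bo x0 r x -> J x \in unitmx.
  move=> xr; apply: unitmx_of_ker => k kJ; apply/eqP; rewrite -normr_le0 leNgt; apply/negP => k0.
  (* Along a small multiple of a kernel vector, [f] would move by at most a quarter of the
     displacement, whereas [Li] requires at least one half. *)
  have [t t0 tP] := frf x xr 4^-1 (ltac:(by rewrite invr_gt0)). have [u u0 uP] := open_ballP oB xr. pose h := Num.min t u / (2 * `|k|).
  have m0 : 0 < Num.min t u by rewrite lt_min t0 u0. have h0 : 0 < h by rewrite divr_gt0 // mulr_gt0. have hk : `|h *: k| < Num.min t u.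
    rewrite normrZ (gtr0_norm h0) /h invfM mulrA mulfVK ?gt_eqF //. by rewrite ltr_pdivrMr // mulr_natr mulr2n ltrDl.
  have := tP (h *: k) (lt_le_trans hk _); rewrite ge_min lexx => /(_ isT). rewrite -scalemxAl kJ scaler0 subr0.
  have := Li (x + h *: k) x _ xr; rewrite addrAC subrr add0r => H1 H2. have : `|h *: k| <= 2 * (4^-1 * `|h *: k|).
    apply: le_trans (H1 _) _; last by rewrite ler_wpM2l.
    by apply: uP; rewrite addrAC subrr add0r; apply: lt_le_trans hk _; rewrite ge_min lexx orbT.
  have : 0 < `|h *: k| by rewrite normrZ mulr_gt0 // normr_gt0 gt_eqF. by move=> *; lra.
pose Q x : 'M[R]_n := invmx (J x).
have sQ : smx (Bo x0 r) Q by apply: smx_inv.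
have oS := @Bo_open (f x0) (r / 4).
have cg y : Bo (f x0) (r / 4) y -> exists+ t, forall z, `|z - y| < t ->
    Bo (f x0) (r / 4) z /\ `|g z - g y| <= 2 * `|z - y|.
  move=> yr; have [t t0 tP] := open_ballP oS yr; exists t => // z /tP zr; split=> //. have [gz fz] := gP' z zr; have [gy fy] := gP' y yr.
  by have := Li _ _ gz gy; rewrite fz fy.
have dg v y : Bo (f x0) (r / 4) y -> forall i, is_derive y v (fun z => g z 0 i : R^o) ((v *m Q (g y)) 0 i).
  move=> yr i; apply/derP => e e0; have [gy fy] := gP' y yr. have [C C0 CP] := mulmx_le (Q (g y)). pose e1 := e / (2 * C * (`|v| + 1)).
  have v0 : 0 < `|v| + 1 by rewrite ltr_wpDl. have e10 : 0 < e1 by rewrite divr_gt0 // !mulr_gt0.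
  have [t t0 tP] := frf _ gy e1 e10; have [u u0 uP] := cg y yr.
  exists (Num.min u (t / 2) / (`|v| + 1)) => [|h]; first by rewrite divr_gt0 // lt_min u0 divr_gt0. rewrite ltr_pdivlMr // => hr.
  have hv : `|h *: v| <= `|h| * (`|v| + 1) by rewrite normrZ ler_wpM2l // lerDl.
  have hv1 : `|h *: v| < Num.min u (t / 2) := le_lt_trans hv hr.
  have hu : `|y + h *: v - y| < u by rewrite addrAC subrr add0r; apply: lt_le_trans hv1 _; rewrite ge_min lexx.
  have [zr] := uP _ hu; rewrite addrAC subrr add0r => gz. set k := g _ - g y in gz; have [_ fz] := gP' _ zr. have kt : `|k| < t.
    apply: le_lt_trans gz _; rewrite mulrC -ltr_pdivlMr //. by apply: lt_le_trans hv1 _; rewrite ge_min lexx orbT.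
  have Ek : g y + k = g (y + h *: v) by rewrite /k subrKC. have := tP k kt; rewrite Ek fz fy addlK => H.
  have E : (h *: v - k *m J (g y)) *m Q (g y) = h *: (v *m Q (g y)) - k by rewrite mulmxBl -scalemxAl -mulmxA mulmxV ?mulmx1 // uJ.
  have := CP (h *: v - k *m J (g y)); rewrite E => H3. move: (v *m Q (g y)) E H3 => q E H3.
  have H4 : `|g (y + h *: v) 0 i - g y 0 i - h * q 0 i| <= `|h *: q - k|.
    rewrite (_ : _ - _ - _ = - ((h *: q - k) 0 i)); last by rewrite /k !mxE opprB. by rewrite normrN; exact: coord_le.
  apply: le_trans H4 _; apply: le_trans H3 _. apply: (@le_trans _ _ (C * (e1 * (2 * (`|h| * (`|v| + 1)))))).
    rewrite ler_wpM2l ?(ltW C0) //; apply: le_trans H _; rewrite ler_wpM2l ?(ltW e10) //. by apply: le_trans gz _; rewrite ler_wpM2l.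
  apply: le_of_eq; rewrite /e1; field. by rewrite !gt_eqF.
have cgi i y : Bo (f x0) (r / 4) y -> {for y, continuous (fun z => g z 0 i : R^o)}.
  move=> yr; apply/contP => e e0; have [t t0 tP] := cg y yr. exists (Num.min t (e / 2)) => [|z]; first by rewrite lt_min t0 divr_gt0.
  rewrite lt_min => /andP[/tP[_ zt] ze]. have := coord_le (g z - g y) i; rewrite !mxE => /le_trans; apply.
  by apply: le_trans zt _; rewrite mulrC -ler_pdivlMr // ltW.
have key k : forall i, Ck k (Bo (f x0) (r / 4)) (fun y => g y 0 i : R^o).
  elim: k => [|k IH] i; first by split=> // y; exact: cgi. apply: (@Ck_der _ _ _ _ _ _ (fun v y => (v *m Q (g y)) 0 i : R^o)) => //.
  - by move=> y; exact: cgi.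
  - by move=> v y yr; exact: dg.
  move=> v; apply: (@Ck_comp _ _ n k _ (Bo x0 r) (fun x => (v *m Q x) 0 i : R^o) g) => //.
    by move=> y yr; case: (gP' y yr).
  by apply: (smxM oB _ sQ); exact: smx_cst.
by move=> i j k; rewrite (ord1 i); exact: key.
Qed.
End InverseFunction.

(** * The matrix exponential *)

Section MatrixNorm.
Context {R : realType}.

Lemma mxcoord_le m n (A : 'M[R]_(m, n)) i j : `|A i j| <= `|A|.
rewrite [leRHS]/Num.norm /= mx_normrE.
exact: (le_bigmax _ (fun i : 'I_m * 'I_n => `|A i.1 i.2|) (i, j)).
Qed.
Lemma mxnorm_le m n (A : 'M[R]_(m, n)) (c : R) : 0 <= c -> (forall i j, `|A i j| <= c) -> `|A| <= c.
by move=> c0 h; rewrite [leLHS]/Num.norm /= mx_normrE; apply: bigmax_le => // -[i j] _.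
Qed.
(** The norm is the largest absolute value of an entry and is not submultiplicative, whence the
    factor [n] here and in every bound on the exponential. *)
Lemma mx_norm m n p (A : 'M[R]_(m, n)) (B : 'M[R]_(n, p)) : `|A *m B| <= n%:R * `|A| * `|B|.
apply: mxnorm_le => [|i j]; first by rewrite !mulr_ge0.
rewrite mxE; apply: le_trans (ler_norm_sum _ _ _) _.
apply: (@le_trans _ _ (\sum_(k < n) `|A| * `|B|)).
  by apply: ler_sum => k _; rewrite normrM ler_pM // mxcoord_le.
by rewrite sumr_const card_ord -[leRHS]mulrA [leRHS]mulr_natl.
Qed.

Lemma exprmx_norm n (A : 'M[R]_n) k : `|A ^+ k| <= (n%:R * `|A|) ^+ k.
elim: k => [|k IH].
  rewrite !expr0; apply: mxnorm_le => // i j; rewrite mxE. by case: (i == j); rewrite /= ?normr1 ?normr0.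
rewrite !exprS; apply: le_trans (mx_norm _ _) _.
by rewrite ler_wpM2l // mulr_ge0.
Qed.
End MatrixNorm.

(** The chain rule for an affine inner map with linear part [l]. Here the intermediate space is
    arbitrary, such as matrices or pairs, which [Ck_comp] does not cover. *)
Lemma Ck_affine (R : realType) (V W : normedModType R) k (O : set V) (O' : set W) (f : W -> R^o) (a l : V -> W) : open O -> continuous a ->
  (forall x v (h : R), a (x + h *: v) = a x + h *: l v) -> (forall x, O x -> O' (a x)) -> Ck k O' f -> Ck k O (fun x => f (a x)).
move=> oO ca al aO; have c (g : W -> R^o) j : Ck j O' g -> forall x, O x -> {for x, continuous (fun x => g (a x))}.
  move=> hg x Ox; apply: (@continuous_comp _ _ _ a g); first exact: ca. by apply: Ck_cont hg _ _; apply: aO.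
elim: k f => [|k IH] f hf; first by split=> //; exact: c hf.
apply: (@Ck_der _ _ _ _ _ _ (fun v x => 'D_(l v) f (a x) : R^o)) => //.
- exact: c hf.
- move=> v x Ox; have [_ /(_ (l v))[d _]] := hf. have /derivableP/derP D := d _ (aO _ Ox).
  by apply/derP => e /D[r r0 rP]; exists r => // h /rP; rewrite al.
- by move=> v; apply: (IH (fun y => 'D_(l v) f y)); have [_ /(_ (l v))[]] := hf.
Qed.
Lemma continuous_ext1 (R : realType) (V W : normedModType R) (f g : V -> W) x : f =1 g -> {for x, continuous g} -> {for x, continuous f}.
by move=> /funext ->. Qed.

Section MatrixDerivative.
Context {R : realType}.

Definition mder m n (F : R -> 'M[R]_(m, n)) (t : R) (L : 'M[R]_(m, n)) := forall i j, is_D t (fun s => F s i j : R^o) (L i j).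

Lemma mder_cst m n (A : 'M[R]_(m, n)) t : mder (fun=> A) t 0.
by move=> i j; rewrite mxE; exact: is_derive_cst. Qed.
Lemma mderD m n (F G : R -> 'M[R]_(m, n)) t L M : mder F t L -> mder G t M -> mder (fun s => F s + G s) t (L + M).
move=> h h' i j; rewrite mxE; fun_mxE.
exact: (@is_deriveD _ _ _ _ _ _ _ _ _ (h i j) (h' i j)).
Qed.
Lemma mderN m n (F : R -> 'M[R]_(m, n)) t L : mder F t L -> mder (fun s => - F s) t (- L).
move=> h i j; rewrite mxE; fun_mxE.
exact: (@is_deriveN _ _ _ _ _ _ _ (h i j)).
Qed.
Lemma is_derive_finsum (V : normedModType R) (I : Type) (r : seq I) (F : I -> V -> R^o) (L : I -> R^o) (x v : V) :
  (forall i, is_derive x v (F i) (L i)) -> is_derive x v (fun s => \sum_(i <- r) F i s : R^o) (\sum_(i <- r) L i).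
move=> h; elim: r => [|i r IH].
  by rewrite big_nil; under eq_fun do rewrite big_nil; exact: is_derive_cst.
rewrite big_cons; under eq_fun do rewrite big_cons.
exact: (@is_deriveD _ _ _ _ _ _ _ _ _ (h i) IH).
Qed.

Lemma deriveM1 (f g : R -> R^o) (t l l' : R) : is_D t f (l : R^o) -> is_D t g (l' : R^o) ->
  is_D t (fun s => f s * g s : R^o) (l * g t + f t * l').
move=> h h'; have := @is_deriveM _ _ _ _ _ _ _ _ h h'.
by move=> H; apply: is_derive_eq H _; rewrite /GRing.scale /= addrC mulrC.
Qed.
Lemma mderM m n p (F : R -> 'M[R]_(m, n)) (G : R -> 'M[R]_(n, p)) t L M : mder F t L -> mder G t M ->
  mder (fun s => F s *m G s) t (L *m G t + F t *m M).
move=> h h' i j; rewrite !mxE -big_split /=; fun_mxE.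
by apply: is_derive_finsum => k; apply: deriveM1.
Qed.
Lemma mderMl m n p (F : R -> 'M[R]_(m, n)) (B : 'M[R]_(n, p)) t L : mder F t L -> mder (fun s => F s *m B) t (L *m B).
by move=> h; have := mderM h (mder_cst B t); rewrite mulmx0 addr0. Qed.
Lemma mderMr m n p (F : R -> 'M[R]_(n, p)) (B : 'M[R]_(m, n)) t L : mder F t L -> mder (fun s => B *m F s) t (B *m L).
by move=> h; have := mderM (mder_cst B t) h; rewrite mul0mx add0r. Qed.
Lemma mder_eq m n (F : R -> 'M[R]_(m, n)) t L L' : mder F t L -> L = L' -> mder F t L'.
by move=> h <-. Qed.
Lemma mder_scale m n (C : 'M[R]_(m, n)) t : mder (fun s => s *: C) t C.
move=> i j; fun_mxE.
have := deriveM1 (is_derive_id (t : R^o) 1) (is_derive_cst (C i j : R^o) t (1 : R^o)).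
by rewrite mul1r mulr0 addr0.
Qed.
Lemma mder0_cst m n (F : R -> 'M[R]_(m, n)) : (forall t, mder F t 0) -> forall s t, F s = F t.
move=> h s t; apply/matrixP => i j.
apply: (@is_derive_0_is_cst R (fun x => F x i j)) => x.
by have := h x i j; rewrite mxE.
Qed.
End MatrixDerivative.

Section Expm.
Context {R : realType}.

Definition pexpm n (A : 'M[R]_n) (N : nat) : 'M[R]_n := series (fun k => (k`!%:R)^-1 *: A ^+ k) N.
Fact expm_key : unit. Proof. by []. Qed.
(** The limit is taken entry by entry, where it is a real series; the lock keeps conversion from
    unfolding it. *)
Definition expm n (A : 'M[R]_n) : 'M[R]_n := locked_with expm_key (\matrix_(i, j) limn (fun N => pexpm A N i j : R^o)).

Definition mcvg m n (u : nat -> 'M[R]_(m, n)) (l : 'M[R]_(m, n)) := forall i j, (fun N => u N i j : R^o) @ \oo --> (l i j : R^o).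

Lemma pexpmS n (A : 'M[R]_n) N : pexpm A N.+1 = pexpm A N + (N`!%:R)^-1 *: A ^+ N.
by rewrite /pexpm seriesSr addrC. Qed.
Lemma pexpm0 n (A : 'M[R]_n) : pexpm A 0 = 0.
by rewrite /pexpm /series /= big_geq. Qed.
Lemma exp_sum_le (x : R) N : 0 <= x -> \sum_(0 <= k < N) (k`!%:R)^-1 * x ^+ k <= expR x.
move=> x0; have := @is_cvg_series_exp_coeff R x => c.
have -> : \sum_(0 <= k < N) (k`!%:R)^-1 * x ^+ k = series (exp_coeff x) N by rewrite /series /=; apply: eq_bigr => k _; rewrite /exp_coeff /= mulrC.
apply: nondecreasing_cvgn_le; last exact: c.
have /nondecreasing_seqP // : forall k, series (exp_coeff x) k <= series (exp_coeff x) k.+1.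
by move=> k; rewrite seriesSr lerDl; exact: exp_coeff_ge0.
Qed.

Lemma pexpm_cvg_to n (A : 'M[R]_n) : mcvg (pexpm A) (expm A).
move=> i j; rewrite /expm unlock mxE.
suff : cvgn (series (fun k => ((k`!%:R)^-1 *: A ^+ k) i j : R^o)).
  rewrite (_ : series _ = fun N => pexpm A N i j) //. by apply/funext => N; rewrite /pexpm /series /= summxE.
apply: normed_cvg; apply: (@series_le_cvg _ _ (exp_coeff (n%:R * `|A|))).
- by move=> k /=.
- by move=> k; apply: exp_coeff_ge0; rewrite mulr_ge0.
- move=> k /=; rewrite mxE normrM ger0_norm ?invr_ge0 // /exp_coeff /= mulrC.
  by rewrite ler_wpM2r ?invr_ge0 // (le_trans (mxcoord_le _ _ _)) ?exprmx_norm.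
- exact: is_cvg_series_exp_coeff.
Qed.

Arguments pexpm_cvg_to {n} A _ _.

Lemma cvg_finsum (I : Type) (r : seq I) (u : I -> nat -> R^o) (l : I -> R^o) : (forall i, u i @ \oo --> l i) ->
  (fun N => \sum_(i <- r) u i N : R^o) @ \oo --> (\sum_(i <- r) l i : R^o).
move=> h; elim: r => [|i r IH].
  by rewrite big_nil; under eq_fun do rewrite big_nil; exact: cvg_cst.
by rewrite big_cons; under eq_fun do rewrite big_cons; apply: cvgD.
Qed.

Lemma mcvg_unique m n (u : nat -> 'M[R]_(m, n)) l l' : mcvg u l -> mcvg u l' -> l = l'.
move=> h h'; apply/matrixP => i j.
exact: (cvg_unique (@Rhausdorff R) (h i j) (h' i j)).
Qed.
Lemma mcvg_ext m n (u v : nat -> 'M[R]_(m, n)) l : u =1 v -> mcvg u l -> mcvg v l.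
by move=> /funext ->. Qed.
Lemma mcvg_mulmxl m n p (u : nat -> 'M[R]_(m, n)) l (B : 'M[R]_(n, p)) : mcvg u l -> mcvg (fun N => u N *m B) (l *m B).
move=> h i j; rewrite mxE; fun_mxE.
by apply: cvg_finsum => k; apply: cvgM; [exact: h|exact: cvg_cst].
Qed.
Lemma mcvg_mulmxr m n p (u : nat -> 'M[R]_(n, p)) l (B : 'M[R]_(m, n)) : mcvg u l -> mcvg (fun N => B *m u N) (B *m l).
move=> h i j; rewrite mxE; fun_mxE.
by apply: cvg_finsum => k; apply: cvgM; [exact: cvg_cst|exact: h].
Qed.
Lemma mcvg_le m n (u : nat -> 'M[R]_(m, n)) l (c : R) : mcvg u l -> (forall N, `|u N| <= c) -> `|l| <= c.
move=> h uc; apply: mxnorm_le => [|i j]; first exact: le_trans (uc 0).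
have H : (fun N => `|u N i j|) @ \oo --> `|l i j| by apply: cvg_norm; exact: h.
rewrite -(cvg_lim (@Rhausdorff R) H); apply: limr_le; first by apply/cvg_ex; exists `|l i j|.
by apply: nearW => N; apply: le_trans (mxcoord_le _ _ _) (uc N).
Qed.

(** Intertwining passes to every power, hence to the series. A rectangular [B] computes the blocks
    of exponentials of block matrices; with adjoint matrices the lemma carries commutation relations
    from the algebra to the group. *)
Lemma expm_tw m n (B : 'M[R]_(m, n)) (A : 'M[R]_n) (A' : 'M[R]_m) : B *m A = A' *m B -> B *m expm A = expm A' *m B.
move=> BA; have E N : B *m pexpm A N = pexpm A' N *m B.
  have EA k : B *m A ^+ k = A' ^+ k *m B.
    elim: k => [|k IH]; first by rewrite !expr0 mulmx1 mul1mx. by rewrite !exprS -!mulmxE mulmxA BA -!mulmxA IH.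
  elim: N => [|N IH]; first by rewrite !pexpm0 mulmx0 mul0mx. by rewrite !pexpmS mulmxDr mulmxDl IH -scalemxAr -scalemxAl EA.
apply: mcvg_unique; first exact: mcvg_mulmxr B (pexpm_cvg_to A).
apply: (@mcvg_ext _ _ (fun N => pexpm A' N *m B)) => [N|]; first by rewrite E.
exact: mcvg_mulmxl (pexpm_cvg_to A').
Qed.

Lemma expm0 n : expm (0 : 'M[R]_n) = 1%:M.
apply: mcvg_unique; first exact: (pexpm_cvg_to 0).
move=> i j.
rewrite -(cvg_shiftS (fun N => pexpm 0 N i j : R^o)).
have E N : pexpm (0 : 'M[R]_n) N.+1 = 1%:M.
  elim: N => [|N IH]; first by rewrite pexpmS pexpm0 add0r fact0 invr1 scale1r expr0. by rewrite pexpmS IH expr0n /= scaler0 addr0.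
by under eq_fun do rewrite E; exact: cvg_cst.
Qed.

Lemma expm_comm n (A : 'M[R]_n) : A *m expm A = expm A *m A.
exact: expm_tw. Qed.
Lemma expm_norm n (A : 'M[R]_n) : `|expm A| <= expR (n%:R * `|A|).
apply: mcvg_le (pexpm_cvg_to A) _ => N; apply: le_trans (ler_norm_sum _ _ _) _.
apply: le_trans (exp_sum_le N _); last by rewrite mulr_ge0.
apply: ler_sum => k _; rewrite normrZ ger0_norm ?invr_ge0 // ler_wpM2l ?invr_ge0 //.
exact: exprmx_norm.
Qed.

Definition tblock n (A B C : 'M[R]_n) : 'M[R]_(n + n) := block_mx A B 0 C.

Lemma tblock_norm n (A B C : 'M[R]_n) (c : R) : `|A| <= c -> `|B| <= c -> `|C| <= c -> `|tblock A B C| <= c.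
move=> a b c0; apply: mxnorm_le => [|i j]; first exact: le_trans a.
rewrite /tblock /block_mx mxE; case: (fintype.split i) => i'; rewrite mxE;
  case: (fintype.split j) => j'; first exact: le_trans (mxcoord_le _ _ _) a.
- exact: le_trans (mxcoord_le _ _ _) b.
- by rewrite mxE normr0 (le_trans _ a).
- exact: le_trans (mxcoord_le _ _ _) c0.
Qed.

(* [[A, B], [0, A + h B]] intertwines with [A] through [(1, 0)] and with [A + h B]
   through [(1, h)]; hence the difference quotient of [expm] in the direction [B] is
   a block of an exponential. *)
Lemma expm_diff n (A B : 'M[R]_n) h : expm (A + h *: B) = expm A + h *: ursubmx (expm (tblock A B (A + h *: B))).
set C := A + _; have c1 : col_mx 1%:M 0 *m expm A = expm (tblock A B C) *m col_mx 1%:M 0.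
  by apply: expm_tw; rewrite mul_col_mx mul_block_col !(mul1mx, mul0mx, mulmx1, mulmx0, addr0).
have c2 : col_mx 1%:M (h *: 1%:M) *m expm C = expm (tblock A B C) *m col_mx 1%:M (h *: 1%:M).
  apply: expm_tw; rewrite mul_col_mx mul_block_col. by rewrite -!scalemxAl -!scalemxAr !(mul1mx, mul0mx, mulmx1, add0r).
move: c1 c2; rewrite -[expm (tblock A B C)]submxK block_mxKur !mul_block_col !mul_col_mx.
rewrite -!scalemxAl -!scalemxAr !(mul1mx, mul0mx, mulmx1, mulmx0, addr0).
by move=> /eq_col_mx[-> _] /eq_col_mx[-> _].
Qed.

Lemma expm_continuous n (A : 'M[R]_n) i j : {for A, continuous (fun X : 'M[R]_n => expm X i j : R^o)}.
apply/contP => e e0; pose K := expR ((n + n)%:R * (`|A| + 1)).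
have K0 : 0 < K by exact: expR_gt0.
exists (Num.min 1 (e / K)) => [|X]; first by rewrite lt_min ltr01 divr_gt0.
rewrite lt_min ltr_pdivlMr // => /andP[h1 he].
have [->|XA] := eqVneq X A; first by rewrite subrr normr0 ltW.
have n0 : `|X - A| != 0 by rewrite normr_eq0 subr_eq0.
(* A step of length [|X - A|] in a direction of norm 1: the block in [expm_diff] is then bounded by
   [K], uniformly for [|X - A| < 1]. *)
have := expm_diff A (`|X - A|^-1 *: (X - A)) `|X - A|; rewrite scalerA mulfV // scale1r subrKC => ->.
rewrite mxE addlK !mxE normrM normr_id; apply: le_trans (ltW he); rewrite ler_wpM2l //.
apply: le_trans (mxcoord_le _ _ _) _; apply: le_trans (expm_norm _) _; rewrite ler_expR ler_wpM2l //.
apply: tblock_norm; first by rewrite lerDl.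
  by rewrite normrZ normfV normr_id mulVf // lerDr.
by rewrite -(subrKC A X); apply: le_trans (ler_normD _ _) _; rewrite lerD2l ltW.
Qed.

Lemma expm_is_derive n (A B : 'M[R]_n) i j : is_derive A B (fun X : 'M[R]_n => expm X i j : R^o) (ursubmx (expm (tblock A B A)) i j : R^o).
apply/derP => e e0; have B0 : 0 < `|B| + 1 by rewrite ltr_wpDl.
have /contP/(_ e e0)[r r0 rP] := @expm_continuous _ (tblock A B A) (lshift n i) (rshift n j).
exists (r / (`|B| + 1)) => [|h]; first by rewrite divr_gt0.
rewrite ltr_pdivlMr // => hr; rewrite expm_diff mxE addlK !mxE -mulrBr normrM mulrC ler_wpM2r //.
apply: rP; apply: le_lt_trans hr; rewrite /tblock opp_block_mx add_block_mx !subrr addlK.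
apply: tblock_norm; rewrite ?normr0 ?mulr_ge0 ?addr_ge0 //.
by rewrite normrZ ler_wpM2l // lerDl.
Qed.

(** The derivative at [A] along [B] is a block of [expm] at an affine function of [A], in twice the
    size; the induction on [k] must therefore hold for all sizes at once. *)
Lemma Ck_expm k n i j : Ck k [set: 'M[R]_n] (fun X : 'M[R]_n => expm X i j : R^o).
elim: k n i j => [|k IH] n i j; first by split=> // x _; exact: expm_continuous.
apply: (@Ck_der _ _ _ _ _ _ (fun B A => ursubmx (expm (tblock A B A)) i j : R^o)).
- by move=> x _; exact: expm_continuous.
- exact: openT.
- by move=> B A _; exact: expm_is_derive.
move=> B; under eq_fun do rewrite !mxE.
apply: (@Ck_affine R 'M[R]_n 'M[R]_(n + n) k setT setT (fun X : 'M[R]_(n + n) => expm X (lshift n i) (rshift n j) : R^o)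
  (fun A : 'M[R]_n => tblock A B A) (fun A : 'M[R]_n => tblock A 0 A)) => //.
- exact: openT.
- move=> A; apply: mcontinuousP => r s; rewrite /tblock -[r]splitK -[s]splitK.
  by case: (fintype.split r) => r'; case: (fintype.split s) => s'; (apply: continuous_ext1 => [y|];
      first by rewrite /= (block_mxEul, block_mxEur, block_mxEdl, block_mxEdr));
    [exact: coord_cont|exact: cst_continuous..|exact: coord_cont].
- by move=> x v h; rewrite /tblock scale_block_mx add_block_mx !scaler0 !addr0.
- exact: IH.
Qed.

Lemma smx_expm (V : normedModType R) n (O : set V) (A : V -> 'M[R]_n) : open O -> smx O A -> smx O (fun x => expm (A x)).
move=> oO hA i j k.
(* [Ck_comp] wants row vectors in the middle, hence the detour through [mxvec]. *)
have -> : (fun x => expm (A x) i j : R^o) = (fun x => (fun y : 'rV[R]_(n * n) => expm (vec_mx y) i j : R^o) (mxvec (A x))).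
  by apply/funext => x; rewrite mxvecK.
apply: (@Ck_comp _ _ _ k O setT (fun y : 'rV[R]_(n * n) => expm (vec_mx y) i j : R^o) (fun x => mxvec (A x))) => //; first exact: openT.
  apply: (@Ck_affine R 'rV[R]_(n * n) 'M[R]_n k setT setT (fun X : 'M[R]_n => expm X i j : R^o)
    (fun y => vec_mx y) (fun y => vec_mx y)) => //; first exact: openT.
  - by move=> y; apply: mcontinuousP => r s; rewrite (_ : (fun y => vec_mx y r s : R^o) = fun y : 'rV[R]_(n * n) => y 0 (mxvec_index r s)); [exact: coord_cont|by apply/funext => z; rewrite mxE].
  - by move=> x v h; rewrite linearD linearZ.
  - exact: Ck_expm.
move=> l; case/mxvec_indexP: l => r s.
by under eq_fun do rewrite mxvecE; exact: hA.
Qed.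
Lemma expm_scale_comm n (A : 'M[R]_n) (t : R) : A *m expm (t *: A) = expm (t *: A) *m A.
by apply: expm_tw; rewrite -scalemxAl -scalemxAr. Qed.
Lemma tblockX n (X A : 'M[R]_n) k : A *m X = X *m A -> tblock X A X ^+ k.+1 = tblock (X ^+ k.+1) (k.+1%:R *: (A *m X ^+ k)) (X ^+ k.+1).
move=> XA; elim: k => [|k IH]; first by rewrite !expr1 expr0 scale1r mulmx1.
rewrite exprS IH /tblock [LHS]mulmx_block !mul0mx !mulmx0 !addr0 add0r; congr block_mx; rewrite [in RHS]exprS //.
rewrite -scalemxAr mulmxA -XA -mulmxA -mulmxE [in A *m X ^+ _]exprS -mulmxE.
by rewrite -[X in _ + X]scale1r -scalerDl natr1.
Qed.

(** When [A] and [X] commute, the [k]-th power contributes [k A X^(k-1)] to the block, and the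
    series sums to [A expm X]; this gives the derivative along a line in [expm_line]. *)
Lemma expm_tblock n (X A : 'M[R]_n) : A *m X = X *m A -> ursubmx (expm (tblock X A X)) = A *m expm X.
move=> XA; have E N : ursubmx (pexpm (tblock X A X) N.+1) = A *m pexpm X N.
  elim: N => [|N IH].
    rewrite pexpmS !pexpm0 mulmx0 add0r expr0 fact0 invr1 scale1r. by rewrite -[1]/(1%:M) scalar_mx_block block_mxKur.
  rewrite pexpmS tblockX // [pexpm X _]pexpmS mulmxDr -IH -[pexpm (tblock X A X) _]submxK.
  rewrite scale_block_mx add_block_mx !block_mxKur scalerA -scalemxAr; congr (_ + _ *: _).
  by rewrite factS natrM invfM mulrAC mulVf ?mul1r // pnatr_eq0.
apply: (@mcvg_unique _ _ (fun N => A *m pexpm X N)); last first.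
  by apply: mcvg_mulmxr; exact: pexpm_cvg_to.
move=> i j.
have := pexpm_cvg_to (tblock X A X) (lshift n i) (rshift n j).
rewrite -(cvg_shiftS (fun N => pexpm _ N _ _)) !mxE; under [in X in X -> _]eq_fun => N.
  rewrite (_ : pexpm _ _ _ _ = (A *m pexpm X N) i j); last by rewrite -E !mxE. over.
by [].
Qed.

Lemma expm_line n (A : 'M[R]_n) t : mder (fun s => expm (s *: A)) t (A *m expm (t *: A)).
move=> i j; have := expm_is_derive (t *: A) A i j; rewrite expm_tblock; last first.
  by rewrite -scalemxAl -scalemxAr.
move=> /derP D; apply/derP => e /D[r r0 rP]; exists r => // h /rP.
by rewrite scalerDl /GRing.scale /= mulr1.
Qed.

Lemma expmK n (A : 'M[R]_n) : expm (- A) *m expm A = 1%:M.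
have d0 t : mder (fun s => expm (s *: (- A)) *m expm (s *: A)) t 0.
  apply: mder_eq (mderM (expm_line (- A) t) (expm_line A t)) _.
  have -> : expm (t *: - A) *m (A *m expm (t *: A)) = A *m expm (t *: - A) *m expm (t *: A) by have := expm_scale_comm (- A) t; rewrite mulNmx mulmxN mulmxA => /oppr_inj ->.
  by rewrite mulNmx !mulNmx addNr.
by have := mder0_cst d0 1 0; rewrite !scale1r !scale0r expm0 mulmx1.
Qed.
Lemma expmVK n (A : 'M[R]_n) : expm A *m expm (- A) = 1%:M.
by have := expmK (- A); rewrite opprK. Qed.
Lemma expm_unit n (A : 'M[R]_n) : expm A \in unitmx.
by have [] := mulmx1_unit (expmVK A). Qed.
End Expm.

Section Phi.
Context {R : realType}.

(* [phim A = \sum_k A ^+ k / (k + 1)!], read off the exponential of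
   [[A, 0], [1, 0]]. *)
Definition phim n (A : 'M[R]_n) : 'M[R]_n := dlsubmx (expm (block_mx A 0 1%:M 0 : 'M[R]_(n + n))).

Lemma phim_expm n (A : 'M[R]_n) s : expm (s *: block_mx A 0 1%:M 0 : 'M[R]_(n + n)) = block_mx (expm (s *: A)) 0 (s *: phim (s *: A)) 1%:M.
set M := block_mx A 0 1%:M 0.
have u0 : expm (s *: M) *m col_mx 0 1%:M = col_mx 0 1%:M :> 'M[R]_(n + n, n).
  rewrite -[LHS](@expm_tw _ _ _ (col_mx 0 1%:M) 0); first by rewrite expm0 mulmx1.
  by rewrite mulmx0 -scalemxAl /M mul_block_col !mulmx0 !mul0mx !addr0 col_mx0 scaler0.
have l0 : expm (s *: M) *m col_mx 1%:M 0 = expm (s *: M) *m col_mx 1%:M 0 by [].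
have ul : row_mx 1%:M 0 *m expm (s *: M) = expm (s *: A) *m row_mx 1%:M 0 :> 'M[R]_(n, n + n).
  apply: expm_tw. by rewrite -scalemxAr /M mul_row_block !mul1mx !mul0mx !addr0 -scalemxAl mul_mx_row mulmx1 mulmx0.
have dl : block_mx 1%:M 0 0 (s *: 1%:M) *m expm (block_mx (s *: A) 0 1%:M 0) =
    expm (s *: M) *m block_mx 1%:M 0 0 (s *: 1%:M) :> 'M[R]_(n + n).
  apply: expm_tw; rewrite /M !mulmx_block scale_block_mx. by rewrite !mulmx_block !(mul1mx, mulmx1, mul0mx, mulmx0, addr0, add0r, scaler0).
move: dl u0 ul; rewrite /phim -[expm (s *: M)]submxK.
rewrite -[expm (block_mx (s *: A) 0 1%:M 0)]submxK.
move: (ulsubmx _) (ursubmx _) (dlsubmx _) (drsubmx _) => a b c d.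
move: (ulsubmx _) (ursubmx _) (dlsubmx _) (drsubmx _) => a' b' c' d'.
rewrite !mulmx_block mul_block_col mul_row_block !(mul1mx, mulmx1, mul0mx, mulmx0, addr0, add0r).
move=> /eq_block_mx[_ _ E _] /eq_col_mx[-> ->]; rewrite mul_mx_row mulmx1 mulmx0.
move=> /eq_row_mx[-> _]; rewrite -E block_mxKdl -scalemxAl mul1mx.
by [].
Qed.

Lemma phim_deriv n (A : 'M[R]_n) s : mder (fun s => s *: phim (s *: A)) s (s *: phim (s *: A) *m A + 1%:M).
have d := expm_line (block_mx A 0 1%:M 0 : 'M[R]_(n + n)) s.
have E s' : s' *: phim (s' *: A) = dlsubmx (expm (s' *: block_mx A 0 1%:M 0 : 'M[R]_(n + n))) by rewrite phim_expm block_mxKdl.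
have -> : s *: phim (s *: A) *m A + 1%:M = dlsubmx (block_mx A 0 1%:M 0 *m expm (s *: block_mx A 0 1%:M 0 : 'M[R]_(n + n))).
  by rewrite expm_scale_comm phim_expm mulmx_block block_mxKdl mul1mx.
move=> i j; under eq_fun do rewrite E !mxE.
by have := d (rshift n i) (lshift n j); rewrite !mxE.
Qed.

Lemma phim0 n : phim (0 : 'M[R]_n) = 1%:M.
have := phim_deriv (0 : 'M[R]_n) 0; rewrite mulmx0 add0r => d.
apply/matrixP => i j; apply: der_uniq (d i j).
under eq_fun do rewrite scaler0; exact: mder_scale.
Qed.
Lemma phim_tw m n (B : 'M[R]_(m, n)) (A : 'M[R]_n) (A' : 'M[R]_m) : B *m A = A' *m B -> B *m phim A = phim A' *m B.
move=> BA.
have : block_mx B 0 0 B *m expm (block_mx A 0 1%:M 0 : 'M[R]_(n + n)) = expm (block_mx A' 0 1%:M 0 : 'M[R]_(m + m)) *m block_mx B 0 0 B.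
  apply: expm_tw; rewrite !mulmx_block. by rewrite !(mul1mx, mulmx1, mul0mx, mulmx0, addr0, add0r) BA.
have := phim_expm A 1; have := phim_expm A' 1; rewrite !scale1r => -> ->.
rewrite !mulmx_block !(mul1mx, mulmx1, mul0mx, mulmx0, addr0, add0r).
by case/eq_block_mx.
Qed.

Lemma smx_phim (V : normedModType R) n (O : set V) (A : V -> 'M[R]_n) : open O -> smx O A -> smx O (fun x => phim (A x)).
move=> oO hA i j; rewrite /phim; under eq_fun do rewrite !mxE.
apply: (@smx_expm R V (n + n) O (fun x => block_mx (A x) 0 1%:M 0) oO _) => {i j} i j.
rewrite -(splitK i) -(splitK j); case: (fintype.split i) => i'; case: (fintype.split j) => j' /=.
+ by under eq_fun do rewrite block_mxEul; exact: hA.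
+ by under eq_fun do rewrite block_mxEur; exact: smooth_cst.
+ by under eq_fun do rewrite block_mxEdl; exact: smooth_cst.
+ by under eq_fun do rewrite block_mxEdr; exact: smooth_cst.
Qed.

Lemma expm_stable m n (u : 'rV[R]_n) (A : 'M[R]_n) (Q : 'M[R]_(n, m)) (A' : 'M[R]_m) :
  A *m Q = Q *m A' -> u *m Q = 0 -> u *m expm A *m Q = 0.
by move=> h uQ; rewrite -mulmxA -(expm_tw (esym h)) mulmxA uQ mul0mx.
Qed.
Lemma phim_stable m n (u : 'rV[R]_n) (A : 'M[R]_n) (Q : 'M[R]_(n, m)) (A' : 'M[R]_m) :
  A *m Q = Q *m A' -> u *m Q = 0 -> u *m phim A *m Q = 0.
by move=> h uQ; rewrite -mulmxA -(phim_tw (esym h)) mulmxA uQ mul0mx.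
Qed.

(** Variation of constants: the value at time [s] of the solution of [w' = w A + v] starting at
    [w0]. For [A = - adm x] it tells how a velocity is carried along [e (s x)]. *)
Definition lin_sol n (A : 'M[R]_n) (w0 v : 'rV[R]_n) (s : R) : 'rV[R]_n := w0 *m expm (s *: A) + v *m (s *: phim (s *: A)).

Lemma lin_sol_deriv n (A : 'M[R]_n) w0 v s : mder (lin_sol A w0 v) s (lin_sol A w0 v s *m A + v).
apply: mder_eq.
  by apply: mderD; apply: mderMr; [exact: expm_line|exact: phim_deriv].
rewrite /lin_sol mulmxDl mulmxDr mulmx1 addrA -!mulmxA; congr (_ + _ + _).
by rewrite expm_scale_comm.
Qed.
Lemma lin_sol0 n (A : 'M[R]_n) w0 v : lin_sol A w0 v 0 = w0.
by rewrite /lin_sol !scale0r expm0 mulmx1 mulmx0 addr0. Qed.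
End Phi.

Section CkMore.
Context {R : realType}.

Lemma Ck_rowcomp (V : normedModType R) n k (O : set V) (F : V -> 'rV[R]_n) j : open O -> Ck k O F -> Ck k O (fun x => F x 0 j : R^o).
move=> oO; elim: k F => [|k IH] F [c h].
  split=> // x Ox; apply: (@continuous_comp _ _ _ F (fun y : 'rV[R]_n => y 0 j : R^o)).
    exact: c.
  exact: coord_cont.
split=> [x Ox|v].
  apply: (@continuous_comp _ _ _ F (fun y : 'rV[R]_n => y 0 j : R^o)); first exact: c. exact: coord_cont.
have [d D] := h v; split=> [x Ox|]; first exact: (derivable_mxP _ _ _).1 (d x Ox) 0 j.
apply: Ck_ext (IH _ D) => // x; rewrite inE => Ox.
by rewrite derive_mx ?mxE //; exact: d.
Qed.

Lemma Ck_comp1 (V : normedModType R) k (O : set V) (f : R -> R^o) (g : V -> R^o) :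
  open O -> Ck k [set: R^o] f -> Ck k O g -> Ck k O (fun x => f (g x)).
move=> oO hf hg.
have -> : (fun x => f (g x)) = (fun x => (fun y : 'rV[R]_1 => f (y 0 0)) (const_mx (g x))) by apply/funext => x; rewrite mxE.
apply: (@Ck_comp R V 1 k O setT (fun y => f (y 0 0)) (fun x => const_mx (g x))) => //; first exact: openT.
  apply: (@Ck_affine R 'rV[R]_1 R^o k setT setT f (fun y => y 0 0) (fun y => y 0 0)) => //.
  - exact: openT.
  - exact: coord_cont.
  - by move=> x v h; rewrite !mxE.
by move=> j; fun_mxE.
Qed.

Lemma smooth_comp1 (V : normedModType R) (O : set V) (f : R -> R^o) (g : V -> R^o) :
  open O -> smooth [set: R^o] f -> smooth O g -> smooth O (fun x => f (g x)).
by move=> oO hf hg k; apply: Ck_comp1. Qed.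
End CkMore.

Lemma der_loc (R : realType) (V : normedModType R) (f g : V -> R^o) x v (l d : R) :
  0 < d -> (forall y, `|y - x| < d -> f y = g y) -> is_derive x v g l -> is_derive x v f l.
move=> d0 fg /derP D; apply/derP => e /D[r r0 rP].
have v0 : 0 < `|v| + 1 by rewrite ltr_wpDl.
exists (Num.min r (d / (`|v| + 1))) => [|h]; first by rewrite lt_min r0 divr_gt0.
rewrite lt_min ltr_pdivlMr // => /andP[hr hd].
rewrite !fg ?subrr ?normr0 //; first exact: rP.
rewrite addlK normrZ; apply: le_lt_trans hd.
by rewrite ler_wpM2l // lerDl.
Qed.

(** * Smooth cutoff functions *)

Section Bump.
Context {R : realType}.

(* The functions [t ^- n * exp (- 1 / t)], extended by 0 to the left; they are
   closed under differentiation up to linear combinations. *)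
Definition flat n (t : R) : R := if 0 < t then t^-1 ^+ n * expR (- t^-1) else 0.

(** A single term of the exponential series at [1 / t] already dominates [t^-(n+k)]; so [flat n]
    vanishes to every order at 0. *)
Lemma flat_le n k t : 0 < t -> flat n t <= (n + k)`!%:R * t ^+ k.
move=> t0; rewrite /flat t0 expRN.
have i0 : 0 < t^-1 by rewrite invr_gt0.
have H : ((n + k)`!%:R)^-1 * t^-1 ^+ (n + k) <= expR t^-1.
  apply: le_trans (exp_sum_le (n + k).+1 (ltW i0)). rewrite big_nat_recr //= lerDr; apply: sumr_ge0 => j _.
  by rewrite mulr_ge0 ?invr_ge0 // exprn_ge0 // ltW.
rewrite ler_pdivrMr ?expR_gt0 //.
have f0 : 0 < (n + k)`!%:R :> R by rewrite ltr0n fact_gt0.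
have -> : t^-1 ^+ n = (n + k)`!%:R * t ^+ k * (((n + k)`!%:R)^-1 * t^-1 ^+ (n + k)).
  rewrite exprD; move: (t^-1 ^+ n) => a. have -> : t ^+ k = (t^-1 ^+ k)^-1 by rewrite exprVn invrK. field; rewrite !gt_eqF ?exprn_gt0 //.
by rewrite ler_wpM2l // mulr_ge0 ?exprn_ge0 // ltW.
Qed.

Lemma flat_ge0 n t : 0 <= flat n t.
rewrite /flat; case: ifP => // t0; rewrite mulr_ge0 ?expR_ge0 // exprn_ge0 //.
by rewrite invr_ge0 ltW.
Qed.
Lemma flat_is_derive n (t : R) : is_D t (flat n : R -> R^o) (flat n.+2 t - n%:R * flat n.+1 t : R^o).
have [t0|t0|->] := ltgtP t 0.
- have -> : flat n.+2 t - n%:R * flat n.+1 t = 0 by rewrite /flat ltNge (ltW t0) /= mulr0 subrr.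
  apply: (@der_loc _ _ _ (fun=> 0 : R^o) _ _ _ (- t)); first by rewrite oppr_gt0.
    move=> y yt; rewrite /flat ltNge; have -> // : y <= 0. by have := ler_norm (y - t); move: yt; lra.
- have inv : is_D t (fun s : R => s^-1 : R^o) (- (t^-1 ^+ 2)).
    have := is_deriveV (lt0r_neq0 t0) (is_derive_id (t : R^o) 1). by rewrite /GRing.scale /= mulr1 exprVn.
  have loc (f : R -> R^o) (l : R) : (forall s, 0 < s -> flat n s = f s) ->
      is_D t f l -> is_D t (flat n : R -> R^o) l.
    move=> ff; apply: (der_loc t0) => y yt; apply: ff. by have := ler_norm (t - y); rewrite distrC; move: yt; lra.
  have ft m : flat m.+1 t = t^-1 * flat m t by rewrite /flat t0 exprS mulrA. elim: n loc => [|n IH] loc.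
    rewrite mul0r subr0; apply: (loc (fun s => expR (- s^-1))).
      by move=> s s0; rewrite /flat s0 expr0 mul1r.
    have -> : flat 2 t = expR (- t^-1) * - - (t^-1 ^+ 2) by rewrite /flat t0 opprK mulrC.
    exact: (@is_derive1_comp _ expR (fun s => - s^-1)).
  apply: (loc (fun s => s^-1 * flat n s)).
    by move=> s s0; rewrite /flat s0 exprS mulrA.
  have -> : flat n.+3 t - n.+1%:R * flat n.+2 t =
      - (t^-1 ^+ 2) * flat n t + t^-1 * (flat n.+2 t - n%:R * flat n.+1 t).
    by rewrite !ft -natr1; ring.
  apply: deriveM1 inv _; apply: IH => f l ff; apply: (der_loc t0) => y yt; apply: ff.
  by have := ler_norm (t - y); rewrite distrC; move: yt; lra.
have -> : flat n.+2 0 - n%:R * flat n.+1 0 = 0 by rewrite /flat ltxx mulr0 subrr.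
apply/derP => e e0; pose C : R := (n + 2)`!%:R.
have C0 : 0 < C by rewrite ltr0n fact_gt0.
exists (e / C) => [|h hr]; first by rewrite divr_gt0.
rewrite add0r [h *: (1 : R^o)]mulr1 mulr0 subr0 {2}/flat ltxx subr0.
rewrite ger0_norm ?flat_ge0 //; have [h0|h0] := ltP 0 h; last first.
  by rewrite /flat ltNge h0 /= mulr_ge0 // ltW.
apply: le_trans (flat_le n 2 h0) _; rewrite -/C expr2 mulrA (gtr0_norm h0).
by rewrite ler_wpM2r ?(ltW h0) // mulrC -ler_pdivlMr // ltW // -(gtr0_norm h0).
Qed.

Lemma smooth_flat n : smooth [set: R^o] (flat n : R^o -> R^o).
have c m x : {for x, continuous (flat m : R^o -> R^o)} by apply: derive_cont; exact: flat_is_derive.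
move=> k; elim: k n => [|k IH] n; first by split=> // x _; exact: c.
apply: (@Ck_der R R^o R^o k setT (flat n) (fun v t : R => v * (flat n.+2 t - n%:R * flat n.+1 t) : R^o)) => //.
- exact: openT.
- move=> v x _; rewrite -{1}[v]mulr1; apply: is_derive_dirZ; exact: flat_is_derive.
move=> v; apply: CkM; [exact: openT|exact: Ck_cst|].
apply: CkD; [exact: openT|exact: IH|].
have := @CkM R R^o k setT (fun=> - n%:R) (flat n.+1) openT (Ck_cst _ _ _) (IH _).
by apply: Ck_ext; [exact: openT|move=> x _; rewrite mulNr].
Qed.

Definition step (u : R) : R := flat 0 u / (flat 0 u + flat 0 (1 - u)).

Lemma flat0_gt0 u : 0 < u -> 0 < flat 0 u.
by move=> u0; rewrite /flat u0 mulr_gt0 ?expR_gt0. Qed.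
Lemma flat0_eq0 u : u <= 0 -> flat 0 u = 0.
by move=> u0; rewrite /flat ltNge u0. Qed.
Lemma step_den u : 0 < flat 0 u + flat 0 (1 - u).
have [u0|u0] := ltP 0 u; first by rewrite ltr_pwDl ?flat0_gt0 // flat_ge0.
by rewrite ltr_wpDl ?flat_ge0 // flat0_gt0 // subr_gt0 (le_lt_trans u0).
Qed.
Lemma step1 u : 1 <= u -> step u = 1.
move=> u1; rewrite /step [X in _ + X]flat0_eq0 ?subr_le0 // addr0 divff // gt_eqF //.
by rewrite flat0_gt0 // (lt_le_trans ltr01).
Qed.
Lemma step0 u : u <= 0 -> step u = 0.
by move=> u0; rewrite /step flat0_eq0 // mul0r. Qed.
Lemma step_ge0 u : 0 <= step u.
by rewrite divr_ge0 ?flat_ge0 // ltW // step_den. Qed.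
Lemma step_le1 u : step u <= 1.
by rewrite ler_pdivrMr ?step_den // mul1r lerDl flat_ge0. Qed.
Lemma smooth_step : smooth [set: R^o] (step : R^o -> R^o).
have o := @openT R^o.
have h : smooth [set: R^o] (fun u : R^o => flat 0 (1 - u) : R^o).
  move=> k; apply: (@Ck_affine R R^o R^o k setT setT (flat 0) (fun u => 1 - u) (fun u => - u)) => //.
  - by move=> x; apply: cvgB; [exact: cvg_cst|exact: cvg_id].
  - by move=> x v c; rewrite scalerN opprD addrA.
  - exact: smooth_flat.
apply: smoothM => //; first exact: smooth_flat.
apply: smoothV => //; last by apply: smoothD => //; exact: smooth_flat.
by move=> x _; rewrite gt_eqF // step_den.
Qed.

(** For a coordinate [x] of the displacement the argument of [step] is [(9/16 - x^2/r^2) * 16/5]: it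
    is at least 1 if [|x| <= r/2] and at most 0 if [|x| >= 3r/4]. The product over the coordinates
    turns this into balls of the maximum norm. *)
Definition bump n (q0 : 'rV[R]_n) (r : R) (q : 'rV[R]_n) : R :=
  \prod_j step ((3 / 4 * r) ^+ 2 / r ^+ 2 * (16 / 5) - (q 0 j - q0 0 j) ^+ 2 / r ^+ 2 * (16 / 5)).

Lemma smooth_bump n (q0 : 'rV[R]_n) r : smooth setT (bump q0 r : _ -> R^o).
have o := @openT 'rV[R]_n; rewrite /bump; apply: smooth_prod => // j _.
apply: (smooth_comp1 o smooth_step); apply: smoothD => //; first exact: smooth_cst.
apply: smoothN => //; apply: smoothM => //; last exact: smooth_cst.
apply: smoothM => //; last exact: smooth_cst.
have h : smooth setT (fun q : 'rV[R]_n => q 0 j - q0 0 j : R^o) by apply: smoothD => //; [exact: smooth_coord|exact: smooth_cst].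
exact: smoothM.
Qed.

Lemma bump1 n (q0 : 'rV[R]_n) r q : 0 < r -> `|q - q0| <= r / 2 -> bump q0 r q = 1.
move=> r0 qr; rewrite /bump big1 // => j _; apply: step1.
have r2 : 0 < r ^+ 2 by rewrite exprn_gt0.
have H : (q 0 j - q0 0 j) ^+ 2 <= (r / 2) ^+ 2.
  rewrite -[X in X <= _]real_normK ?num_real // lerXn2r ?nnegrE ?divr_ge0 ?(ltW r0) //.
  by have := coord_le (q - q0) j; rewrite !mxE => /le_trans; apply.
have : (q 0 j - q0 0 j) ^+ 2 / r ^+ 2 <= 1 / 4.
  rewrite ler_pdivrMr //; apply: le_trans H _; apply: le_of_eq; by field.
have -> : (3 / 4 * r) ^+ 2 / r ^+ 2 = 9 / 16 by field; rewrite (gt_eqF r0).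
lra.
Qed.

Lemma bump0 n (q0 : 'rV[R]_n) r q : 0 < r -> 3 / 4 * r <= `|q - q0| -> bump q0 r q = 0.
move=> r0 qr; have r2 : 0 < r ^+ 2 by rewrite exprn_gt0.
have [j qj] : exists j, 3 / 4 * r <= `|q 0 j - q0 0 j|.
  apply: contrapT => h; have : `|q - q0| < 3 / 4 * r.
    apply: norm_lt_coord => [|j]; first by rewrite mulr_gt0. by rewrite !mxE ltNge; apply/negP => hj; apply: h; exists j.
  by rewrite ltNge qr.
rewrite /bump (bigD1 j) //= step0 ?mul0r //.
rewrite -mulrBl pmulr_lle0 // -mulrBl pmulr_lle0 ?invr_gt0 // subr_le0.
by rewrite -[leRHS]real_normK ?num_real // lerXn2r ?nnegrE // mulr_ge0 // ltW.
Qed.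
Lemma bump_ge0 n (q0 : 'rV[R]_n) r q : 0 <= bump q0 r q.
by apply: prodr_ge0 => j _; exact: step_ge0. Qed.
Lemma bump_le1 n (q0 : 'rV[R]_n) r q : bump q0 r q <= 1.
suff /andP[] : (0 <= bump q0 r q) && (bump q0 r q <= 1) by [].
rewrite /bump; elim/big_ind: _ => [|x y /andP[x0 x1] /andP[y0 y1]|j _].
- by rewrite ler01 lexx.
- by rewrite mulr_ge0 //= mulr_ile1.
- by rewrite step_ge0 step_le1.
Qed.
End Bump.

(** * Gronwall's inequality *)

Section Gronwall.
Context {R : realType}.

Lemma gronwall_scalar (N dN : R -> R) (K c : R) : (forall s : R, 0 <= s <= 1 -> is_D s (N : R -> R^o) (dN s : R^o)) ->
  (forall s : R, 0 <= s <= 1 -> dN s <= K * (N s + c)) -> forall s : R, 0 <= s <= 1 -> N s + c <= (N 0 + c) * expR (K * s).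
move=> dNP h s /andP[s0 s1].
pose M t := (N (s * t) + c) * expR (- (K * s) * t).
have [t /andP[t0 t1]|t /andP[t0 t1]] := @mvt01 R M (fun t => s * (dN (s * t) - K * (N (s * t) + c)) * expR (- (K * s) * t)).
  have st : 0 <= s * t <= 1 by rewrite mulr_ge0 //= mulr_ile1.
  have D1 : is_D t (fun t => N (s * t) + c : R^o) (dN (s * t) * s).
    have H : is_D t (fun t : R => s * t : R^o) s.
      have := deriveM1 (is_derive_cst (s : R^o) t (1 : R^o)) (is_derive_id (t : R^o) 1). by rewrite mul0r add0r mulr1.
    have := @is_deriveD _ _ _ _ _ _ _ _ _ (@is_derive1_comp _ N _ _ _ _ (dNP _ st) H) (is_derive_cst (c : R^o) t (1 : R^o)).
    by rewrite addr0.
  have D2 : is_D t (fun t => expR (- (K * s) * t) : R^o) (expR (- (K * s) * t) * - (K * s)).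
    have H : is_D t (fun t : R => - (K * s) * t : R^o) (- (K * s)).
      have := deriveM1 (is_derive_cst (- (K * s) : R^o) t (1 : R^o)) (is_derive_id (t : R^o) 1).
      by rewrite mul0r add0r mulr1.
    exact: (@is_derive1_comp _ expR _ _ _ _ (is_derive_expR _) H).
  have := deriveM1 D1 D2; rewrite /M => H; apply: is_derive_eq H _. by ring.
have st : 0 <= s * t <= 1 by rewrite mulr_ge0 //= mulr_ile1.
move=> E; have : M 1 <= M 0.
  rewrite -subr_le0 E -mulrA mulr_ge0_le0 // mulr_le0_ge0 ?expR_ge0 //. by rewrite subr_le0; apply: h.
rewrite /M !mulr1 !mulr0 expR0 mulr1 expRN => H.
by rewrite -ler_pdivrMr ?expR_gt0.
Qed.

Lemma sqr_norm_le_sum n (x : 'rV[R]_n) : `|x| ^+ 2 <= \sum_j x 0 j ^+ 2.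
have S0 : 0 <= \sum_j x 0 j ^+ 2 by apply: sumr_ge0 => j _; exact: sqr_ge0.
rewrite -[leRHS]sqr_sqrtr // lerXn2r ?nnegrE ?sqrtr_ge0 //.
apply: norm_le => [|j]; first exact: sqrtr_ge0.
rewrite -[`|_|]ger0_norm // -sqrtr_sqr ler_sqrt // real_normK ?num_real //.
rewrite (bigD1 j) //= lerDl; apply: sumr_ge0 => i _; exact: sqr_ge0.
Qed.

(** The maximum norm is not differentiable, so the scalar inequality is applied to the sum of
    squares [N], which lies between [|e|^2] and [n |e|^2]; this is the origin of the factors [n.+1]
    and [3 n]. *)
Lemma gronwall n (e de : R -> 'rV[R]_n) (C eta : R) : 0 <= C -> 0 <= eta -> (forall s : R, 0 <= s <= 1 -> mder e s (de s)) ->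
  (forall s : R, 0 <= s <= 1 -> `|de s| <= C * (`|e s| + eta)) -> forall s : R, 0 <= s <= 1 ->
  `|e s| <= (`|e 0| + eta) * ((n.+1)%:R * expR (3 * n%:R * C)).
move=> C0 eta0 dP h s s01; pose N t := \sum_j e t 0 j ^+ 2.
pose dN t := \sum_j (de t 0 j * e t 0 j + e t 0 j * de t 0 j).
have N0 (t : R) : 0 <= N t by apply: sumr_ge0 => j _; exact: sqr_ge0.
have DN (t : R) : 0 <= t <= 1 -> is_D t (N : R -> R^o) (dN t : R^o).
  move=> t01; rewrite /N; under eq_fun do under eq_bigr do rewrite expr2. apply: is_derive_finsum => j; apply: deriveM1; exact: dP.
have hN (t : R) : 0 <= t <= 1 -> dN t <= 3 * n%:R * C * (N t + eta ^+ 2).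
  move=> t01; apply: (@le_trans _ _ (\sum_(j < n) 3 * C * (N t + eta ^+ 2))); last first.
    by rewrite sumr_const card_ord -[leLHS]mulr_natl; apply: le_of_eq; ring.
  apply: ler_sum => j _; set a := `|e t|; have a0 : 0 <= a := normr_ge0 _. have h1 : `|de t 0 j * e t 0 j| <= C * (a + eta) * a.
    rewrite normrM ler_pM // ?coord_le //. exact: le_trans (coord_le _ _) (h t t01).
  have h2 : a ^+ 2 <= N t by exact: sqr_norm_le_sum. rewrite [e t 0 j * _]mulrC; apply: le_trans (ler_norm _) _.
  apply: le_trans (ler_normD _ _) _. have h3 : (a + eta) * a <= 3 / 2 * (N t + eta ^+ 2).
    have : 0 <= (a - eta) ^+ 2 by exact: sqr_ge0. have : 0 <= eta ^+ 2 by exact: sqr_ge0. by move: h2; rewrite !expr2; nra.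
  have := ler_wpM2l C0 h3; move: h1; lra.
have := gronwall_scalar DN hN s01 => H.
have K1 : 1 <= expR (3 * n%:R * C) by rewrite -expR0 ler_expR !mulr_ge0.
have Ks : expR (3 * n%:R * C * s) <= expR (3 * n%:R * C) by rewrite ler_expR ler_piMr ?mulr_ge0 //; case/andP: s01.
have N0e : N 0 <= n%:R * `|e 0| ^+ 2.
  apply: (@le_trans _ _ (\sum_(j < n) `|e 0| ^+ 2)).
    apply: ler_sum => j _; rewrite -[X in X <= _]real_normK ?num_real //. by rewrite lerXn2r ?nnegrE // coord_le.
  by rewrite sumr_const card_ord mulr_natl.
set K := expR _ in K1 Ks *.
have E0 : 0 <= expR (3 * n%:R * C * s) by exact: expR_ge0.
have sq : `|e s| ^+ 2 <= ((`|e 0| + eta) * (n.+1%:R * K)) ^+ 2.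
  apply: le_trans (sqr_norm_le_sum _) _; rewrite -/(N s).
  have h4 : N s <= (N 0 + eta ^+ 2) * expR (3 * n%:R * C * s) by apply: le_trans H; rewrite lerDl sqr_ge0.
  apply: le_trans h4 _; apply: (@le_trans _ _ ((n.+1%:R * (`|e 0| + eta) ^+ 2) * K)).
    apply: ler_pM => //; first by rewrite addr_ge0 // sqr_ge0. rewrite -natr1 mulrDl mul1r; apply: lerD.
      apply: le_trans N0e _; rewrite ler_wpM2l // lerXn2r ?nnegrE ?addr_ge0 //.
        by rewrite lerDl.
      by rewrite lerXn2r ?nnegrE ?addr_ge0 // lerDr.
  rewrite exprMn mulrAC mulrC ler_wpM2l ?sqr_ge0 //. rewrite expr2 -[leLHS]mul1r ler_pM ?mulr_ge0 ?(le_trans ler01 K1) //.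
  by rewrite mulr_ege1 // ler1n.
by rewrite -(ler_pXn2r (_ : (0 < 2)%N)) ?nnegrE // !mulr_ge0 ?addr_ge0 // (le_trans ler01 K1).
Qed.
End Gronwall.

Lemma is_deriveMl (R : realType) (V : normedModType R) (f : V -> R^o) (c l : R) (x v : V) :
  is_derive x v f (l : R^o) -> is_derive x v (fun s => c * f s : R^o) (l * c).
move=> /derP D; apply/derP => e e0.
have c0 : 0 < `|c| + 1 by rewrite ltr_wpDl.
have [r r0 rP] := D _ (divr_gt0 e0 c0); exists r => // h /rP H.
rewrite (_ : _ - _ - _ = c * (f (x + h *: v) - f x - h * l)); last by ring.
rewrite normrM; apply: le_trans (ler_wpM2l _ H) _ => //.
rewrite mulrA ler_wpM2r // mulrCA ger_pMr // ler_pdivrMr // mul1r lerDl //.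
Qed.

Lemma mderZ (R : realType) m n (c : R) (F : R -> 'M[R]_(m, n)) t L : mder F t L -> mder (fun s => c *: F s) t (c *: L).
move=> h i j; rewrite mxE mulrC; fun_mxE.
exact: is_deriveMl.
Qed.
Lemma mder_epsP (R : realType) n (F : R -> 'rV[R]_n) t L : mder F t L <-> forall e : R, 0 < e -> exists+ a, forall h : R, `|h| < a ->
    `|F (t + h) - F t - h *: L| <= e * `|h|.
split=> [H e e0|H i j].
  have [a [a0 _ aP]] := fin_radius ltr01 (fun j => (derP _ _ _ _).1 (H 0 j) e e0).
  exists a => // h /aP ha; apply: norm_le => [|j]; first by rewrite mulr_ge0 // ltW. by have := ha j; rewrite [h *: (1 : R^o)]mulr1 !mxE.
apply/derP => e /H[a a0 aP]; exists a => // h /aP.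
rewrite [h *: (1 : R^o)]mulr1 (ord1 i); apply: le_trans.
by have := coord_le (F (t + h) - F t - h *: L) j; rewrite !mxE.
Qed.

(** * Variation of a flow line with the field *)

Section FlowVariation.
Context {R : realType} {D d : nat}.

Lemma smooth_lip n (I : finType) (F : I -> 'rV[R]_n -> R^o) (O : set 'rV[R]_n) x0 : open O -> (forall i, smooth O (F i)) -> O x0 ->
  exists+ r, exists+ C, forall i y, `|y - x0| < r -> `|F i y| <= C /\ forall z, `|z - x0| < r -> `|F i y - F i z| <= C * `|y - z|.
move=> oO sF Ox.
have [r [r0 _ rP]] := fin_radius ltr01 (fun i => Ck1_uniform oO (sF i 1%N) Ox ltr01).
pose c := 1 + \sum_i \sum_j `|'D_(unitv j) (F i) x0|; pose M := \sum_i `|F i x0|.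
have c0 : 0 <= n%:R * c by rewrite mulr_ge0 // addr_ge0 // !sumr_ge0 // => i _; rewrite sumr_ge0.
have M0 : 0 <= M by rewrite sumr_ge0.
have lip i y z : `|y - x0| < r -> `|z - x0| < r -> `|F i y - F i z| <= n%:R * c * `|y - z|.
  move=> yr zr; have := @C1_approx R n (F i) x0 r c (fun=> 0) _ _ y z yr zr. rewrite big1 ?subr0 => [|j _]; last by rewrite mul0r.
  apply=> w /rP/(_ i)[_ /(_ _) h] j; have [dF b] := h j; rewrite ?subr0 //.
  rewrite -(subrK ('D_(unitv j) (F i) x0) ('D__ _ w)); apply: le_trans (ler_normD _ _) (lerD b _).
  rewrite (bigD1 i) //= (bigD1 j) //= -addrA lerDl addr_ge0 // !sumr_ge0 // => k _. by rewrite sumr_ge0.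
have cr := mulr_ge0 c0 (ltW r0).
exists r => //; exists (n%:R * c * (r + 1) + M + 1) => [|i y yr]; first by lra.
split=> [|z zr]; last by apply: le_trans (lip _ _ _ yr zr) _; rewrite ler_wpM2r //; lra.
have x0r : `|x0 - x0| < r by rewrite subrr normr0.
rewrite -(subrK (F i x0) (F i y)); apply: le_trans (ler_normD _ _) _.
have : `|F i x0| <= M by rewrite /M (bigD1 i) //= lerDl sumr_ge0.
by have := lip i _ _ yr x0r; have := ler_wpM2l c0 (ltW yr); lra.
Qed.

Definition mfrechet (F : 'rV[R]_d -> 'M[R]_(D, d)) (p v : 'rV[R]_d) : 'M[R]_(D, d) :=
  \matrix_(i, j) \sum_k 'D_(unitv k) (fun q => F q i j : R^o) p * v 0 k.

Lemma mfrechetD F p a u v : mfrechet F p (a *: u + v) = a *: mfrechet F p u + mfrechet F p v.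
apply/matrixP => i j; rewrite !mxE mulr_sumr -big_split /=.
by apply: eq_bigr => k _; rewrite !mxE; ring.
Qed.

Variables (q0 : 'rV[R]_d) (O : set 'rV[R]_d) (Vm : 'rV[R]_d -> 'M[R]_(D, d)).
Variable adm : 'rV[R]_D -> 'M[R]_D.
Hypotheses (oO : open O) (Oq0 : O q0) (sVm : smx O Vm).
Hypothesis bracketVm : forall q x y j, O q -> 'D_(x *m Vm q) (fun p => (y *m Vm p) 0 j : R^o) q -
  'D_(y *m Vm q) (fun p => (x *m Vm p) 0 j : R^o) q = (y *m adm x *m Vm q) 0 j.

Lemma Vm_taylor : exists r C : R, [/\ 0 < r, 0 < C, Bo q0 r `<=` O & forall q p, `|q - q0| < r -> `|p - q0| < r ->
    [/\ `|Vm q| <= C, `|Vm q - Vm p| <= C * `|q - p|, forall v, `|mfrechet Vm p v| <= C * `|v| &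
        `|Vm q - Vm p - mfrechet Vm p (q - p)| <= C * `|q - p| ^+ 2]].
pose F (a : ('I_D * 'I_d) * option 'I_d) : 'rV[R]_d -> R^o := fun q =>
  let f p := Vm p a.1.1 a.1.2 : R^o in if a.2 is Some k then 'D_(unitv k) f q else f q.
have [|r r0 [C C0 CP]] := @smooth_lip d _ F O q0 oO _ Oq0.
  by case=> ij [k|]; [apply: smooth_derive|]; exact: sVm.
have [r1 r10 r1O] := open_ballP oO Oq0.
pose s := Num.min r1 r; have s0 : 0 < s by rewrite lt_min r10.
have sP q : `|q - q0| < s -> O q /\ `|q - q0| < r by rewrite lt_min => /andP[/r1O].
have ss (q : 'rV[R]_d) : `|q - q0| < s / 5 -> `|q - q0| < s by move: s0; lra.
have sr q : `|q - q0| < s / 5 -> `|q - q0| < r by move=> /ss/sP[].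
pose n : R := d%:R; have n0 : 0 <= n by []; have nC : 0 <= n * C by rewrite mulr_ge0 // ltW.
have C2 : C <= (n * 4 + 1) * C by lra.
exists (s / 5), ((n * 4 + 1) * C); split=> // [||q /ss/sP[]//|q p qs ps].
- exact: divr_gt0.
- exact: lt_le_trans C2.
have D1 ij k y z : `|y - q0| < r -> `|z - q0| < r ->
    `|'D_(unitv k) (fun q => Vm q ij.1 ij.2 : R^o) y - 'D_(unitv k) (fun q => Vm q ij.1 ij.2 : R^o) z| <= C * `|y - z|.
  by move=> yr zr; have [_ /(_ z zr)] := CP (ij, Some k) y yr.
have C0' := ltW C0; have C4 := le_trans C0' C2.
split=> [||v|]; apply: mxnorm_le => [|i j]; rewrite ?(mulr_ge0 C4) ?sqr_ge0 //.
- by apply: le_trans C2; have [] := CP (i, j, None) q (sr q qs).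
- rewrite !mxE; apply: le_trans (ler_wpM2r _ C2) => //. by have [_ /(_ p (sr p ps))] := CP (i, j, None) q (sr q qs).
- rewrite mxE; apply: le_trans (@sum_coord_le _ _ v _ C _) _.
    by move=> k; have [] := CP (i, j, Some k) p (sr p ps).
  rewrite -/n ler_wpM2r //; lra.
rewrite !mxE; have [->|qp] := eqVneq q p.
  by rewrite !subrr big1 ?subrr ?normr0 ?mulr_ge0 // ?addr_ge0 ?mulr_ge0 // => k _; rewrite !mxE mulr0.
have qp0 : 0 < `|q - p| by rewrite normr_gt0 subr_eq0.
have near w : `|w - p| < 2 * `|q - p| -> O w /\ `|w - q0| < r.
  move=> wp; apply: sP; have h1 := ler_normD (w - p) (p - q0). have h2 := ler_normB (q - q0) (p - q0).
  by move: h1 h2 qs ps; rewrite addrA subrK opprB addrA subrK; lra.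
have := @C1_approx R d (fun q => Vm q i j) p (2 * `|q - p|) (2 * (C * `|q - p|))
  (fun k => 'D_(unitv k) (fun q => Vm q i j : R^o) p) _ _ q p _ _.
rewrite subrr normr0 => H; apply: le_trans (H _ _ _ _) _ => [w /near[Ow _] k|w /[dup] wp /near[_ wr] k|||].
- exact: smooth_derivable (sVm i j) Ow.
- apply: le_trans (D1 (i, j) k _ _ wr (sr p ps)) _. by rewrite mulrCA ler_wpM2l // ltW.
- by rewrite ltr_pMl // ltr1n.
- by rewrite mulr_gt0.
rewrite expr2 !mulrA ler_wpM2r // ler_wpM2r //.
by rewrite -/n; lra.
Qed.

Lemma Drow (x : 'rV[R]_D) j v p : O p -> 'D_v (fun p => (x *m Vm p) 0 j : R^o) p = (x *m mfrechet Vm p v) 0 j.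
move=> Op; have sx : smx O (fun q => x *m Vm q) by apply: (smxM oO _ sVm); exact: smx_cst.
rewrite (smooth_DE v oO (sx 0 j) Op) mxE.
under [RHS]eq_bigr do rewrite mxE mulr_sumr.
rewrite exchange_big; apply: eq_bigr => k _ /=; under [RHS]eq_bigr do rewrite mulrA.
rewrite -mulr_suml; congr (_ * _); apply: (der_uniq (smooth_der (unitv k) (sx 0 j) Op)).
fun_mxE; under eq_bigr do rewrite mulrC.
by apply: is_derive_finsum => i; apply: is_deriveMl; apply: smooth_der (sVm i j) Op.
Qed.

Lemma Vm_comp (p : R -> 'rV[R]_d) s v : O (p s) -> mder p s v -> mder (fun t => Vm (p t)) s (mfrechet Vm (p s) v).
move=> Op dp i j; rewrite mxE.
apply: (@derive_comp R R^o d (fun q => Vm q i j : R^o) (fun k => 'D_(unitv k) (fun q => Vm q i j : R^o) (p s)) p).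
  exact: sm_frechet oO (sVm i j) Op.
by move=> k; exact: dp.
Qed.

Lemma bracket_mx q x y : O q -> x *m mfrechet Vm q (y *m Vm q) = y *m mfrechet Vm q (x *m Vm q) - y *m adm x *m Vm q.
move=> Oq; apply/rowP => j; rewrite [RHS]mxE [(- _ : 'rV[R]_d) 0 j]mxE -!(Drow _ _ _ Oq).
by rewrite -bracketVm // subKr.
Qed.
(** The core of the differential of the exponential map: [phi t] is a flow line of the field with
    coefficients [X t]. By the bracket relation, [lin_sol (- adm (X t0)) w0 X'] read through [Vm]
    solves the linearized flow equation, and Gronwall's inequality for the remainder [E] shows that
    it is the derivative in [t]. *)
Lemma flow_variation : exists+ r, forall (phi : R -> R -> 'rV[R]_d) (X : R -> 'rV[R]_D) (t0 dl : R) (w0 X' : 'rV[R]_D), 0 < dl ->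
  (forall t s : R, `|t - t0| < dl -> 0 <= s <= 1 -> `|phi t s - q0| < r /\ mder (phi t) s (X t *m Vm (phi t s))) ->
  mder X t0 X' -> mder (fun t => phi t 0) t0 (w0 *m Vm (phi t0 0)) ->
  mder (fun t => phi t 1) t0 (lin_sol (- adm (X t0)) w0 X' 1 *m Vm (phi t0 1)).
have [r [C [r0 C0 rO tay]]] := Vm_taylor; exists r => // phi X t0 dl w0 X' dl0 hphi dX dphi0.
pose W := lin_sol (- adm (X t0)) w0 X'; pose p0 := phi t0; pose U s := W s *m Vm (p0 s).
have t0d : `|t0 - t0| < dl by rewrite subrr normr0.
pose dU s := X' *m Vm (p0 s) + X t0 *m mfrechet Vm (p0 s) (U s).
have dUP (s : R) : 0 <= s <= 1 -> mder U s (dU s).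
  move=> s01; have [p0r dp0] := hphi t0 s t0d s01; have Op := rO _ p0r. apply: mder_eq (mderM (lin_sol_deriv _ _ _ s) (Vm_comp Op dp0)) _.
  rewrite /dU (bracket_mx (X t0) (W s) Op) mulmxDl mulmxN mulNmx addrAC addrC; congr (_ + _). exact: addrC.
pose a := D%:R * `|X t0| * C; pose b := D%:R * `|X'| * C; pose k := D%:R * C.
have [a0 b0 k0] : [/\ 0 <= a, 0 <= b & 0 <= k] by rewrite !mulr_ge0 // ltW.
have I0 : 0 <= (0 : R) <= 1 by rewrite lexx ler01.
have I1 : 0 <= (1 : R) <= 1 by rewrite ler01 lexx.
have mb (x : 'rV[R]_D) (M : 'M[R]_(D, d)) c : `|M| <= C * c -> `|x *m M| <= D%:R * `|x| * C * c by move=> Mc; apply: le_trans (mx_norm _ _) _; rewrite -[leRHS]mulrA ler_wpM2l // mulr_ge0.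
have [Bu Bu0 UB] : exists2 Bu : R, 0 <= Bu & forall s : R, 0 <= s <= 1 -> `|U s| <= Bu.
  exists ((`|U 0| + 1) * (d.+1%:R * expR (3 * d%:R * (a + b)))) => [|s s01].
    by rewrite !mulr_ge0 ?expR_ge0 // addr_ge0.
  apply: gronwall dUP _ s s01 => // [|s s01]; first by rewrite addr_ge0.
  have [p0r _] := hphi t0 s t0d s01; have [Vb _ /(_ (U s)) Fb _] := tay _ _ p0r p0r.
  apply: le_trans (ler_normD _ _) _; have := mb (X t0) _ _ Fb; have := mb X' (Vm (p0 s)) 1.
  rewrite mulr1 => /(_ Vb); rewrite -/a -/b; have := mulr_ge0 b0 (normr_ge0 (U s)); lra.
apply/mder_epsP => e e0.
pose c := 2 * r + Bu; pose A := 2 * a * c + a + b; pose B := 2 * a * Bu ^+ 2 + b * Bu.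
have c0 : 0 <= c by rewrite addr_ge0 // mulr_ge0 // ltW.
have A1 : 0 <= A by have := mulr_ge0 a0 c0; rewrite /A; lra.
have A0 : 0 <= A + 1 by rewrite addr_ge0.
have B0 : 0 <= B by have := mulr_ge0 a0 (sqr_ge0 Bu); have := mulr_ge0 b0 Bu0; rewrite /B; lra.
pose K := (d.+1)%:R * expR (3 * d%:R * (A + 1)).
have K0 : 0 < K by rewrite mulr_gt0 ?expR_gt0 // ltr0n.
pose e3 := e / (2 * K); have e30 : 0 < e3 by rewrite divr_gt0 // mulr_gt0.
have /mder_epsP/(_ (e3 / (2 * (k + 1))))[|a1 a10 a1P] := dX.
  by rewrite divr_gt0 // mulr_gt0 // ltr_wpDl.
have /mder_epsP/(_ e3 e30)[a2 a20 a2P] := dphi0.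
pose a3 := e3 / (2 * (B + 1)); have a30 : 0 < a3 by rewrite divr_gt0 // mulr_gt0 // ltr_wpDl.
exists (Num.min (Num.min a1 a2) (Num.min (Num.min a3 dl) 1)) => [|h].
  by rewrite !lt_min a10 a20 a30 dl0 ltr01.
rewrite !lt_min => /andP[/andP[ha1 ha2] /andP[/andP[ha3 hdl] h1]].
have td : `|t0 + h - t0| < dl by rewrite addlK.
pose p s := phi (t0 + h) s; pose E s := p s - p0 s - h *: U s.
pose dE s := X (t0 + h) *m Vm (p s) - X t0 *m Vm (p0 s) - h *: dU s.
have dEP (s : R) : 0 <= s <= 1 -> mder E s (dE s).
  move=> s01; have [_ d0] := hphi t0 s t0d s01; have [_ d1] := hphi _ s td s01.
  exact: mderD (mderD d1 (mderN d0)) (mderN (mderZ h (dUP s s01))).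
have dEB (s : R) : 0 <= s <= 1 -> `|dE s| <= (A + 1) * (`|E s| + e3 * `|h|).
  move=> s01; have [q2 _] := hphi t0 s t0d s01; have [q1 _] := hphi _ s td s01.
  have [Vb Lb _ Tb] := tay _ _ q1 q2; have [_ _ /(_ (E s)) Fb _] := tay _ _ q1 q2.
  have pE : p s - p0 s = h *: U s + E s by rewrite /E subrKC.
  (* Taylor remainder of [Vm], linear term in [E], error in [X], product of two first-order
     increments: terms in [E] are left to Gronwall's inequality, the others are small compared with
     [h]. *)
  have -> : dE s = X t0 *m (Vm (p s) - Vm (p0 s) - mfrechet Vm (p0 s) (p s - p0 s)) +
      X t0 *m mfrechet Vm (p0 s) (E s) + (X (t0 + h) - X t0 - h *: X') *m Vm (p s) + h *: (X' *m (Vm (p s) - Vm (p0 s))).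
    rewrite pE mfrechetD /dE /dU !(mulmxBr, mulmxBl, mulmxDr) -!(scalemxAr, scalemxAl). by apply/rowP => j; rewrite !mxE; ring.
  have T3 : `|(X (t0 + h) - X t0 - h *: X') *m Vm (p s)| <= e3 / 2 * `|h|.
    have := mb (X (t0 + h) - X t0 - h *: X') (Vm (p s)) 1; rewrite !mulr1 => /(_ Vb) H.
    apply: le_trans H _; rewrite mulrAC -/k; apply: le_trans (ler_wpM2l k0 (a1P h ha1)) _.
    rewrite mulrA ler_wpM2r // mulrA ler_pdivrMr ?mulr_gt0 ?ltr_wpDl //. by have := mulr_ge0 k0 (ltW e30); lra.
  have N1 : `|p s - p0 s| <= `|h| * Bu + `|E s| by rewrite pE; apply: le_trans (ler_normD _ _) _; rewrite lerD2r normrZ ler_wpM2l // UB.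
  have n2 : `|E s| <= c.
    apply: le_trans (ler_normB _ _) _; rewrite normrZ; have := ler_normB (p s - q0) (p0 s - q0).
    rewrite opprB addrA subrK; have := ler_wpM2r (normr_ge0 (U s)) (ltW h1). by rewrite mul1r; have := UB s s01; rewrite /c; lra.
  apply: le_trans (ler_normD _ _) _; rewrite normrZ. apply: le_trans (lerD (ler_normD _ _) (ler_wpM2l (normr_ge0 h) (mb X' _ _ Lb))) _.
  apply: le_trans (lerD (lerD (ler_normD _ _) T3) (lexx _)) _.
  apply: le_trans (lerD (lerD (lerD (mb (X t0) _ _ Tb) (mb (X t0) _ _ Fb)) (lexx _)) (lexx _)) _.
  have yB : `|h| * B <= e3 / 2 by move: ha3; rewrite ltr_pdivlMr ?mulr_gt0 ?ltr_wpDl // => /ltW; have := normr_ge0 h; lra.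
  rewrite -/a -/b; move: (normr_ge0 h) (normr_ge0 (E s)) (normr_ge0 (p s - p0 s)) N1 n2 (ltW h1) yB.
  move: `|p s - p0 s| `|E s| `|h| => n m y y0 m0 n0 N1 n2 y1 yB.
  have h3 := ler_pM n0 n0 N1 N1; have h4 := ler_wpM2r m0 n2; have h5 := sqr_ge0 (y * Bu - m).
  (* From [n <= y Bu + m]: one factor of [m^2] is replaced by its bound [c], which keeps the
     estimate linear in the error. *)
  have S : n ^+ 2 <= 2 * (y * y * (Bu * Bu)) + 2 * (c * m) by rewrite !expr2 in h5 *; lra.
  have h6 := ler_wpM2l a0 S; have h7 := ler_wpM2l (mulr_ge0 y0 b0) N1. have h8 := ler_wpM2r (mulr_ge0 b0 m0) y1; have h9 := ler_wpM2l y0 yB.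
  have h10 := mulr_ge0 A1 (mulr_ge0 (ltW e30) y0). move: h6 h7 h8 h9 h10 m0; rewrite /A /B !expr2; clear; lra.
have := gronwall A0 (mulr_ge0 (ltW e30) (normr_ge0 h)) dEP dEB I1; rewrite -/K => H.
apply: le_trans H _; apply: (@le_trans _ _ ((e3 * `|h| + e3 * `|h|) * K)).
  rewrite ler_wpM2r ?(ltW K0) // lerD2r /E /U /W lin_sol0; exact: a2P.
by apply: le_of_eq; rewrite /e3; field; rewrite gt_eqF.
Qed.
End FlowVariation.

Lemma Bo_ctr (R : realType) n (x : 'rV[R]_n) r : 0 < r -> Bo x r x.
by rewrite /Bo /= subrr normr0. Qed.
Lemma Bo0 (R : realType) n (x : 'rV[R]_n) r : Bo 0 r x = (`|x| < r).
by rewrite /Bo /= subr0. Qed.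

Definition bext (R : realType) n (q0 : 'rV[R]_n) (r : R) (f : 'rV[R]_n -> R) (q : 'rV[R]_n) : R :=
  if `|q - q0| < r then bump q0 r q * f q else 0.

Lemma bextE (R : realType) n (q0 : 'rV[R]_n) r f q : 0 < r -> `|q - q0| <= r / 2 -> bext q0 r f q = f q.
by move=> r0 h; rewrite /bext bump1 // mul1r ifT //; have := r0; lra. Qed.
Lemma bext_smooth (R : realType) n (q0 : 'rV[R]_n) r (f : 'rV[R]_n -> R) : 0 < r ->
  smooth (Bo q0 r) (f : _ -> R^o) -> smooth setT (bext q0 r f : _ -> R^o).
move=> r0 sf; apply: smooth_local => q _; have [qr|qr] := ltP `|q - q0| r.
  exists (Bo q0 r) => //; apply: (@smooth_ext _ _ _ _ (fun q => bump q0 r q * f q : R^o)).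
  - exact: Bo_open.
  - by move=> x; rewrite inE /Bo /= /bext => ->.
  - apply: smoothM => //; first exact: Bo_open. by apply: smooth_sub (@smooth_bump _ _ q0 r).
exists (Bo q (r / 4)); first by apply: Bo_ctr; rewrite divr_gt0.
apply: (@smooth_ext _ _ _ _ (fun=> 0)); [exact: Bo_open| |exact: smooth_cst].
move=> x; rewrite inE /Bo /= /bext => xq; case: ifP => // _; rewrite bump0 ?mul0r //.
have := ler_normD (x - q0) (q - x); rewrite addrC subrKA => h.
by move: h qr xq; rewrite -(normrN (x - q)) opprB; move: r0; lra.
Qed.

(** * Smooth functions on manifolds and translations on Lie groups *)

Section Charts.
Context {R : realType} {M : topologicalType} {d : nat}.
Variable A : set (chart R M d).
Hypothesis mA : manifold A.
Implicit Types (c : chart R M d) (f : M -> R).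

Lemma chartP c : A c -> is_chart c.
by case: mA => _ h _ _; apply: h. Qed.
Lemma chart_at x : exists2 c, A c & cdom c x.
by case: mA => _ _ h _; apply: h. Qed.
Lemma cdom_open c : A c -> open (cdom c).
by move=> /chartP[[]]. Qed.
Lemma cimg_open c : A c -> open (cimg c).
by move=> /chartP[[]]. Qed.
Lemma cmapK c x : A c -> cdom c x -> cinv c (cmap c x) = x.
by move=> /chartP[_ h _ _]; apply: h. Qed.
Lemma cmap_img c x : cdom c x -> cimg c (cmap c x).
by move=> h; exists x. Qed.
Lemma cinv_dom c v : A c -> cimg c v -> cdom c (cinv c v).
by move=> Ac [x xc <-]; rewrite cmapK. Qed.
Lemma cinvK c v : A c -> cimg c v -> cmap c (cinv c v) = v.
by move=> Ac [x xc <-]; rewrite cmapK. Qed.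
Lemma cinv_open c (O : set M) : A c -> open O -> open [set v | cimg c v /\ O (cinv c v)].
move=> Ac oO; rewrite openE => v [cv Ov]; apply: filterI.
  by apply: open_nbhs_nbhs; split=> //; exact: cimg_open.
have [_ _ _ h] := chartP Ac; apply: (h _ cv).
by apply: open_nbhs_nbhs.
Qed.
Lemma smooth_funM f1 f2 : smooth_fun A f1 -> smooth_fun A f2 -> smooth_fun A (fun x => f1 x * f2 x).
by move=> s1 s2 c Ac; apply: smoothM; [exact: cimg_open|exact: s1|exact: s2]. Qed.
Lemma smooth_funD f1 f2 : smooth_fun A f1 -> smooth_fun A f2 -> smooth_fun A (fun x => f1 x + f2 x).
by move=> s1 s2 c Ac; apply: smoothD; [exact: cimg_open|exact: s1|exact: s2]. Qed.
Lemma smooth_fun_cst (a : R) : smooth_fun A (fun=> a).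
by move=> c Ac; exact: smooth_cst. Qed.

Section Extension.
Variables (c : chart R M d) (q0 : 'rV[R]_d) (r : R).
Hypotheses (Ac : A c) (r0 : 0 < r) (rc : Bo q0 r `<=` cimg c).

Definition cext (F : 'rV[R]_d -> R) (x : M) : R := if pselect (cdom c x) then bext q0 r F (cmap c x) else 0.

Lemma cextE F x : cdom c x -> cext F x = bext q0 r F (cmap c x).
by rewrite /cext; case: pselect. Qed.
(** The support lies in the image of a compact ball, which is closed because [M] is Hausdorff. So
    near every point the extension is either a smooth expression in the chart [c] or identically
    0. *)
Lemma cext_smooth F : smooth (Bo q0 r) (F : _ -> R^o) -> smooth_fun A (cext F).
move=> sF c1 Ac1; pose B : set 'rV[R]_d := [set q | `|q - q0| <= 3 / 4 * r].
have Bc q : B q -> cimg c q by move=> Bq; apply: rc; rewrite /Bo /=; move: Bq; rewrite /B /=; have := r0; lra.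
have cK : closed (cinv c @` B).
  apply: compact_closed; first by case: mA => [[]]. apply: continuous_compact (@ballc_compact _ _ _ _).
  apply: continuous_in_subspaceT => q; rewrite inE => Bq. by have [_ _ _ h] := chartP Ac; apply: h; exact: Bc.
pose O1 := [set v | cimg c1 v /\ cdom c (cinv c1 v)].
pose O2 := [set v | cimg c1 v /\ (~` (cinv c @` B)) (cinv c1 v)].
have oO1 : open O1 by apply: cinv_open => //; exact: cdom_open.
have oO2 : open O2 by apply: cinv_open => //; exact: closed_openC.
apply: smooth_local => v cv; have [in1|nO1] := pselect (O1 v).
  exists O1 => //; apply: (@smooth_ext _ _ _ O1 (fun v => bext q0 r F (cmap c (cinv c1 v)))) => //.
    by move=> w; rewrite inE => - [_ h]; rewrite cextE.
  apply: (@smooth_comp _ _ _ O1 setT (bext q0 r F) (fun v => cmap c (cinv c1 v))) => //.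
  - exact: openT.
  - exact: bext_smooth.
  - case: mA => _ _ _ /(_ c1 c Ac1 Ac) h j k; apply: Ck_rowcomp => //; apply: Ck_sub (h k) => w [cw dw].
    by exists (cinv c1 w); [split=> //; exact: cinv_dom|rewrite cinvK].
exists O2; first by split=> // - [q Bq E]; apply: nO1; split=> //; rewrite -E; apply: cinv_dom => //; exact: Bc.
apply: (@smooth_ext _ _ _ O2 (fun=> 0)) => //; last exact: smooth_cst.
move=> w; rewrite inE => - [cw nw]; rewrite /cext /bext; case: pselect => // h; case: ifP => // _.
rewrite bump0 ?mul0r // leNgt; apply/negP => hb; apply: nw.
by exists (cmap c (cinv c1 w)); [exact: ltW|rewrite cmapK].
Qed.
End Extension.
End Charts.

Section Translations.
Context {R : realType} {G : topGroupType} {d : nat}.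
Variable A : set (chart R G d).
Hypothesis lG : lie_group A.
Implicit Types (f : G -> R) (u : G).

Lemma lie_mfd : manifold A. Proof. by case: lG. Qed.
Notation mA := lie_mfd.

Lemma mulg_cont : continuous (fun x : G * G => (x.1 * x.2)%g).
by case: lG. Qed.
Lemma mult_smooth f c1 c2 : smooth_fun A f -> A c1 -> A c2 -> smooth [set v : 'rV[R]_d * 'rV[R]_d | cimg c1 v.1 /\ cimg c2 v.2]
    (fun v => f (cinv c1 v.1 * cinv c2 v.2)%g : R^o).
move=> sf A1 A2; apply: smooth_local => v [v1 v2].
have [c3 A3 c3v] := chart_at mA (cinv c1 v.1 * cinv c2 v.2)%g.
pose O := [set v : 'rV[R]_d * 'rV[R]_d | [/\ cimg c1 v.1, cimg c2 v.2 & cdom c3 (cinv c1 v.1 * cinv c2 v.2)%g]].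
exists O => //.
have oO : open O.
  rewrite openE => w [w1 w2 w3]. have [_ _ _ h1] := chartP mA A1; have [_ _ _ h2] := chartP mA A2.
  have C : {for w, continuous (fun v : 'rV[R]_d * 'rV[R]_d => (cinv c1 v.1 * cinv c2 v.2)%g)}.
    apply: (@continuous_comp _ _ _ (fun v : 'rV[R]_d * 'rV[R]_d => (cinv c1 v.1, cinv c2 v.2))
      (fun x : G * G => (x.1 * x.2)%g)); last exact: mulg_cont.
    have C1 : (fun v : 'rV[R]_d * 'rV[R]_d => cinv c1 v.1) @ w --> cinv c1 w.1.
      exact: (cvg_comp (fst : 'rV[R]_d * 'rV[R]_d -> _) (cinv c1) cvg_fst (h1 _ w1)).
    have C2 : (fun v : 'rV[R]_d * 'rV[R]_d => cinv c2 v.2) @ w --> cinv c2 w.2.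
      exact: (cvg_comp (snd : 'rV[R]_d * 'rV[R]_d -> _) (cinv c2) cvg_snd (h2 _ w2)).
    exact: (cvg_pair C1 C2).
  have N3 : nbhs w [set v : 'rV[R]_d * 'rV[R]_d | cdom c3 (cinv c1 v.1 * cinv c2 v.2)%g] by apply: C; apply: open_nbhs_nbhs; split=> //; exact: (cdom_open mA A3).
  have N1 : nbhs w [set v : 'rV[R]_d * 'rV[R]_d | cimg c1 v.1] by apply: (cvg_fst : (fun v : 'rV[R]_d * 'rV[R]_d => v.1) @ w --> w.1); apply: open_nbhs_nbhs; split=> //; exact: (cimg_open mA A1).
  have N2 : nbhs w [set v : 'rV[R]_d * 'rV[R]_d | cimg c2 v.2] by apply: (cvg_snd : (fun v : 'rV[R]_d * 'rV[R]_d => v.2) @ w --> w.2); apply: open_nbhs_nbhs; split=> //; exact: (cimg_open mA A2).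
  by near=> z; split; near: z.
apply: (@smooth_ext _ _ _ O (fun v => (fun q => f (cinv c3 q) : R^o) (cmap c3 (cinv c1 v.1 * cinv c2 v.2)%g))) => //.
  by move=> w; rewrite inE => - [_ _ h]; rewrite (cmapK mA).
apply: (@smooth_comp _ _ _ O (cimg c3) (fun q => f (cinv c3 q) : R^o)
   (fun v : 'rV[R]_d * 'rV[R]_d => cmap c3 (cinv c1 v.1 * cinv c2 v.2)%g)) => //.
- exact: (cimg_open mA A3).
- by move=> w [_ _ h]; exact: cmap_img.
- exact: sf.
- by case: lG => _ _ _ /(_ c1 c2 c3 A1 A2 A3) h _ j k; apply: Ck_rowcomp => //; exact: h.
Unshelve. all: by end_near.
Qed.

Lemma sm_ltrans f u : smooth_fun A f -> smooth_fun A (fun x => f (u * x)%g).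
move=> sf c Ac; have [c1 A1 c1u] := chart_at mA u; have oc := cimg_open mA Ac.
have -> : (fun v => f (u * cinv c v)%g : R^o) =
    (fun v => (fun w : 'rV[R]_d * 'rV[R]_d => f (cinv c1 w.1 * cinv c w.2)%g : R^o) (cmap c1 u, v)).
  by apply/funext => v /=; rewrite (cmapK mA).
move=> k; apply: (@Ck_affine R 'rV[R]_d ('rV[R]_d * 'rV[R]_d)%type k (cimg c) [set v : 'rV[R]_d * 'rV[R]_d | cimg c1 v.1 /\ cimg c v.2]
   (fun w : 'rV[R]_d * 'rV[R]_d => f (cinv c1 w.1 * cinv c w.2)%g : R^o) (fun v => (cmap c1 u, v)) (fun v => (0, v)) oc).
- move=> v; have C1 : (fun _ : 'rV[R]_d => cmap c1 u) @ v --> cmap c1 u by exact: cst_continuous.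
  have C2 : (fun v : 'rV[R]_d => v) @ v --> v by exact: cvg_id. exact: (cvg_pair C1 C2).
- by move=> x v h; rewrite /GRing.add /= /GRing.scale /= /add_pair /= /scale_pair /= scaler0 addr0.
- by move=> x cx; split=> //; exact: cmap_img.
- exact: (mult_smooth sf A1 Ac k).
Qed.
End Translations.

Lemma is_derive_shift (R : realType) (f : R -> R^o) (t a l : R) : is_D (t + a) f (l : R^o) -> is_D t (fun s : R => f (s + a)) (l : R^o).
move=> /derP D; apply/derP => e /D[r r0 rP]; exists r => // h /rP.
by rewrite [t + a + _]addrAC.
Qed.

Section LinearFlow.
Context {R : realType}.

Lemma mder_shift m n (F : R -> 'M[R]_(m, n)) (t a : R) L : mder F (t + a) L -> mder (fun s => F (s + a)) t L.
by move=> h i j; exact: (is_derive_shift (h i j)). Qed.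
Lemma is_derive_scale (f : R -> R^o) (t a l : R) : is_D (a * t) f (l : R^o) -> is_D t (fun s : R => f (a * s)) (a * l : R^o).
move=> /is_derive_dirZ -/(_ a) /derP h; apply/derP => eps /h[r r0 rP].
exists r => // k /rP; rewrite mulrDr.
suff -> : k *: (a *: (1 : R^o)) = a * k *: (1 : R^o) by rewrite ![_ *: (1 : R^o)]mulr1.
by rewrite scalerA mulrC.
Qed.
Lemma mder_scaled m n (F : R -> 'M[R]_(m, n)) (t a : R) L : mder F (a * t) L -> mder (fun s => F (a * s)) t (a *: L).
by move=> h i j; rewrite mxE; exact: (is_derive_scale (h i j)). Qed.
Lemma expm_add n (A : 'M[R]_n) (s t : R) : expm ((s + t) *: A) = expm (t *: A) *m expm (s *: A).
have H (u : R) : mder (fun s => expm ((s + t) *: A) *m expm (- (s *: A))) u 0.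
  have d1 := mder_shift (expm_line A (u + t)). have d2 := expm_line (- A) u.
  apply: mder_eq; first (apply: mderM; [exact: d1|under eq_fun do rewrite -scalerN; exact: d2]).
  rewrite /= expm_scale_comm mulNmx mulmxN scalerN -mulmxA. exact: subrr.
have := mder0_cst H s 0; rewrite add0r scale0r oppr0 expm0 mulmx1 => <-.
by rewrite -[RHS]mulmxA [X in _ *m X]expmK mulmx1.
Qed.
Lemma lin_sol_mx n (A : 'M[R]_n) w0 v s : row_mx w0 v *m expm (s *: block_mx A 0 1%:M 0 : 'M[R]_(n + n)) = row_mx (lin_sol A w0 v s) v.
by rewrite phim_expm mul_row_block mulmx0 mulmx1 add0r. Qed.
Lemma lin_solD n (A : 'M[R]_n) w0 v s t : lin_sol A (lin_sol A w0 v s) v t = lin_sol A w0 v (s + t).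
suff : row_mx (lin_sol A (lin_sol A w0 v s) v t) v = row_mx (lin_sol A w0 v (s + t)) v.
  by case/eq_row_mx.
by rewrite -[RHS]lin_sol_mx [s + t]addrC expm_add mulmxA !lin_sol_mx.
Qed.
Lemma lin_sol_scale n (A : 'M[R]_n) w0 v a : lin_sol (a *: A) w0 (a *: v) 1 = lin_sol A w0 v a.
by rewrite /lin_sol !scale1r -scalemxAl scalemxAr. Qed.
Lemma lin_sol_ker n (A : 'M[R]_n) (w : 'rV[R]_n) : w *m A = 0 -> lin_sol A w (- w) 1 = 0.
move=> wA; rewrite /lin_sol !scale1r mulNmx.
have wA' : w *m A = 0 *m w by rewrite wA mul0mx.
by rewrite (expm_tw wA') (phim_tw wA') expm0 phim0 subrr.
Qed.
End LinearFlow.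

Lemma is_derive_min0 (R : realType) (g : R -> R^o) (t l : R) : (forall s : R, g t <= g s) -> is_D t g (l : R^o) -> l = 0.
move=> gmin /derP D; apply/eqP; apply: contraT => l0.
have l1 : 0 < `|l| by rewrite normr_gt0.
have [r r0 rP] := D (`|l| / 2) (divr_gt0 l1 (ltr0n _ 2)).
pose h : R := - Num.sg l * (r / 2).
have hE : `|h| = r / 2 by rewrite normrM normrN normr_sg l0 mul1r gtr0_norm // divr_gt0.
have hl : h * l = - (r / 2 * `|l|) by rewrite /h [`|l|]normrEsg; ring.
have hr : `|h| < r by rewrite hE ltr_pdivrMr // mulr_natr mulr2n ltrDl.
have := rP h hr; rewrite hE [h *: _]mulr1 hl => H.
have := gmin (t + h); have := ler_norm (g (t + h) - g t - - (r / 2 * `|l|)).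
have : 0 < r / 2 * `|l| by rewrite mulr_gt0 // divr_gt0.
move: H; set q := r / 2 * `|l|; have -> : `|l| / 2 * (r / 2) = q / 2 by rewrite /q; ring.
move: (g (t + h)) (g t) => a b; lra.
Qed.
Lemma mder_cont (R : realType) n (F : R -> 'rV[R]_n) t L : mder F t L -> {for t, continuous F}.
by move=> dF; apply: mcontinuousP => i j; apply: derive_cont (dF i j). Qed.
Lemma mder_lt (R : realType) n (F : R -> 'rV[R]_n) t L (c : R) : mder F t L -> `|F t| < c ->
  exists+ r, forall s, `|s - t| < r -> `|F s| < c.
move=> /mder_cont/contP cF Ft.
have [|r r0 rP] := cF ((c - `|F t|) / 2); first by rewrite divr_gt0 // subr_gt0.
exists r => // s /rP h; rewrite -[F s](subrK (F t)); apply: le_lt_trans (ler_normD _ _) _.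
by move: h Ft; lra.
Qed.

(* A Lie group with a linear parametrization by row vectors of its Lie algebra
   and of its exponential map; [y *m adm x] stands for [[x, y]]. *)
Record lieData (R : realType) := LieData { ld_G : topGroupType; ld_d : nat; ld_A : set (chart R ld_G ld_d); ld_D : nat;
  ld_adm : 'rV[R]_ld_D -> 'M[R]_ld_D; ld_lam : 'rV[R]_ld_D -> (ld_G -> R) -> ld_G -> R; ld_e : 'rV[R]_ld_D -> ld_G; ld_lie : lie_group ld_A;
  ld_admL : forall a x y, ld_adm (a *: x + y) = a *: ld_adm x + ld_adm y; ld_adm_alt : forall x, x *m ld_adm x = 0;
  ld_lam_der : forall x, derivation ld_A (ld_lam x) /\ left_invariant ld_A (ld_lam x); ld_lamL : forall (a : R) x y f, smooth_fun ld_A f ->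
    forall u, ld_lam (a *: x + y) f u = a * ld_lam x f u + ld_lam y f u; ld_lam_bracket : forall x y f, smooth_fun ld_A f ->
    forall u, ld_lam (y *m ld_adm x) f u = ld_lam x (ld_lam y f) u - ld_lam y (ld_lam x f) u;
  ld_lam_inj : forall x, (forall f, smooth_fun ld_A f -> forall u, ld_lam x f u = 0) -> x = 0;
  ld_lam_surj : forall dD, derivation ld_A dD -> left_invariant ld_A dD ->
    exists x, forall f, smooth_fun ld_A f -> forall u, dD f u = ld_lam x f u; ld_e0 : ld_e 0 = 1%g;
  ld_e_der : forall x f, smooth_fun ld_A f -> forall t : R, is_D t (fun s : R => f (ld_e (s *: x)) : R^o) (ld_lam x f (ld_e (t *: x)))
}.

(** * The exponential map of a Lie group *)

Section LieGroup.
Context {R : realType} {Ld : lieData R}.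
Notation G := (ld_G Ld).
Notation d := (ld_d Ld).
Notation A := (@ld_A _ Ld).
Notation D := (ld_D Ld).
Notation adm := (@ld_adm _ Ld).
Notation lam := (@ld_lam _ Ld).
Notation e := (@ld_e _ Ld).
Notation lG := (ld_lie Ld).
Notation lam_der := (@ld_lam_der _ Ld).
Notation lamL := (@ld_lamL _ Ld).
Notation e0 := (ld_e0 Ld).
Notation e_der := (@ld_e_der _ Ld).
Notation sm := (smooth_fun A).
Notation mA := (lie_mfd lG).

Lemma lam_smooth x f : sm f -> sm (lam x f).
by case: (lam_der x) => -[h _ _] _; apply: h. Qed.
Lemma lam_ltrans x f u v : sm f -> lam x (fun y => f (u * y)%g) v = lam x f (u * v)%g.
by move=> sf; case: (lam_der x) => _ h; exact: (h f sf u v). Qed.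
Lemma lam0 f u : sm f -> lam 0 f u = 0.
move=> sf; have := lamL 1 0 0 sf u; rewrite scale1r addr0 mul1r => /eqP.
by rewrite -subr_eq subrr eq_sym => /eqP.
Qed.
Lemma lamE x f u : sm f -> lam x f u = \sum_i x 0 i * lam (delta_mx 0 i) f u.
move=> sf; rewrite {1}(row_sum x); elim: (index_enum _) => [|i r IH].
  by rewrite !big_nil lam0.
by rewrite !big_cons lamL // IH.
Qed.

(** The left logarithmic derivative [c^-1 c'], tested on global smooth functions so that no tangent
    space has to be formed. *)
Definition Vel (c : R -> G) (w : 'rV[R]_D) (t : R) := forall f, sm f -> is_D t (fun s => f (c s) : R^o) (lam w f (c t)).

Lemma Vel_ltrans u c w t : Vel c w t -> Vel (fun s => (u * c s)%g) w t.
by move=> h f sf; rewrite -lam_ltrans //; apply: (h (fun y => f (u * y)%g)); exact: (sm_ltrans lG).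
Qed.
Lemma Vel_exp x t : Vel (fun s => e (s *: x)) x t.
by move=> f sf; exact: e_der. Qed.
Lemma Vel_mexp u x t : Vel (fun s => (u * e (s *: x))%g) x t.
by apply: Vel_ltrans; exact: Vel_exp. Qed.
Lemma Vel_cst u t : Vel (fun=> u) 0 t.
by move=> f sf; rewrite lam0 //; exact: is_derive_cst. Qed.
Lemma Vel_shift c w t a : Vel c w (t + a) -> Vel (fun s => c (s + a)) w t.
by move=> h f sf; apply: (is_derive_shift (f := fun s => f (c s) : R^o)); exact: h. Qed.
Lemma Vel_eq c c' w t (dl : R) : 0 < dl -> (forall s : R, `|s - t| < dl -> c s = c' s) -> Vel c' w t -> Vel c w t.
move=> dl0 cc h f sf; rewrite cc ?subrr ?normr0 //.
apply: (der_loc dl0 _ (h f sf)) => s /= sd; by rewrite cc.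
Qed.
Lemma Vel_near c w t f (a : R) : Vel c w t -> sm f -> a < f (c t) -> exists+ dl, forall s : R, `|s - t| < dl -> a < f (c s).
move=> h sf fa; have /contP C := derive_cont (h f sf).
have [|dl dl0 dlP] := C ((f (c t) - a) / 2); first by rewrite divr_gt0 // subr_gt0.
exists dl => // s /dlP; rewrite distrC => H; have := le_trans (ler_norm _) H.
by move: fa; move: (f (c t)) (f (c s)) => x y; lra.
Qed.

(** Coordinates near the identity in a form usable on all of [G]: the functions [kap] are globally
    smooth and agree with a chart on the image of a ball only. The cutoffs of [cut_ex] have
    uniformly bounded left invariant derivatives, and thereby control how long a curve stays in the
    patch. *)
Record locCoord := LocCoord { kap : 'I_d -> G -> R; psi : 'rV[R]_d -> G; ctr : 'rV[R]_d; rad : R; rad_gt0 : 0 < rad;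
  kap_smooth : forall j, sm (kap j); psi_ctr : psi ctr = 1%g; kap_psi : forall q j, Bo ctr rad q -> kap j (psi q) = q 0 j;
  psi_smooth : forall f, sm f -> smooth (Bo ctr rad) (fun q => f (psi q) : R^o); psi2_smooth : forall f c, sm f -> A c ->
    smooth [set v : 'rV[R]_d * 'rV[R]_d | cimg c v.1 /\ Bo ctr rad v.2] (fun v => f (cinv c v.1 * psi v.2)%g : R^o);
  cut_ex : forall eps : R, 0 < eps -> exists2 g : G -> R, sm g & [/\ g 1%g = 1, forall u, 0 <= g u <= 1,
        forall u, g u != 0 -> exists2 q, Bo ctr rad q /\ `|q - ctr| < eps & u = psi q & exists+ C, forall u x, `|lam x g u| <= C * `|x|];
  cext_ex : forall F : 'rV[R]_d -> R, smooth (Bo ctr rad) (F : _ -> R^o) ->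
    exists g : G -> R, exists+ r, sm g /\ forall q, `|q - ctr| < r -> g (psi q) = F q }.

Lemma loc_coord_ex : exists L : locCoord, True.
have [c Ac c1] := chart_at mA (1%g : G).
have [r r0 rP] := open_ballP (cimg_open mA Ac) (cmap_img c1).
pose q0 := cmap c 1%g; have rc : Bo q0 r `<=` cimg c by move=> q; apply: rP.
have r2 : 0 < r / 2 by rewrite divr_gt0.
have rc2 (s : R) : s <= r -> Bo q0 s `<=` cimg c by move=> sr q qs; apply: rc; apply: lt_le_trans qs sr.
have r2r : r / 2 <= r by lra.
pose K j := cext c q0 r (fun q => q 0 j).
have K_sm j : sm (K j) by apply: (cext_smooth mA Ac r0 rc); apply: smooth_coord; exact: Bo_open.
have cut (eps : R) : 0 < eps -> exists2 g : G -> R, sm g & [/\ g 1%g = 1, forall u, 0 <= g u <= 1,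
        forall u, g u != 0 -> exists2 q, Bo q0 (r / 2) q /\ `|q - q0| < eps & u = cinv c q &
        exists+ C, forall u x, `|lam x g u| <= C * `|x|].
  move=> eps0; pose s := Num.min eps (r / 2); have s0 : 0 < s by rewrite lt_min eps0 r2. have sr : s <= r / 2 by rewrite ge_min lexx orbT.
  have se : s <= eps by rewrite ge_min lexx. pose g := cext c q0 s (fun=> 1); have sg : sm g.
    by apply: (cext_smooth mA Ac s0 (rc2 _ (le_trans sr r2r))); exact: smooth_cst.
  have g01 u : 0 <= g u <= 1.
    rewrite /g /cext /bext; case: pselect => [_|_] /=; last by rewrite lexx ler01.
    by case: ifP; rewrite ?mulr1 ?bump_ge0 ?bump_le1 // lexx ler01.
  have gN u : g u != 0 -> exists2 q, `|q - q0| < 3 / 4 * s & u = cinv c q.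
    rewrite /g /cext /bext; case: pselect => [cu|cu] /=; last by rewrite eqxx.
    case: ifP; rewrite ?eqxx // mulr1 => _ b0; exists (cmap c u); last by rewrite (cmapK mA).
    by rewrite ltNge; apply: contra b0 => /(bump0 s0) ->.
  have s34 : 3 / 4 * s < s by move: s0; lra. exists g => //; split=> //.
  - by rewrite /g cextE // bextE // subrr normr0 divr_ge0 // ltW.
  - move=> u /gN[q qs ->]; exists q => //; rewrite /Bo /=; split; lra.
  have bnd i : exists C : R, forall u, `|lam (delta_mx 0 i) g u| <= C.
    pose B : set 'rV[R]_d := [set q | `|q - q0| <= 3 / 4 * s]. have sl := lam_smooth (delta_mx 0 i) sg.
    have cL : {within B, continuous (fun q => lam (delta_mx 0 i) g (cinv c q) : R^o)}.
      apply: continuous_in_subspaceT => q; rewrite inE => Bq. apply: smooth_cont (sl c Ac) _; apply: rc.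
      by move: Bq; rewrite /B /Bo /= -/q0; have := s0; lra.
    have /compact_bounded[N [_ NP]] := continuous_compact cL (@ballc_compact _ _ _ _).
    exists (`|N| + 1) => u; have [u0|u1] := eqVneq (g u) 0.
      (* Where the nonnegative function [g] vanishes it is minimal along every curve, so its
         derivatives vanish; elsewhere the point comes from the compact set [B]. *)
      have -> : lam (delta_mx 0 i) g u = 0; last by rewrite normr0 addr_ge0.
      have := @Vel_mexp u (delta_mx 0 i) 0 g sg; rewrite scale0r e0 mulg1 => /is_derive_min0; apply.
      by move=> t; rewrite scale0r e0 mulg1 u0; case/andP: (g01 (u * e (t *: delta_mx 0 i))%g).
    have [q qs ->] := gN u u1; apply: (NP (`|N| + 1)).
      by rewrite (le_lt_trans (ler_norm N)) // ltrDl.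
    by exists q => //; exact: ltW.
  have /choice[C CP] := bnd; have C0 i : 0 <= C i by apply: le_trans (CP i 1%g).
  exists (D%:R * (\sum_i C i) + 1); first by rewrite ltr_wpDl // mulr_ge0 // sumr_ge0.
  move=> u x; rewrite lamE //; under eq_bigr do rewrite mulrC.
  apply: le_trans (@sum_coord_le _ _ x (fun i => lam (delta_mx 0 i) g u) (\sum_i C i) _) _.
    by move=> i; apply: le_trans (CP i u) _; rewrite (bigD1 i) //= lerDl sumr_ge0.
  by rewrite ler_wpM2r // lerDl.
have rr2 : Bo q0 (r / 2) `<=` cimg c by exact: rc2.
have KP q j : Bo q0 (r / 2) q -> K j (cinv c q) = q 0 j.
  move=> qr; have cq := rr2 q qr; rewrite /K cextE; last exact: (cinv_dom mA). by rewrite (cinvK mA) // bextE // ltW.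
have P2 f c' : sm f -> A c' -> smooth [set v : 'rV[R]_d * 'rV[R]_d | cimg c' v.1 /\ Bo q0 (r / 2) v.2]
      (fun v => f (cinv c' v.1 * cinv c v.2)%g : R^o).
  by move=> sf A'; apply: smooth_sub (mult_smooth lG sf A' Ac) => v [h1 /rr2 h2].
have P1' f : sm f -> smooth (Bo q0 (r / 2)) (fun q => f (cinv c q) : R^o) by move=> sf; apply: smooth_sub (sf c Ac).
have ce (F : 'rV[R]_d -> R) : smooth (Bo q0 (r / 2)) (F : _ -> R^o) ->
    exists g : G -> R, exists+ s, sm g /\ forall q, `|q - q0| < s -> g (cinv c q) = F q.
  move=> sF; exists (cext c q0 (r / 2) F), (r / 2 / 2); first by rewrite divr_gt0. split=> [|q qr]; first exact: (cext_smooth mA Ac r2 rr2).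
  have cq : cimg c q by apply: rr2; apply: lt_le_trans qr _; have := r2; lra. rewrite cextE; last exact: (cinv_dom mA).
  by rewrite (cinvK mA) // bextE // ltW.
by exists (LocCoord r2 K_sm (cmapK mA Ac c1) KP P1' P2 cut ce).
Qed.

Section Coordinates.
Variable L : locCoord.
Notation kap := (kap L).
Notation psi := (psi L).
Notation q0 := (ctr L).
Notation r := (rad L).
Notation r0 := (rad_gt0 L).

Definition kapv (u : G) : 'rV[R]_d := \row_j kap j u.

Lemma kapv_psi q : Bo q0 r q -> kapv (psi q) = q.
by move=> qr; apply/rowP => j; rewrite mxE kap_psi. Qed.

Definition Vm (q : 'rV[R]_d) : 'M[R]_(D, d) := \matrix_(i, j) lam (delta_mx 0 i) (kap j) (psi q).

Lemma VmE x q j : (x *m Vm q) 0 j = lam x (kap j) (psi q).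
by rewrite mxE lamE; [apply: eq_bigr => i _; rewrite mxE|exact: kap_smooth]. Qed.
Lemma Vm_smooth : smx (Bo q0 r) Vm.
move=> i j; fun_mxE.
apply: (psi_smooth L); apply: lam_smooth; exact: kap_smooth.
Qed.
Lemma Vel_kapv c w t q : Vel c w t -> c t = psi q -> mder (fun s => kapv (c s)) t (w *m Vm q).
move=> h ct i j; rewrite (ord1 i) VmE -ct; fun_mxE.
by apply: h; exact: kap_smooth.
Qed.

(** A nonzero value certifies that a point lies in the coordinate patch; by continuity the
    certificate persists along curves ([detects_near]). *)
Definition detects (m : G -> R) := sm m /\ forall u, m u != 0 -> exists2 q, Bo q0 r q & u = psi q.

Lemma detects_ex : exists m, detects m /\ exists2 r1 : R, 0 < r1 <= r & forall q, Bo q0 r1 q -> 0 < m (psi q).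
have [m m_sm [m1 m01 mN _]] := cut_ex L r0; exists m; split.
  by split=> // u /mN[q [qr _] ->]; exists q.
have q0r : Bo q0 r q0 by exact: Bo_ctr r0.
have /contP C := smooth_cont (psi_smooth L m_sm) q0r.
have [s s0 sP] := C (1 / 2) (divr_gt0 ltr01 (ltr0n _ 2)).
exists (Num.min s r); first by rewrite lt_min s0 r0 ge_min lexx orbT.
move=> q; rewrite /Bo /= lt_min => /andP[qs qr].
have := sP q qs; rewrite psi_ctr m1 distrC => h; have := le_trans (ler_norm _) h; lra.
Qed.

Definition in_coords (c : R -> G) t := exists+ dl, forall s : R, `|s - t| < dl -> exists2 q, Bo q0 r q & c s = psi q.

Lemma detects_near c t m : detects m -> {for t, continuous (fun s => m (c s) : R^o)} -> 0 < m (c t) -> in_coords c t.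
move=> [m_sm mN] /contP C mt.
have [s s0 sP] := C (m (c t) / 2) (divr_gt0 mt (ltr0n _ 2)).
exists s => // s' /sP; rewrite distrC => h; apply: mN; rewrite gt_eqF //.
by have := le_trans (ler_norm _) h; move: mt; move: (m (c t)) (m (c s')) => a b; lra.
Qed.

Lemma Vel_psi_comp c t q (f : G -> R) v : sm f -> in_coords c t -> Bo q0 r q -> c t = psi q -> mder (fun s => kapv (c s)) t v ->
  is_D t (fun s => f (c s) : R^o) ('D_v (fun p => f (psi p) : R^o) q).
move=> sf [s s0 sP] qr ct dk.
apply: (der_loc (g := fun s => f (psi (kapv (c s))) : R^o) s0) => [s' /sP[q' q'r ->]|].
  by rewrite kapv_psi.
have sfp := psi_smooth L sf.
rewrite (smooth_DE v (@Bo_open _ _ q0 r) sfp qr).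
apply: (@derive_comp _ _ _ (fun p => f (psi p) : R^o) (fun j => 'D_(unitv j) (fun p => f (psi p) : R^o) q) (fun s => kapv (c s))).
  rewrite ct kapv_psi //; exact: sm_frechet (@Bo_open _ _ q0 r) sfp qr.
by move=> j; exact: dk.
Qed.

Lemma chain_psi m x q f : detects m -> 0 < m (psi q) -> sm f -> Bo q0 r q -> lam x f (psi q) = 'D_(x *m Vm q) (fun q => f (psi q) : R^o) q.
move=> dm mq sf qr; pose c s := (psi q * e (s *: x))%g.
have c0 : c 0 = psi q by rewrite /c scale0r e0 mulg1.
have Vc : Vel c x 0 by exact: Vel_mexp.
have := Vc f sf; rewrite c0 => D1; apply: (der_uniq D1).
apply: (Vel_psi_comp sf _ qr c0); last exact: Vel_kapv.
apply: (detects_near dm); last by rewrite c0.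
by case: dm => m_sm _; apply: derive_cont (Vc m m_sm).
Qed.

Lemma Vm_bracket m q x y j : detects m -> 0 < m (psi q) -> Bo q0 r q -> 'D_(x *m Vm q) (fun p => (y *m Vm p) 0 j : R^o) q -
  'D_(y *m Vm q) (fun p => (x *m Vm p) 0 j : R^o) q = (y *m adm x *m Vm q) 0 j.
move=> dm mq qr.
have E z : (fun p => (z *m Vm p) 0 j : R^o) = (fun p => lam z (kap j) (psi p) : R^o) by apply/funext => p; rewrite VmE.
have sl z := lam_smooth z (kap_smooth L j).
rewrite VmE !E -!(chain_psi _ dm mq (sl _) qr) ld_lam_bracket //; exact: kap_smooth.
Qed.

(** For fixed parameter, the curve [e (s' X)] translated by [c] is a flow line of a left invariant
    field, so [flow_variation] applies in coordinates; its bracket hypothesis is [Vm_bracket]. The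
    cutoff keeps the whole flow line in the patch. *)
Lemma Vel_mul_exp_small : exists+ r1, forall (c : R -> G) (X : R -> 'rV[R]_D) t w0 X',
  c t = 1%g -> Vel c w0 t -> mder X t X' -> `|X t| < r1 -> Vel (fun s => c s * e (X s))%g (lin_sol (- adm (X t)) w0 X' 1) t.
have [m [dm [s /andP[s0 sr] sP]]] := detects_ex.
have sb q : Bo q0 s q -> Bo q0 r q by move=> h; apply: lt_le_trans h sr.
have o : Bo q0 s q0 by exact: Bo_ctr.
have sV : smx (Bo q0 s) Vm by apply: smx_sub Vm_smooth => q /sb.
have [r' r'0 FV] := flow_variation (@Bo_open _ _ q0 s) o sV (fun q x y j qs => Vm_bracket x y j dm (sP q qs) (sb q qs)).
have rs0 : 0 < Num.min r' s by rewrite lt_min r'0.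
have [g sg [g1 g01 gN [C C0 CP]]] := cut_ex L rs0.
(* Along the segment to [X] with [|X| < r1] the cutoff changes by at most 1/4; it starts above 3/4,
   hence stays at least 1/2. *)
pose r1 := 1 / (4 * C); have r10 : 0 < r1 by rewrite divr_gt0 // mulr_gt0.
exists r1 => // c X t w0 X' ct Vc dX Xt.
have gt34 : 3 / 4 < g (c t) by rewrite ct g1; lra.
have [dl1 dl10 dl1P] := Vel_near Vc sg gt34.
have [dl2 dl20 dl2P] := mder_lt dX Xt.
pose dl := Num.min dl1 dl2; have dl0 : 0 < dl by rewrite lt_min dl10.
pose phi t' s' := kapv (c t' * e (s' *: X t'))%g.
have stay (t' s' : R) : `|t' - t| < dl -> 0 <= s' <= 1 -> 1 / 2 <= g (c t' * e (s' *: X t'))%g.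
  rewrite lt_min => /andP[/dl1P h1 /dl2P h2] /andP[s'0 s'1]. have [//|k k01] := @mvt01 R (fun k => g (c t' * e (k *: (s' *: X t')))%g)
    (fun k => lam (s' *: X t') g (c t' * e (k *: (s' *: X t')))%g). by move=> k _; exact: Vel_mexp.
  rewrite scale1r scale0r e0 mulg1 => E. have : `|g (c t' * e (s' *: X t'))%g - g (c t')| <= C * r1.
    rewrite E; apply: le_trans (CP _ _) _; rewrite ler_wpM2l ?(ltW C0) //. rewrite normrZ ger0_norm //; apply: le_trans (ltW h2).
    by rewrite ler_piMl.
  have -> : C * r1 = 1 / 4 by rewrite /r1; field; rewrite gt_eqF. rewrite distrC => h; have := le_trans (ler_norm _) h; move: h1.
  by move: (g _) (g _) => a b; lra.
have inq (t' s' : R) : `|t' - t| < dl -> 0 <= s' <= 1 -> exists2 q, Bo q0 s q /\ `|q - q0| < r' & (c t' * e (s' *: X t'))%g = psi q.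
  move=> h1 h2; have [|q [qr qm] E] := gN (c t' * e (s' *: X t'))%g.
    by rewrite gt_eqF // (lt_le_trans _ (stay _ _ h1 h2)).
  by exists q => //; move: qm; rewrite lt_min => /andP[].
have td : `|t - t| < dl by rewrite subrr normr0.
have I0 : 0 <= (0 : R) <= 1 by rewrite lexx ler01.
have I1 : 0 <= (1 : R) <= 1 by rewrite ler01 lexx.
have H := FV phi X t dl w0 X' dl0 _ dX _.
have [q [qs _] E] := inq t 1 td I1; rewrite scale1r in E.
have phi1 : phi t 1 = q by rewrite /phi scale1r E kapv_psi //; exact: sb.
move=> f sf; rewrite E (chain_psi _ dm (sP q qs) sf (sb q qs)).
have phiE : (fun t' => phi t' 1) = (fun t' => kapv (c t' * e (X t'))%g) by apply/funext => t'; rewrite /phi scale1r.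
apply: (Vel_psi_comp sf _ (sb q qs) E).
  exists dl => // t' h; have [q' [q's _] E'] := inq t' 1 h I1. by exists q'; [exact: sb|rewrite -E' scale1r].
rewrite -phiE -phi1; apply: H.
- move=> t' s' h1 h2; have [q' [q's q'r] E'] := inq t' s' h1 h2. have q'E : phi t' s' = q' by rewrite /phi E' kapv_psi //; exact: sb.
  split; first by rewrite q'E. rewrite q'E; apply: (Vel_kapv _ E'); exact: Vel_mexp.
- have [q' [q's q'r] E'] := inq t 0 td I0. have q'E : phi t 0 = q' by rewrite /phi E' kapv_psi //; exact: sb.
  have -> : phi^~ 0 = (fun t' => kapv (c t')) by apply/funext => t'; rewrite /phi scale0r e0 mulg1.
  rewrite q'E; apply: Vel_kapv Vc _; by rewrite -E' scale0r e0 mulg1.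
Qed.
End Coordinates.

Lemma admZ a x : adm (a *: x) = a *: adm x.
have E0 : adm 0 = 0.
  have := @ld_admL _ Ld 1 0 0; rewrite scale1r addr0 scale1r => /eqP. by rewrite -subr_eq subrr eq_sym => /eqP.
by rewrite -[a *: x]addr0 ld_admL E0 addr0.
Qed.
Lemma admN x : adm (- x) = - adm x.
by rewrite -scaleN1r admZ scaleN1r. Qed.
Lemma lamZ a x f u : sm f -> lam (a *: x) f u = a * lam x f u.
by move=> sf; rewrite -[a *: x]addr0 lamL // lam0 // addr0. Qed.
Lemma Vel_scale c w t a : Vel c w (a * t) -> Vel (fun s => c (a * s)) (a *: w) t.
by move=> h f sf; rewrite lamZ //; apply: (is_derive_scale (f := fun s => f (c s) : R^o)); exact: h.
Qed.
Lemma Vel_unique c w w' t : Vel c w t -> Vel c w' t -> w = w'.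
move=> h h'; apply/eqP; rewrite -subr_eq0; apply/eqP; apply: (@ld_lam_inj _ Ld) => f sf u.
have E z : lam z f u = lam z (fun y => f (u * (c t)^-1 * y)%g) (c t) by rewrite lam_ltrans // mulgVK.
rewrite -(scaleN1r w') addrC lamL // !E mulN1r.
have sf' := sm_ltrans lG (u * (c t)^-1)%g sf.
by rewrite (der_uniq (h _ sf') (h' _ sf')) addNr.
Qed.

(** Smooth functions and their left translates keep their value along [c]; a cutoff puts
    [(c 0)^-1 * c 1] into the patch, and the coordinate functions identify it with 1. *)
Lemma Vel0_cst c : (forall t : R, 0 <= t <= 1 -> Vel c 0 t) -> c 1 = c 0.
move=> h; have [L _] := @loc_coord_ex.
have E f : sm f -> f (c 1) = f (c 0).
  move=> sf; have [|k _] := @mvt01 R (fun t => f (c t)) (fun=> 0).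
    by move=> t t01; have := h t t01 f sf; rewrite lam0.
  by move/eqP; rewrite subr_eq0 => /eqP.
have [g sg [g1 _ gN _]] := cut_ex L (rad_gt0 L).
have := E _ (sm_ltrans lG (c 0)^-1%g sg); rewrite /= mulVg g1 => gE.
have [|q [qr _] qE] := gN ((c 0)^-1 * c 1%R)%g; first by rewrite gE oner_neq0.
suff q0 : q = ctr L by apply: (mulgI (c 0)^-1%g); rewrite qE q0 psi_ctr mulVg.
apply/rowP => j; rewrite -(kap_psi j qr) -qE.
have := E _ (sm_ltrans lG (c 0)^-1%g (kap_smooth L j)) => /= ->.
by rewrite mulVg -(psi_ctr L) kap_psi // /Bo /= subrr normr0 rad_gt0.
Qed.

Lemma Vel_mul_exp_near1 : exists+ r1, forall (c : R -> G) (X : R -> 'rV[R]_D) t w0 X', Vel c w0 t -> mder X t X' -> `|X t| < r1 ->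
  Vel (fun s => c s * e (X s))%g (lin_sol (- adm (X t)) w0 X' 1) t.
have [L _] := @loc_coord_ex; have [r1 r10 H] := Vel_mul_exp_small L.
exists r1 => // c X t w0 X' Vc dX Xr.
have := H _ X t w0 X' (mulVg (c t)) (Vel_ltrans (c t)^-1%g Vc) dX Xr.
move=> /(Vel_ltrans (c t)); under eq_fun do rewrite mulgA mulVKg; by [].
Qed.

(** The curve [k |-> e ((t k + s) x) e (- t k x)] has zero velocity: the two contributions cancel
    because [x] commutes with itself. The bound on [t] comes from the local form of the velocity
    formula. *)
Lemma exp_add_small : exists+ r1, forall x (s t : R), `|t| * `|x| < r1 -> e ((s + t) *: x) = (e (s *: x) * e (t *: x))%g.
have [r1 r10 H] := Vel_mul_exp_near1.
have K (x : 'rV[R]_D) (s t : R) : `|t| * `|x| < r1 -> (e ((t + s) *: x) * e (- (t *: x)))%g = e (s *: x).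
  move=> tx; have := @Vel0_cst (fun k => e ((t * k + s) *: x) * e (- ((t * k) *: x)))%g.
  rewrite !mulr1 !mulr0 add0r scale0r oppr0 e0 mulg1; apply => k /andP[k0 k1].
  have -> : (0 : 'rV[R]_D) = lin_sol (- adm (- ((t * k) *: x))) (t *: x) (- (t *: x)) 1.
    rewrite lin_sol_ker // mulmxN -scalerN admZ. by rewrite admN -scalemxAl -scalemxAr mulmxN ld_adm_alt oppr0 !scaler0 oppr0.
  apply: (H (fun k => e ((t * k + s) *: x)) (fun k => - ((t * k) *: x))).
  - apply: (Vel_scale (c := fun k => e ((k + s) *: x))). by apply: (Vel_shift (c := fun k => e (k *: x))); exact: Vel_exp.
  - rewrite -scaleN1r; under eq_fun do rewrite -scaleN1r; apply: mderZ. by apply: (mder_scaled (F := fun k => k *: x)); exact: mder_scale.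
  - rewrite normrN normrZ normrM; apply: le_lt_trans tx. by rewrite ler_wpM2r // [`|k|]ger0_norm // ler_piMr.
exists r1 => // x s t tx.
have tx' : `|- t| * `|x| < r1 by rewrite normrN.
have := K x (s + t) (- t) tx'; rewrite addrC addrK scaleNr opprK => E.
by rewrite -E.
Qed.

Lemma exp_add x (s t : R) : e ((s + t) *: x) = (e (s *: x) * e (t *: x))%g.
have [r1 r10 H] := exp_add_small.
have [n nP] : exists n : nat, `|t| * `|x| < n.+1%:R * r1.
  exists (Num.truncn (`|t| * `|x| / r1)). rewrite -ltr_pdivrMr //; exact: truncnS_gt.
pose u := t / n.+1%:R; have n0 : n.+1%:R != 0 :> R by rewrite pnatr_eq0.
have uP : `|u| * `|x| < r1 by rewrite normrM normfV [`|n.+1%:R|]ger0_norm // mulrAC ltr_pdivrMr ?ltr0n // [ltRHS]mulrC.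
have step s' k : e ((s' + k%:R * u) *: x) = (e (s' *: x) * e (u *: x) ^+ k)%g.
  elim: k => [|k IH]; first by rewrite mul0r addr0 expg0 mulg1. by rewrite -natr1 mulrDl mul1r addrA H // IH expgSr mulgA.
have tE : t = n.+1%:R * u by rewrite /u mulrCA mulfV // mulr1.
rewrite tE step; congr (_ * _)%g.
by have := step 0 n.+1; rewrite add0r scale0r e0 mul1g.
Qed.

Lemma expN x : e (- x) = (e x)^-1%g.
apply: (mulgI (e x)); rewrite mulgV.
by rewrite -{1}[x]scale1r -scaleN1r -exp_add subrr scale0r e0.
Qed.
Lemma expMn x n : e (n%:R *: x) = (e x ^+ n)%g.
elim: n => [|n IH]; first by rewrite scale0r e0 expg0.
by rewrite -natr1 exp_add scale1r IH expgSr.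
Qed.
(** [e (X s)] is a power of an exponential of a small vector; each factor carries the velocity by
    [lin_sol] over an equal fraction of time, and [lin_solD] adds the fractions up to 1. *)
Lemma Vel_mul_exp c X t w0 X' : Vel c w0 t -> mder X t X' -> Vel (fun s => c s * e (X s))%g (lin_sol (- adm (X t)) w0 X' 1) t.
move=> Vc dX; have [r1 r10 H] := Vel_mul_exp_near1.
have [n nP] : exists n : nat, `|X t| < n.+1%:R * r1.
  exists (Num.truncn (`|X t| / r1)). rewrite -ltr_pdivrMr //; exact: truncnS_gt.
pose a : R := n.+1%:R^-1; have n0 : n.+1%:R != 0 :> R by rewrite pnatr_eq0.
have a0 : 0 < a by rewrite invr_gt0 ltr0n.
have aX : `|a *: X t| < r1 by rewrite normrZ gtr0_norm // mulrC ltr_pdivrMr ?ltr0n // [ltRHS]mulrC.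
have step k : Vel (fun s => c s * e (a *: X s) ^+ k)%g (lin_sol (- adm (X t)) w0 X' (k%:R * a)) t.
  elim: k => [|k IH].
    by under eq_fun do rewrite expg0 mulg1; rewrite mul0r lin_sol0.
  have := H _ (fun s => a *: X s) t _ (a *: X') IH (mderZ a dX) aX. rewrite admZ -scalerN lin_sol_scale lin_solD -/a.
  by under eq_fun do rewrite -mulgA -expgSr; rewrite -natr1 mulrDl mul1r.
have := step n.+1; rewrite /a mulfV //.
by under eq_fun do rewrite -expMn scalerA mulfV // scale1r.
Qed.

Lemma Vel_cst_exp c w : (forall t : R, 0 <= t <= 1 -> Vel c w t) -> c 1 = (c 0 * e w)%g.
move=> h; suff : (c 1%R * e (1%R *: - w))%g = (c 0%R * e (0%R *: - w))%g.
  by rewrite scale0r e0 mulg1 scale1r expN => <-; rewrite mulgVK.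
apply: (@Vel0_cst (fun s => c s * e (s *: - w))%g) => t t01.
have -> : (0 : 'rV[R]_D) = lin_sol (- adm (t *: - w)) w (- w) 1 by rewrite lin_sol_ker // mulmxN admZ -scalemxAr admN mulmxN ld_adm_alt oppr0 scaler0 oppr0.
by apply: Vel_mul_exp; [exact: h|exact: mder_scale].
Qed.

(** Conjugation by [u^-1] rather than [u]: as matrices act on row vectors from the right, this makes
    [u |-> M] multiplicative in the same order ([is_AdM]). *)
Definition is_Ad (u : G) (M : 'M[R]_D) := forall y, (u^-1 * e y * u)%g = e (y *m M).

Lemma exp_conj x : is_Ad (e x) (expm (- adm x)).
move=> y; have := @Vel_cst_exp (fun s => (e x)^-1 * e (s *: y) * e x)%g (y *m expm (- adm x)).
rewrite scale0r scale1r e0 mulg1 mulVg mul1g; apply => t _.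
have -> : y *m expm (- adm x) = lin_sol (- adm x) y 0 1 by rewrite /lin_sol mul0mx addr0 scale1r.
apply: (@Vel_mul_exp (fun s => (e x)^-1 * e (s *: y))%g (fun=> x) t y 0); last exact: mder_cst.
exact: Vel_mexp.
Qed.

Lemma is_Ad_unique u M N : is_Ad u M -> is_Ad u N -> M = N.
move=> hM hN; apply/row_matrixP => i; rewrite !rowE.
have E (t : R) : e (t *: (delta_mx 0 i *m M)) = e (t *: (delta_mx 0 i *m N)) by rewrite !scalemxAl -hM -hN.
apply: (@Vel_unique (fun t => e (t *: (delta_mx 0 i *m M))) _ _ 0); first exact: Vel_exp.
by under eq_fun do rewrite E; exact: Vel_exp.
Qed.
Lemma is_Ad1 : is_Ad 1%g 1%:M.
by move=> y; rewrite invg1 mul1g mulg1 mulmx1. Qed.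
Lemma is_AdM u v M N : is_Ad u M -> is_Ad v N -> is_Ad (u * v)%g (M *m N).
by move=> hM hN y; rewrite mulmxA -hN -hM invgM !mulgA. Qed.
Lemma is_AdV u M : M \in unitmx -> is_Ad u M -> is_Ad u^-1%g (invmx M).
move=> uM hM y; have := hM (y *m invmx M); rewrite mulmxKV // => <-.
by rewrite invgK !mulgA mulgV mul1g mulgK.
Qed.

Section NormalCoordinates.
Variable L : locCoord.
Notation psi := (psi L).
Notation q0 := (ctr L).
Notation r := (rad L).

Lemma ctr_in : Bo q0 r q0.
exact: Bo_ctr (rad_gt0 _). Qed.
Lemma chain_ctr x f : sm f -> lam x f 1%g = 'D_(x *m Vm L q0) (fun q => f (psi q) : R^o) q0.
move=> sf; have [m [dm [s /andP[s0 sr] sP]]] := detects_ex L.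
rewrite -(chain_psi x dm _ sf ctr_in) ?psi_ctr //.
by rewrite -(psi_ctr L); apply: sP; rewrite /Bo /= subrr normr0.
Qed.
Lemma Vm_inj (x : 'rV[R]_D) : x *m Vm L q0 = 0 -> x = 0.
move=> x0; apply: ld_lam_inj => f sf u.
have := chain_ctr x (sm_ltrans lG u sf); rewrite lam_ltrans // mulg1 x0 => ->.
have sfu := psi_smooth L (sm_ltrans lG u sf).
rewrite (smooth_DE 0 (@Bo_open _ _ q0 r) sfu ctr_in).
by rewrite big1 // => j _; rewrite mxE mulr0.
Qed.

(** The derivative of [f (u * psi q)] at the centre in the direction [v] is a left invariant
    derivation in [f], hence some [lam x]. With [Vm_inj] this identifies the tangent space at 1 with
    the Lie algebra. *)
Lemma Vm_surj v : exists x : 'rV[R]_D, x *m Vm L q0 = v.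
pose dD f u := 'D_v (fun q => f (u * psi q)%g : R^o) q0.
have dP f u : sm f -> is_derive q0 v (fun q => f (u * psi q)%g : R^o) (dD f u) by move=> sf; apply: smooth_der (psi_smooth L (sm_ltrans lG u sf)) ctr_in.
have [||x xP] := @ld_lam_surj _ Ld dD.
- split=> [f sf c Ac|a f1 f2 s1 s2 u|f1 f2 s1 s2 u].
  + have oc := cimg_open (lie_mfd lG) Ac. have sF := @psi2_smooth L f c sf Ac.
    pose F := fun w : 'rV[R]_d * 'rV[R]_d => f (cinv c w.1 * psi w.2)%g : R^o.
    have E : {in cimg c, (fun w => (fun z => 'D_(0, v) F z) (w, q0)) =1 (fun w => dD f (cinv c w) : R^o)}.
      move=> w; rewrite inE => cw.
      have h1 : is_derive (w, q0) (0, v) F ('D_(0, v) F (w, q0)) by apply: smooth_der sF _; split=> //; exact: ctr_in.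
      have := (derive_line0 F (w, q0) (0, v) _).1 h1.
      have := (derive_line0 (fun q => f (cinv c w * psi q)%g : R^o) q0 v _).1 (dP f (cinv c w) sf). move=> h2 h3; apply: (der_uniq _ h2).
      have -> : (fun t : R => f (cinv c w * psi (q0 + t *: v))%g : R^o) = (fun t => F ((w, q0) + t *: ((0 : 'rV[R]_d), v))) => //.
      by apply/funext => t; rewrite /F /= scaler0 addr0.
    apply: (smooth_ext oc E) => k. apply: (@Ck_affine R 'rV[R]_d ('rV[R]_d * 'rV[R]_d)%type k (cimg c)
       [set v : 'rV[R]_d * 'rV[R]_d | cimg c v.1 /\ Bo q0 r v.2] (fun z => 'D_(0, v) F z) (fun w => (w, q0)) (fun w => (w, 0)) oc).
    * move=> w; have C2 : (fun _ : 'rV[R]_d => q0) @ w --> q0 by exact: cst_continuous.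
      have C1 : (fun v : 'rV[R]_d => v) @ w --> w by exact: cvg_id. exact: (cvg_pair C1 C2).
    * by move=> x w h; rewrite /GRing.add /= /GRing.scale /= /add_pair /= /scale_pair /= scaler0 addr0.
    * by move=> w cw; split=> //; exact: ctr_in.
    * exact: smooth_derive.
  + have := is_deriveD (is_deriveZ a (dP f1 u s1)) (dP f2 u s2) => H. have sa : sm (fun=> a) by exact: smooth_fun_cst.
    exact: (der_uniq (dP _ u (smooth_funD (lie_mfd lG) (smooth_funM (lie_mfd lG) sa s1) s2)) H).
  + have := is_deriveM (dP f1 u s1) (dP f2 u s2) => H. rewrite (der_uniq (dP _ u (smooth_funM (lie_mfd lG) s1 s2)) H).
    by rewrite psi_ctr mulg1 [dD f1 u * _]mulrC.
- by move=> f sf u w; rewrite /dD; under eq_fun do rewrite mulgA.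
exists x; apply/rowP => j; rewrite VmE psi_ctr -xP; last exact: kap_smooth.
apply: (der_uniq (dP (kap L j) 1%g (kap_smooth L j))).
have := @frechet_is_derive R d (fun q => q 0 j) q0 (fun i => (i == j)%:R) v.
rewrite (bigD1 j) //= eqxx mul1r big1 ?addr0 => [H|i /negPf ->]; last by rewrite mul0r.
apply: der_loc (rad_gt0 L) _ _; last apply: H.
  by move=> q qr; rewrite mul1g kap_psi.
move=> eps eps0; exists 1 => // k _.
rewrite (bigD1 j) //= eqxx mul1r big1 ?addr0 => [|i /negPf ->]; last by rewrite mul0r.
by rewrite !mxE addlK subrr normr0 mulr_ge0 // ltW.
Qed.

Lemma Vm_inv : exists B : 'M[R]_(d, D), Vm L q0 *m B = 1%:M /\ B *m Vm L q0 = 1%:M.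
have /choice[x xP] : forall j : 'I_d, exists x : 'rV[R]_D, x *m Vm L q0 = delta_mx 0 j by move=> j; exact: Vm_surj.
pose B := \matrix_(j < d) x j.
have BV : B *m Vm L q0 = 1%:M by apply/row_matrixP => j; rewrite row_mul rowK xP row1.
exists B; split=> //; apply/row_matrixP => i; rewrite row1; apply/eqP; rewrite -subr_eq0; apply/eqP.
by apply: Vm_inj; rewrite mulmxBl rowE -!mulmxA BV mulmx1 subrr.
Qed.
End NormalCoordinates.

(* [S] is a family of group elements whose Maurer-Cartan form, read on row
   vectors, is the smooth matrix function [w]. *)
Definition fam m (O : set 'rV[R]_m) (S : 'rV[R]_m -> G) (w : 'rV[R]_m -> 'M[R]_(m, D)) :=
  [/\ open O, smx O w & forall t v, O t -> Vel (fun s => S (t + s *: v)) (v *m w t) 0].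

(** * Families of group elements and their Maurer-Cartan forms *)

Section FamilySmooth.
Context {m : nat} {O : set 'rV[R]_m} {S : 'rV[R]_m -> G} {w : 'rV[R]_m -> 'M[R]_(m, D)}.
Hypothesis fS : fam O S w.

Lemma fam_derive f t v : sm f -> O t -> is_derive t v (fun t => f (S t) : R^o) (lam (v *m w t) f (S t)).
move=> sf Ot; apply: (derive_line0 (fun t => f (S t) : R^o) t v _).2.
by case: fS => _ _ /(_ t v Ot f sf); rewrite scale0r addr0.
Qed.
Lemma fam_near (L : locCoord) t0 (eps : R) : O t0 -> S t0 = 1%g -> 0 < eps -> exists+ dl, forall t, `|t - t0| < dl -> O t /\
    exists2 q, Bo (ctr L) (rad L) q /\ `|q - ctr L| < eps & S t = psi L q.
case: (fS) => oO sw _ Ot St eps0; have [r1 r10 r1P] := open_ballP oO Ot.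
have [g sg [g1 _ gN [C C0 CP]]] := cut_ex L eps0.
have /contP cw := smx_cont sw Ot; have [r2 r20 r2P] := cw 1 ltr01.
pose K := C * (m%:R * (`|w t0| + 1)) + 1.
have K0 : 0 < K by rewrite ltr_wpDl // mulr_ge0 ?(ltW C0) // mulr_ge0 // addr_ge0.
pose dl := Num.min (Num.min r1 r2) (1 / (2 * K)).
exists dl => [|t]; first by rewrite !lt_min r10 r20 divr_gt0 // mulr_gt0.
rewrite !lt_min => /andP[/andP[h1 h2] h3]; split; first exact: r1P.
apply: gN; have [s /andP[s0 s1]|s /andP[s0 s1]] := @mvt_seg R _ (fun t => g (S t) : R^o) t0 (t - t0).
  have Os : O (t0 + s *: (t - t0)) by apply: r1P; rewrite addlK normrZ ger0_norm //; apply: le_lt_trans h1; rewrite ler_piMl.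
  by have [] := fam_derive (t - t0) sg Os.
have Os : O (t0 + s *: (t - t0)) by apply: r1P; rewrite addlK normrZ ger0_norm //; apply: le_lt_trans h1; rewrite ler_piMl.
have [_ ->] := fam_derive (t - t0) sg Os; rewrite subrKC St g1 => E.
have : `|g (S t) - 1| <= K * `|t - t0|.
  rewrite E; apply: le_trans (CP _ _) _; apply: le_trans (ler_wpM2l (ltW C0) (mx_norm _ _)) _.
  have wb : `|w (t0 + s *: (t - t0))| <= `|w t0| + 1.
    rewrite -[X in `|X|](subrK (w t0)) addrC; apply: le_trans (ler_normD _ _) _; rewrite lerD2l.
    by apply: r2P; rewrite addlK normrZ ger0_norm //; apply: le_lt_trans h2; rewrite ler_piMl.
  apply: (@le_trans _ _ (C * (m%:R * (`|w t0| + 1)) * `|t - t0|)); last first.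
    by rewrite ler_wpM2r // lerDl.
  rewrite -!mulrA ler_wpM2l ?(ltW C0) // ler_wpM2l // mulrC ler_wpM2r //.
have h4 : K * `|t - t0| < 1 / 2 by rewrite mulrC -ltr_pdivlMr //; apply: lt_le_trans h3 _; rewrite invfM mulrA.
move=> h5; apply/eqP => g0; move: h5; rewrite g0 sub0r normrN normr1; lra.
Qed.
End FamilySmooth.

Lemma fam_ltrans m (O : set 'rV[R]_m) S w u : fam O S w -> fam O (fun t => u * S t)%g w.
by case=> oO sw h; split=> // t v Ot; apply: Vel_ltrans; exact: h. Qed.
(** Smoothness is regained from the form alone, by induction: the derivative of [f (S t)] is a
    combination of functions [lam _ f (S t)] with smooth coefficients. The base case, continuity,
    comes from a cutoff through [fam_near]. *)
Lemma fam_smooth m (O : set 'rV[R]_m) S w f : fam O S w -> sm f -> smooth O (fun t => f (S t) : R^o).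
move=> fS sf k; case: (fS) => oO sw _; elim: k f sf => [|k IH] f sf.
  split=> // t0 Ot; have [L _] := @loc_coord_ex. apply/contP => eps eps0.
  pose f' y := f (S t0 * y)%g; have sf' : sm f' by exact: (sm_ltrans lG).
  have /contP/(_ _ eps0)[r1 r10 r1P] := smooth_cont (psi_smooth L sf') (ctr_in L).
  have [dl dl0 dlP] := fam_near (fam_ltrans (S t0)^-1%g fS) L Ot (mulVg _) r10.
  exists dl => // t /dlP[_ [q [_ qr] E]]; have := r1P q qr; rewrite -E psi_ctr /f'. by rewrite mulVKg mulg1.
have cf : forall t, O t -> {for t, continuous (fun t => f (S t) : R^o)} by have := IH f sf; exact: Ck_cont.
apply: (@Ck_der _ _ _ k O _ (fun v t => lam (v *m w t) f (S t) : R^o) cf oO).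
  by move=> v t Ot; exact: (fam_derive fS).
move=> v; apply: (@Ck_ext _ _ _ k O (fun t => \sum_i (v *m w t) 0 i * lam (delta_mx 0 i) f (S t) : R^o)) => //.
  by move=> t _; rewrite /= lamE.
elim: (index_enum _) => [|i s IHs].
  by apply: (@Ck_ext _ _ _ k O (fun=> 0)) => //; [move=> t _; rewrite big_nil|exact: Ck_cst].
apply: (@Ck_ext _ _ _ k O (fun t => (v *m w t) 0 i * lam (delta_mx 0 i) f (S t) +
    \sum_(i <- s) (v *m w t) 0 i * lam (delta_mx 0 i) f (S t) : R^o)) => //.
  by move=> t _; rewrite big_cons.
apply: CkD => //; apply: CkM => //.
  exact: (smxM oO (smx_cst O v) sw 0 i k).
exact: IH (lam_smooth _ sf).
Qed.

Definition jac m n (Z : 'rV[R]_m -> 'rV[R]_n) t : 'M[R]_(m, n) := \matrix_(i, j) 'D_(unitv i) (fun t => Z t 0 j : R^o) t.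

Lemma jac_smooth m n (O : set 'rV[R]_m) (Z : 'rV[R]_m -> 'rV[R]_n) : smx O Z -> smx O (jac Z).
by move=> sZ i j; fun_mxE; apply: smooth_derive; exact: sZ. Qed.
Lemma jac_mderiv m n (O : set 'rV[R]_m) (Z : 'rV[R]_m -> 'rV[R]_n) t v : open O -> smx O Z -> O t ->
  mder (fun s => Z (t + s *: v)) 0 (v *m jac Z t).
move=> oO sZ Ot i j; rewrite (ord1 i) mxE.
have := smooth_der v (sZ 0 j) Ot; rewrite (smooth_DE v oO (sZ 0 j) Ot).
move/(derive_line0 (fun t => Z t 0 j : R^o) t v _).1.
by under eq_bigr do rewrite mulrC; under [X in _ -> is_derive _ _ _ X]eq_bigr do rewrite mxE.
Qed.

Lemma smx_adm m (O : set 'rV[R]_m) (Z : 'rV[R]_m -> 'rV[R]_D) : open O -> smx O Z -> smx O (fun t => adm (Z t)).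
move=> oO sZ i j.
apply: (@smooth_ext _ _ _ O (fun t => \sum_k Z t 0 k * adm (delta_mx 0 k) i j : R^o)) => //.
  move=> t _; rewrite {2}(row_sum (Z t)); elim: (index_enum _) => [|k s IH].
    rewrite !big_nil; have /matrixP/(_ i j) := @admZ 0 0. by rewrite !scale0r mxE.
  by rewrite !big_cons ld_admL !mxE IH.
by apply: smooth_sum => // k _; apply: smoothM => //; exact: smooth_cst.
Qed.

Lemma fam_mul_exp m (O : set 'rV[R]_m) S w Z : fam O S w -> smx O Z -> fam O (fun t => S t * e (Z t))%g
    (fun t => w t *m expm (- adm (Z t)) + jac Z t *m phim (- adm (Z t))).
case=> oO sw h sZ; split=> // [|t v Ot].
  have sA : smx O (fun t => - adm (Z t)) by apply: smxN => //; exact: smx_adm. apply: smxD => //; apply: smxM => //.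
  - exact: smx_expm.
  - exact: jac_smooth.
  - exact: smx_phim.
have := Vel_mul_exp (h t v Ot) (jac_mderiv v oO sZ Ot).
by rewrite scale0r addr0 mulmxDr /lin_sol !scale1r !mulmxA.
Qed.
Lemma fam_cst m (O : set 'rV[R]_m) u : open O -> fam O (fun=> u) (fun=> 0).
by move=> oO; split=> // [|t v _]; [exact: smx_cst|rewrite mulmx0; exact: Vel_cst]. Qed.
Lemma fam_eq m (O : set 'rV[R]_m) (S : 'rV[R]_m -> G) w w' : {in O, w =1 w'} -> fam O S w -> fam O S w'.
move=> E [oO sw h]; split=> // [|t v Ot]; first exact: smx_ext sw.
by rewrite -E ?inE //; exact: h.
Qed.
Lemma fam_sub m (O O' : set 'rV[R]_m) (S : 'rV[R]_m -> G) w : open O' -> O' `<=` O -> fam O S w -> fam O' S w.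
by move=> oO' s [oO sw h]; split=> // [|t v /s]; [exact: smx_sub sw|exact: h].
Qed.
Lemma fam_ext m (O : set 'rV[R]_m) (S S' : 'rV[R]_m -> G) w : {in O, S =1 S'} -> fam O S w -> fam O S' w.
move=> E [oO sw h]; split=> // t v Ot; have [r r0 rP] := open_ballP oO Ot.
have v0 : 0 < `|v| + 1 by rewrite ltr_wpDl.
apply: (@Vel_eq _ (fun s => S (t + s *: v)) _ _ (r / (`|v| + 1))); last exact: h.
  by rewrite divr_gt0.
move=> s; rewrite subr0 ltr_pdivlMr // => sr; rewrite E // inE; apply: rP.
by rewrite addlK normrZ; apply: le_lt_trans sr; rewrite ler_wpM2l // lerDl.
Qed.

Lemma fam_unique m (O : set 'rV[R]_m) (S : 'rV[R]_m -> G) w w' t : fam O S w -> fam O S w' -> O t -> w t = w' t.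
move=> [_ _ h] [_ _ h'] Ot; apply/row_matrixP => i; rewrite !rowE.
exact: (Vel_unique (h t (delta_mx 0 i) Ot) (h' t (delta_mx 0 i) Ot)).
Qed.
Lemma mder_line m n (p q : 'M[R]_(m, n)) : mder (fun s : R => p + s *: q) 0 q.
by rewrite -[X in mder _ _ X]add0r; apply: mderD; [exact: mder_cst|exact: mder_scale]. Qed.
Lemma inverse_at0 n (rho : R) (F : 'rV[R]_n -> 'rV[R]_n) : 0 < rho -> smx (Bo 0 rho) F -> F 0 = 0 ->
  (forall x, mder (fun s : R => F (0 + s *: x)) 0 x) ->
  exists r s (g : 'rV[R]_n -> 'rV[R]_n), [/\ [/\ 0 < r, 0 < s & Bo 0 r `<=` Bo (0 : 'rV[R]_n) rho],
    forall x y, Bo 0 r x -> Bo 0 r y -> F x = F y -> x = y, forall y, Bo 0 s y -> Bo 0 r (g y) /\ F (g y) = y, smx (Bo 0 s) g & g 0 = 0].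
move=> rho0 sF F0 dF; have o : Bo 0 rho (0 : 'rV[R]_n) by exact: Bo_ctr.
have [|r [s [g [[r0 s0 rb] [inj surj sg]]]]] := inverse_fun (@Bo_open _ _ 0 rho) sF o.
  move=> i j; apply: (der_uniq (smooth_der (unitv j) (sF 0 i) o)). apply: (derive_line0 (fun x => F x 0 i : R^o) 0 (unitv j) _).2.
  by have := dF (unitv j) 0 i; rewrite [unitv j 0 i]mxE eqxx.
rewrite F0 in surj sg; exists r, s, g; split=> //.
by have [|h1 h2] := surj 0; [exact: Bo_ctr|apply: inj => //; [exact: Bo_ctr|rewrite h2 F0]].
Qed.

(** The condition [wF 0 = 1] makes the differential of [F] in the normalized coordinates [Y] the
    identity, so the inverse function theorem applies. Its consequences are packaged as injectivity,
    a left inverse [Zt] smooth on all of [G], and the lifting of an arbitrary family through [F]. *)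
Lemma local_inverse (F : 'rV[R]_D -> G) wF : fam setT F wF -> F 0 = 1%g -> wF 0 = 1%:M ->
  exists+ r, [/\ forall x y, Bo 0 r x -> Bo 0 r y -> F x = F y -> x = y, exists2 Zt : G -> 'rV[R]_D, forall j, sm (fun u => Zt u 0 j) &
      exists+ r1, forall x, `|x| < r1 -> Zt (F x) = x &
    forall m (O : set 'rV[R]_m) (S : 'rV[R]_m -> G) w t0 (eps : R), fam O S w -> O t0 -> 0 < eps ->
      exists+ rho, exists Z : 'rV[R]_m -> 'rV[R]_D, [/\ Bo t0 rho `<=` O, smx (Bo t0 rho) Z, Z t0 = 0 &
          forall t, Bo t0 rho t -> S t = (S t0 * F (Z t))%g /\ `|Z t| < eps]].
move=> fF F0 wF0; have [L _] := @loc_coord_ex; have [B [VB BV]] := Vm_inv L.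
pose Y u := (kapv L u - ctr L) *m B.
have Yinj q q' : Bo (ctr L) (rad L) q -> Bo (ctr L) (rad L) q' -> Y (psi L q) = Y (psi L q') -> q = q'.
  move=> qr q'r; rewrite /Y !kapv_psi // => /(congr1 (mulmx^~ (Vm L (ctr L)))). by rewrite -!mulmxA BV !mulmx1 => /addIr.
have Ysm m (O : set 'rV[R]_m) (S : 'rV[R]_m -> G) w : fam O S w -> smx O (fun t => Y (S t)).
  move=> fS; have [oO _ _] := fS; apply: smxM => //; last exact: smx_cst. apply: smxB => //; last exact: smx_cst.
  by move=> i j; fun_mxE; apply: fam_smooth fS _; exact: kap_smooth.
have [rho1 rho10 rho1P] := fam_near fF L (I : setT 0) F0 ltr01.
have sYF : smx (Bo 0 rho1) (fun x => Y (F x)).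
  apply: (Ysm D _ _ wF); apply: fam_sub fF => //; exact: Bo_open.
have Y1 : Y 1%g = 0 by rewrite /Y -(psi_ctr L) kapv_psi ?subrr ?mul0mx //; exact: ctr_in.
have o1 : Bo 0 rho1 (0 : 'rV[R]_D) by exact: Bo_ctr.
have [|x|r [s [g [[r0 s0 rb] inj surj sg g0]]]] := inverse_at0 rho10 sYF; rewrite ?F0 //.
  have [_ _ /(_ 0 x I)] := fF; rewrite wF0 mulmx1 => V.
  have := @Vel_kapv L _ _ _ (ctr L) V; rewrite scale0r addr0 F0 psi_ctr => /(_ erefl) K.
  by have := mderMl B (mderD K (mder_cst (- ctr L) 0)); rewrite addr0 -mulmxA VB mulmx1.
have os : Bo 0 s (0 : 'rV[R]_D) by exact: Bo_ctr.
exists r => //; split=> [x y xr yr E||m O S w t0 eps fS Ot eps0].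
- by apply: inj => //; rewrite E.
- exists (fun u => \row_j bext 0 s (fun q => g q 0 j) (Y u)).
    move=> j c Ac; have oc : open (cimg c) by exact: (cimg_open (lie_mfd lG)).
    apply: (@smooth_ext _ _ _ _ (fun v => bext 0 s (fun q => g q 0 j) (Y (cinv c v)) : R^o)) => //.
      by move=> v _; rewrite mxE.
    apply: (@smooth_comp _ _ _ (cimg c) setT (bext 0 s (fun q => g q 0 j)) (fun v => Y (cinv c v))) => //.
    + exact: openT.
    + by apply: bext_smooth => //; exact: sg.
    + move=> k; have msY : smx (cimg c) (fun v => Y (cinv c v)); last exact: msY. apply: smxM => //; last exact: smx_cst.
      apply: smxB => //; last exact: smx_cst. by move=> i l; fun_mxE; exact: kap_smooth.
  have /contP cY := smx_cont sYF o1. have [r2 r20 r2P] := cY (s / 4) (divr_gt0 s0 (ltr0n _ 4)).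
  exists (Num.min r r2); first by rewrite lt_min r0.
  move=> x; rewrite lt_min => /andP[xr xr2]; have := r2P x; rewrite subr0 F0 Y1 subr0 => /(_ xr2) h.
  have [|h1 h2] := surj (Y (F x)); first by rewrite Bo0; move: h s0; lra.
  apply/rowP => j; rewrite mxE bextE //; last by rewrite subr0; move: h s0; lra.
  by have -> : g (Y (F x)) = x by apply: inj => //; rewrite Bo0.
pose S1 t := ((S t0)^-1 * S t)%g; have fS1 : fam O S1 w by exact: fam_ltrans.
have [rho2 rho20 rho2P] := fam_near fS1 L Ot (mulVg _) ltr01.
have oO : open O by case: fS.
have sY1 := Ysm _ _ _ _ fS1.
have /contP cY := smx_cont sY1 Ot.
have [rho3 rho30 rho3P] := cY (s / 2) (divr_gt0 s0 (ltr0n _ 2)).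
have /contP cg := smx_cont sg os.
have [rho4 rho40 rho4P] := cg (eps / 2) (divr_gt0 eps0 (ltr0n _ 2)).
have [rho5 rho50 rho5P] := cY (rho4 / 2) (divr_gt0 rho40 (ltr0n _ 2)).
pose rho := Num.min (Num.min rho2 rho3) rho5.
have St1 : S1 t0 = 1%g by exact: mulVg.
exists rho; first by rewrite !lt_min rho20 rho30.
exists (fun t => g (Y (S1 t))).
have Ys t : Bo t0 rho t -> Bo 0 s (Y (S1 t)).
  rewrite {1}/Bo /= !lt_min => /andP[/andP[_ h] _]. by have := rho3P t h; rewrite St1 Y1 /Bo /=; have := s0; lra.
have bO : Bo t0 rho `<=` O by move=> t; rewrite /Bo /= !lt_min => /andP[/andP[/rho2P[]]].
split=> //.
- apply: (@smx_comp _ _ _ _ _ (Bo t0 rho) (Bo 0 s) g); try exact: Bo_open.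
  + exact: Ys.
  + exact: sg.
  + exact: smx_sub sY1.
- by rewrite St1 Y1.
move=> t tr; have [h1 h2] := surj _ (Ys t tr); split; last first.
  have : `|Y (S1 t) - Y (S1 t0)| <= rho4 / 2.
    by apply: rho5P; move: tr; rewrite /Bo /= !lt_min => /andP[].
  rewrite St1 Y1 => h; have := rho4P (Y (S1 t)); rewrite g0 !subr0 in h *.
  by move=> /(_ _)/le_lt_trans; apply; [move: rho40 h; lra|move: eps0; lra].
have [_ [q [qr _] E]] : O t /\ exists2 q, Bo (ctr L) (rad L) q /\ `|q - ctr L| < 1 & S1 t = psi L q by apply: rho2P; move: tr; rewrite /Bo /= !lt_min => /andP[/andP[]].
have [_ [q' [q'r _] E']] := rho1P _ (rb _ h1).
rewrite E' E in h2; have qq := Yinj _ _ q'r qr h2.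
by rewrite E' qq -E /S1 mulVKg.
Qed.

Lemma jac_comp m n (O : set 'rV[R]_m) (Z : 'rV[R]_m -> 'rV[R]_n) (y : R -> 'rV[R]_m) t y' :
  open O -> smx O Z -> O (y t) -> mder y t y' -> mder (fun s => Z (y s)) t (y' *m jac Z (y t)).
move=> oO sZ Ot dy i j; rewrite (ord1 i) mxE; under eq_bigr do rewrite mulrC mxE.
apply: (@derive_comp _ _ _ (fun q => Z q 0 j : R^o) (fun l => 'D_(unitv l) (fun q => Z q 0 j : R^o) (y t)) y).
  exact: sm_frechet oO (sZ 0 j) Ot.
by move=> l; exact: dy.
Qed.

Lemma smx_mulr m n p (O : set 'rV[R]_m) (Z : 'rV[R]_m -> 'M[R]_(n, p)) k (P : 'M[R]_(p, k)) : open O ->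
  smx O Z -> smx O (fun x => Z x *m P).
by move=> oO sZ; apply: smxM => //; exact: smx_cst. Qed.
Lemma jac_mulr m n p (O : set 'rV[R]_m) (Z : 'rV[R]_m -> 'rV[R]_n) (P : 'M[R]_(n, p)) t : open O ->
  smx O Z -> O t -> jac (fun x => Z x *m P) t = jac Z t *m P.
move=> oO sZ Ot; apply/row_matrixP => i; rewrite !rowE; apply/rowP => j.
have h1 := jac_mderiv (delta_mx 0 i) oO (smx_mulr P oO sZ) Ot.
have h2 := mderMl P (jac_mderiv (delta_mx 0 i) oO sZ Ot).
by rewrite (der_uniq (h1 0 j) (h2 0 j)) mulmxA.
Qed.

Lemma jac_id m t : jac (fun x : 'rV[R]_m => x) t = 1%:M.
apply/row_matrixP => i; rewrite !rowE mulmx1; apply/rowP => j.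
have h1 := jac_mderiv (delta_mx 0 i) (@openT _) (smx_id (@openT _)) (I : [set: 'rV[R]_m] t).
have h2 : mder (fun s => t + s *: delta_mx 0 i) 0 (delta_mx 0 i : 'rV[R]_m) by rewrite -[X in mder _ _ X]add0r; apply: mderD; [exact: mder_cst|exact: mder_scale].
exact: (der_uniq (h1 0 j) (h2 0 j)).
Qed.
Lemma adm0 : adm 0 = 0.
by rewrite -[0](scale0r 0) admZ scale0r. Qed.
Lemma fam_exp m (O : set 'rV[R]_m) u Z : open O -> smx O Z -> fam O (fun t => u * e (Z t))%g (fun t => jac Z t *m phim (- adm (Z t))).
move=> oO sZ; apply: fam_eq (fam_mul_exp (fam_cst u oO) sZ) => t _.
by rewrite mul0mx add0r.
Qed.

Definition lexp (P : 'M[R]_D) (x : 'rV[R]_D) := e (x *m P).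

Lemma fam_mul_lexp (F : 'rV[R]_D -> G) wF P : fam setT F wF -> exists2 w', fam setT (fun x => F x * lexp P x)%g w' & w' 0 = wF 0 + P.
move=> fF; have o := @openT 'rV[R]_D; have sP := smx_mulr P o (smx_id o).
eexists; first exact: (fam_mul_exp fF sP).
rewrite /= mul0mx adm0 oppr0 expm0 phim0 !mulmx1.
by rewrite (@jac_mulr _ _ _ setT (fun x => x)) ?jac_id ?mul1mx //; exact: smx_id.
Qed.

Lemma fam_lexp P : exists2 w', fam setT (lexp P) w' & w' 0 = P.
have [w' fw w0] := fam_mul_lexp P (fam_cst 1%g (@openT 'rV[R]_D)).
exists w'; last by rewrite w0 add0r.
by apply: fam_ext fw => x _; rewrite mul1g.
Qed.

(** * Subalgebras and families tangent to them *)

Definition inP n (P : 'M[R]_n) (x : 'rV[R]_n) := x *m P = x.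

Lemma compl_idem n (P : 'M[R]_n) : P *m P = P -> (1%:M - P) *m (1%:M - P) = 1%:M - P.
by move=> PP; rewrite mulmxBl mul1mx mulmxBr mulmx1 PP subrr subr0. Qed.
Lemma inP_Q n (P : 'M[R]_n) (x : 'rV[R]_n) : inP P x <-> x *m (1%:M - P) = 0.
rewrite /inP mulmxBr mulmx1; split=> [->|/eqP]; first by rewrite subrr.
by rewrite subr_eq0 eq_sym => /eqP.
Qed.

(** A subalgebra is given by a projection onto it: membership becomes a matrix equation, and the
    complement [1 - P] comes along. *)
Definition subalg (P : 'M[R]_D) := P *m P = P /\ forall x y, inP P x -> inP P y -> inP P (y *m adm x).

Lemma subalgP_stable P x : subalg P -> inP P x -> P *m adm x *m (1%:M - P) = 0.
move=> [PP sub] xP; apply/row_matrixP => i; rewrite row_mul row0 row_mul.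
have iP : inP P (row i P) by rewrite /inP -row_mul PP.
by have := sub x (row i P) xP iP => /inP_Q.
Qed.
Lemma stable_factor n (P A : 'M[R]_n) : P *m P = P -> P *m A *m (1%:M - P) = 0 ->
  A *m (1%:M - P) = (1%:M - P) *m ((1%:M - P) *m A *m (1%:M - P)).
by move=> PP h; rewrite !mulmxA (compl_idem PP) [(1%:M - P) *m A]mulmxBl mul1mx mulmxBl h subr0.
Qed.
Lemma inP_expm P x y : subalg P -> inP P x -> inP P y -> inP P (y *m expm (adm x)).
move=> sP xP /inP_Q yP; apply/inP_Q; have [PP _] := sP.
exact: expm_stable (stable_factor PP (subalgP_stable sP xP)) yP.
Qed.
Lemma inP_phim P x y : subalg P -> inP P x -> inP P y -> inP P (y *m phim (adm x)).
move=> sP xP /inP_Q yP; apply/inP_Q; have [PP _] := sP.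
exact: phim_stable (stable_factor PP (subalgP_stable sP xP)) yP.
Qed.
Lemma inPN n (P : 'M[R]_n) (x : 'rV[R]_n) : inP P x -> inP P (- x).
by rewrite /inP mulNmx => ->. Qed.
Lemma unitmx_near m n (O : set 'rV[R]_m) (N : 'rV[R]_m -> 'M[R]_n) t0 : open O -> smx O N -> O t0 ->
  N t0 = 1%:M -> exists+ a, forall t, `|t - t0| < a -> N t \in unitmx.
move=> oO sN Ot N1.
have /contP/(_ (1 / 2) (divr_gt0 ltr01 (ltr0n _ 2)))[a a0 aP] := smooth_cont (smooth_det oO sN) Ot.
exists a => // t /aP; rewrite N1 det1 unitmxE unitfE; apply: contraTneq => ->.
by rewrite sub0r normrN normr1 -ltNge; lra.
Qed.

(* Write [S t = S t0 * e y * e x] with [x] in the subalgebra and [y] in a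
   complement: the Maurer-Cartan form forces [dy = 0]. *)
Lemma fam_subalg P m (O : set 'rV[R]_m) (S : 'rV[R]_m -> G) w t0 (eps : R) : subalg P -> fam O S w ->
  (forall t, O t -> w t *m P = w t) -> O t0 -> 0 < eps -> exists+ rho, exists Z : 'rV[R]_m -> 'rV[R]_D,
    [/\ Bo t0 rho `<=` O, smx (Bo t0 rho) Z, Z t0 = 0 & forall t, Bo t0 rho t -> [/\ S t = (S t0 * e (Z t))%g, `|Z t| < eps & inP P (Z t)]].
move=> sP fS wP Ot eps0; have [PP sub] := sP; pose Q : 'M[R]_D := 1%:M - P.
have QQ : Q *m Q = Q := compl_idem PP.
have QP : Q *m P = 0 by rewrite /Q mulmxBl mul1mx PP subrr.
have [w1 f1 w10] := fam_lexp Q; have [w2 f2 w20] := fam_mul_lexp P f1.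
have F0 : (lexp Q 0 * lexp P 0)%g = 1%g by rewrite /lexp !mul0mx e0 mulg1.
have w2E : w2 0 = 1%:M by rewrite w20 w10 /Q subrK.
have [r r0 [_ _ loc]] := local_inverse f2 F0 w2E.
have epsP : 0 < eps / (D%:R * `|P| + 1) by rewrite divr_gt0 // ltr_wpDl // mulr_ge0.
have [rho rho0 [Z [bO sZ Z0 ZP]]] := loc _ _ _ _ t0 _ fS Ot epsP.
have ob := @Bo_open _ _ t0 rho.
pose y t := Z t *m Q; pose x t := Z t *m P.
have sy : smx (Bo t0 rho) y by exact: smx_mulr.
have sx : smx (Bo t0 rho) x by exact: smx_mulr.
have SE t : Bo t0 rho t -> S t = (S t0 * e (y t) * e (x t))%g by move=> /ZP[-> _]; rewrite /lexp mulgA.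
have t0b : Bo t0 rho t0 by exact: Bo_ctr.
have dyQ t : Bo t0 rho t -> jac y t *m Q = jac y t by move=> tb; rewrite /y (jac_mulr Q ob sZ tb) -mulmxA QQ.
have xP t : inP P (x t) by rewrite /inP /x -mulmxA PP.
have fS' : fam (Bo t0 rho) S w by exact: fam_sub fS.
have fp := fam_mul_exp (fam_exp (S t0) ob sy) sx.
have wE t : Bo t0 rho t -> w t = jac y t *m phim (- adm (y t)) *m expm (- adm (x t)) + jac x t *m phim (- adm (x t)).
  have E : {in Bo t0 rho, (fun t => S t0 * e (y t) * e (x t))%g =1 S} by move=> t'; rewrite inE => t'b; rewrite (SE t' t'b).
  exact: (fam_unique fS' (fam_ext E fp)).
(* The values of [w] and of the form of [e (x t)] lie in the subalgebra, and [Ad (e (x t))]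
   preserves it; hence so does the remaining contribution, which is due to [y]. *)
have key t : Bo t0 rho t -> jac y t *m phim (- adm (y t)) *m Q = 0.
  move=> tb; apply/row_matrixP => i; rewrite row_mul row0; apply/inP_Q. set a := row i _; have aE : inP P (a *m expm (- adm (x t))).
    have -> : a *m expm (- adm (x t)) = row i (w t) - row i (jac x t *m phim (- adm (x t))).
      apply/eqP; rewrite eq_sym subr_eq; apply/eqP. by rewrite (wE t tb) /a -row_mul [LHS]linearD.
    rewrite /inP mulmxBl -row_mul wP; last exact: bO. congr (_ - _); rewrite row_mul -admN; apply: inP_phim => //; first exact: inPN.
    by rewrite /inP -row_mul /x (jac_mulr P ob sZ tb) -mulmxA PP.
  have := inP_expm sP (xP t) aE; rewrite -mulmxA expmK mulmx1; by [].
(* At [t0] this matrix is [Q + P = 1], so it is invertible nearby; since it sends [jac y t] to 0,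
   [y] has zero derivative. *)
have [rho1 rho10 rho1P] : exists+ rho1, forall t, Bo t0 rho1 t ->
    Bo t0 rho t /\ Q *m phim (- adm (y t)) *m Q + P \in unitmx.
  have sN : smx (Bo t0 rho) (fun t => Q *m phim (- adm (y t)) *m Q + P).
    apply: smxD => //; last exact: smx_cst. apply: smx_mulr => //; apply: smxM => //; first exact: smx_cst.
    apply: smx_phim => //; apply: smxN => //; exact: smx_adm.
  have [|a a0 aP] := unitmx_near ob sN t0b.
    by rewrite /y Z0 mul0mx adm0 oppr0 phim0 mulmx1 QQ /Q subrK.
  exists (Num.min rho a) => [|t]; first by rewrite lt_min rho0. by rewrite /Bo /= lt_min => /andP[h1 /aP h2].
have dy0 t : Bo t0 rho1 t -> jac y t = 0.
  move=> /rho1P[tb uN]; apply: (can_inj (mulmxK uN)); rewrite mul0mx mulmxDr !mulmxA dyQ // key // add0r.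
  by rewrite -(dyQ t tb) -mulmxA QP mulmx0.
have y0 t : Bo t0 rho1 t -> y t = 0.
  move=> tb; have -> : (0 : 'rV[R]_D) = y t0 by rewrite /y Z0 mul0mx.
  apply/rowP => j; have seg (s : R) : 0 <= s <= 1 -> Bo t0 rho1 (t0 + s *: (t - t0)).
    move=> /andP[s0 s1]; rewrite /Bo /= addlK normrZ ger0_norm //. by apply: le_lt_trans tb; rewrite ler_piMl.
  have [s s01|s s01] := @mvt_seg R _ (fun t => y t 0 j : R^o) t0 (t - t0).
    by apply: smooth_derivable (sy 0 j) _; have [] := rho1P _ (seg s s01).
  rewrite subrKC; have [sb _] := rho1P _ (seg s s01).
  rewrite (smooth_DE _ ob (sy 0 j) sb) big1 => [/eqP|i _]; first by rewrite subr_eq0 => /eqP.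
  have := congr1 (fun M : 'M[R]_(m, D) => M i j) (dy0 _ (seg s s01)); rewrite !mxE => ->. by rewrite mul0r.
exists rho1 => //; exists x; split.
- by move=> t /rho1P[/bO].
- by apply: smx_sub sx => t /rho1P[].
- by rewrite /x Z0 mul0mx.
move=> t tb; have [tb' _] := rho1P t tb; split=> //.
  by rewrite (SE t tb') (y0 t tb) e0 mulg1.
have [_ zb] := ZP t tb'; apply: le_lt_trans (mx_norm _ _) _.
have K : 0 < D%:R * `|P| + 1 by rewrite ltr_wpDl // mulr_ge0.
move: zb; rewrite ltr_pdivlMr // => zb; apply: le_lt_trans zb.
by rewrite mulrAC mulrC ler_wpM2l // lerDl.
Qed.
End LieGroup.

Lemma double_eq0 (V : zmodType) (x : V) : x = x + x -> x = 0.
by move=> /eqP; rewrite -subr_eq subrr eq_sym => /eqP. Qed.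
Lemma half_double (F : numFieldType) (V : lmodType F) (x : V) : 2^-1 *: (x + x) = x.
by rewrite -mulr2n -[x *+ 2]scaler_nat scalerA mulVf ?scale1r // pnatr_eq0. Qed.
Lemma half_parts (F : numFieldType) (V : lmodType F) (x y : V) : 2^-1 *: (x + y) + 2^-1 *: (x - y) = x.
by rewrite -scalerDr addrACA subrr addr0 half_double. Qed.

(** * Lie brackets and the Killing form in coordinates *)

Section LieBasics.
Context {K : fieldType} {L : lieAlgType K}.
Implicit Types (x y z : L) (U V W : {vspace L}).

Lemma lieDl x y z : lie (x + y) z = lie x z + lie y z.
by have := lie_linearl z 1 x y; rewrite !scale1r. Qed.
Lemma lieDr x y z : lie x (y + z) = lie x y + lie x z.
by have := lie_linearr x 1 y z; rewrite !scale1r. Qed.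
Lemma lie0l x : lie 0 x = 0.
by apply: double_eq0; rewrite -lieDl addr0. Qed.
Lemma lie0r x : lie x 0 = 0.
by apply: double_eq0; rewrite -lieDr addr0. Qed.
Lemma lieZl a x y : lie (a *: x) y = a *: lie x y.
by have := lie_linearl y a x 0; rewrite !addr0 lie0l addr0. Qed.
Lemma lieZr a x y : lie x (a *: y) = a *: lie x y.
by have := lie_linearr x a y 0; rewrite !addr0 lie0r addr0. Qed.
Lemma lieNl x y : lie (- x) y = - lie x y.
by rewrite -scaleN1r lieZl scaleN1r. Qed.
Lemma lieNr x y : lie x (- y) = - lie x y.
by rewrite -scaleN1r lieZr scaleN1r. Qed.
Lemma lieBl x y z : lie (x - y) z = lie x z - lie y z.
by rewrite lieDl lieNl. Qed.
Lemma lieBr x y z : lie x (y - z) = lie x y - lie x z.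
by rewrite lieDr lieNr. Qed.
Lemma lieC x y : lie x y = - lie y x.
have := liexx (x + y); rewrite lieDl !lieDr !liexx addr0 add0r => /eqP.
by rewrite addr_eq0 => /eqP.
Qed.
Lemma lieJ x y z : lie x (lie y z) = lie (lie x y) z + lie y (lie x z).
have /eqP := lie_jacobi x y z; rewrite -addrA addr_eq0 => /eqP ->.
by rewrite opprD [LHS]addrC (lieC (lie x y) z) (lieC x z) lieNr.
Qed.
Lemma lie_suml (I : Type) (r : seq I) (F : I -> L) y : lie (\sum_(i <- r) F i) y = \sum_(i <- r) lie (F i) y.
by elim: r => [|i r IH]; rewrite ?big_nil ?lie0l // !big_cons lieDl IH. Qed.
Lemma lie_sumr (I : Type) (r : seq I) (F : I -> L) y : lie y (\sum_(i <- r) F i) = \sum_(i <- r) lie y (F i).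
by elim: r => [|i r IH]; rewrite ?big_nil ?lie0r // !big_cons lieDr IH. Qed.
Lemma liev_mem U V x y : x \in U -> y \in V -> lie x y \in liev U V.
move=> /coord_vbasis -> /coord_vbasis ->; rewrite lie_suml rpred_sum // => i _.
rewrite lieZl lie_sumr rpredZ // rpred_sum // => j _; rewrite lieZr rpredZ //.
apply: memv_span; apply/allpairsP; exists ((vbasis U)`_i, (vbasis V)`_j).
by split=> //=; apply: mem_nth; rewrite size_tuple.
Qed.

Lemma liev_sub U V W : (forall x y, x \in U -> y \in V -> lie x y \in W) -> (liev U V <= W)%VS.
move=> h; apply/span_subvP => z /allpairsP[[x y] /= [xU yV ->]].
by apply: h; exact: vbasis_mem.
Qed.
Lemma liev_le U V W : (liev U V <= W)%VS -> forall x y, x \in U -> y \in V -> lie x y \in W.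
by move=> h x y xU yV; apply: (subvP h); exact: liev_mem. Qed.

Definition crd x : 'rV[K]_(\dim {:L}) := \row_i coord (vbasis {:L}) i x.

Lemma crdE x : x = \sum_i crd x 0 i *: (vbasis {:L})`_i.
by rewrite {1}(coord_vbasis (memvf x)); apply: eq_bigr => i _; rewrite mxE. Qed.
Lemma crdD x y : crd (x + y) = crd x + crd y.
by apply/rowP => i; rewrite !mxE linearD. Qed.
Lemma crdZ a x : crd (a *: x) = a *: crd x.
by apply/rowP => i; rewrite !mxE linearZ. Qed.
Lemma crd0 : crd 0 = 0.
by apply/rowP => i; rewrite !mxE linear0. Qed.
Lemma crdN x : crd (- x) = - crd x.
by rewrite -scaleN1r crdZ scaleN1r. Qed.
Lemma crd_inj : injective crd.
by move=> x y E; rewrite [x]crdE [y]crdE E. Qed.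
Lemma crd_sum (I : Type) (r : seq I) (F : I -> L) : crd (\sum_(i <- r) F i) = \sum_(i <- r) crd (F i).
by elim: r => [|i r IH]; rewrite ?big_nil ?crd0 // !big_cons crdD IH. Qed.
Lemma crd_basis (i : 'I_(\dim {:L})) : crd (vbasis {:L})`_i = delta_mx 0 i.
by apply/rowP => j; rewrite !mxE eqxx /= coord_free ?(basis_free (vbasisP _)) // eq_sym.
Qed.

(** The matrix of [ad x] acting on row vectors from the right, which reverses products: see the
    order in [adMlie]. *)
Definition adM x : 'M[K]_(\dim {:L}) := \matrix_i crd (lie x (vbasis {:L})`_i).

Lemma adME x y : crd (lie x y) = crd y *m adM x.
rewrite {1}[y]crdE lie_sumr crd_sum mulmx_sum_row; apply: eq_bigr => i _.
by rewrite lieZr crdZ rowK.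
Qed.
Lemma killingE x y : kf x y = \tr (adM x *m adM y).
rewrite mxtrace_mulC /killing /mxtrace; apply: eq_bigr => i _.
have := adME x (lie y (vbasis {:L})`_i); rewrite (adME y) crd_basis -mulmxA -rowE => /rowP/(_ i).
by rewrite !mxE.
Qed.
Lemma crd_surj v : exists x, crd x = v.
exists (\sum_i v 0 i *: (vbasis {:L})`_i); rewrite crd_sum [v]row_sum_delta.
by apply: eq_bigr => i _; rewrite crdZ crd_basis -row_sum_delta.
Qed.
Lemma rowmx_eq n (A B : 'M[K]_(\dim {:L}, n)) : (forall x, crd x *m A = crd x *m B) -> A = B.
by move=> h; apply/row_matrixP => i; rewrite !rowE -crd_basis h. Qed.
Lemma adMD x y : adM (x + y) = adM x + adM y.
by apply: rowmx_eq => z; rewrite mulmxDr -!adME lieDl crdD. Qed.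
Lemma adMZ a x : adM (a *: x) = a *: adM x.
by apply: rowmx_eq => z; rewrite -scalemxAr -!adME lieZl crdZ. Qed.
Lemma adMlie x y : adM (lie x y) = adM y *m adM x - adM x *m adM y.
apply: rowmx_eq => z; rewrite mulmxBr !mulmxA -!adME; apply/eqP.
by rewrite eq_sym subr_eq -crdD -lieJ.
Qed.
Lemma killC x y : kf x y = kf y x.
by rewrite !killingE mxtrace_mulC. Qed.
Lemma killDl x y z : kf (x + y) z = kf x z + kf y z.
by rewrite !killingE adMD mulmxDl mxtraceD. Qed.
Lemma killZl a x z : kf (a *: x) z = a * kf x z.
by rewrite !killingE adMZ -scalemxAl mxtraceZ. Qed.
Lemma killDr x y z : kf z (x + y) = kf z x + kf z y.
by rewrite killC killDl !(killC z). Qed.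
Lemma killZr a x z : kf z (a *: x) = a * kf z x.
by rewrite killC killZl killC. Qed.
Lemma kill0l x : kf 0 x = 0.
by rewrite -(scale0r 0) killZl mul0r. Qed.
Lemma kill0r x : kf x 0 = 0.
by rewrite killC kill0l. Qed.
Lemma killNl x y : kf (- x) y = - kf x y.
by rewrite -scaleN1r killZl mulN1r. Qed.
Lemma killNr x y : kf x (- y) = - kf x y.
by rewrite killC killNl killC. Qed.
Lemma killBl x y z : kf (x - y) z = kf x z - kf y z.
by rewrite killDl killNl. Qed.
Lemma killBr x y z : kf z (x - y) = kf z x - kf z y.
by rewrite killDr killNr. Qed.
Lemma kill_inv x y z : kf (lie x y) z = - kf y (lie x z).
have trB (A B : 'M[K]_(\dim {:L})) : \tr (A - B) = \tr A - \tr B by rewrite linearB.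
rewrite !killingE !adMlie mulmxBl mulmxBr !trB opprB; congr (_ - _); first by rewrite mulmxA.
by rewrite -mulmxA mxtrace_mulC mulmxA.
Qed.
End LieBasics.

Ltac vring := apply: crd_inj; apply/rowP => ?; rewrite !(crdD, crdN, crdZ, crd0, mxE); ring.

(** * Cartan involutions, complexification and the compact conjugation *)

Section CartanInvolution.
Context {R : realType} {L : lieAlgType R}.
Variables (k p : {vspace L}).
Hypothesis cd : cartan_decomposition k p.
Implicit Types (x y : L).

Definition sig x : L := daddv_pi k p x - daddv_pi p k x.

Lemma cd_cap : (k :&: p = 0)%VS.
by case: cd => -[_ /directv_addP]. Qed.
Lemma cd_mem x : x \in (k + p)%VS.
by case: cd => -[e _] _ _ _; have := memvf x; rewrite -e. Qed.
Lemma cd_dec x : exists a b, [/\ a \in k, b \in p & x = a + b].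
exists (daddv_pi k p x), (daddv_pi p k x); rewrite !memv_pi; split=> //.
by rewrite daddv_pi_add ?cd_cap // cd_mem.
Qed.
Lemma sigD x y : sig (x + y) = sig x + sig y.
by rewrite /sig !linearD /= addrACA. Qed.
Lemma sigZ a x : sig (a *: x) = a *: sig x.
by rewrite /sig scalerBr !linearZ. Qed.
Lemma sig0 : sig 0 = 0.
by apply: double_eq0; rewrite -sigD addr0. Qed.
Lemma sigk x : x \in k -> sig x = x.
move=> xk; have := daddv_pi_add cd_cap (cd_mem x).
rewrite /sig daddv_pi_id ?cd_cap // => h.
have -> : daddv_pi p k x = 0 by apply: (addrI x); rewrite addr0.
by rewrite subr0.
Qed.

Lemma sigp x : x \in p -> sig x = - x.
have cp0 : (p :&: k = 0)%VS by rewrite capvC cd_cap.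
move=> xp; have := daddv_pi_add cd_cap (cd_mem x).
rewrite /sig [daddv_pi p k x]daddv_pi_id // => h.
have -> : daddv_pi k p x = 0 by apply: (addIr x); rewrite add0r.
by rewrite sub0r.
Qed.
Lemma sigDP a b : a \in k -> b \in p -> sig (a + b) = a - b.
by move=> ak bp; rewrite sigD (sigk ak) (sigp bp). Qed.
Lemma sigK x : sig (sig x) = x.
have [a [b [ak bp ->]]] := cd_dec x.
by rewrite (sigDP ak bp) (sigDP ak) ?opprK // rpredN.
Qed.
Lemma sig_k x : sig x = x -> x \in k.
have [a [b [ak bp ->]]] := cd_dec x; rewrite (sigDP ak bp) => /addrI /eqP.
rewrite eq_sym -subr_eq0 opprK -mulr2n -scaler_nat scaler_eq0 pnatr_eq0 /= => /eqP ->.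
by rewrite addr0.
Qed.
Lemma sig_p x : sig x = - x -> x \in p.
have [a [b [ak bp ->]]] := cd_dec x; rewrite (sigDP ak bp) opprD => /addIr /eqP.
by rewrite -subr_eq0 opprK -mulr2n -scaler_nat scaler_eq0 pnatr_eq0 /= => /eqP ->; rewrite add0r.
Qed.
Lemma sig_lie x y : sig (lie x y) = lie (sig x) (sig y).
have [_ [kk kp pp] _ _] := cd.
have [a [b [ak bp ->]]] := cd_dec x; have [a' [b' [ak' bp' ->]]] := cd_dec y.
rewrite (sigDP ak bp) (sigDP ak' bp') !lieDl !lieDr !lieNl !lieNr opprK !sigD.
rewrite (sigk (liev_le kk ak ak')) (sigp (liev_le kp ak bp')) (sigk (liev_le pp bp bp')).
have ba : lie b a' \in p by rewrite lieC rpredN; exact: liev_le kp _ _ ak' bp.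
by rewrite (sigp ba).
Qed.

(** The matrix [S] of the involution intertwines [ad (sig z)] with [ad z], and traces are invariant
    under conjugation. *)
Lemma kill_sig x y : kf (sig x) (sig y) = kf x y.
pose S : 'M[R]_(\dim {:L}) := \matrix_i crd (sig (vbasis {:L})`_i).
have SE z : crd (sig z) = crd z *m S.
  rewrite {1}[z]crdE mulmx_sum_row -[RHS]/(\sum_i _).
  have : sig (\sum_i crd z 0 i *: (vbasis {:L})`_i) = \sum_i crd z 0 i *: sig (vbasis {:L})`_i.
    elim: (index_enum _) => [|i r IH]; last by rewrite !big_cons sigD sigZ IH. by rewrite !big_nil -(scale0r 0) sigZ !scale0r.
  move=> ->; rewrite crd_sum; apply: eq_bigr => i _; by rewrite crdZ rowK.
have SS : S *m S = 1%:M by apply: rowmx_eq => z; rewrite mulmxA -!SE sigK mulmx1.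
have AS z : S *m adM (sig z) = adM z *m S by apply: rowmx_eq => w; rewrite !mulmxA -SE -!adME -SE sig_lie.
rewrite !killingE -[adM (sig x)]mul1mx -SS -!mulmxA [S *m (adM (sig x) *m _)]mulmxA AS.
rewrite -!mulmxA AS mxtrace_mulC -!mulmxA SS mulmx1; by [].
Qed.

Lemma kill_kp x y : x \in k -> y \in p -> kf x y = 0.
move=> xk yp; have := kill_sig x y; rewrite (sigk xk) (sigp yp) killNr => /eqP.
rewrite eq_sym -subr_eq0 opprK -mulr2n -mulr_natr mulf_eq0 pnatr_eq0 orbF => /eqP; by [].
Qed.
Lemma kill_sigC x y : kf x (sig y) = kf y (sig x).
by rewrite -{1}[x]sigK kill_sig killC. Qed.
Lemma kill_sig_ge0 x : 0 <= - kf x (sig x) /\ (kf x (sig x) = 0 -> x = 0).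
have [_ _ kn pn] := cd.
have [a [b [ak bp ->]]] := cd_dec x; rewrite (sigDP ak bp) killDl !killDr !killNr.
rewrite (kill_kp ak bp) (killC b a) (kill_kp ak bp) oppr0 addr0 add0r.
have a0 : 0 <= - kf a a /\ (kf a a = 0 -> a = 0).
  have [->|/eqP a0] := eqVneq a 0; first by rewrite kill0l oppr0.
  by have h := kn a ak a0; split=> [|E]; [rewrite oppr_ge0 ltW|move: h; rewrite E ltxx].
have b0 : 0 <= kf b b /\ (kf b b = 0 -> b = 0).
  have [->|/eqP b0] := eqVneq b 0; first by rewrite kill0l. by have h := pn b bp b0; split=> [|E]; [rewrite ltW|move: h; rewrite E ltxx].
move: a0 b0 => [a1 a2] [b1 b2]; split; first by move: a1 b1; move: (kf a a) (kf b b) => u v; lra.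
move=> E; have [E1 E2] : kf a a = 0 /\ kf b b = 0.
  by move: a1 b1 E; move: (kf a a) (kf b b) => u v u0 v0 E; split; lra.
by rewrite a2 // b2 // addr0.
Qed.

(** The Killing form is negative on [k'] and positive on [p], so they meet in 0 only. This compares
    the given Cartan decomposition with the one hidden in the Iwasawa hypothesis. *)
Lemma cd_dim (k' p' : {vspace L}) : cartan_decomposition k' p' -> (\dim k' <= \dim k)%N.
move=> [_ _ kn' _]; have [[kpf /directvP/= kpd] _ kn pn] := cd.
have k'p : (k' :&: p = 0)%VS.
  apply/eqP; rewrite -subv0; apply/subvP => x; rewrite memv_cap memv0 => /andP[xk xp].
  apply: contraT => /eqP x0; have := kn' x xk x0; by rewrite ltNge ltW // pn.
have : (\dim (k' + p) <= \dim (k + p))%N by rewrite kpf dimvS // subvf.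
have := dimv_sum_cap k' p; rewrite k'p dimv0 addn0 => -> .
by rewrite kpd leq_add2r.
Qed.
End CartanInvolution.

Section Complexification.
Context {R : realType} {g0 : lieAlgType R} {g : lieAlgType R[i]}.
Variable iota : g0 -> g.
Hypothesis cx : complexification iota.
Notation C := R[i].
Notation "'i" := ('i%C : C).
Implicit Types (x y : g0) (z w : g).

Lemma iotaD x y : iota (x + y) = iota x + iota y.
by case: cx => h _ _; have := h 1 x y; rewrite !scale1r. Qed.
Lemma iota0 : iota 0 = 0.
by apply: double_eq0; rewrite -iotaD addr0. Qed.
Lemma iotaZ (a : R) x : iota (a *: x) = (a%:C)%C *: iota x.
by case: cx => h _ _; have := h a x 0; rewrite !addr0 iota0 addr0. Qed.
Lemma iotaN x : iota (- x) = - iota x.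
by rewrite -scaleN1r iotaZ rmorphN1 scaleN1r. Qed.
Lemma iota_lie x y : iota (lie x y) = lie (iota x) (iota y).
by case: cx. Qed.
Lemma cx_dec z : exists xy : g0 * g0, z = iota xy.1 + 'i *: iota xy.2.
by case: cx => _ _ /(_ z)[xy [E _]]; exists xy. Qed.

Definition re z : g0 := (sval (cid (cx_dec z))).1.
Definition im z : g0 := (sval (cid (cx_dec z))).2.

Lemma reimE z : z = iota (re z) + 'i *: iota (im z).
by rewrite /re /im; case: (cid _). Qed.
Lemma reim_uniq x y x' y' : iota x + 'i *: iota y = iota x' + 'i *: iota y' -> x = x' /\ y = y'.
case: cx => _ _ /(_ (iota x + 'i *: iota y))[xy [_ U]] E.
have := U (x, y) erefl; have := U (x', y') E; move=> -> [-> ->]; by [].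
Qed.
Lemma i2 z : 'i *: ('i *: z) = - z.
by rewrite scalerA -expr2 sqr_i scaleN1r. Qed.
Lemma cplx_scale (a : C) z : a *: z = ((complex.Re a)%:C)%C *: z + 'i *: (((complex.Im a)%:C)%C *: z).
by rewrite scalerA -scalerDl -complexE. Qed.
(** A real basis of [g0] is a complex basis of [g]: [P] and [Q] are the two changes of basis, shown
    to be mutually inverse while the two dimensions are still formally distinct. *)
Lemma kill_iota x y : kf (iota x) (iota y) = ((kf x y)%:C)%C.
pose P : 'M[C]_(\dim {:g0}, \dim {:g}) := \matrix_i crd (iota (vbasis {:g0})`_i).
pose Q : 'M[C]_(\dim {:g}, \dim {:g0}) := \matrix_(j, k) ((crd (re (vbasis {:g})`_j) 0 k +i* crd (im (vbasis {:g})`_j) 0 k))%C.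
have PE (w : g0) : crd (iota w) = map_mx (real_complex R) (crd w) *m P.
  rewrite {1}[w]crdE mulmx_sum_row.
  have -> : iota (\sum_i crd w 0 i *: (vbasis {:g0})`_i) = \sum_i ((crd w 0 i)%:C)%C *: iota (vbasis {:g0})`_i.
    elim: (index_enum _) => [|i r IH]; last by rewrite !big_cons iotaD iotaZ IH. by rewrite !big_nil iota0.
  by rewrite crd_sum; apply: eq_bigr => i _; rewrite crdZ rowK !mxE.
have QP : Q *m P = 1%:M.
  apply/row_matrixP => j; rewrite row1 -crd_basis row_mul {1}[(vbasis {:g})`_j]reimE crdD crdZ !PE.
  rewrite scalemxAl -mulmxDl; congr (_ *m _); apply/rowP => k; rewrite !mxE. by rewrite [LHS]complexE.
have PQ : P *m Q = 1%:M.
  apply/row_matrixP => j; rewrite row_mul rowK row1; set v := _ *m Q.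
  have vP : v *m P = crd (iota (vbasis {:g0})`_j) by rewrite /v -mulmxA QP mulmx1. have [a aE] := crd_surj (\row_l complex.Re (v 0 l)).
  have [c cE] := crd_surj (\row_l complex.Im (v 0 l)).
  have vE : v = map_mx (real_complex R) (crd a) + 'i *: map_mx (real_complex R) (crd c) by apply/rowP => l; rewrite aE cE !mxE [LHS]complexE.
  have /crd_inj E : crd (iota (vbasis {:g0})`_j) = crd (iota a + 'i *: iota c) by rewrite crdD crdZ !PE scalemxAl -mulmxDl -vE vP.
  have [E1 E2] : (vbasis {:g0})`_j = a /\ 0 = c by apply: reim_uniq; rewrite iota0 scaler0 addr0.
  rewrite vE -E1 -E2 crd0 crd_basis map_mx0 scaler0 addr0. by apply/rowP => l; rewrite !mxE; case: (_ && _).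
have PA (w : g0) : P *m adM (iota w) = map_mx (real_complex R) (adM w) *m P.
  apply/row_matrixP => i; rewrite !rowE !mulmxA -!rowE rowK -adME -iota_lie PE; congr (_ *m _). by apply/rowP => k; rewrite !mxE.
rewrite !killingE -[adM (iota x)]mul1mx -QP -!mulmxA [P *m (adM (iota x) *m _)]mulmxA PA.
rewrite -!mulmxA PA mxtrace_mulC -!mulmxA PQ mulmx1 -map_mxM; by rewrite trace_map_mx.
Qed.
Lemma conjcN (a : C) : ((- a)^*)%C = - (a^*)%C.
by case: a. Qed.

Section Theta.
Variables (k p : {vspace g0}).
Hypothesis cd : cartan_decomposition k p.
Notation sig := (sig k p).

(** The antilinear extension of the Cartan involution; by [theta_conjE] it is the conjugation with
    respect to the compact form. *)
Definition theta z := iota (sig (re z)) - 'i *: iota (sig (im z)).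

Lemma thetaE x y : theta (iota x + 'i *: iota y) = iota (sig x) - 'i *: iota (sig y).
by have [E1 E2] := reim_uniq (reimE (iota x + 'i *: iota y)); rewrite /theta -E1 -E2. Qed.
Lemma theta_iota x : theta (iota x) = iota (sig x).
have E : iota x = iota x + 'i *: iota 0 by rewrite iota0 scaler0 addr0.
by rewrite {1}E thetaE sig0; rewrite iota0 scaler0 subr0.
Qed.
Lemma thetaD z w : theta (z + w) = theta z + theta w.
rewrite {1}[z]reimE {1}[w]reimE addrACA -iotaD -scalerDr -iotaD thetaE /theta !sigD !iotaD.
by rewrite scalerDr opprD addrACA.
Qed.
Lemma theta_i z : theta ('i *: z) = - ('i *: theta z).
rewrite {1}[z]reimE scalerDr i2 addrC -iotaN thetaE /theta -scaleN1r sigZ scaleN1r iotaN.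
by rewrite scalerBr i2 opprK opprD addrC.
Qed.
Lemma thetaZr (a : R) z : theta ((a%:C)%C *: z) = (a%:C)%C *: theta z.
rewrite {1}[z]reimE scalerDr scalerA mulrC -scalerA -!iotaZ thetaE /theta !sigZ !iotaZ scalerBr.
by congr (_ - _); rewrite !scalerA mulrC.
Qed.
Lemma thetaZ (a : C) z : theta (a *: z) = (a^*)%C *: theta z.
rewrite (cplx_scale a) thetaD theta_i !thetaZr [RHS]cplx_scale; congr (_ + _).
  by case: a.
by case: a => a b; rewrite /= rmorphN scaleNr scalerN.
Qed.
Lemma thetaN z : theta (- z) = - theta z.
by rewrite -scaleN1r thetaZ rmorphN1 scaleN1r. Qed.
Lemma thetaB z w : theta (z - w) = theta z - theta w.
by rewrite thetaD thetaN. Qed.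
Lemma thetaK z : theta (theta z) = z.
rewrite -[theta z]/(iota (sig (re z)) - 'i *: iota (sig (im z))) thetaB theta_i !theta_iota !(sigK cd) opprK.
by rewrite -reimE.
Qed.
Lemma theta_lie z w : theta (lie z w) = lie (theta z) (theta w).
rewrite {1}[z]reimE {1}[w]reimE !lieDl !lieDr !lieZl !lieZr i2 -!iota_lie.
rewrite !thetaD thetaN !theta_i !theta_iota !(sig_lie cd) !iota_lie.
by rewrite !lieNl !lieNr !lieZl !lieZr i2 !opprK.
Qed.
Lemma kill_theta z w : kf (theta z) (theta w) = ((kf z w)^*)%C.
rewrite {2}[z]reimE {2}[w]reimE /theta.
rewrite !killBl !killBr !killDl !killDr !killZl !killZr !kill_iota !(kill_sig cd).
complex_ring.
Qed.

Definition herm z w : C := - kf z (theta w).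

Lemma herm_gt0 z : z <> 0 -> 0 < herm z z.
move=> z0; rewrite /herm {1}[z]reimE /theta killDl !killBr !killZl !killZr !kill_iota.
have [a0 a1] := kill_sig_ge0 cd (re z); have [b0 b1] := kill_sig_ge0 cd (im z).
have E : kf (re z) (sig (im z)) = kf (im z) (sig (re z)) by rewrite (kill_sigC cd).
rewrite ltcE /=; apply/andP; split; first by apply/eqP; rewrite E; ring.
rewrite E lt_neqAle; apply/andP; split; last by move: a0 b0; lra.
apply: contra_notN z0 => /eqP S.
have [E1 E2] : kf (re z) (sig (re z)) = 0 /\ kf (im z) (sig (im z)) = 0 by move: a0 b0 S; move: (kf _ _) (kf (im z) (sig (im z))) => u v u0 v0 S; split; lra.
by rewrite [z]reimE (a1 E1) (b1 E2) iota0 scaler0 addr0.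
Qed.

Lemma compact_formP z : compact_form iota k p z <-> theta z = z.
split=> [[x [y [xk yp ->]]]|E].
  by rewrite thetaE (sigk cd xk) (sigp cd yp) iotaN scalerN opprK.
have := E; rewrite /theta -scalerN -iotaN {3}[z]reimE => /reim_uniq[E1 E2].
exists (re z), (im z); split; last exact: reimE.
- exact: sig_k E1.
- by apply: (sig_p cd); rewrite -{2}E2 opprK.
Qed.

Lemma theta_conjE (th : g -> g) : conjugation (compact_form iota k p) th -> th =1 theta.
move=> h z.
pose x := 2^-1 *: (z + theta z); pose y := - ('i *: (2^-1 *: (z - theta z))).
have zE : z = x + 'i *: y by rewrite /y scalerN i2 opprK half_parts.
have c2 : (2^-1 : C)^*%C = 2^-1 by rewrite conjc_inv conjc_nat.
have tx : theta x = x by rewrite /x thetaZ c2 thetaD thetaK addrC.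
have ty : theta y = y by rewrite /y thetaN theta_i thetaZ c2 thetaB thetaK -(opprB z) scalerN !scalerN opprK.
rewrite {1}zE h; try exact/compact_formP.
by rewrite zE thetaD theta_i tx ty.
Qed.
End Theta.
End Complexification.

(** A conjugation for which [- kf z (th w)] is a positive Hermitian form. The abstraction lets
    [triangular_real] use a second one, attached to the Cartan decomposition that underlies the
    Iwasawa hypothesis. *)
Record cptInv (R : realType) (g : lieAlgType R[i]) := CompactInv { th :> g -> g; thD : forall z w, th (z + w) = th z + th w;
  thZ : forall (a : R[i]) z, th (a *: z) = (a^*)%C *: th z;
  thK : forall z, th (th z) = z; th_lie : forall z w, th (lie z w) = lie (th z) (th w);
  kill_th : forall z w, kf (th z) (th w) = ((kf z w)^*)%C;
  hm_gt0' : forall z, z <> 0 -> 0 < - kf z (th z)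
}.

Lemma span_ex (K : fieldType) (g : vectType K) (S : set g) : exists X : seq g, (forall x, x \in X -> S x) /\
  (forall x, S x -> x \in <<X>>%VS).
suff H n : forall X : seq g, (forall x, x \in X -> S x) -> (\dim {:g} - \dim <<X>> <= n)%N ->
    exists X : seq g, (forall x, x \in X -> S x) /\ (forall x, S x -> x \in <<X>>%VS).
  by apply: (H _ [::]); [move=> x; rewrite in_nil|exact: leqnn].
elim: n => [|n IH] X XS dX.
  exists X; split=> // x _; have /eqP -> : <<X>>%VS == fullv; last exact: memvf. by rewrite eqEdim subvf /= -subn_eq0 -leqn0.
have [h|nh] := pselect (forall x, S x -> x \in <<X>>%VS); first by exists X.
have [x /not_implyP[Sx /negP xX]] : exists x, ~ (S x -> x \in <<X>>%VS) by exact/existsNP.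
apply: (IH (x :: X)) => [y|]; first by rewrite inE => /orP[/eqP ->|/XS].
have lt : (\dim <<X>> < \dim <<x :: X>>)%N.
  rewrite ltn_neqAle dimvS ?span_cons ?addvSr // andbT -span_cons; apply: contra xX => /eqP E.
  have /eqP -> : <<X>>%VS == <<x :: X>>%VS by rewrite eqEdim span_cons addvSr /= -span_cons -E leqnn. by apply: memv_span; rewrite inE eqxx.
rewrite -ltnS; apply: leq_trans dX; apply: ltn_sub2l => //.
by apply: leq_trans lt _; rewrite dimvS // subvf.
Qed.

Lemma span_ind (K : fieldType) (V : vectType K) (Q : set V) (W : {vspace V}) (S : V -> Prop) :
  (forall W' : {vspace V}, (forall x, Q x -> x \in W') -> (W <= W')%VS) ->
  S 0 -> (forall x y, S x -> S y -> S (x + y)) -> (forall a x, Q x -> S (a *: x)) -> forall x, x \in W -> S x.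
move=> WP S0 SD SQ; have [X [XS XP]] := span_ex Q.
move=> x /(subvP (WP _ XP)) /(@coord_span _ _ _ (in_tuple X)) ->.
elim: (index_enum _) => [|i r IH]; first by rewrite big_nil.
by rewrite big_cons; apply: SD => //; apply: SQ; apply: XS; rewrite mem_nth // -(size_tuple (in_tuple X)).
Qed.

(** * The Hermitian form, orthogonal projections and common eigenvectors *)

Section HermitianForm.
Context {R : realType} {g : lieAlgType R[i]} (T : cptInv g).
Notation C := R[i].
Notation "'i" := ('i%C : C).
Implicit Types (x y z w v : g).

Lemma th0 : T 0 = 0.
by apply: double_eq0; rewrite -thD addr0. Qed.
Lemma thN z : T (- z) = - T z.
by rewrite -scaleN1r thZ rmorphN1 scaleN1r. Qed.
Lemma thB z w : T (z - w) = T z - T w.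
by rewrite thD thN. Qed.
Lemma th_i z : T ('i *: z) = - ('i *: T z).
rewrite thZ -scaleNr; congr (_ *: _).
by apply/eqP; rewrite eq_complex /= oppr0 !eqxx.
Qed.

Definition hm z w : C := - kf z (T w).

Lemma hm_gt0 z : z <> 0 -> 0 < hm z z. Proof. exact: hm_gt0'. Qed.
Lemma hmDl z w v : hm (z + w) v = hm z v + hm w v.
by rewrite /hm killDl opprD. Qed.
Lemma hmZl a z v : hm (a *: z) v = a * hm z v.
by rewrite /hm killZl mulrN. Qed.
Lemma hmC z w : hm z w = ((hm w z)^*)%C.
by rewrite /hm conjcN -(kill_th T) thK killC. Qed.
Lemma hm0l v : hm 0 v = 0.
by rewrite /hm kill0l oppr0. Qed.
Lemma hm0r v : hm v 0 = 0.
by rewrite hmC hm0l conjc0. Qed.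
Lemma conjcD (a b : C) : ((a + b)^*)%C = (a^*)%C + (b^*)%C.
by case: a b => a1 a2 [b1 b2]; apply/eqP; rewrite eq_complex /= opprD !eqxx. Qed.
Lemma conjcM (a b : C) : ((a * b)^*)%C = (a^*)%C * (b^*)%C.
by case: a b => a1 a2 [b1 b2]; complex_ring. Qed.
Lemma hmDr z w v : hm v (z + w) = hm v z + hm v w.
by rewrite hmC hmDl conjcD -!hmC. Qed.
Lemma hmZr a z v : hm v (a *: z) = (a^*)%C * hm v z.
by rewrite hmC hmZl conjcM -hmC. Qed.
Lemma hmNl z v : hm (- z) v = - hm z v.
by rewrite -scaleN1r hmZl mulN1r. Qed.
Lemma hmNr z v : hm v (- z) = - hm v z.
by rewrite hmC hmNl conjcN -hmC. Qed.
Lemma hmBl z w v : hm (z - w) v = hm z v - hm w v.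
by rewrite hmDl hmNl. Qed.
Lemma hmBr z w v : hm v (z - w) = hm v z - hm v w.
by rewrite hmDr hmNr. Qed.
Lemma hm_eq0 z : hm z z = 0 -> z = 0.
by move=> E; apply: contrapT => /hm_gt0; rewrite E ltxx. Qed.
Lemma hm_ge0 z : 0 <= hm z z.
by have [->|/eqP/hm_gt0/ltW//] := eqVneq z 0; rewrite hm0l. Qed.
Lemma hm_lie x z w : hm (lie x z) w = - hm z (lie (T x) w).
by rewrite /hm kill_inv th_lie thK. Qed.
Lemma hm_real z : ((hm z z)^*)%C = hm z z. Proof. by rewrite -hmC. Qed.
Lemma hm_ortho_span (X : seq g) v : (forall w, w \in X -> hm v w = 0) -> forall w, w \in <<X>>%VS -> hm v w = 0.
move=> h w wX; rewrite (@coord_span _ _ _ (in_tuple X) w wX); elim: (index_enum _) => [|i r IH]; first by rewrite big_nil hm0r.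
by rewrite big_cons hmDr hmZr IH addr0 h ?mulr0 // mem_nth // -(size_tuple (in_tuple X)).
Qed.
Lemma orth_proj (X : seq g) v : exists2 f, f \in <<X>>%VS & forall w, w \in <<X>>%VS -> hm (v - f) w = 0.
elim: X v => [|x X IH] v.
  exists 0; first exact: mem0v. by move=> w; rewrite span_nil memv0 => /eqP ->; rewrite hm0r.
have [fx fxX fxP] := IH x; have [fv fvX fvP] := IH v.
pose x' := x - fx; have x'E : x' = x - fx by [].
have fxP' w : w \in <<X>>%VS -> hm x' w = 0 by exact: fxP.
clearbody x'; clear fxP.
have sX : (<<X>> <= <<x :: X>>)%VS by rewrite span_cons addvSr.
have xX : x \in <<x :: X>>%VS by apply: memv_span; rewrite inE eqxx.
have x'X : x' \in <<x :: X>>%VS by rewrite x'E rpredB // (subvP sX).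
exists (fv + (hm v x' / hm x' x') *: x').
  by rewrite rpredD ?rpredZ // (subvP sX).
apply: hm_ortho_span => w; rewrite inE => /orP[/eqP ->|wX]; last first.
  have wX' : w \in <<X>>%VS by exact: memv_span. by rewrite opprD addrA hmBl fvP // hmZl (fxP' w wX') mulr0 subr0.
have [x'0|/eqP/hm_gt0 x'0] := eqVneq x' 0.
  rewrite x'0 scaler0 addr0; have -> : x = fx by apply/eqP; rewrite -subr_eq0 -x'E x'0. exact: fvP.
have xE : x = x' + fx by rewrite x'E subrK.
have e1 : hm x' fx = 0 by exact: fxP'.
have e2 : hm (v - fv) fx = 0 by exact: fvP.
have e3 : hm fv x' = 0 by rewrite hmC (fxP' fv fvX) conjc0.
rewrite xE opprD addrA hmBl !hmDr e2 addr0 hmZl [hm (_ *: x') fx]hmZl e1 mulr0 addr0 hmBl e3 subr0.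
by rewrite divfK ?subrr // gt_eqF.
Qed.


Lemma common_eigen (W : {vspace g}) (xs : seq g) : W <> 0%VS -> (forall x w, x \in xs -> w \in W -> lie x w \in W) ->
  (forall x y w, x \in xs -> y \in xs -> w \in W -> lie x (lie y w) = lie y (lie x w)) ->
  exists v, [/\ v \in W, v <> 0 & forall x, x \in xs -> exists a : C, lie x v = a *: v].
move=> W0 st cm; set m := \dim W.
pose cW v : 'rV[C]_m := \row_i coord (vbasis W) i v.
pose vW (r : 'rV[C]_m) := \sum_i r 0 i *: (vbasis W)`_i.
have cWK v : v \in W -> vW (cW v) = v by move=> vv; rewrite {2}(coord_vbasis vv); apply: eq_bigr => i _; rewrite mxE.
have vWm r : vW r \in W by apply: rpred_sum => i _; rewrite rpredZ // vbasis_mem // mem_nth // size_tuple.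
have fb := basis_free (vbasisP W).
have vWK r : cW (vW r) = r by apply/rowP => i; rewrite mxE coord_sum_free.
pose A x : 'M[C]_m := \matrix_i cW (lie x (vbasis W)`_i).
have bW (i : 'I_m) : (vbasis W)`_i \in W by rewrite vbasis_mem // mem_nth // size_tuple.
have cWsum (I : Type) (r : seq I) (F : I -> g) : cW (\sum_(i <- r) F i) = \sum_(i <- r) cW (F i) by apply/rowP => i; rewrite mxE linear_sum summxE; apply: eq_bigr => k _; rewrite mxE.
have cWZ a v : cW (a *: v) = a *: cW v by apply/rowP => i; rewrite !mxE linearZ.
have AE x v : x \in xs -> v \in W -> cW (lie x v) = cW v *m A x.
  move=> xX vv; rewrite {1}(coord_vbasis vv) lie_sumr cWsum mulmx_sum_row. by apply: eq_bigr => i _; rewrite lieZr cWZ rowK mxE.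
have m0 : (0 < m)%N by rewrite lt0n dimv_eq0; apply/eqP.
have AC : {in [seq A x | x <- xs] &, forall B B', comm_mx B B'}.
  move=> B B' /mapP[x xX ->] /mapP[y yX ->]; rewrite /comm_mx; apply/row_matrixP => i. rewrite !row_mul !rowK -!AE ?st //. by rewrite cm.
have [v v0 /allP vS] := common_eigenvector m0 AC.
exists (vW v); split=> //; first by move=> E; move: v0; rewrite -(vWK v) E /cW => /negP; apply; apply/eqP/rowP => i; rewrite !mxE linear0.
move=> x xX; have /vS : A x \in [seq A x | x <- xs] by exact: map_f.
move=> /sub_rVP[a vE]; exists a; rewrite -[LHS]cWK ?st // AE // vWK vE.
by rewrite /vW scaler_sumr; apply: eq_bigr => i _; rewrite mxE scalerA.
Qed.
End HermitianForm.

Record rootDatum (R : realType) (g : lieAlgType R[i]) (T : cptInv g) := RootDatum { rd_h : {vspace g}; rd_b : {vspace g}; rd_n : {vspace g};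
  rd_Dp : seq (functional rd_h); rd_E : functional rd_h -> g; rd_cartan : cartan_subalgebra rd_h;
  rd_th : forall x, x \in rd_h -> T x \in rd_h; rd_borel : borel rd_b; rd_hb : (rd_h <= rd_b)%VS; rd_uniq : uniq rd_Dp;
  rd_roots : forall al : functional rd_h, al \in rd_Dp <-> borel_roots rd_b al; rd_span : is_root_span [set` rd_Dp] rd_n;
  rd_root : forall al, al \in rd_Dp -> root_space al (rd_E al); rd_norm : forall al, al \in rd_Dp -> kf (rd_E al) (T (rd_E al)) = -1
}.

(** * Roots and the structure of the Borel subalgebra *)

Section Roots.
Context {R : realType} {g : lieAlgType R[i]} (T : cptInv g).
Notation C := R[i].
Notation "'i" := ('i%C : C).
Notation hm := (hm T).
Variable rd : rootDatum T.
Notation h := (rd_h rd).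
Notation b := (rd_b rd).
Notation n := (rd_n rd).
Notation Dp := (rd_Dp rd).
Notation E := (@rd_E _ _ _ rd).
Let h_cartan := rd_cartan rd.
Let h_th := @rd_th _ _ _ rd.
Let b_borel := rd_borel rd.
Let hb := rd_hb rd.
Let Dp_uniq := rd_uniq rd.
Let Dp_roots := @rd_roots _ _ _ rd.
Let n_span := @rd_span _ _ _ rd.
Let E_root := @rd_root _ _ _ rd.
Let E_norm := @rd_norm _ _ _ rd.
Implicit Types (x y z w v e : g) (al be : functional h).

Lemma memv_scaleK (U : {vspace g}) (c : C) x : c != 0 -> c *: x \in U -> x \in U.
by move=> c0 cU; rewrite -[x]scale1r -(mulVf c0) -scalerA rpredZ. Qed.
Lemma real_part_h x : x \in h -> exists x1 x2, [/\ x1 \in h, x2 \in h, T x1 = x1 & T x2 = x2] /\ x = x1 + 'i *: x2.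
move=> xh; exists (2^-1 *: (x + T x)), (- ('i *: (2^-1 *: (x - T x)))).
have c2 : (2^-1 : C)^*%C = 2^-1 by rewrite conjc_inv conjc_nat.
split; last by rewrite scalerN i2 opprK half_parts.
split; rewrite ?rpredN ?rpredZ ?rpredD ?rpredN ?h_th //.
- by rewrite thZ c2 thD thK addrC.
- by rewrite thN th_i thZ c2 thB thK -(opprB x) scalerN !scalerN opprK.
Qed.

(** For [x] fixed by [T], [ad x] is skew for the Hermitian form, so [a (a z) = 0] implies [a z = 0],
    and nilpotency on [h] forces [ad x = 0] there. As [h] is stable under [T], such elements span it
    over the complex numbers. *)
Lemma h_abelian x y : x \in h -> y \in h -> lie x y = 0.
have [sub [m nil] _] := h_cartan.
have skew0 x' : x' \in h -> T x' = x' -> forall y', y' \in h -> lie x' y' = 0.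
  move=> xh Tx y' yh; pose a := lie x'.
  have st k z : z \in h -> iter k a z \in iter k (liev h) h by move=> zh; elim: k => [|k IH] //=; exact: liev_mem.
  have sk z w : hm (a z) w = - hm z (a w) by rewrite /a hm_lie Tx.
  have down z : a (a z) = 0 -> a z = 0 by move=> E; apply: (@hm_eq0 _ _ T); rewrite sk E hm0r oppr0.
  have E0 : iter m a y' = 0 by apply/eqP; rewrite -memv0 -nil st.
  have H k : iter k.+1 a y' = 0 -> a y' = 0 by elim: k => [|k IH] // E; apply: IH; exact: down.
  by case: (m) E0 => [/= ->|k]; [rewrite /a lie0r|exact: H].
move=> xh yh; have [x1 [x2 [[h1 h2 t1 t2] ->]]] := real_part_h xh.
by rewrite lieDl lieZl !skew0 // scaler0 addr0.
Qed.
Lemma rspE al x y : root_space al x -> y \in h -> lie y x = al (vsproj h y) *: x.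
by move=> h1 yh; rewrite -[y in LHS](vsprojK yh). Qed.
Lemma weight_ex v : v <> 0 -> (forall x, x \in h -> exists a : C, lie x v = a *: v) -> exists al, root_space al v.
move=> v0 hv; have hvv : hm v v != 0 by rewrite gt_eqF // hm_gt0.
pose f (y : subvs_of h) : C^o := hm (lie (vsval y) v) v / hm v v.
have lf : linear f.
  move=> a y y'; rewrite /f linearP lieDl lieZl hmDl hmZl mulrDl; congr (_ + _). by rewrite -mulrA.
pose F : {linear subvs_of h -> C^o} := HB.pack f (GRing.isLinear.Build C (subvs_of h) C^o _ f lf).
exists (linfun F) => y; rewrite lfunE /= /f; have [a E] := hv _ (subvsP y).
by rewrite E hmZl mulfK.
Qed.

Lemma weight_th al x z : root_space al x -> x <> 0 -> z \in h ->
  al (vsproj h (T z)) = - ((al (vsproj h z))^*)%C.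
move=> ax x0 zh; have hxx : hm x x != 0 by rewrite gt_eqF // hm_gt0.
apply: (mulIf hxx); rewrite -hmZl -(rspE ax (h_th zh)) hm_lie thK (rspE ax zh).
by rewrite hmZr mulNr.
Qed.

Lemma weight_orth al be x y : root_space al x -> root_space be y -> al <> be -> hm x y = 0.
move=> ax bey ab; have [->|/eqP y0] := eqVneq y 0; first exact: hm0r.
have [z zh zne] : exists2 z, z \in h & al (vsproj h z) <> be (vsproj h z).
  apply: contrapT => nz; apply: ab; apply/lfunP => z; apply: contrapT => zne.
  by apply: nz; exists (vsval z); [exact: subvsP|rewrite vsvalK].
have : al (vsproj h z) * hm x y = be (vsproj h z) * hm x y.
  rewrite -hmZl -(rspE ax zh) hm_lie (rspE bey (h_th zh)) hmZr. by rewrite (weight_th bey y0 zh) conjcN conjcK mulNr opprK.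
move/eqP; rewrite -subr_eq0 -mulrBl mulf_eq0 subr_eq0 => /orP[/eqP //|/eqP //].
Qed.

Lemma weight_opp al x : root_space al x -> root_space (- al) (T x).
move=> ax y; have [->|/eqP x0] := eqVneq x 0; first by rewrite th0 lie0r scaler0.
have yh := subvsP y; rewrite -{1}[vsval y](thK T) -th_lie (rspE ax (h_th yh)).
by rewrite thZ (weight_th ax x0 yh) conjcN conjcK vsvalK opp_lfunE scaleNr.
Qed.
Lemma weight_lie al be x y : root_space al x -> root_space be y -> root_space (al + be) (lie x y).
move=> ax bey z; rewrite lieJ ax bey lieZl lieZr -scalerDl add_lfunE; by [].
Qed.
Lemma weight_h x : x \in h -> root_space (0 : functional h) x.
by move=> xh y; rewrite h_abelian ?subvsP // zero_lfunE scale0r. Qed.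
Lemma weight0_h x : root_space (0 : functional h) x -> x \in h.
move=> x0; have [_ _ self] := h_cartan; apply: self => y yh.
by rewrite lieC (rspE x0 yh) zero_lfunE scale0r oppr0 mem0v.
Qed.
Lemma weightZ al a x : root_space al x -> root_space al (a *: x).
by move=> ax y; rewrite lieZr ax !scalerA mulrC. Qed.
Lemma weightD al x y : root_space al x -> root_space al y -> root_space al (x + y).
by move=> ax ay z; rewrite lieDr ax ay scalerDr. Qed.

(* An [h]-stable subspace is spanned by its weight vectors: otherwise their
   orthogonal complement contains a common eigenvector of [h]. *)
Lemma weight_span (V W : {vspace g}) : (forall x v, x \in h -> v \in V -> lie x v \in V) ->
  (forall al x, x \in V -> root_space al x -> x \in W) -> (V <= W)%VS.
move=> st hW.
have [X [XS XP]] := span_ex [set x | x \in V /\ exists al, root_space al x].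
have XV : (<<X>> <= V)%VS by apply/span_subvP => x /XS[].
have Xst z w : z \in h -> w \in <<X>>%VS -> lie z w \in <<X>>%VS.
  move=> zh wX; rewrite (@coord_span _ _ _ (in_tuple X) w wX) lie_sumr rpred_sum // => i _.
  have /XS[_ [al ax]] : X`_i \in X by rewrite mem_nth // -(size_tuple (in_tuple X)).
  by rewrite lieZr rpredZ // (rspE ax zh) rpredZ // memv_span // mem_nth // -(size_tuple (in_tuple X)).
have [Y [YS YP]] := span_ex [set v | v \in V /\ forall w, w \in <<X>>%VS -> hm v w = 0].
have YE v : v \in <<Y>>%VS -> v \in V /\ forall w, w \in <<X>>%VS -> hm v w = 0.
  move=> vY; split; first by apply: (subvP (_ : (<<Y>> <= V)%VS)) vY; apply/span_subvP => x /YS[].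
  move=> w wX; rewrite hmC; suff -> : hm w v = 0 by rewrite conjc0.
  by apply: (@hm_ortho_span _ _ T Y) vY => y /YS[_ yP]; rewrite hmC yP // conjc0.
apply: subv_trans (_ : (<<X>> <= W)%VS); last first.
  by apply/span_subvP => x /XS[xV [al ax]]; exact: hW ax.
apply/subvP => v vV; have [f fX fP] := orth_proj T X v.
have vfY : v - f \in <<Y>>%VS by apply: YP; split=> //; rewrite rpredB // (subvP XV).
have [Y0|/eqP Y0] := eqVneq <<Y>>%VS 0%VS.
  by move: vfY; rewrite Y0 memv0 subr_eq0 => /eqP ->.
have [u [uY u0 uP]] : exists v, [/\ v \in <<Y>>%VS, v <> 0 & forall x, x \in vbasis h -> exists a : C, lie x v = a *: v].
  apply: common_eigen => // [x w xh wY|x y w xh yh wY].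
    have [wV wP] := YE w wY; have xh' := vbasis_mem xh; apply: YP; split; first exact: st.
    by move=> z zX; rewrite hm_lie wP ?oppr0 // Xst // h_th.
  by rewrite lieJ (h_abelian (vbasis_mem xh) (vbasis_mem yh)) lie0l add0r.
have [|al au] := @weight_ex u u0.
  move=> x /coord_vbasis ->; rewrite lie_suml; elim: (index_enum _) => [|i r [a IH]].
    by exists 0; rewrite big_nil scale0r.
  have [b bE] : exists b : C, lie (vbasis h)`_i u = b *: u by apply: uP; rewrite mem_nth // size_tuple.
  by exists (coord (vbasis h) i x * b + a); rewrite big_cons IH lieZl bE scalerA scalerDl.
have [uV uO] := YE u uY; have uX : u \in <<X>>%VS by apply: XP; split=> //; exists al.
by case: u0; apply: (@hm_eq0 _ _ T); exact: uO.
Qed.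

(** The Killing dual of the root, usually written t_alpha ([corootP]), and not the normalized
    coroot. The division by [hm e e] makes it invariant under rescaling of [e]. *)
Definition coroot e := - (hm e e)^-1 *: lie e (T e).

Lemma corootP al e : root_space al e -> e <> 0 ->
  [/\ coroot e \in h, T (coroot e) = - coroot e & forall y, y \in h -> kf (coroot e) y = al (vsproj h y)].
move=> ae e0; have hee : hm e e != 0 by rewrite gt_eqF // hm_gt0.
split.
- apply: weight0_h; apply: weightZ; rewrite -(subrr al); exact: weight_lie (weight_opp ae).
- rewrite /coroot thZ th_lie thK conjcN conjc_inv hm_real [lie (T e) e]lieC scalerN; by [].
- move=> y yh; rewrite /coroot killZl kill_inv [lie e y]lieC killNr opprK.
  by rewrite (rspE ae yh) killZr killC -[kf _ _]opprK -/(hm e e) mulrN mulrNN mulrCA mulVf ?mulr1.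
Qed.

Lemma coroot_gt0 al e : root_space al e -> e <> 0 -> al <> 0 -> 0 < al (vsproj h (coroot e)).
move=> ae e0 al0; have [th' Tt K] := corootP ae e0.
rewrite -K //; have -> : kf (coroot e) (coroot e) = hm (coroot e) (coroot e).
  by rewrite /hm Tt killNr opprK.
apply: hm_gt0 => t0; apply: al0; apply/lfunP => y; rewrite zero_lfunE.
by have := K (vsval y) (subvsP y); rewrite t0 kill0l vsvalK => <-.
Qed.
Lemma kill_h_nondeg x : x \in h -> (forall y, y \in h -> kf x y = 0) -> x = 0.
by move=> xh K; apply: (@hm_eq0 _ _ T); rewrite /hm K ?oppr0 // h_th. Qed.

(* Root spaces are lines: if [e'] is orthogonal to [e] in the root space of [al]
   then [|[e, e']|^2 = - al(t_al) |e|^2 |e'|^2]. *)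
Lemma root_dim1 al e e' : al <> 0 -> root_space al e -> e <> 0 -> root_space al e' -> exists c : C, e' = c *: e.
move=> al0 ae e0 ae'; have hee : hm e e != 0 by rewrite gt_eqF // hm_gt0.
exists (hm e' e / hm e e); set f := e' - (hm e' e / hm e e) *: e.
have af : root_space al f by apply: weightD => //; rewrite -scaleNr; exact: weightZ.
have fe : hm f e = 0 by rewrite /f hmBl hmZl divfK // subrr.
suff : f = 0 by move/eqP; rewrite subr_eq0 => /eqP.
clearbody f; have ef : lie e (T f) = 0.
  have eh : lie e (T f) \in h by apply: weight0_h; rewrite -(subrr al); exact: weight_lie (weight_opp af).
  apply: kill_h_nondeg => // y yh; rewrite kill_inv [lie e y]lieC killNr opprK.
  by rewrite (rspE ae yh) killZr killC -[kf _ _]opprK -/(hm e f) hmC fe conjc0 oppr0 mulr0.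
have [th' Tt K] := corootP ae e0; apply: contrapT => f0.
have E : hm (lie e f) (lie e f) = - (hm e e * al (vsproj h (coroot e)) * hm f f).
  have := hm_lie T (T e) (lie e f) f; rewrite thK => /eqP; rewrite -eqr_oppLR => /eqP <-.
  have ef' : lie (T e) f = 0 by rewrite -[f in LHS](thK T) -th_lie ef th0.
  have ee : lie (T e) e = hm e e *: coroot e by rewrite /coroot scalerA mulrN mulfV // scaleN1r -lieC.
  by rewrite lieJ ef' lie0r addr0 ee lieZl (rspE af th') scalerA hmZl.
have : 0 < hm e e * al (vsproj h (coroot e)) * hm f f.
  by rewrite !mulr_gt0 ?hm_gt0 //; exact: coroot_gt0.
by have := hm_ge0 T (lie e f); rewrite E oppr_ge0 => h1 h2; have := lt_le_trans h2 h1; rewrite ltxx.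
Qed.

Notation P := (borel_roots b).

Lemma b_lie x y : x \in b -> y \in b -> lie x y \in b.
by case: b_borel => sub _ _; exact: liev_le. Qed.
Lemma borel_root_mem al e : is_root al -> root_space al e -> e <> 0 -> e \in b -> P al.
move=> ral ae e0 eb; split=> // x ax; have [al0 _] := ral.
by have [c ->] := root_dim1 al0 ae e0 ax; rewrite rpredZ.
Qed.
Lemma root_opp al : is_root al -> is_root (- al).
case=> al0 [x ax x0]; split; first by move=> E; apply: al0; rewrite -[al]opprK E oppr0.
by exists (T x); [exact: weight_opp|move=> E; apply: x0; rewrite -(thK T x) E th0].
Qed.

(* A root and its opposite would give a perfect subalgebra of [b]. *)
Lemma borel_roots_opp al : P al -> ~ P (- al).
move=> [[al0 [e ae e0]] Pal] [_ Pn]; have [_ [m sol] _] := b_borel.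
have [th' Tt K] := corootP ae e0; have a0 := coroot_gt0 ae e0 al0.
have an0 : al (vsproj h (coroot e)) != 0 by rewrite gt_eqF.
have hee : (hm e e)^-1 != 0 by rewrite invr_eq0 gt_eqF // hm_gt0.
have H k : [/\ e \in iter k (fun W => liev W W) b, T e \in iter k (fun W => liev W W) b & coroot e \in iter k (fun W => liev W W) b].
  elim: k => [|k [h1 h2 h3]] /=.
    split; [exact: Pal| by apply: Pn; exact: weight_opp|exact: (subvP hb)].
  split.
  - by apply: (memv_scaleK an0); rewrite -(rspE ae th'); exact: liev_mem.
  - have E : lie (coroot e) (T e) = - (al (vsproj h (coroot e)) *: T e) by rewrite (rspE (weight_opp ae) th') opp_lfunE scaleNr.
    by apply: (memv_scaleK an0); rewrite -memvN -E; exact: liev_mem.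
  - by rewrite /coroot rpredZ // liev_mem.
by have [h1 _ _] := H m; move: h1; rewrite sol memv0 => /eqP.
Qed.
Lemma n_mem al x : al \in Dp -> root_space al x -> x \in n.
by move=> aD ax; apply: (n_span n).1 (subvv n) _ _; exists al. Qed.
Lemma n_sub (W : {vspace g}) : (forall al x, al \in Dp -> root_space al x -> x \in W) -> (n <= W)%VS.
by move=> H; apply: (n_span W).2 => x [al aD ax]; exact: H ax. Qed.
Lemma n_sub_b : (n <= b)%VS.
by apply: n_sub => al x /Dp_roots[_ h1]; exact: h1. Qed.
Lemma b_decomp : b = (h + n)%VS.
apply/eqP; rewrite eqEsubv; apply/andP; split; last by rewrite subv_add hb n_sub_b.
apply: weight_span => [x v xh vb|al x xb ax]; first by apply: b_lie => //; exact: (subvP hb).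
have [->|/eqP x0] := eqVneq x 0; first exact: mem0v.
have [al0|/eqP al0] := eqVneq al 0.
  by apply: (subvP (addvSl h n)); apply: weight0_h; rewrite -al0.
apply: (subvP (addvSr h n)); apply: (@n_mem al) => //; apply/Dp_roots.
by apply: (borel_root_mem _ ax x0 xb); split=> //; exists x.
Qed.
Lemma Dp_neq0 al : al \in Dp -> al <> 0.
by move=> /Dp_roots[[]]. Qed.
Lemma Dp_oppF al : al \in Dp -> - al \in Dp -> False.
by move=> /Dp_roots p1 /Dp_roots p2; exact: borel_roots_opp p1 p2. Qed.
Lemma Dp_ex al : al \in Dp -> exists2 e, root_space al e & e <> 0.
by move=> /Dp_roots[[]]. Qed.
Lemma Dp_lie al be x y : al \in Dp -> be \in Dp -> root_space al x -> root_space be y -> lie x y \in n.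
move=> aD bD ax bey; have [->|/eqP l0] := eqVneq (lie x y) 0; first exact: mem0v.
have ab := weight_lie ax bey; apply: n_mem (ab); apply/Dp_roots.
apply: (borel_root_mem _ ab l0).
  split; last by exists (lie x y). by move=> /eqP; rewrite addr_eq0 => /eqP E; apply: (Dp_oppF bD); rewrite -E.
apply: b_lie; [by case/Dp_roots: aD => _; apply|by case/Dp_roots: bD => _; apply].
Qed.

Lemma n_ind (S : g -> Prop) : S 0 -> (forall x y, S x -> S y -> S (x + y)) ->
  (forall al x, al \in Dp -> root_space al x -> S x) -> forall x, x \in n -> S x.
move=> S0 SD Sx; apply: (span_ind (Q := [set x | exists2 al, al \in Dp & root_space al x])) => //.
  by move=> W WP; apply: n_sub => al x aD ax; apply: WP; exists al.
by move=> a x [al aD ax]; apply: (Sx al) => //; exact: weightZ.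
Qed.

Lemma hn_lie x y : x \in h -> y \in n -> lie x y \in n.
move=> xh; apply: (n_ind (S := fun y => lie x y \in n)) => [|y' z|al z aD az].
- by rewrite lie0r mem0v.
- by rewrite lieDr; exact: rpredD.
- by rewrite (rspE az xh) rpredZ // (n_mem aD).
Qed.

Lemma nn_lie x y : x \in n -> y \in n -> lie x y \in n.
move=> xn yn; move: x xn; apply: n_ind => [|x x'|al x aD ax]; first by rewrite lie0l mem0v.
  by rewrite lieDl; exact: rpredD.
move: y yn; apply: n_ind => [|y y'|be y bD bey]; first by rewrite lie0r mem0v.
  by rewrite lieDr; exact: rpredD.
exact: (Dp_lie aD bD).
Qed.

Lemma bb_lie x y : x \in b -> y \in b -> lie x y \in n.
rewrite b_decomp => /memv_addP[x1 x1h [x2 x2n ->]] /memv_addP[y1 y1h [y2 y2n ->]].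
rewrite lieDl !lieDr h_abelian // add0r; apply: rpredD; first exact: hn_lie.
by apply: rpredD; [rewrite lieC rpredN; exact: hn_lie|exact: nn_lie].
Qed.
Lemma hmE al : al \in Dp -> hm (E al) (E al) = 1.
by move=> aD; rewrite /hm E_norm // opprK. Qed.
Lemma E_neq0 al : al \in Dp -> E al <> 0.
by move=> aD E0; have := hmE aD; rewrite E0 hm0l => /eqP; rewrite eq_sym oner_eq0. Qed.
Lemma hmEE al be : al \in Dp -> be \in Dp -> hm (E al) (E be) = (al == be)%:R.
move=> aD bD; have [<-|/eqP ab] := eqVneq al be; first by rewrite hmE.
exact: weight_orth (E_root aD) (E_root bD) ab.
Qed.
Lemma rootE al x : al \in Dp -> root_space al x -> x = hm x (E al) *: E al.
move=> aD ax; have [c xE] := root_dim1 (Dp_neq0 aD) (E_root aD) (E_neq0 aD) ax.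
by rewrite {2}xE hmZl hmE // mulr1.
Qed.

(** The orthogonal projection onto [n], the vectors [E al] being orthonormal by [hmEE]. *)
Definition prn x := \sum_(al <- Dp) hm x (E al) *: E al.

Lemma sum_delta be (F : functional h -> C) : be \in Dp -> \sum_(al <- Dp) F al * (al == be)%:R = F be.
move=> bD; rewrite (bigD1_seq be) //= eqxx mulr1 big1 ?addr0 // => al /negPf ->.
by rewrite mulr0.
Qed.
Lemma hm_prn x be : be \in Dp -> hm (prn x) (E be) = hm x (E be).
move=> bD; rewrite /prn -[RHS](sum_delta (fun al => hm x (E al)) bD).
rewrite big_seq [RHS]big_seq; elim/big_ind2: _ => [|x1 x2 y1 y2 <- <-|al aD]; first exact: hm0l.
  exact: hmDl.
by rewrite hmZl hmEE.
Qed.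

Lemma prn_id x : x \in n -> prn x = x.
apply: (n_ind (S := fun y => prn y = y)) => [|y z Ey Ez|al y aD ay].
- by rewrite /prn big1 // => al _; rewrite hm0l scale0r.
- rewrite -{2}Ey -{2}Ez /prn -big_split /=; apply: eq_bigr => al _. by rewrite hmDl scalerDl.
rewrite /prn (bigD1_seq al) //= -(rootE aD ay) big_seq_cond big1 ?addr0 // => be /andP[bD /eqP ba].
by rewrite (weight_orth ay (E_root bD)) ?scale0r // => E'; apply: ba.
Qed.

Lemma hm_prn_prn x : hm (prn x) (prn x) = \sum_(al <- Dp) `|hm x (E al)| ^+ 2.
have H y : hm y (prn x) = \sum_(al <- Dp) ((hm x (E al))^*)%C * hm y (E al).
  rewrite /prn; elim: (Dp) => [|al s IH]; first by rewrite !big_nil hm0r. by rewrite !big_cons hmDr hmZr IH.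
rewrite H big_seq [RHS]big_seq; apply: eq_bigr => al aD.
by rewrite hm_prn // sqr_normc mulrC.
Qed.

Lemma bessel x : \sum_(al <- Dp) `|hm x (E al)| ^+ 2 <= hm x x.
have o : hm (x - prn x) (prn x) = 0.
  rewrite [X in hm _ X]/prn big_seq; apply: (big_ind (fun s => hm (x - prn x) s = 0)) => [|y z Ey Ez|al aD].
  - exact: hm0r.
  - by rewrite hmDr Ey Ez addr0.
  - by rewrite hmZr hmBl hm_prn // subrr mulr0.
set y := x - prn x in o *; have xE : x = y + prn x by rewrite /y subrK.
have -> : hm x x = hm y y + hm (prn x) (prn x).
  rewrite [in LHS]xE; clearbody y; clear xE; move: (prn x) o => z o. by rewrite hmDl !hmDr o [hm z y]hmC o conjc0 addr0 add0r.
by rewrite hm_prn_prn lerDr hm_ge0.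
Qed.

(** The Killing dual of the sum of the positive roots, that is of twice the usual rho. Its
    positivity on [Dp] orders the roots and later provides the contracting direction in a. *)
Definition Hp := \sum_(al <- Dp) coroot (E al).

Lemma E_coroot al : al \in Dp -> lie (E al) (T (E al)) = - coroot (E al).
by move=> aD; rewrite /coroot hmE // invr1 scaleN1r opprK. Qed.
Lemma Hp_h : Hp \in h.
rewrite /Hp big_seq rpred_sum // => al aD.
by have [] := corootP (E_root aD) (E_neq0 aD).
Qed.
Lemma T_Hp : T Hp = - Hp.
rewrite /Hp big_seq; elim/big_ind: _ => [|x y Ex Ey|al aD]; first by rewrite th0 oppr0.
  by rewrite thD Ex Ey opprD.
by have [] := corootP (E_root aD) (E_neq0 aD).
Qed.
(** Both sides compute the scalar product of the two roots: apply [coroot (E al) = -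
    [E al, T (E al)]] to [E be] by the Jacobi identity, and move the outer bracket across the
    Hermitian form. *)
Lemma coroot_norms al be : al \in Dp -> be \in Dp -> al (vsproj h (coroot (E be))) =
  hm (lie (T (E al)) (E be)) (lie (T (E al)) (E be)) - hm (lie (E al) (E be)) (lie (E al) (E be)).
move=> aD bD; have [ha Ta Ka] := corootP (E_root aD) (E_neq0 aD).
have [hb' Tb Kb] := corootP (E_root bD) (E_neq0 bD).
rewrite -Ka // killC Kb //.
have -> : be (vsproj h (coroot (E al))) = hm (lie (coroot (E al)) (E be)) (E be) by rewrite (rspE (E_root bD) ha) hmZl hmE // mulr1.
have -> : coroot (E al) = - lie (E al) (T (E al)) by rewrite E_coroot ?opprK.
have -> : lie (- lie (E al) (T (E al))) (E be) = lie (T (E al)) (lie (E al) (E be)) - lie (E al) (lie (T (E al)) (E be)).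
  by rewrite lieNl [X in _ - X]lieJ opprD addrCA subrr addr0.
have e1 : hm (lie (T (E al)) (lie (E al) (E be))) (E be) = - hm (lie (E al) (E be)) (lie (E al) (E be)) by rewrite hm_lie thK.
have e2 : hm (lie (E al) (lie (T (E al)) (E be))) (E be) =
    - hm (lie (T (E al)) (E be)) (lie (T (E al)) (E be)) by rewrite hm_lie.
by rewrite hmBl e1 e2; ring.
Qed.

(* Expand [al(Hp)] over the roots: the brackets of [E al] stay in [n], so that
   Bessel's inequality compares the two sums, strictly at [al] itself. *)
Lemma Hp_gt0 al : al \in Dp -> 0 < al (vsproj h Hp).
move=> aD.
have -> : al (vsproj h Hp) = \sum_(be <- Dp) al (vsproj h (coroot (E be))) by rewrite /Hp linear_sum linear_sum.
rewrite big_seq (eq_bigr (fun be => hm (lie (T (E al)) (E be)) (lie (T (E al)) (E be)) -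
   hm (lie (E al) (E be)) (lie (E al) (E be)))) => [|be bD]; last exact: coroot_norms.
rewrite -big_seq sumrB subr_gt0.
pose f ga := \sum_(be <- Dp) `|hm (lie (T (E al)) (E ga)) (E be)| ^+ 2.
have -> : \sum_(be <- Dp) hm (lie (E al) (E be)) (lie (E al) (E be)) = \sum_(ga <- Dp) f ga.
  rewrite /f exchange_big /= big_seq [RHS]big_seq; apply: eq_bigr => be bD.
  have nb : lie (E al) (E be) \in n by exact: (Dp_lie aD bD (E_root aD) (E_root bD)).
  rewrite -{1 2}(prn_id nb) hm_prn_prn; apply: eq_bigr => ga _. by rewrite hm_lie normrN hmC normcJ.
have fle ga : f ga <= hm (lie (T (E al)) (E ga)) (lie (T (E al)) (E ga)) by exact: bessel.
rewrite (bigD1_seq al) //= [ltRHS](bigD1_seq al) //=; apply: ltr_leD; last exact: ler_sum.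
have [ha Ta Ka] := corootP (E_root aD) (E_neq0 aD).
have E1 : lie (T (E al)) (E al) = coroot (E al) by rewrite lieC E_coroot ?opprK.
(* For the term of [al] itself the vector is a coroot: it lies in [h], orthogonal to [n], so its
   Bessel sum is 0 while its norm is positive. This is where the inequality becomes strict. *)
rewrite /f E1 big_seq big1 => [|be bD].
  apply: hm_gt0 => t0; have := coroot_gt0 (E_root aD) (E_neq0 aD) (Dp_neq0 aD). by rewrite t0 !linear0 ltxx.
rewrite (weight_orth (weight_h ha) (E_root bD)) ?normr0 ?expr0n // => E0.
by apply: (Dp_neq0 bD); rewrite -E0.
Qed.
Lemma liev_mono (U V : {vspace g}) : (U <= V)%VS -> (liev U U <= liev V V)%VS.
by move=> UV; apply: liev_sub => x y xU yU; apply: liev_mem; exact: (subvP UV). Qed.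

Definition badroot ga := [/\ is_root ga, ga \notin Dp & - ga \notin Dp].

(** Otherwise all brackets of [n] with a vector [e] of weight [ga] would fall back into [n], and [b]
    together with [e] would span a larger solvable subalgebra, against the maximality of [b]. *)
Lemma badroot_step ga : badroot ga -> exists2 al, al \in Dp & badroot (al + ga).
move=> [rga gD gND]; apply: contrapT => nex; have [ga0 [e ge e0]] := rga.
have ne x : x \in n -> lie x e \in n.
  apply: (n_ind (S := fun x => lie x e \in n)) => [|x' y|al x' aD ax]; first by rewrite lie0l mem0v.
    by rewrite lieDl; exact: rpredD.
  have [->|/eqP l0] := eqVneq (lie x' e) 0; first exact: mem0v. have ag := weight_lie ax ge. have rag : is_root (al + ga).
    split; last by exists (lie x' e). by move/eqP; rewrite addr_eq0 => /eqP E'; move: gND; rewrite -E' aD.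
  have [agD|agD] := boolP (al + ga \in Dp); first exact: (n_mem agD).
  have [nD|nD] := boolP (- (al + ga) \in Dp); last by case: nex; exists al. have /Dp_roots[_ nb] := nD; have fb := nb _ (weight_opp ag).
  set f := T (lie x' e) in fb. have xf0 : lie x' f <> 0.
    move=> xf; apply: l0; apply: (@hm_eq0 _ _ T); rewrite /hm kill_inv -/f xf kill0r !oppr0 //.
  have xb : x' \in b by case/Dp_roots: aD => _; apply. have axf : root_space (- ga) (lie x' f).
    have := weight_lie ax (weight_opp ag); by rewrite opprD addrA subrr add0r.
  case/negP: gND; apply/Dp_roots; apply: borel_root_mem axf xf0 (b_lie xb fb). exact: root_opp.
pose c := (b + <[e]>)%VS.
have be_lie x : x \in b -> lie x e \in (n + <[e]>)%VS.
  rewrite b_decomp => /memv_addP[x1 x1h [x2 x2n ->]]; rewrite lieDl (rspE ge x1h) addrC. by rewrite memv_add ?ne ?rpredZ ?memv_line.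
have nc : (n <= c)%VS by apply: subv_trans n_sub_b (addvSl _ _).
have cc : (liev c c <= n + <[e]>)%VS.
  apply: liev_sub => x y /memv_addP[x1 x1b [x2 /vlineP[a ->] ->]] /memv_addP[y1 y1b [y2 /vlineP[a' ->] ->]].
  rewrite lieDl !lieDr !lieZl !lieZr liexx !scaler0 addr0; apply: rpredD; first apply: rpredD.
  - by apply: (subvP (addvSl _ _)); exact: bb_lie.
  - by rewrite rpredZ // be_lie.
  - by rewrite rpredZ // lieC rpredN be_lie.
have n2 : (liev (n + <[e]>) (n + <[e]>) <= n)%VS.
  apply: liev_sub => x y /memv_addP[x1 x1b [x2 /vlineP[a ->] ->]] /memv_addP[y1 y1b [y2 /vlineP[a' ->] ->]].
  rewrite lieDl !lieDr !lieZl !lieZr liexx !scaler0 addr0; apply: rpredD; first apply: rpredD.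
  - exact: nn_lie.
  - by rewrite rpredZ // ne.
  - by rewrite rpredZ // lieC rpredN ne.
have [_ [m sol] maxb] := b_borel.
have cb : c = b.
  apply: maxb; last exact: addvSl.
  - by apply: subv_trans cc _; rewrite subv_add nc addvSr.
  (* Two derived algebras bring [c] back into [b]: the first lies in [n + <[e]>], the second in
     [n]. *)
  exists (m + 2)%N; rewrite iterD; apply/eqP; rewrite -subv0 -[X in (_ <= X)%VS]sol.
  have h2 : (iter 2 (fun W => liev W W) c <= b)%VS by rewrite /=; apply: subv_trans (liev_mono cc) _; apply: subv_trans n2 n_sub_b.
  by elim: (m) => [|k IH] //=; exact: liev_mono.
case/negP: gD; apply/Dp_roots; apply: borel_root_mem rga ge e0 _.
by rewrite -cb; apply: (subvP (addvSr _ _)); exact: memv_line.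
Qed.

Lemma count_ltn (X : eqType) (a1 a2 : pred X) (s : seq X) (x : X) : subpred a1 a2 -> x \in s ->
  a2 x -> ~~ a1 x -> (count a1 s < count a2 s)%N.
move=> sub; elim: s => [//|y s IH]; rewrite inE => /orP[/eqP <-|xs] h2 h1 /=.
  by rewrite (negPf h1) h2 add0n add1n ltnS; exact: sub_count.
have := IH xs h2 h1; have := sub y; case: (a1 y) => [->//|_]; case: (a2 y) => //= h3.
by rewrite add0n add1n ltnS ltnW.
Qed.

(** A bad root would start an endless chain of bad roots with increasing values at [Hp], but these
    values are eigenvalues of [ad Hp]. The induction is on the number of eigenvalues above the
    current one. *)
Lemma roots_pm ga : is_root ga -> ga \in Dp \/ - ga \in Dp.
move=> rga; have [|gD] := boolP (ga \in Dp); first by left.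
have [|gND] := boolP (- ga \in Dp); first by right.
have [r rE] := closed_field_poly_normal (char_poly (adM Hp)).
have ev be : is_root be -> be (vsproj h Hp) \in r.
  move=> [be0 [x bx x0]]. have : eigenvalue (adM Hp) (be (vsproj h Hp)).
    apply/eigenvalueP; exists (crd x).
      by rewrite -adME (rspE bx Hp_h) crdZ.
    by apply/eqP => c0; apply: x0; apply: crd_inj; rewrite c0 crd0.
  rewrite eigenvalue_root_char rE (monicP (char_poly_monic _)) scale1r. by rewrite root_prod_XsubC.
suff H k be : badroot be -> (count (fun z : C => be (vsproj h Hp) < z)%R r < k)%N -> False.
  by case: (H _ ga _ (leqnn _)).
elim: k be => [//|k IH] be bad; rewrite ltnS.
have [al aD bad'] := badroot_step bad; have [rab _ _] := bad'.
move=> le; apply: (IH _ bad'); apply: leq_trans le.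
have lt : be (vsproj h Hp) < (al + be) (vsproj h Hp) by rewrite add_lfunE ltrDr Hp_gt0.
apply: (@count_ltn _ _ _ _ ((al + be) (vsproj h Hp))) => //.
- by move=> z /=; exact: lt_trans.
- exact: ev.
- by rewrite ltxx.
Qed.

Lemma h_n_orth x y : x \in h -> y \in n -> hm x y = 0.
move=> xh; apply: (n_ind (S := fun y => hm x y = 0)) => [|y' z E1 E2|al z aD az].
- exact: hm0r.
- by rewrite hmDr E1 E2 addr0.
by apply: weight_orth (weight_h xh) az _ => E0; apply: (Dp_neq0 aD); rewrite -E0.
Qed.

Lemma h_Tn_orth x y : x \in h -> y \in n -> hm x (T y) = 0.
move=> xh yn; have := h_n_orth (h_th xh) yn; rewrite /hm => E0.
by rewrite -[LHS]opprK -/(hm x (T y)) /hm thK opprK -{1}[x](thK T) -{1}[y](thK T) kill_th -[kf _ _]opprK E0 oppr0 conjc0 oppr0.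
Qed.
Lemma n_Tn_orth x y : x \in n -> y \in n -> hm x (T y) = 0.
move=> xn yn; move: x xn; apply: n_ind => [|x x' E1 E2|al x aD ax]; first exact: hm0l.
  by rewrite hmDl E1 E2 addr0.
move: y yn; apply: (n_ind (S := fun y => hm x (T y) = 0)) => [|y y' E1 E2|be y bD bey].
- by rewrite th0 hm0r.
- by rewrite thD hmDr E1 E2 addr0.
by apply: weight_orth ax (weight_opp bey) _ => E0; apply: (Dp_oppF bD); rewrite -E0.
Qed.

Lemma g_decomp x : exists xh y y', [/\ xh \in h, y \in n, y' \in n & x = xh + y + T y'].
pose W := (h + n + <<[seq T (E al) | al <- Dp]>>)%VS.
have : x \in W.
  apply: (subvP (_ : (fullv <= W)%VS)); last exact: memvf. apply: weight_span => [y v _ _|al v _ av]; first exact: memvf.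
  have [->|/eqP v0] := eqVneq v 0; first exact: mem0v. have [al0|/eqP al0] := eqVneq al 0.
    by apply: (subvP (addvSl _ _)); apply: (subvP (addvSl _ _)); apply: weight0_h; rewrite -al0.
  have ral : is_root al by split=> //; exists v. case: (roots_pm ral) => aD.
    by apply: (subvP (addvSl _ _)); apply: (subvP (addvSr _ _)); exact: (n_mem aD).
  apply: (subvP (addvSr _ _)); rewrite -(thK T v) (rootE aD (weight_opp av)) thZ rpredZ //. by apply: memv_span; apply: map_f.
case/memv_addP => x1 /memv_addP[xh xhh [y yn ->]] [z zS ->].
suff [y' y'n ->] : exists2 y', y' \in n & z = T y' by exists xh, y, y'.
rewrite (@coord_span _ _ _ (in_tuple [seq T (E al) | al <- Dp]) z zS).
elim: (index_enum _) => [|i r [y' y'n IH]]; first by exists 0; rewrite ?mem0v // big_nil th0.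
rewrite big_cons IH; set c := coord _ _ _; set w := _`_i.
have : w \in [seq T (E al) | al <- Dp] by rewrite mem_nth // -(size_tuple (in_tuple [seq T (E al) | al <- Dp])).
case/mapP => al aD ->; exists ((c^*)%C *: E al + y').
  by rewrite rpredD // rpredZ // (n_mem aD) //; exact: E_root.
by rewrite thD thZ conjcK.
Qed.

(** [aP] and [sP] stand for a and a + n, with a as in the statement of the theorem. The first is
    only a real subspace of [g], hence predicates instead of vector spaces over [R[i]]. *)
Definition aP x := x \in h /\ T x = - x.
Definition sP x := exists a y, [/\ aP a, y \in n & x = a + y].

Lemma us_decomp xh y y' : xh \in h -> y \in n -> y' \in n -> exists2 w, sP w & xh + y + T y' = (2^-1 *: (xh + T xh) + (y' + T y')) + w.
have c2 : (2^-1 : C)^*%C = 2^-1 by rewrite conjc_inv conjc_nat.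
move=> xhh yn y'n; exists (2^-1 *: (xh - T xh) + (y - y')).
  exists (2^-1 *: (xh - T xh)), (y - y'); split=> //; last by rewrite rpredB. split; first by rewrite rpredZ // rpredB // h_th.
  by rewrite thZ c2 thB thK -(opprB xh) scalerN.
rewrite -{1}[xh](half_parts xh (T xh)); set p := _ *: _; set q := _ *: _; set t := T y'.
by vring.
Qed.

Lemma us_cap x : T x = x -> sP x -> x = 0.
move=> Tx [a [y [[ah Ta] yn E0]]]; move: Tx; rewrite E0 thD Ta => E1.
have E2 : a + a = T y - y.
  have -> : T y = a + (a + y) by rewrite -E1; vring. by vring.
have a0 : a = 0.
  have : hm a (a + a) = 0 by rewrite E2 hmBr (h_n_orth ah yn) (h_Tn_orth ah yn) subr0. rewrite hmDr -mulr2n -[hm a a *+ 2]mulr_natl => /eqP.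
  by rewrite mulf_eq0 pnatr_eq0 /= => /eqP/hm_eq0.
rewrite a0 add0r; apply: (@hm_eq0 _ _ T).
have : hm y (T y - y) = 0 by rewrite -E2 a0 addr0 hm0r.
by rewrite hmBr (n_Tn_orth yn yn) sub0r => /eqP; rewrite oppr_eq0 => /eqP.
Qed.
Lemma aP_sP x : aP x -> sP x.
by move=> ax; exists x, 0; split=> //; [exact: mem0v|rewrite addr0]. Qed.
Lemma nP_sP x : x \in n -> sP x.
by move=> xn; exists 0, x; split=> //; [split; [exact: mem0v|rewrite th0 oppr0]|rewrite add0r].
Qed.
Lemma sP_D x y : sP x -> sP y -> sP (x + y).
move=> [a [y1 [[ah Ta] y1n ->]]] [a' [y2 [[ah' Ta'] y2n ->]]].
exists (a + a'), (y1 + y2); split; last by rewrite addrACA.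
  by split; [rewrite rpredD|rewrite thD Ta Ta' opprD].
by rewrite rpredD.
Qed.

(** For [xh] in [h] fixed by [T], this is the u-part of [i (xh + y + T y)] along a + n ([i_decomp]):
    the classical r-matrix of the compact form. *)
Definition rhoe (y : g) := - ('i *: (y - T y)).

Lemma u_decomp x : T x = x -> exists xh y, [/\ xh \in h, T xh = xh, y \in n & x = xh + (y + T y)].
have c2 : (2^-1 : C)^*%C = 2^-1 by rewrite conjc_inv conjc_nat.
move=> Tx; have [xh [y [y' [xhh yn y'n E0]]]] := g_decomp x.
have [w sw E1] := us_decomp xhh yn y'n; exists (2^-1 *: (xh + T xh)), y'.
split=> //; first by rewrite rpredZ // rpredD // h_th.
  by rewrite thZ c2 thD thK addrC.
have w0 : w = 0.
  apply: us_cap sw; have -> : w = x - (2^-1 *: (xh + T xh) + (y' + T y')) by rewrite E0 E1; vring.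
  by rewrite thB Tx thD thZ c2 !thD !thK [T xh + xh]addrC [T y' + y']addrC.
by rewrite E0 E1 w0 addr0.
Qed.

Lemma i_decomp xh y : xh \in h -> T xh = xh -> y \in n -> sP ('i *: (xh + (y + T y)) - rhoe y) /\ T (rhoe y) = rhoe y.
move=> xhh Txh yn; split; last first.
  by rewrite /rhoe thN th_i thB thK -(opprB y) scalerN opprK.
have -> : 'i *: (xh + (y + T y)) - rhoe y = 'i *: xh + ('i *: y + 'i *: y).
  rewrite /rhoe opprK scalerDr -addrA; congr (_ + _); rewrite scalerDr scalerBr addrACA addrN addr0; by [].
apply: sP_D; last by apply: nP_sP; rewrite rpredD // rpredZ.
by apply: aP_sP; split; [rewrite rpredZ|rewrite th_i Txh].
Qed.

Lemma kill_rho xh y zh z : xh \in h -> y \in n -> zh \in h -> z \in n -> kf (rhoe y) (zh + (z + T z)) = - 2 * ((complex.Im (hm y z))%:C)%C.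
move=> xhh yn zhh zn.
have K1 x w : kf x w = - hm x (T w) by rewrite /hm thK opprK.
have a1 : kf y zh = 0 by rewrite killC K1 (h_Tn_orth zhh yn) oppr0.
have a2 : kf (T y) zh = 0.
  rewrite -[zh](thK T) kill_th killC K1. by rewrite (h_Tn_orth (h_th zhh) yn) oppr0 conjc0.
have a3 : kf y z = 0 by rewrite K1 n_Tn_orth ?oppr0.
have a4 : kf (T y) (T z) = 0 by rewrite kill_th a3 conjc0.
have a5 : kf y (T z) = - hm y z by rewrite /hm opprK.
have a6 : kf (T y) z = - ((hm y z)^*)%C by rewrite -[z](thK T) kill_th a5 conjcN thK.
rewrite /rhoe killNl killZl killBl !killDr a1 a2 a3 a4 a5 a6.
by case: (hm y z) => u v; complex_ring.
Qed.

Lemma kill_XY xh y al : xh \in h -> y \in n -> al \in Dp ->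
  kf (xh + (y + T y)) (E al + T (E al)) = - 2 * ((complex.Re (hm y (E al)))%:C)%C /\
  kf (xh + (y + T y)) ('i *: (E al - T (E al))) = - 2 * ((complex.Im (hm y (E al)))%:C)%C.
move=> xhh yn aD; have En : E al \in n by apply: (n_mem aD); exact: E_root.
have K1 x w : kf x w = - hm x (T w) by rewrite /hm thK opprK.
have b1 : kf xh (E al) = 0 by rewrite K1 (h_Tn_orth xhh En) oppr0.
have b2 : kf xh (T (E al)) = 0 by have := h_n_orth xhh En; rewrite /hm => /eqP; rewrite oppr_eq0 => /eqP.
have b3 : kf y (E al) = 0 by rewrite K1 n_Tn_orth ?oppr0.
have b4 : kf (T y) (T (E al)) = 0 by rewrite kill_th b3 conjc0.
have b5 : kf y (T (E al)) = - hm y (E al) by rewrite /hm opprK.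
have b6 : kf (T y) (E al) = - ((hm y (E al))^*)%C by rewrite -[E al](thK T) kill_th b5 conjcN thK.
rewrite !killZr !killBr !killDr !killDl b1 b2 b3 b4 b5 b6.
by case: (hm y _) => u v; split; complex_ring.
Qed.

(** The bivector [Lambda], read through the Killing form, is the operator [rhoe]. Expanding [z] in
    the orthonormal root vectors, both sides become the same multiple of the imaginary part of
    [hm y z]. *)
Lemma sum_XY xh y zh z : xh \in h -> y \in n -> zh \in h -> z \in n ->
  \sum_(al <- Dp) (kf (xh + (y + T y)) (E al + T (E al)) * kf (zh + (z + T z)) ('i *: (E al - T (E al)))
     - kf (xh + (y + T y)) ('i *: (E al - T (E al))) * kf (zh + (z + T z)) (E al + T (E al))) = 2 * kf (rhoe y) (zh + (z + T z)).
move=> xhh yn zhh zn; rewrite (kill_rho xhh yn zhh zn).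
have -> : hm y z = \sum_(al <- Dp) hm y (E al) * ((hm z (E al))^*)%C.
  rewrite -{1}(prn_id zn) /prn; elim: (Dp) => [|al s IH]; first by rewrite !big_nil hm0r. by rewrite !big_cons hmDr hmZr IH mulrC.
rewrite big_seq [in RHS]big_seq.
suff H (s : seq (functional h)) : (forall al, al \in s -> al \in Dp) ->
  \sum_(al <- s) (kf (xh + (y + T y)) (E al + T (E al)) * kf (zh + (z + T z)) ('i *: (E al - T (E al)))
     - kf (xh + (y + T y)) ('i *: (E al - T (E al))) * kf (zh + (z + T z)) (E al + T (E al))) =
  2 * (-2 * ((complex.Im (\sum_(al <- s) hm y (E al) * ((hm z (E al))^*)%C))%:C)%C). by rewrite -!big_seq; exact: H.
elim: s => [|al s IH] sub.
  by rewrite !big_nil; complex_ring.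
rewrite !big_cons IH => [|be bs]; last by apply: sub; rewrite inE bs orbT.
have aD : al \in Dp by apply: sub; rewrite inE eqxx.
have [-> ->] := kill_XY xhh yn aD; have [-> ->] := kill_XY zhh zn aD.
case: (hm y _) (hm z _) (\sum_(_ <- s) _) => u v [u' v'] [u'' v''].
by complex_ring.
Qed.
End Roots.

(** * The Iwasawa property of the Borel subalgebra *)

Section Iwasawa.
Context {R : realType} {g0 : lieAlgType R} {g : lieAlgType R[i]}.
Variable iota : g0 -> g.
Hypothesis cx : complexification iota.
Notation C := R[i].

Definition theta_inv (k p : {vspace g0}) (cd : cartan_decomposition k p) : cptInv g.
refine (@CompactInv R g (theta cx k p) _ _ _ _ _ _).
- exact: thetaD.
- exact: thetaZ.
- exact: thetaK.
- exact: theta_lie.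
- exact: kill_theta.
- exact: herm_gt0.
Defined.

Variables (k0 p0 : {vspace g0}).
Hypothesis cd0 : cartan_decomposition k0 p0.
Notation T := (theta_inv cd0).
Variable rd : rootDatum T.
Notation h := (rd_h rd).
Notation b := (rd_b rd).
Notation n := (rd_n rd).
Notation Dp := (rd_Dp rd).
Notation E := (@rd_E _ _ _ rd).
Hypothesis b_iwasawa : iwasawa_borel iota b.
Let h_th := @rd_th _ _ _ rd.
Let E_root := @rd_root _ _ _ rd.
Let Dp_roots := @rd_roots _ _ _ rd.
Let Hg := @Hp_gt0 _ _ _ rd.

Lemma iota_inj x : iota x = 0 -> x = 0.
move=> x0; have := @reim_uniq _ _ _ _ cx x 0 0 0; rewrite x0 (iota0 cx) => /(_ erefl).
by case.
Qed.

(* Self-adjointness of [ad (iota x)] for one Hermitian form, and its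
   triangularity along the filtration of [n] by the value of roots at [Hp],
   make the eigenvalues [al h1] real. *)
Lemma triangular_real (T' : cptInv g) h1 n1 al : h1 \in h -> n1 \in n -> T' (h1 + n1) = - (h1 + n1) ->
  al \in Dp -> ((al (vsproj h h1))^*)%C = al (vsproj h h1).
move=> h1h n1n Tx aD; set x := h1 + n1.
pose X := [seq E be | be : functional h <- Dp & al (vsproj h (Hp rd)) < be (vsproj h (Hp rd))].
have root_in be y : be \in Dp -> al (vsproj h (Hp rd)) < be (vsproj h (Hp rd)) -> root_space be y -> y \in <<X>>%VS.
  move=> bD lt ry; have -> := rootE bD ry. by rewrite rpredZ // memv_span //; apply/mapP; exists be => //; rewrite mem_filter lt.
have up be y : be \in Dp -> al (vsproj h (Hp rd)) <= be (vsproj h (Hp rd)) -> root_space be y -> lie n1 y \in <<X>>%VS.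
  move=> bD le ry; move: n1 n1n {Tx x}; apply: (n_ind (S := fun z => lie z y \in <<X>>%VS)).
  - by rewrite lie0l rpred0.
  - by move=> u v Hu Hv; rewrite lieDl rpredD.
  - move=> ga z gD rz; have rzy := weight_lie rz ry. have [->|/eqP z0] := pselect (lie z y = 0); first by rewrite rpred0.
    have ga0 : (ga + be : functional h) <> 0.
      move=> e0; have := Hg gD; have : ga = - be by apply/eqP; rewrite -addr_eq0; exact/eqP. by move=> gE; case: (Dp_oppF bD); rewrite -gE.
    have rt : is_root (ga + be : functional h) by split=> //; exists (lie z y) => //; exact/eqP. have zb : lie z y \in b.
      apply: (subvP (n_sub_b rd)). exact: (Dp_lie gD bD rz ry).
    apply: (root_in _ _ _ _ rzy).
      apply/Dp_roots; apply: (borel_root_mem rt rzy _ zb); exact/eqP.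
    by rewrite lfunE /=; apply: le_lt_trans le _; rewrite ltrDr; exact: Hg.
have Fx w : w \in <<X>>%VS -> lie x w \in <<X>>%VS.
  apply: (span_ind (Q := [set` X]) (S := fun w => lie x w \in <<X>>%VS)) => [W' HW||u v Hu Hv|a y /=].
  - by apply/span_subvP => y yX; exact: HW.
  - by rewrite lie0r rpred0.
  - by rewrite lieDr rpredD.
  - move=> /mapP[be]; rewrite mem_filter => /andP[lt bD ->]; rewrite lieZr rpredZ // lieDl rpredD //.
      by rewrite (rspE (E_root bD) h1h) rpredZ //; exact: root_in lt (E_root bD).
    exact: up (ltW lt) (E_root bD).
have [f fF fo] := orth_proj T' X (E al).
set v := E al - f.
have v0 : v <> 0.
  move=> v0; have EF : E al \in <<X>>%VS by move/eqP: v0; rewrite subr_eq0 => /eqP ->. have : hm T (E al) (E al) = 0.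
    have H w : w \in <<X>>%VS -> hm T w (E al) = 0.
      apply: (span_ind (Q := [set` X]) (S := fun w => hm T w (E al) = 0)) => [W' HW||u u' Hu Hu'|a y /=].
      + by apply/span_subvP => y yX; exact: HW.
      + by rewrite hm0l.
      + by rewrite hmDl Hu Hu' addr0.
      + move=> /mapP[be]; rewrite mem_filter => /andP[lt bD ->]; rewrite hmZl. rewrite (hmEE bD aD).
        by case: eqP lt => [->|_ _]; rewrite ?ltxx ?mulr0.
    exact: H.
  by rewrite (hmE aD) => /eqP; rewrite oner_eq0.
set c := al (vsproj h h1).
have xv : lie x v = c *: v.
  set f' := lie x v - c *: v; have f'F : f' \in <<X>>%VS.
    have -> : f' = lie n1 (E al) + c *: f - lie x f.
      rewrite /f' /v lieBr scalerBr {1}/x lieDl (rspE (E_root aD) h1h) -/c; vring.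
    by rewrite rpredB ?Fx // rpredD ?rpredZ //; exact: up (lexx _) (E_root aD).
  have f'0 w : w \in <<X>>%VS -> hm T' f' w = 0.
    move=> wF; rewrite hmBl hmZl fo // mulr0 subr0 hm_lie Tx lieNl hmNr opprK. by apply: fo; exact: Fx.
  have : f' = 0 by apply: (@hm_eq0 _ _ T'); exact: f'0. by move/eqP; rewrite subr_eq0 => /eqP.
have hv : hm T' v v != 0 by rewrite gt_eqF // hm_gt0.
apply: (mulIf hv); rewrite -hmZr -xv -hmZl -xv hm_lie.
by rewrite Tx lieNl hmNr opprK.
Qed.

(** Such a [w] commutes with [h], [n] and [T n], which span [g]; then [ad w = 0], and the Hermitian
    norm of [w] is the trace of 0. *)
Lemma h_faithful w : w \in h -> (forall y, y \in n -> lie w y = 0) -> (forall y, y \in n -> lie (T w) y = 0) -> w = 0.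
move=> wh wn Twn; have ad0 y : lie w y = 0.
  have [yh [y1 [y2 [yhh y1n y2n ->]]]] := g_decomp rd y. have := th_lie T (T w) y2; rewrite thK Twn // th0 => e2.
  by rewrite 2!lieDr (wn _ y1n) -e2 (h_abelian wh yhh) !addr0.
apply: (@hm_eq0 _ _ T); rewrite /hm killingE.
have -> : adM w = 0 by apply: rowmx_eq => y; rewrite -adME ad0 crd0 mulmx0.
by rewrite mul0mx linear0 oppr0.
Qed.

Lemma real_roots_aP h1 : h1 \in h -> (forall al, al \in Dp -> ((al (vsproj h h1))^*)%C = al (vsproj h h1)) ->
  aP rd h1.
move=> h1h re; split=> //; set w := h1 + T h1.
suff : w = 0 by rewrite /w addrC => /eqP; rewrite addr_eq0 => /eqP.
have wh : w \in h by rewrite rpredD // h_th.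
have Tw : T w = w by rewrite thD thK addrC.
have wn y : y \in n -> lie w y = 0.
  apply: (n_ind (S := fun y => lie w y = 0)) => [|u v Hu Hv|al z aD ry].
  - exact: lie0r.
  - by rewrite lieDr Hu Hv addr0.
  - rewrite (rspE ry wh) /w linearD linearD /=. have [e re' e0] := Dp_ex aD. by rewrite (weight_th re' e0 h1h) re // subrr scale0r.
by apply: h_faithful => // y yn; rewrite Tw wn.
Qed.

(** The Cartan decomposition behind [a] and [m] need not be the given one, so [a] need not lie in
    [h]. Root vectors of [m] are brackets of elements of [b], hence in [n]. For [x] in [a],
    [triangular_real] with the other conjugation makes the roots real on the [h]-component, which
    puts it into the a-part. *)
Lemma iwasawa_part : exists k a m : {vspace g0}, [/\ iwasawa_decomposition k a m & forall x, x \in (a + m)%VS -> sP rd (iota x)].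
have [_ [k [a [m [iw ib]]]]] := b_iwasawa; exists k, a, m; split=> //.
have [_ [_ [p [cd [ap _ _] [P Ps Psp]]]]] := iw.
have ab x : x \in a -> iota x \in b by move=> xa; apply: ib; exact: (subvP (addvSl _ _)).
have mb x : x \in m -> iota x \in b by move=> xa; apply: ib; exact: (subvP (addvSr _ _)).
have mn x : x \in m -> iota x \in n.
  apply: (span_ind (Q := [set x | exists2 al, P al & root_space al x]) (S := fun x => iota x \in n)).
  - by move=> W' HW; apply/Psp.
  - by rewrite (iota0 cx) rpred0.
  - by move=> y z Hy Hz; rewrite (iotaD cx) rpredD.
  - move=> c y [al Pal ry]; rewrite (iotaZ cx) rpredZ //. have [al0 _] := let: And3 A _ _ := Ps in A _ Pal.
    have [z z0] : exists z, al z <> 0.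
      apply/existsNP => H; apply: al0; apply/lfunP => z; rewrite H lfunE //.
    have yE : y = (al z : R)^-1 *: lie (vsval z) y by rewrite ry scalerA mulVf ?scale1r //; exact/eqP.
    have ym : y \in m by apply: (Psp m).1; [exact: subvv|exists al]. rewrite yE (iotaZ cx) rpredZ // (iota_lie cx).
    by apply: bb_lie; [apply: ab; exact: subvsP|exact: mb].
move=> _ /memv_addP[x xa [y ym ->]]; rewrite (iotaD cx).
suff sx : sP rd (iota x) by apply: sP_D => //; apply: nP_sP; exact: mn.
have := ab _ xa; rewrite b_decomp => /memv_addP[h1 h1h [n1 n1n xE]].
exists h1, n1; split=> //; apply: real_roots_aP => // al aD.
apply: (triangular_real (T' := theta_inv cd) h1h n1n _ aD).
by rewrite -xE /= theta_iota (sigp cd) ?(iotaN cx) //; exact: (subvP ap).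
Qed.

(** [k0] meets [a + m] trivially, its elements being fixed by [T], and by [cd_dim] it is large
    enough for the two to fill [g0]. *)
Lemma iwasawa_split (z : g0) : exists x s, [/\ x \in k0, sP rd s & iota z = iota x + s].
have [k [a [m [iw am]]]] := iwasawa_part.
have [full [dir [p [cd _ _]]]] := iw.
have cap : (k0 :&: (a + m) = 0)%VS.
  apply/eqP; rewrite -subv0; apply/subvP => x; rewrite memv_cap => /andP[xk xam].
  have Tx : T (iota x) = iota x by rewrite /= theta_iota (sigk cd0). have := us_cap Tx (am _ xam). by move/iota_inj ->; rewrite memv0.
have : z \in (k0 + (a + m))%VS.
  suff -> : (k0 + (a + m))%VS = fullv by exact: memvf.
  apply/eqP; rewrite eqEdim subvf /= -full -addvA [X in (_ <= X)%N]dimv_disjoint_sum //.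
  apply: leq_trans (dimv_add_leqif _ _) _; rewrite leq_add2r; exact: cd_dim cd0 _ _ cd.
by case/memv_addP => x xk [y ym ->]; exists x, (iota y); split=> //; [exact: am|exact: iotaD].
Qed.
End Iwasawa.

(** * Real coordinates orthonormal for the Hermitian form *)

Definition dot {R : realType} {n} (v w : 'rV[R]_n) : R := (v *m w^T) 0 0.

Section Dot.
Context {R : realType} {n : nat}.
Implicit Types (v w : 'rV[R]_n).

Lemma dotE v w : dot v w = \sum_i v 0 i * w 0 i.
by rewrite /dot mxE; apply: eq_bigr => i _; rewrite mxE. Qed.
Lemma dotC v w : dot v w = dot w v.
by rewrite !dotE; apply: eq_bigr => i _; rewrite mulrC. Qed.
Lemma dotDl u v w : dot (u + v) w = dot u w + dot v w.
by rewrite /dot mulmxDl mxE. Qed.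
Lemma dotZl a v w : dot (a *: v) w = a * dot v w.
by rewrite /dot -scalemxAl mxE. Qed.
Lemma dotDr u v w : dot w (u + v) = dot w u + dot w v.
by rewrite ![dot w _]dotC dotDl. Qed.
Lemma dotZr a v w : dot w (a *: v) = a * dot w v.
by rewrite ![dot w _]dotC dotZl. Qed.
Lemma dotNl v w : dot (- v) w = - dot v w.
by rewrite -scaleN1r dotZl mulN1r. Qed.
Lemma dotNr v w : dot w (- v) = - dot w v.
by rewrite dotC dotNl dotC. Qed.
Lemma dotBl u v w : dot (u - v) w = dot u w - dot v w.
by rewrite dotDl dotNl. Qed.
Lemma dot_mx v w (A : 'M[R]_n) : dot (v *m A) w = dot v (w *m A^T).
by rewrite /dot trmx_mul trmxK mulmxA. Qed.
Lemma dot_delta v i : dot v (delta_mx 0 i) = v 0 i.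
by rewrite dotE (bigD1 i) //= mxE !eqxx mulr1 big1 ?addr0 // => j ji; rewrite mxE (negbTE ji) andbF mulr0.
Qed.
Lemma dot_eq0 v : dot v v = 0 -> v = 0.
rewrite dotE => /eqP; rewrite psumr_eq0 => [/allP H|i _]; last by rewrite -expr2 sqr_ge0.
apply/rowP => i; rewrite mxE; have := H i; rewrite mem_index_enum => /(_ isT).
by rewrite mulf_eq0 orbb => /eqP.
Qed.
Lemma dot_inj v w : (forall x, dot v x = dot w x) -> v = w.
by move=> H; apply/rowP => i; rewrite -!dot_delta H. Qed.
End Dot.

Lemma row_ext {R : realType} {m n} (A B : 'M[R]_(m, n)) : (forall v : 'rV_m, v *m A = v *m B) -> A = B.
by move=> H; apply/row_matrixP => i; rewrite !rowE. Qed.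

Section RealCoordinates.
Context {R : realType} {g : lieAlgType R[i]} (T : cptInv g).
Notation C := R[i].
Notation "'i" := ('i%C : C).
Notation hm := (hm T).
Notation N := (\dim {:g}).
Implicit Types (x y : g).

Lemma orthonormal_ex : exists ob : 'I_N -> g, forall i j, hm (ob i) (ob j) = (i == j)%:R.
suff H k : (k <= N)%N -> exists X : seq g, size X = k /\ forall i j, (i < k)%N -> (j < k)%N -> hm X`_i X`_j = (i == j)%:R.
  have [X [sX XP]] := H _ (leqnn N); exists (fun i => X`_i) => i j. by rewrite XP // ltn_ord.
elim: k => [|k IH] kN; first by exists [::].
have [X [sX XP]] := IH (ltnW kN).
have [x xX] : exists x, x \notin <<X>>%VS.
  apply: contrapT => nx; have : (\dim {:g} <= size X)%N.
    apply: leq_trans (dim_span _); apply: dimvS; apply/subvP => x _. by apply: contrapT => /negP xX; apply: nx; exists x.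
  by rewrite sX leqNgt kN.
have [f fX fo] := orth_proj T X x; set v := x - f.
have v0 : v <> 0 by move/eqP; rewrite subr_eq0 => /eqP xf; move: xX; rewrite xf fX.
have hv := hm_gt0 T v0; set r := complex.Re (hm v v).
have rE : hm v v = (r%:C)%C by move: hv; rewrite /r; case: (hm v v) => a b; rewrite ltcE /= => /andP[/eqP -> _].
have r0 : 0 < r by move: hv; rewrite rE ltcR.
pose w := (((Num.sqrt r)^-1)%:C)%C *: v.
have ww : hm w w = 1.
  rewrite hmZl hmZr rE conjc_real -!rmorphM /= mulrA -expr2 exprVn sqr_sqrtr ?ltW //. by rewrite mulVf ?gt_eqF.
exists (rcons X w); split; first by rewrite size_rcons sX.
have wX i : (i < k)%N -> hm w X`_i = 0 by move=> ik; rewrite hmZl fo ?mulr0 // memv_span // mem_nth // sX.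
move=> i j; rewrite !ltnS !nth_rcons sX => ik jk.
have [i1|i1] := ltnP i k; have [j1|j1] := ltnP j k.
- exact: XP.
- have -> : j = k by apply/eqP; rewrite eqn_leq jk. by rewrite eqxx hmC wX // conjc0 ltn_eqF.
- have -> : i = k by apply/eqP; rewrite eqn_leq ik. by rewrite eqxx wX // gtn_eqF.
- have -> : i = k by apply/eqP; rewrite eqn_leq ik. by have -> : j = k by [apply/eqP; rewrite eqn_leq jk]; rewrite eqxx.
Qed.

Definition ob : 'I_N -> g := sval (cid orthonormal_ex).
Lemma obE i j : hm (ob i) (ob j) = (i == j)%:R.
by rewrite /ob; case: cid. Qed.
Lemma ob_coord x : x = \sum_i hm x (ob i) *: ob i.
pose w := [tuple ob i | i < N].
have nw (i : 'I_N) : w`_i = ob i by rewrite -tnth_nth tnth_mktuple.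
have fw : free w.
  apply/freeP => k k0 i; have : hm (\sum_(i < N) k i *: w`_i) (ob i) = 0 by rewrite k0 hm0l.
  rewrite (big_morph (fun z => hm z (ob i)) (fun a b => hmDl T a b (ob i)) (hm0l T _)) (bigD1 i) //= hmZl nw obE eqxx mulr1.
  by rewrite big1 ?addr0 // => j ji; rewrite hmZl nw obE (negbTE ji) mulr0.
have xs : x \in <<w>>%VS.
  have -> : <<w>>%VS = fullv; last exact: memvf. by apply/eqP; rewrite eqEdim subvf /= (eqP fw) size_tuple.
rewrite {1}(coord_span xs); apply: eq_bigr => i _; rewrite nw; congr (_ *: _).
rewrite [x in RHS](coord_span xs) (big_morph (fun z => hm z (ob i)) (fun a b => hmDl T a b (ob i)) (hm0l T _)).
rewrite (bigD1 i) //= hmZl nw obE eqxx mulr1.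
by rewrite big1 ?addr0 // => j ji; rewrite hmZl nw obE (negbTE ji) mulr0.
Qed.

(** Real parts first, imaginary parts after: with this order [dot] is the real part of the Hermitian
    form ([dot_rho]). *)
Definition rho (v : 'rV[R]_(N + N)) : g := \sum_i (v 0 (lshift N i) +i* v 0 (rshift N i))%C *: ob i.
Definition crr x : 'rV[R]_(N + N) := row_mx (\row_i complex.Re (hm x (ob i))) (\row_i complex.Im (hm x (ob i))).

Lemma crrK x : rho (crr x) = x.
rewrite [RHS]ob_coord; apply: eq_bigr => i _; congr (_ *: _).
by rewrite /crr row_mxEl row_mxEr !mxE; case: (hm _ _).
Qed.
Lemma hm_rho v i : hm (rho v) (ob i) = (v 0 (lshift N i) +i* v 0 (rshift N i))%C.
rewrite /rho (big_morph (fun z => hm z (ob i)) (fun a b => hmDl T a b (ob i)) (hm0l T _)).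
rewrite (bigD1 i) //= hmZl obE eqxx mulr1.
by rewrite big1 ?addr0 // => j ji; rewrite hmZl obE (negbTE ji) mulr0.
Qed.
Lemma rhoK v : crr (rho v) = v.
apply/rowP => j; rewrite /crr; case: (split_ordP j) => i ->.
  by rewrite row_mxEl mxE hm_rho.
by rewrite row_mxEr mxE hm_rho.
Qed.
Lemma rho_inj : injective rho. Proof. exact: can_inj rhoK. Qed.
Lemma rhoL a v w : rho (a *: v + w) = (a%:C)%C *: rho v + rho w.
rewrite /rho scaler_sumr -big_split; apply: eq_bigr => i _ /=.
rewrite !mxE scalerA -scalerDl; congr (_ *: _).
by complex_ring.
Qed.
Lemma rho0 : rho 0 = 0.
by rewrite /rho big1 // => i _; rewrite !mxE scale0r. Qed.
Lemma rhoZ a v : rho (a *: v) = (a%:C)%C *: rho v.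
by have := rhoL a v 0; rewrite !addr0 rho0 addr0. Qed.
Lemma rhoD v w : rho (v + w) = rho v + rho w.
by have := rhoL 1 v w; rewrite !scale1r. Qed.
Lemma rhoN v : rho (- v) = - rho v.
by rewrite -scaleN1r rhoZ rmorphN1 scaleN1r. Qed.
Lemma rho_sum (I : Type) (s : seq I) (F : I -> 'rV_(N + N)) : rho (\sum_(i <- s) F i) = \sum_(i <- s) rho (F i).
exact: (big_morph rho rhoD rho0). Qed.
Lemma dot_rho v w : dot v w = complex.Re (hm (rho v) (rho w)).
rewrite [rho w in RHS]/rho (big_morph (fun z => hm (rho v) z) (fun a b => hmDr T a b (rho v)) (hm0r T _)).
rewrite (big_morph (@complex.Re R) (fun a b => raddfD (@complex.Re R) a b) (erefl : complex.Re (0 : C) = 0)).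
rewrite dotE big_split_ord /= -big_split /=; apply: eq_bigr => i _.
by rewrite hmZr hm_rho /=; ring.
Qed.

Definition real_linear (F : g -> g) := forall (a : R) x y, F ((a%:C)%C *: x + y) = (a%:C)%C *: F x + F y.
Definition rmx (F : g -> g) : 'M[R]_(N + N) := \matrix_i crr (F (rho (delta_mx 0 i))).

Lemma rmxE F v : real_linear F -> rho (v *m rmx F) = F (rho v).
move=> FL; have F0 : F 0 = 0.
  by have := FL (-1) 0 0; rewrite rmorphN1 !scaleN1r oppr0 addr0 => ->; rewrite addNr.
rewrite mulmx_sum_row rho_sum [v in RHS]matrix_sum_delta big_ord1 rho_sum.
elim: (index_enum _) => [|i r IH]; first by rewrite !big_nil F0.
by rewrite !big_cons rhoZ rowK crrK IH -FL -rhoZ.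
Qed.
End RealCoordinates.

(* The data of the theorem in real coordinates orthonormal for the real part of
   the Hermitian form [- kf x (theta y)]: [th], [ta], [ji] are the matrices
   of the two conjugations and of multiplication by [i], and [pu], [pa], [pn] those of
   the projections of the sum of u, a and n. *)
Record iwaData (R : realType) := IwaData { id_L :> lieData R; id_th : 'M[R]_(ld_D id_L); id_ta : 'M[R]_(ld_D id_L);
  id_ji : 'M[R]_(ld_D id_L); id_pu : 'M[R]_(ld_D id_L); id_pa : 'M[R]_(ld_D id_L); id_pn : 'M[R]_(ld_D id_L); id_I : eqType;
  id_Dp : seq id_I; id_X : id_I -> 'rV[R]_(ld_D id_L); id_Y : id_I -> 'rV[R]_(ld_D id_L); id_Q : id_I -> 'M[R]_(ld_D id_L);
  id_w : id_I -> 'rV[R]_(ld_D id_L) -> R; id_H : 'rV[R]_(ld_D id_L); th_sq : id_th *m id_th = 1%:M; th_tr : id_th^T = id_th;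
  th_ad : forall x, @ld_adm _ id_L (x *m id_th) = id_th *m ld_adm x *m id_th;
  adm_tr : forall x, (@ld_adm _ id_L x)^T = - ld_adm (x *m id_th); ta_sq : id_ta *m id_ta = 1%:M; ta_tr : id_ta^T = id_ta;
  ta_ad : forall x, @ld_adm _ id_L (x *m id_ta) = id_ta *m ld_adm x *m id_ta; ta_th : id_ta *m id_th = id_th *m id_ta;
  ji_sq : id_ji *m id_ji = - 1%:M; ji_th : id_ji *m id_th = - (id_th *m id_ji); ji_ta : id_ji *m id_ta = - (id_ta *m id_ji);
  ji_adr : forall x, id_ji *m @ld_adm _ id_L x = ld_adm x *m id_ji; ji_adl : forall x, @ld_adm _ id_L (x *m id_ji) = ld_adm x *m id_ji;
  adm_inj : forall x, @ld_adm _ id_L x = 0 -> x = 0; pu_sum : id_pu + id_pa + id_pn = 1%:M; pu_th : id_pu *m id_th = id_pu;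
  pu_id : forall x : 'rV[R]_(ld_D id_L), x *m id_th = x -> x *m id_pu = x; pa_th : id_pa *m id_th = - id_pa; pa_pa : id_pa *m id_pa = id_pa;
  pn_pn : id_pn *m id_pn = id_pn; pa_pn : id_pa *m id_pn = 0; pn_pa : id_pn *m id_pa = 0;
  pa_ad : forall x, id_pa *m @ld_adm _ id_L (x *m id_pa) = 0;
  pn_ada : forall x, id_pn *m @ld_adm _ id_L (x *m id_pa) *m id_pn = id_pn *m ld_adm (x *m id_pa);
  pn_adn : forall x, id_pn *m @ld_adm _ id_L (x *m id_pn) *m id_pn = id_pn *m ld_adm (x *m id_pn);
  pu_iwa : forall x : 'rV[R]_(ld_D id_L), x *m id_ta = x -> x *m id_pu *m id_ta = x *m id_pu;
  pn_Q : forall x : 'rV[R]_(ld_D id_L), x *m id_pn = \sum_(j <- id_Dp) x *m id_pn *m id_Q j;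
  Q_ad : forall j x, j \in id_Dp -> id_Q j *m @ld_adm _ id_L (x *m id_pa) = id_w j (x *m id_pa) *: id_Q j;
  Q_nz : forall j, j \in id_Dp -> id_Q j != 0; w_inj : forall x, (forall j, j \in id_Dp -> id_w j (x *m id_pa) = 0) -> x *m id_pa = 0;
  H_pa : id_H *m id_pa = id_H; H_pn : forall x : 'rV[R]_(ld_D id_L), dot id_H (x *m id_pn) = 0;
  H_gt0 : forall j, j \in id_Dp -> 0 < id_w j id_H; X_th : forall j, id_X j *m id_th = id_X j; Y_th : forall j, id_Y j *m id_th = id_Y j;
  sum_dot : forall a b : 'rV[R]_(ld_D id_L), a *m id_th = a -> b *m id_th = b ->
    \sum_(j <- id_Dp) (dot a (id_X j) * dot b (id_Y j) - dot a (id_Y j) * dot b (id_X j)) = - (2 * dot (a *m id_ji *m id_pu) b)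
}.

Section Conjugation.
Context {R : realType} {g0 : lieAlgType R} {g : lieAlgType R[i]}.
Variable iota : g0 -> g.
Hypothesis cx : complexification iota.
Notation C := R[i].
Notation "'i" := ('i%C : C).
Notation re := (re cx).
Notation im := (im cx).

Definition cjg z := iota (re z) - 'i *: iota (im z).

Lemma cjgE x y : cjg (iota x + 'i *: iota y) = iota x - 'i *: iota y.
by rewrite /cjg; have [<- <-] := reim_uniq cx (reimE cx (iota x + 'i *: iota y)). Qed.
Lemma cjg_iota x : cjg (iota x) = iota x.
by have := cjgE x 0; rewrite (iota0 cx) scaler0 addr0 subr0. Qed.
Lemma cjg_fix z : cjg z = z -> exists x, z = iota x.
move=> zE; exists (re z); rewrite {1}(reimE cx z); suff -> : im z = 0 by rewrite (iota0 cx) scaler0 addr0.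
have := zE; rewrite {2}(reimE cx z) /cjg -scalerN -(iotaN cx) => /(reim_uniq cx)[_ /eqP].
by rewrite eq_sym -addr_eq0 -mulr2n -[_ *+ 2]scaler_nat scaler_eq0 pnatr_eq0 => /eqP.
Qed.
Lemma cjgD z w : cjg (z + w) = cjg z + cjg w.
rewrite (reimE cx z) (reimE cx w) addrACA -scalerDr -!(iotaD cx) !cjgE !(iotaD cx).
by rewrite scalerDr opprD addrACA.
Qed.
Lemma cjgZ (a : R) z : cjg ((a%:C)%C *: z) = (a%:C)%C *: cjg z.
rewrite (reimE cx z) scalerDr scalerA [_ * 'i]mulrC -scalerA -!(iotaZ cx) !cjgE !(iotaZ cx).
by rewrite scalerBr !scalerA [_ * 'i]mulrC.
Qed.
Lemma cjgi z : cjg ('i *: z) = - ('i *: cjg z).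
rewrite (reimE cx z) scalerDr i2 addrC -(iotaN cx) !cjgE (iotaN cx) scalerBr i2 opprK.
by rewrite opprD addrC.
Qed.
Lemma cjgK z : cjg (cjg z) = z.
by rewrite [in RHS](reimE cx z) {2}/cjg -scalerN -(iotaN cx) cjgE (iotaN cx) scalerN opprK.
Qed.
Lemma cjg_lie z w : cjg (lie z w) = lie (cjg z) (cjg w).
rewrite (reimE cx z) (reimE cx w); move: (re z) (im z) (re w) (im w) => x1 x2 y1 y2; rewrite !cjgE.
rewrite !(lieDl, lieDr, lieBl, lieBr, lieZl, lieZr, lieNl, lieNr, cjgD, cjgi) -!(iota_lie cx) !cjg_iota.
vring.
Qed.
Lemma kill_cjg z w : kf (cjg z) (cjg w) = ((kf z w)^*)%C.
rewrite (reimE cx z) (reimE cx w) !cjgE !killDl !killDr !killNl !killNr !killZl !killZr !(kill_iota cx).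
by complex_ring.
Qed.

Variables (k p : {vspace g0}).
Hypothesis cd : cartan_decomposition k p.

Lemma cjg_theta z : cjg (theta cx k p z) = theta cx k p (cjg z).
have sN u : sig k p (- u) = - sig k p u by rewrite -scaleN1r (sigZ k p) scaleN1r.
rewrite (reimE cx z); move: (re z) (im z) => x y.
by rewrite !(cjgE, thetaE) -!scalerN -!(iotaN cx) !(cjgE, thetaE) sN !(iotaN cx) !scalerN.
Qed.
End Conjugation.

Arguments theta_inv : simpl never.

Section Instance.
Context {R : realType} {g0 : lieAlgType R} {g : lieAlgType R[i]}.
Variable iota : g0 -> g.
Hypothesis cx : complexification iota.
Variables (k0 p0 : {vspace g0}).
Hypothesis cd0 : cartan_decomposition k0 p0.
Notation T := (theta_inv cx cd0).
Variable rd : rootDatum T.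
Hypothesis b_iwasawa : iwasawa_borel iota (rd_b rd).
Variables (G : topGroupType) (d : nat) (A : set (chart R G d)).
Hypothesis G_lie : lie_group A.
Variable lam : g -> (G -> R) -> G -> R.
Hypothesis lamP : lie_algebra_iso A lam.
Variable ex : g -> G.
Hypothesis exP : exponential_map A lam ex.
Notation C := R[i].
Notation "'i" := ('i%C : C).
Notation h := (rd_h rd).
Notation n := (rd_n rd).
Notation Dp := (rd_Dp rd).
Notation E := (@rd_E _ _ _ rd).
Notation rho := (rho T).
Notation crr := (crr T).
Notation rmx := (rmx T).
Notation D := (\dim {:g} + \dim {:g})%N.
Implicit Types (v w : 'rV[R]_D) (x y z : g).

Definition iwa_adm v : 'M[R]_D := rmx (lie (rho v)).

Lemma rho_adm v w : rho (v *m iwa_adm w) = lie (rho w) (rho v).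
by rewrite /iwa_adm rmxE // => a x y; rewrite lieDr lieZr. Qed.

Definition iwa_lie : lieData R.
refine (@LieData R G d A D iwa_adm (fun v => lam (rho v)) (fun v => ex (rho v)) G_lie _ _ _ _ _ _ _ _ _).
- move=> a v w; apply: row_ext => u; apply: (rho_inj (T := T)). by rewrite mulmxDr -scalemxAr rhoL !rho_adm rhoL lieDl lieZl.
- by move=> v; apply: (rho_inj (T := T)); rewrite rho_adm liexx rho0.
- by case: lamP => l1 _ _ _ _ v; exact: l1.
- by case: lamP => _ l2 _ _ _ a v w f sf u; rewrite rhoL l2.
- by case: lamP => _ _ l3 _ _ v w f sf u; rewrite rho_adm l3.
- by case: lamP => _ _ _ l4 _ v H; apply: (rho_inj (T := T)); rewrite rho0; exact: l4.
- by case: lamP => _ _ _ _ l5 X dX iX; have [x xP] := l5 X dX iX; exists (crr x) => f sf u; rewrite crrK xP.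
- by case: exP => e0 _; rewrite rho0.
- case: exP => _ e1 v f sf t; rewrite rhoZ; have := e1 (rho v) f sf t. by under eq_fun do rewrite -rhoZ.
Defined.

Lemma dec_ex x : exists t : g * g * g, [/\ T t.1.1 = t.1.1, aP rd t.1.2, t.2 \in n & x = t.1.1 + t.1.2 + t.2].
have [xh [y [y' [xhh yn y'n ->]]]] := g_decomp rd x.
have [z [a [m [ap mn ->]]] ->] := us_decomp xhh yn y'n.
exists (2^-1 *: (xh + T xh) + (y' + T y'), a, m); split=> //; last by rewrite addrA.
change (T (2^-1 *: (xh + T xh) + (y' + T y')) = 2^-1 *: (xh + T xh) + (y' + T y')).
by rewrite (thD T (_ *: _)) thZ (thD T xh) (thD T y') !thK conjc_inv conjc_nat [T xh + _]addrC [T y' + _]addrC.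
Qed.

Definition dec_u x := (sval (cid (dec_ex x))).1.1.
Definition dec_a x := (sval (cid (dec_ex x))).1.2.
Definition dec_n x := (sval (cid (dec_ex x))).2.

Lemma decP x : [/\ T (dec_u x) = dec_u x, aP rd (dec_a x), dec_n x \in n & x = dec_u x + dec_a x + dec_n x].
by rewrite /dec_u /dec_a /dec_n; case: cid. Qed.
Lemma aP_L (c : R) x y : aP rd x -> aP rd y -> aP rd ((c%:C)%C *: x + y).
move=> [xh Tx] [yh Ty]; split; first by rewrite rpredD // rpredZ.
by rewrite thD thZ conjc_real Tx Ty scalerN opprD.
Qed.
(** [us_cap] separates u from a + n, and orthogonality separates a from [n]. Uniqueness is also what
    makes the chosen components real linear ([dec_L]). *)
Lemma dec_uniq x u a m : T u = u -> aP rd a -> m \in n -> x = u + a + m -> [/\ dec_u x = u, dec_a x = a & dec_n x = m].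
move=> Tu Pa Pm xE; have [Tu' Pa' Pm' xE'] := decP x.
have aL : aP rd (a - dec_a x) by have := aP_L (-1) Pa' Pa; rewrite rmorphN1 scaleN1r addrC.
have mL : m - dec_n x \in n by rewrite rpredB.
have E0 : dec_u x - u = (a - dec_a x) + (m - dec_n x).
  have : u + a + m = dec_u x + dec_a x + dec_n x by rewrite -xE.
  by move=> e1; apply/eqP; rewrite -subr_eq0; move/eqP: e1; rewrite -subr_eq0 => /eqP e1; rewrite -oppr0 -e1; apply/eqP; vring.
have u0 : dec_u x - u = 0 by apply: (us_cap (rd := rd)); [rewrite thB Tu Tu'|exists (a - dec_a x), (m - dec_n x)].
have a0 : a - dec_a x = 0.
  apply: (@hm_eq0 _ _ T); have /eqP := E0; rewrite u0 eq_sym addr_eq0 => /eqP e1. by rewrite {2}e1 hmNr (h_n_orth aL.1 mL) oppr0.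
have m0 : m - dec_n x = 0 by have := E0; rewrite u0 a0 add0r.
by split; apply/eqP; rewrite -subr_eq0 ?u0 // -opprB ?a0 ?m0 oppr0.
Qed.

Lemma dec_L : [/\ real_linear dec_u, real_linear dec_a & real_linear dec_n].
have H (c : R) x y : [/\ dec_u ((c%:C)%C *: x + y) = (c%:C)%C *: dec_u x + dec_u y,
    dec_a ((c%:C)%C *: x + y) = (c%:C)%C *: dec_a x + dec_a y & dec_n ((c%:C)%C *: x + y) = (c%:C)%C *: dec_n x + dec_n y].
  have [u1 a1 m1 e1] := decP x; have [u2 a2 m2 e2] := decP y; apply: dec_uniq.
  - by rewrite thD thZ conjc_real u1 u2.
  - exact: aP_L.
  - by rewrite rpredD // rpredZ.
  - by rewrite {1}e1 {1}e2 !scalerDr; vring.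
by split=> c x y; have [] := H c x y.
Qed.

(** The component along the root line of [al]; these give the matrices [id_Q], on which [ad] of an
    element of a acts by a scalar. *)
Definition eproj al x := hm T x (E al) *: E al.

Let mth := rmx T.
Let mta := rmx (cjg cx).
Let mji := rmx (fun x => 'i *: x).
Let mpu := rmx dec_u.
Let mpa := rmx dec_a.
Let mpn := rmx dec_n.
Let mQ al := rmx (eproj al).

Lemma rth v : rho (v *m mth) = T (rho v).
by rewrite rmxE // => a x y; rewrite thD thZ conjc_real. Qed.
Lemma rta v : rho (v *m mta) = cjg cx (rho v).
by rewrite rmxE // => a x y; rewrite cjgD cjgZ. Qed.
Lemma rji v : rho (v *m mji) = 'i *: rho v.
by rewrite rmxE // => a x y; rewrite scalerDr !scalerA mulrC. Qed.
Lemma rpu v : rho (v *m mpu) = dec_u (rho v).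
by rewrite rmxE //; have [] := dec_L. Qed.
Lemma rpa v : rho (v *m mpa) = dec_a (rho v).
by rewrite rmxE //; have [] := dec_L. Qed.
Lemma rpn v : rho (v *m mpn) = dec_n (rho v).
by rewrite rmxE //; have [] := dec_L. Qed.
Lemma rQ al v : rho (v *m mQ al) = eproj al (rho v).
by rewrite rmxE // => a x y; rewrite /eproj hmDl hmZl scalerDl scalerA. Qed.
Lemma aP0 : aP rd 0. Proof. by split; rewrite ?rpred0 ?th0 ?oppr0. Qed.
Lemma du x : T x = x -> [/\ dec_u x = x, dec_a x = 0 & dec_n x = 0].
by move=> Tx; apply: dec_uniq => //; [exact: aP0|exact: rpred0|rewrite !addr0]. Qed.
Lemma da x : aP rd x -> [/\ dec_u x = 0, dec_a x = x & dec_n x = 0].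
by move=> Tx; apply: dec_uniq => //; [exact: th0|exact: rpred0|rewrite add0r addr0]. Qed.
Lemma dn x : x \in n -> [/\ dec_u x = 0, dec_a x = 0 & dec_n x = x].
by move=> Tx; apply: dec_uniq => //; [exact: th0|exact: aP0|rewrite !add0r]. Qed.
Lemma root_real al x : al \in Dp -> aP rd x -> al (vsproj h x) = ((complex.Re (al (vsproj h x)))%:C)%C.
move=> aD [xh Tx]; have [e re e0] := Dp_ex aD; have := weight_th re e0 xh.
rewrite Tx linearN linearN /= => /oppr_inj.
by case: (al _) => a b /eqP; rewrite eq_complex /= => /andP[_ /eqP bE]; apply/eqP; rewrite eq_complex /= eqxx /=; apply/eqP; lra.
Qed.

Let mx_ext (A1 A2 : 'M[R]_D) : (forall v, rho (v *m A1) = rho (v *m A2)) -> A1 = A2.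
by move=> H; apply: row_ext => v; exact: (rho_inj (H v)). Qed.
Let ad := iwa_adm.
Let rad v w : rho (v *m ad w) = lie (rho w) (rho v). Proof. exact: rho_adm. Qed.
Let rE := (rth, rta, rji, rpu, rpa, rpn, rQ, rad).
Ltac mtac := let v := fresh "v" in apply: mx_ext => v; rewrite ?mulmxN ?mulmx1 ?mulmx0 ?mulmxA ?mulmxN ?mulmxA ?rhoN ?rE.
Let Tu x : T (dec_u x) = dec_u x. Proof. by case: (decP x). Qed.
Let aPd x : aP rd (dec_a x). Proof. by case: (decP x). Qed.
Let nd x : dec_n x \in n. Proof. by case: (decP x). Qed.

Lemma conj_tr (F : g -> g) (A1 : 'M[R]_D) : (forall v, rho (v *m A1) = F (rho v)) -> (forall x, F (F x) = x) ->
  (forall x y, hm T (F x) (F y) = ((hm T x y)^*)%C) -> A1^T = A1.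
move=> FE FK Fh; apply: row_ext => v; apply: dot_inj => w.
rewrite -[v *m A1^T]/(v *m A1^T) -[w in RHS]mulmx1 dot_mx trmxK (_ : 1%:M = A1 *m A1).
  by rewrite !(dot_rho T) !FE mulmxA !FE Fh; case: (hm _ _ _).
by apply: mx_ext => u; rewrite mulmx1 mulmxA !FE FK.
Qed.

Let hmT x y : hm T (T x) (T y) = ((hm T x y)^*)%C. Proof. by rewrite /hm kill_th conjcN. Qed.
Let cT x : cjg cx (T x) = T (cjg cx x). Proof. exact: cjg_theta. Qed.
Let TX j : T (E j + T (E j)) = E j + T (E j). Proof. by rewrite thD thK addrC. Qed.
Let TY j : T ('i *: (E j - T (E j))) = 'i *: (E j - T (E j)). Proof. by rewrite th_i thB thK -scalerN opprB. Qed.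

Definition iwa : iwaData R.
refine (@IwaData R iwa_lie mth mta mji mpu mpa mpn _ Dp (fun al => crr (E al + T (E al))) (fun al => crr ('i *: (E al - T (E al)))) mQ
  (fun al v => complex.Re (al (vsproj h (rho v)))) (crr (Hp rd))
  _ _ _ _ _ _ _ _ _ _ _ _ _ _ _ _ _ _ _ _ _ _ _ _ _ _ _ _ _ _ _ _ _ _ _ _); simpl.
- by mtac; rewrite thK.
- by apply: (conj_tr (F := T)) => [v|x|x y] //; [exact: rth|exact: thK].
- by move=> x; mtac; rewrite th_lie thK.
- move=> x; apply: row_ext => v; apply: dot_inj => w; rewrite dot_mx trmxK !(dot_rho T). by rewrite mulmxN rhoN !rE hmNl hm_lie thK opprK.
- by mtac; rewrite cjgK.
- apply: (conj_tr (F := cjg cx)) => [v|x|x y]; [exact: rta|exact: cjgK|]. by rewrite /hm -cT kill_cjg conjcN.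
- by move=> x; mtac; rewrite cjg_lie cjgK.
- by mtac; rewrite cT.
- by mtac; rewrite i2.
- by mtac; rewrite th_i.
- by mtac; rewrite cjgi.
- by move=> x; mtac; rewrite lieZr.
- by move=> x; mtac; rewrite lieZl.
- move=> x x0; have {}x0 : ad x = 0 by exact: x0. apply: (rho_inj (T := T)); rewrite rho0; apply: (@hm_eq0 _ _ T); rewrite /hm killingE.
  have -> : adM (rho x) = 0 by apply: rowmx_eq => y; rewrite -adME -(crrK T y) -rad x0 !mulmx0 rho0 crd0. by rewrite mul0mx linear0 oppr0.
- by apply: mx_ext => v; rewrite mulmx1 !mulmxDr !rhoD !rE; case: (decP (rho v)) => _ _ _ <-.
- by mtac; rewrite Tu.
- move=> x xE; apply: (rho_inj (T := T)); rewrite rE; have /du[] // : T (rho x) = rho x. by rewrite -rE xE.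
- by mtac; case: (aPd (rho v)) => _ ->.
- by mtac; case: (da (aPd (rho v))).
- by mtac; case: (dn (nd (rho v))).
- by mtac; case: (da (aPd (rho v))) => _ _ ->; rewrite rho0.
- by mtac; case: (dn (nd (rho v))) => _ -> _; rewrite rho0.
- by move=> x; mtac; rewrite (h_abelian (aPd _).1 (aPd _).1) rho0.
- by move=> x; mtac; case: (dn (hn_lie (aPd (rho x)).1 (nd (rho v)))).
- by move=> x; mtac; case: (dn (nn_lie (nd (rho x)) (nd (rho v)))).
(* Here the Iwasawa property enters: [iwasawa_split] decomposes the real element with a u-part in
   [k0], and by uniqueness that is the u-part, which is therefore real. *)
- move=> x xE; apply: (rho_inj (T := T)); rewrite !rE. have [z zE] : exists z : g0, rho x = iota z by apply: cjg_fix; rewrite -rE xE.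
  have [y [s [yk [a [m [Pa Pm ->]]] e1]]] := iwasawa_split b_iwasawa z.
  have Ty : T (iota y) = iota y by rewrite -[T _]/(theta cx k0 p0 _) theta_iota (sigk cd0).
  have e2 : rho x = iota y + a + m by rewrite zE e1 addrA. have [-> _ _] := dec_uniq Ty Pa Pm e2. exact: cjg_iota.
- move=> x; apply: (rho_inj (T := T)); rewrite rho_sum rE -{1}(prn_id (nd (rho x))) /prn. by apply: eq_bigr => j _; rewrite !rE.
- move=> j x jD; apply: mx_ext => v; rewrite mulmxA -scalemxAr rhoZ !rE /eproj lieZr.
  rewrite (rspE (rd_root jD) (aPd _).1) {1}(root_real jD (aPd _)) !scalerA. by congr (_ *: _); rewrite mulrC.
- move=> j jD; apply/eqP => Q0; have := rQ j (crr (E j)).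
  rewrite Q0 mulmx0 rho0 crrK /eproj hmE // scale1r => E0; exact: (E_neq0 jD (esym E0)).
- move=> x H; apply: (rho_inj (T := T)); rewrite rho0; have Pa := aPd (rho x). have an y : y \in n -> lie (dec_a (rho x)) y = 0.
    apply: (n_ind (S := fun y => lie (dec_a (rho x)) y = 0)) => [|u v Hu Hv|al z aD ry].
    + exact: lie0r.
    + by rewrite lieDr Hu Hv addr0.
    + by rewrite (rspE ry Pa.1) (root_real aD Pa) -rpa H // scale0r.
  rewrite rE; apply: (h_faithful (rd := rd) Pa.1 an) => y yn. by rewrite Pa.2 lieNl an // oppr0.
- apply: (rho_inj (T := T)); rewrite rE crrK. by case: (da (conj (Hp_h rd) (T_Hp rd))).
- by move=> x; rewrite (dot_rho T) crrK rE (h_n_orth (Hp_h rd) (nd _)).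
- by move=> j jD; rewrite crrK; have := Hp_gt0 jD; case: (j _) => a b; rewrite ltcE /= => /andP[].
- by move=> j; apply: (rho_inj (T := T)); rewrite rE crrK TX.
- by move=> j; apply: (rho_inj (T := T)); rewrite rE crrK TY.
(* The Killing form is real on vectors fixed by [T] and equals [- dot] there, so the real part of
   [sum_XY] is the required identity. *)
- move=> a b aE bE; have Ta : T (rho a) = rho a by rewrite -rE aE. have Tb : T (rho b) = rho b by rewrite -rE bE.
  have dK v x : T x = x -> dot v (crr x) = - complex.Re (kf (rho v) x) by move=> Tx; rewrite (dot_rho T) crrK /hm Tx; case: (kf _ _).
  have Kr x y : T x = x -> T y = y -> kf x y = ((complex.Re (kf x y))%:C)%C.
    move=> Tx Ty; have := kill_th T x y; rewrite Tx Ty; case: (kf _ _) => p q /eqP.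
    rewrite eq_complex /= => /andP[_ /eqP qE]; apply/eqP; rewrite eq_complex /= eqxx /=; apply/eqP; lra.
  have [xh [y [xhh Txh yn aE']]] := u_decomp rd Ta. have [zh [z [zhh Tzh zn bE']]] := u_decomp rd Tb.
  have := sum_XY xhh yn zhh zn; rewrite -aE' -bE'. have [[s [m [sa mn sE]]] Tr] := i_decomp xhh Txh yn; rewrite -aE' in sE.
  have dE : rho (a *m mji *m mpu) = rhoe T y by rewrite !rE; have [|->] // := dec_uniq Tr sa mn (x := 'i *: rho a); rewrite -addrA -sE addrC subrK.
  move/(congr1 (@complex.Re R)); rewrite (big_morph (@complex.Re R) (fun a b => raddfD (@complex.Re R) a b) (erefl : complex.Re (0 : C) = 0)).
  have -> : complex.Re (2 * kf (rhoe T y) (rho b)) = - (2 * dot (a *m mji *m mpu) b).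
    rewrite -{2}(rhoK T b) dK // dE mulrN opprK. by case: (kf _ _) => p q /=; ring.
  move=> <-; apply: eq_bigr => j _; rewrite !dK //.
  rewrite [kf (rho a) (E j + _)]Kr // [kf (rho b) ('i *: _)]Kr // [kf (rho a) ('i *: _)]Kr // [kf (rho b) (E j + _)]Kr //.
  have RM p q r s' : complex.Re ((p%:C)%C * (q%:C)%C - (r%:C)%C * (s'%:C)%C : C) = p * q - r * s' by rewrite /=; ring. rewrite RM; ring.
Defined.
End Instance.

Lemma mder_tr (R : realType) m n (F : R -> 'M[R]_(m, n)) t L : mder F t L -> mder (fun s => (F s)^T) t L^T.
by move=> h i j; rewrite mxE; fun_mxE; exact: h. Qed.
Lemma expm_antisym (R : realType) n (A : 'M[R]_n) : A^T = - A -> (expm A)^T *m expm A = 1%:M.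
move=> AT; have := @mder0_cst _ _ _ (fun s => (expm (s *: A))^T *m expm (s *: A)) _ 1 0.
rewrite scale1r scale0r expm0 trmx1 mulmx1; apply=> t.
apply: mder_eq (mderM (mder_tr (expm_line A t)) (expm_line A t)) _.
by rewrite trmx_mul AT mulmxN mulNmx mulmxA addNr.
Qed.
Lemma mder_unique (R : realType) m n (F : R -> 'M[R]_(m, n)) t L L' : mder F t L -> mder F t L' -> L = L'.
by move=> h h'; apply/matrixP => i j; exact: der_uniq (h i j) (h' i j). Qed.
Lemma smx_tr (R : realType) (N : normedModType R) m n (O : set N) (F : N -> 'M[R]_(m, n)) : smx O F -> smx O (fun q => (F q)^T).
by move=> h i j; fun_mxE; exact: h. Qed.
Lemma smx_near0 (R : realType) m n p (r eps : R) (N : 'rV[R]_m -> 'M[R]_(n, p)) : 0 < r -> smx (Bo 0 r) N -> 0 < eps ->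
  exists+ a, forall x : 'rV[R]_m, `|x| < a -> `|N x - N 0| <= eps.
move=> r0 sN eps0; have b0 : Bo 0 r (0 : 'rV[R]_m) by exact: Bo_ctr.
have /contP/(_ _ eps0)[a a0 aP] := smx_cont sN b0.
by exists a => // x xa; apply: aP; rewrite subr0.
Qed.

Ltac msm := repeat first [assumption | exact: openT | exact: Bo_open | exact: smx_cst | apply: smx_id |
  apply: smx_phim | apply: smx_expm | apply: smx_adm | apply: smxN | apply: smx_tr |
  apply: smxB | apply: smxD | apply: smx_mulr | apply: smxM].

(** * The generated subgroups and the adjoint representation *)

Section Poisson.
Context {R : realType} {W : iwaData R}.
Notation G := (ld_G W).
Notation d := (ld_d W).
Notation A := (@ld_A _ W).
Notation D := (ld_D W).
Notation adm := (@ld_adm _ W).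
Notation lam := (@ld_lam _ W).
Notation e := (@ld_e _ W).
Notation lG := (ld_lie W).
Notation lamL := (@ld_lamL _ W).
Notation e0 := (ld_e0 W).
Notation sm := (smooth_fun A).
Notation th := (id_th W).
Notation ta := (id_ta W).
Notation ji := (id_ji W).
Notation pu := (id_pu W).
Notation pa := (id_pa W).
Notation pn := (id_pn W).
Notation V := 'rV[R]_D.
Implicit Types (x y : V) (u v : G).

Definition gen S : set G := smallest (subgroup (G := G)) (e @` S).

Lemma gen_ind (S : set V) (Q : G -> Prop) : Q 1%g -> (forall u v, Q u -> Q v -> Q (u * v)%g) ->
  (forall u, Q u -> Q u^-1%g) -> (forall x, S x -> Q (e x)) -> forall u, gen S u -> Q u.
move=> Q1 QM QV Qe u; apply; split; last by move=> _ [x Sx <-]; exact: Qe.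
by split=> // x y Qx Qy; apply: QM => //; exact: QV.
Qed.
Lemma gen_e (S : set V) x : S x -> gen S (e x).
by move=> Sx A [_]; apply; exists x. Qed.
Lemma gen1 (S : set V) : gen S 1%g.
by move=> A [[]]. Qed.
Lemma genV (S : set V) u : gen S u -> gen S u^-1%g.
by move=> Su A hA; have [[A1 AM] _] := hA; rewrite -[u^-1%g]mul1g; apply: AM => //; exact: Su. Qed.
Lemma genM (S : set V) u v : gen S u -> gen S v -> gen S (u * v)%g.
move=> Su Sv A hA; have [[A1 AM] _] := hA.
by rewrite -[v]invgK; apply: AM; [exact: Su|exact: genV hA].
Qed.
Lemma gen_sub (S S' : set V) : S `<=` S' -> gen S `<=` gen S'.
by move=> SS u; apply: gen_ind; [exact: gen1|exact: genM|exact: genV|move=> x /SS; exact: gen_e]. Qed.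

(** [is_Ad_unique] makes this the adjoint matrix wherever one exists, in particular on the group
    generated by exponentials ([Adm_ex]); elsewhere the value is the identity matrix. *)
Definition Adm u : 'M[R]_D := xget 1%:M (is_Ad (Ld := W) u).

Lemma AdmE u M : is_Ad (Ld := W) u M -> Adm u = M.
by move=> h; apply: (is_Ad_unique _ h); exact: xgetI h. Qed.
Lemma Adm_ex u : gen setT u -> is_Ad (Ld := W) u (Adm u) /\ Adm u \in unitmx.
suff : gen setT u -> exists2 M, is_Ad (Ld := W) u M & M \in unitmx.
  by move=> h /h[M uM Mu]; rewrite (AdmE uM).
move: u; apply: gen_ind => [|u v [M uM Mu] [N vN Nu]|u [M uM Mu]|x _].
- by exists 1%:M; [exact: is_Ad1|exact: unitmx1].
- by exists (M *m N); [exact: is_AdM|rewrite unitmx_mul Mu].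
- by exists (invmx M); [exact: is_AdV|rewrite unitmx_inv].
- by exists (expm (- adm x)); [exact: exp_conj|exact: expm_unit].
Qed.
Lemma AdmP u y : gen setT u -> (u^-1 * e y * u)%g = e (y *m Adm u).
by case/Adm_ex. Qed.
Lemma AdmP' u y : gen setT u -> (e y * u)%g = (u * e (y *m Adm u))%g.
by move=> /(AdmP y) <-; rewrite !mulgA mulgV mul1g. Qed.
Lemma Adm_unit u : gen setT u -> Adm u \in unitmx. Proof. by case/Adm_ex. Qed.
Lemma Adm_exp x : Adm (e x) = expm (- adm x). Proof. by apply: AdmE; exact: exp_conj. Qed.
Lemma Adm1 : Adm 1%g = 1%:M. Proof. by apply: AdmE; exact: is_Ad1. Qed.
Lemma AdmM u v : gen setT u -> gen setT v -> Adm (u * v)%g = Adm u *m Adm v.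
by move=> /Adm_ex[hu _] /Adm_ex[hv _]; apply: AdmE; exact: is_AdM. Qed.
Lemma AdmV u : gen setT u -> Adm u^-1%g = invmx (Adm u).
by move=> /Adm_ex[hu uu]; apply: AdmE; exact: is_AdV. Qed.
Lemma AdmVK u : gen setT u -> Adm u *m Adm u^-1%g = 1%:M.
by move=> hu; rewrite AdmV // mulmxV // Adm_unit. Qed.
Lemma AdmVK' u : gen setT u -> Adm u^-1%g *m Adm u = 1%:M.
by move=> hu; rewrite AdmV // mulVmx // Adm_unit. Qed.
Lemma genT (S : set V) u : gen S u -> gen setT u. Proof. exact: gen_sub. Qed.
(** Differentiate at [t = 0] two expressions for [Ad (u^-1 * e (t x) * u)]. *)
Lemma Adm_lie u x : gen setT u -> Adm u *m adm (x *m Adm u) = adm x *m Adm u.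
move=> hu; set M := Adm u.
have H (t : R) : M *m expm (t *: - adm (x *m M)) = expm (t *: - adm x) *m M.
  have := AdmE (is_AdM (is_AdM (is_AdV (Adm_unit hu) (Adm_ex hu).1) (exp_conj (t *: x))) (Adm_ex hu).1).
  rewrite AdmP // -scalemxAl Adm_exp admZ scalerN => ->. by rewrite !mulmxA mulmxV ?Adm_unit // mul1mx admZ scalerN.
have h1 := mderMr M (expm_line (- adm (x *m M)) 0).
have h2 := mderMl M (expm_line (- adm x) 0).
have h3 : mder (fun s => M *m expm (s *: - adm (x *m M))) 0 (- adm x *m expm (0 *: - adm x) *m M) by move=> i j; have := h2 i j; under eq_fun do rewrite -H.
have := mder_unique h1 h3; rewrite !scale0r expm0 !mulmx1 mulmxN mulNmx.
by move/eqP; rewrite eqr_opp => /eqP.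
Qed.

Lemma Adm_comm (S : set V) (P : 'M[R]_D) u : (forall x, S x -> P *m adm x = adm x *m P) -> gen S u -> P *m Adm u = Adm u *m P.
move=> h; suff : gen S u -> gen setT u /\ P *m Adm u = Adm u *m P by move=> H /H[].
move: u; apply: gen_ind => [|u v [uT uP] [vT vP]|u [uT uP]|x Sx].
- by split; [exact: gen1|rewrite Adm1 mulmx1 mul1mx].
- by split; [exact: genM|rewrite AdmM // mulmxA uP -mulmxA vP mulmxA].
- split; first exact: genV. by rewrite -[LHS]mul1mx -(AdmVK' uT) -!mulmxA [Adm u *m (P *m _)]mulmxA -uP -!mulmxA AdmVK // mulmx1.
- split; first exact: gen_e. by rewrite Adm_exp; apply: expm_tw; rewrite mulmxN h // mulNmx.
Qed.
Lemma Adm_ji u : gen setT u -> ji *m Adm u = Adm u *m ji.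
by apply: Adm_comm => x _; exact: ji_adr. Qed.

Definition inU x := x *m th = x.
Definition Ug := gen inU.
Definition G0g := gen [set x | x *m ta = x].
Definition inK x := inU x /\ x *m ta = x.
Definition K0g := gen inK.

Lemma Adm_th u : Ug u -> th *m Adm u = Adm u *m th.
apply: Adm_comm => x xU; have := th_ad x; rewrite xU => {1}->.
by rewrite !mulmxA th_sq mul1mx.
Qed.
Lemma Adm_ta u : G0g u -> ta *m Adm u = Adm u *m ta.
apply: Adm_comm => x /= xU; have := ta_ad x; rewrite xU => {1}->.
by rewrite !mulmxA ta_sq mul1mx.
Qed.
Lemma K0_U : K0g `<=` Ug. Proof. by apply: gen_sub => x []. Qed.
Lemma K0_G0 : K0g `<=` G0g. Proof. by apply: gen_sub => x []. Qed.
Lemma Adm_orth u : Ug u -> (Adm u)^T *m Adm u = 1%:M.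
suff : Ug u -> gen setT u /\ (Adm u)^T *m Adm u = 1%:M by move=> H /H[].
move: u; apply: gen_ind => [|u v [uT uP] [vT vP]|u [uT uP]|x xU].
- by split; [exact: gen1|rewrite Adm1 mulmx1 trmx1].
- by split; [exact: genM|rewrite AdmM // trmx_mul mulmxA -[_ *m _ *m Adm u]mulmxA uP mulmx1].
- split; [exact: genV|]; have uI : Adm u^-1%g = (Adm u)^T.
    by rewrite -[RHS]mulmx1 -(AdmVK uT) mulmxA uP mul1mx.
  by rewrite uI trmxK -uI AdmVK.
- split; first exact: gen_e. by rewrite Adm_exp; apply: expm_antisym; rewrite linearN /= adm_tr xU.
Qed.

Lemma Adm_dot u x y : Ug u -> dot (x *m Adm u) (y *m Adm u) = dot x y.
move=> hu; have e1 := Adm_orth hu; rewrite dot_mx -mulmxA (_ : Adm u *m (Adm u)^T = 1%:M) ?mulmx1 //.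
exact: mulmx1C.
Qed.
Lemma inU_Adm u x : Ug u -> inU x -> inU (x *m Adm u).
by move=> hu xU; rewrite /inU -mulmxA -Adm_th // mulmxA xU. Qed.
Lemma sqr_norm_dot x : `|x| ^+ 2 <= dot x x.
apply: le_trans (sqr_norm_le_sum x) _; rewrite dotE; apply: ler_sum => i _.
by rewrite expr2.
Qed.
Lemma dot_le x y : `|dot x y| <= D%:R * `|x| * `|y|.
by rewrite dotE; apply: sum_coord_le => j; exact: coord_le. Qed.
Lemma Adm_norm u x : Ug u -> `|x *m Adm u| <= D%:R * `|x|.
move=> hu; have [->|x0] := eqVneq x 0; first by rewrite mul0mx normr0 mulr0.
have D1 : (1 : R) <= D%:R.
  rewrite ler1n lt0n; apply/eqP => D0; move: x0; apply/negP/negPn/eqP/rowP => -[j jD]; exfalso. by move: jD; rewrite D0.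
rewrite -(@ler_pXn2r _ 2) ?nnegrE ?mulr_ge0 // ?ler0n //.
apply: le_trans (sqr_norm_dot _) _; rewrite Adm_dot //.
apply: le_trans (ler_norm _) _; apply: le_trans (dot_le _ _) _.
rewrite exprMn -mulrA -expr2 ler_wpM2r // ?exprn_ge0 //.
by rewrite expr2 ler_peMl // ler0n.
Qed.

(** * Smooth functions on U and their gradients *)

Implicit Types (f h : G -> R).

(** The projection onto u along the eigenspace -1 of [th]. Unlike [pu], which projects along a + n,
    it is symmetric, as gradients require. *)
Definition qu : 'M[R]_D := 2^-1 *: (1%:M + th).

Lemma qu_th : qu *m th = qu.
by rewrite /qu -scalemxAl mulmxDl mul1mx th_sq addrC. Qed.
Lemma qu_in x : inU (x *m qu).
by rewrite /inU -mulmxA qu_th. Qed.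
Lemma qu_id x : inU x -> x *m qu = x.
by move=> xU; rewrite /qu -scalemxAr mulmxDr mulmx1 xU half_double.
Qed.
Lemma qu_tr : qu^T = qu.
by rewrite /qu linearZ /= linearD /= trmx1 th_tr. Qed.
Lemma inU_lie x y : inU x -> inU y -> inU (y *m adm x).
by move=> xU yU; have := th_ad x; rewrite xU /inU => {1}->; rewrite !mulmxA yU -mulmxA th_sq mulmx1.
Qed.
Lemma inUL a x y : inU x -> inU y -> inU (a *: x + y).
by rewrite /inU mulmxDl -scalemxAl => -> ->. Qed.
Lemma inUZ a x : inU x -> inU (a *: x).
by rewrite /inU -scalemxAl => ->. Qed.
Lemma inU0 : inU (0 : V). Proof. by rewrite /inU mul0mx. Qed.
Lemma inU_sum m (F : 'I_m -> V) : (forall i, inU (F i)) -> inU (\sum_i F i).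
by move=> h; rewrite /inU mulmx_suml; apply: eq_bigr => i _; exact: h. Qed.
Lemma qu_inP x : inP qu x <-> inU x.
by split=> [h|]; [rewrite -h; exact: qu_in|exact: qu_id]. Qed.
Lemma qu_sub : subalg (Ld := W) qu.
split; first by apply: row_ext => x; rewrite mulmxA qu_id //; exact: qu_in.
by move=> x y /qu_inP xU /qu_inP yU; apply/qu_inP; exact: inU_lie.
Qed.
Lemma UgM_e u x : Ug u -> inU x -> Ug (u * e x)%g.
by move=> hu xU; apply: genM => //; exact: gen_e. Qed.

Definition CUW : set (G -> R) := [set f | forall u, Ug u -> forall m (x : 'I_m -> V), (forall i, inU (x i)) ->
    smooth [set: 'rV[R]_m] (fun t => f (u * e (\sum_i t 0 i *: x i))%g : R^o)].

Definition lf x f u : R := derive1 (fun t : R => f (u * e (t *: x))%g : R^o) 0.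
Definition rf x f u : R := derive1 (fun t : R => f (e (t *: x) * u)%g : R^o) 0.

Lemma derive1P (g : R -> R^o) (t l : R) : is_D t g (l : R^o) -> derive1 g t = l.
by move=> h; rewrite derive1E; exact: derive_val. Qed.
Lemma smx_split1 m n (O : set 'rV[R]_(m + n)) : open O ->
  smx O (fun z : 'rV[R]_(m + n) => lsubmx z) /\ smx O (fun z : 'rV[R]_(m + n) => rsubmx z).
by move=> oO; split=> i j; fun_mxE; exact: smooth_coord.
Qed.
Lemma row_mx_Bo m n (x : 'rV[R]_m) (y : 'rV[R]_n) r : `|x| < r -> `|y| < r -> Bo 0 r (row_mx x y).
move=> xr yr; rewrite Bo0; apply: norm_lt_coord => [|j]; first exact: le_lt_trans xr.
case: (split_ordP j) => k ->; rewrite ?row_mxEl ?row_mxEr; first exact: le_lt_trans (coord_le _ _) xr.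
exact: le_lt_trans (coord_le _ _) yr.
Qed.
Lemma inP_mx m n (P E : 'M[R]_n) (B : 'M[R]_(m, n)) : (forall z : 'rV_n, inP P z -> inP P (z *m E)) -> B *m P = B -> B *m E *m P = B *m E.
by move=> h BP; apply: row_ext => q; rewrite !mulmxA; apply: h; rewrite /inP -mulmxA BP. Qed.
Lemma fam_mul_sub P m (O : set 'rV[R]_m) S w (Z : 'rV[R]_m -> V) : subalg (Ld := W) P -> fam (Ld := W) O S w ->
  (forall t, O t -> w t *m P = w t) -> smx O Z -> (forall t, inP P (Z t)) ->
  exists2 w', fam (Ld := W) O (fun t => S t * e (Z t))%g w' & forall t, O t -> w' t *m P = w' t.
move=> sP fS wP sZ ZP; exists (fun t => w t *m expm (- adm (Z t)) + jac Z t *m phim (- adm (Z t))).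
  exact: fam_mul_exp.
move=> t Ot; have oO : open O by case: fS.
have jP : jac Z t *m P = jac Z t by rewrite -(jac_mulr P oO sZ Ot); congr (jac _ t); apply/funext => x; exact: ZP.
have ZN := inPN (ZP t); rewrite -!admN mulmxDl; congr (_ + _).
  by apply: (inP_mx _ (wP _ Ot)) => y yP; exact: inP_expm.
by apply: (inP_mx _ jP) => y yP; exact: inP_phim.
Qed.

Lemma fam_exp_sub P m (O : set 'rV[R]_m) u (Z : 'rV[R]_m -> V) : subalg (Ld := W) P -> open O -> smx O Z -> (forall t, inP P (Z t)) ->
  exists2 w', fam (Ld := W) O (fun t => u * e (Z t))%g w' & forall t, O t -> w' t *m P = w' t.
by move=> sP oO sZ ZP; apply: fam_mul_sub sP (fam_cst u oO) _ sZ ZP => t _; rewrite mul0mx.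
Qed.
(** The local group law in exponential coordinates: the product is a family whose form takes values
    in the subalgebra, so [fam_subalg] writes it as [e (Z _)] with [Z] smooth. *)
Lemma exp_mul_sub P (eps : R) : subalg (Ld := W) P -> 0 < eps -> exists+ r,
  exists Z : 'rV[R]_(D + D) -> V, [/\ smx (Bo 0 r) Z, forall t, Bo 0 r t -> `|Z t| < eps &
    forall y x, inP P y -> inP P x -> `|y| < r -> `|x| < r ->
    [/\ Bo 0 r (row_mx y x), inP P (Z (row_mx y x)), `|Z (row_mx y x)| < eps & (e y * e x)%g = e (Z (row_mx y x))]].
move=> sP eps0; have [PP _] := sP; have [fl fr] := smx_split1 (@openT 'rV[R]_(D + D)).
have PPz z : inP P (z *m P) by rewrite /inP -mulmxA PP.
have [wa fa waP] := fam_exp_sub 1%g sP openT (smx_mulr P openT fl) (fun=> PPz _).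
have [wS fS wSP] := fam_mul_sub sP fa waP (smx_mulr P openT fr) (fun=> PPz _).
have [rho rho0 [Z [_ sZ _ ZP]]] := fam_subalg (t0 := 0) sP fS wSP I eps0.
exists rho => //; exists Z; split=> // [t /ZP[]//|y x yP xP yr xr].
have rb := row_mx_Bo yr xr.
by have := ZP _ rb; rewrite !mul1g row_mxKl row_mxKr yP xP !linear0 !mul0mx e0 !mul1g => -[].
Qed.

(** A function of class [CUW] is controlled along [u * e (\sum_i t_i x_i)] only. Composing it with
    the smooth coordinates [Zt] of the splitting of the algebra by [qu] and [1 - qu] extends it to
    [G] near [u], where the calculus of [lam] applies. *)
Lemma CU_ext f u : CUW f -> Ug u -> exists2 f', sm f' & exists+ r,
  forall y x, inU y -> inU x -> `|y| < r -> `|x| < r -> f (u * e y * e x)%g = f' (u * e y * e x)%g.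
move=> Cf hu; have [w1 f1 w10] := @fam_lexp _ W qu; have [w2 f2 w20] := fam_mul_lexp (1%:M - qu) f1.
have F0 : (lexp (Ld := W) qu 0 * lexp (1%:M - qu) 0)%g = 1%g by rewrite /lexp !mul0mx e0 mulg1.
have w2E : w2 0 = 1%:M by rewrite w20 w10 addrC subrK.
have [r r0 [_ [Zt sZ [r1 r10 ZP]] _]] := local_inverse f2 F0 w2E.
pose phi (x : V) := f (u * e (x *m qu))%g.
have sphi : smooth setT (phi : _ -> R^o).
  have := Cf u hu D (fun i => delta_mx 0 i *m qu) (fun i => qu_in _); apply: smooth_ext; first exact: openT.
  move=> x _; rewrite /phi; congr (f (u * e _)%g). by rewrite [in RHS](row_sum x) mulmx_suml; apply: eq_bigr => i _; rewrite -scalemxAl.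
exists (fun v => phi (Zt (u^-1 * v)%g)).
  apply: (@sm_ltrans _ _ _ _ lG (fun v => phi (Zt v)) u^-1%g) => c Ac.
  apply: (@smooth_comp _ _ _ (cimg c) setT phi (fun q => Zt (cinv c q))) => //.
  - exact: (cimg_open (lie_mfd lG)).
  - exact: openT.
  - by move=> j; exact: sZ.
have [r2 r20 [Z [_ _ r2P]]] := exp_mul_sub qu_sub r10; exists r2 => // y x yU xU yr xr.
have [_ /qu_inP zU zr E] := r2P y x ((qu_inP _).2 yU) ((qu_inP _).2 xU) yr xr.
rewrite -!mulgA E mulKg /phi; have := ZP _ zr; rewrite /lexp.
by rewrite mulmxBr mulmx1 qu_id // subrr e0 mulg1 => ->; rewrite qu_id.
Qed.

(** A family tangent to u starting in [U] stays there by [fam_subalg]; along it [f] and its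
    derivatives in u can be read from one smooth function on [G]. *)
Lemma CU_near f m (O : set 'rV[R]_m) S w t0 : CUW f -> fam (Ld := W) O S w -> (forall t, O t -> w t *m th = w t) ->
  O t0 -> Ug (S t0) -> exists2 f', sm f' & exists+ rho, forall t, Bo t0 rho t -> [/\ O t, Ug (S t), f (S t) = f' (S t) & forall x, inU x ->
       is_D (0 : R) (fun s : R => f (S t * e (s *: x))%g : R^o) (lam x f' (S t))].
move=> Cf fS wU Ot hu; have [f' sf [r r0 fE]] := CU_ext Cf hu; exists f' => //.
have wP t : O t -> w t *m qu = w t by move=> tO; apply: row_ext => v; rewrite mulmxA qu_id // /inU -mulmxA wU.
have [rho rho0 [Z [bO sZ Z0 ZP]]] := fam_subalg qu_sub fS wP Ot r0.
exists rho => // t tr; have [E Zs /qu_inP ZU] := ZP t tr; split.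
- exact: bO.
- by rewrite E; exact: UgM_e.
- by have := fE (Z t) 0 ZU inU0 Zs; rewrite normr0 e0 !mulg1 -E; exact.
move=> x xU; have := @Vel_mexp _ W (S t) x 0 _ sf; rewrite scale0r e0 mulg1.
apply: (der_loc (d := r / (`|x| + 1))); first by rewrite divr_gt0 // ltr_wpDl.
move=> s; rewrite subr0 ltr_pdivlMr ?ltr_wpDl // => sr; rewrite E; apply: fE => //; first exact: inUZ.
by rewrite normrZ; apply: le_lt_trans sr; rewrite ler_wpM2l // lerDl.
Qed.

Lemma fam_U m u (x : 'I_m -> V) : (forall i, inU (x i)) -> exists2 w,
  fam (Ld := W) (setT : set 'rV[R]_m) (fun t => u * e (\sum_i t 0 i *: x i))%g w & forall t, setT t -> w t *m th = w t.
move=> xU; pose X : 'M[R]_(m, D) := \matrix_i x i.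
have XE (t : 'rV[R]_m) : \sum_i t 0 i *: x i = t *m X by rewrite mulmx_sum_row; apply: eq_bigr => i _; rewrite rowK.
have XU (t : 'rV[R]_m) : inU (t *m X) by rewrite -XE; apply: inU_sum => i; exact: inUZ.
have sX : smx setT (fun t : 'rV[R]_m => t *m X) by msm.
have [w fw wP] := fam_exp_sub u qu_sub openT sX (fun t => (qu_inP _).2 (XU t)).
exists w; first by apply: fam_ext fw => t _ /=; rewrite XE.
by move=> t /wP wE; apply: row_ext => v; rewrite mulmxA -wE !mulmxA; exact: qu_in.
Qed.

Lemma CU_at f u : CUW f -> Ug u -> exists2 f', sm f' & exists+ rho, forall y, inU y -> `|y| < rho ->
    f (u * e y)%g = f' (u * e y)%g /\ forall x, inU x ->
       is_D (0 : R) (fun s : R => f (u * e y * e (s *: x))%g : R^o) (lam x f' (u * e y)%g).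
move=> Cf hu; have [w fS wU] := fam_U u (fun i => qu_in (delta_mx 0 i)).
have [|f' sf [rho rho0 fP]] := CU_near (t0 := 0) Cf fS wU I.
  by rewrite big1 ?e0 ?mulg1 // => i _; rewrite mxE scale0r.
exists f' => //; exists rho => // y yU yr; have := fP y; rewrite Bo0 => /(_ yr)[_ _].
have -> : \sum_i y 0 i *: (delta_mx 0 i *m qu) = y; last by [].
by rewrite -[RHS]qu_id // [in RHS](row_sum y) mulmx_suml; apply: eq_bigr => i _; rewrite -scalemxAl.
Qed.

Lemma lf_derive f u x : CUW f -> Ug u -> inU x -> is_D (0 : R) (fun s : R => f (u * e (s *: x))%g : R^o) (lf x f u).
move=> Cf hu xU; have [f' sf [r r0 fP]] := CU_at Cf hu.
have r1 : `|0 : V| < r by rewrite normr0.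
have [_ /(_ x xU)] := fP 0 inU0 r1.
by rewrite e0 mulg1 => h; rewrite /lf (derive1P h).
Qed.

Lemma lf_near f u : CUW f -> Ug u -> exists2 f', sm f' & exists+ rho, forall y, inU y -> `|y| < rho ->
    f (u * e y)%g = f' (u * e y)%g /\ forall x, inU x -> lf x f (u * e y)%g = lam x f' (u * e y)%g.
move=> Cf hu; have [f' sf [r r0 fP]] := CU_at Cf hu; exists f' => //; exists r => // y yU yr.
by have [fE D] := fP y yU yr; split=> // x xU; apply: derive1P; exact: D.
Qed.
Lemma lf_at f u : CUW f -> Ug u -> exists2 f', sm f' & f u = f' u /\ forall x, inU x -> lf x f u = lam x f' u.
move=> Cf hu; have [f' sf [r r0 fP]] := lf_near Cf hu; exists f' => //.
by have := fP 0 inU0; rewrite normr0 e0 mulg1 => /(_ r0).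
Qed.
Lemma lf_CU f x : CUW f -> inU x -> CUW (lf x f).
move=> Cf xU u hu m y yU; have [w fS wU] := fam_U u yU; apply: smooth_local => t0 _.
have [|f' sf [rho rho0 fP]] := CU_near (t0 := t0) Cf fS wU I.
  by apply: UgM_e => //; apply: inU_sum => i; exact: inUZ.
exists (Bo t0 rho); first exact: Bo_ctr.
apply: (@smooth_ext _ _ _ _ (fun t : 'rV[R]_m => lam x f' (u * e (\sum_i t 0 i *: y i))%g : R^o)); first exact: Bo_open.
  by move=> t; rewrite inE => /fP[_ _ _ /(_ x xU) h]; rewrite /lf (derive1P h).
apply: smooth_sub (fam_smooth fS (lam_smooth x sf)) => //.
Qed.

Lemma lf_bracket f u x y : CUW f -> Ug u -> inU x -> inU y -> lf x (lf y f) u - lf y (lf x f) u = lf (y *m adm x) f u.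
move=> Cf hu xU yU; have [f' sf [r r0 fP]] := lf_near Cf hu.
have f0 z : inU z -> lf z f u = lam z f' u by move=> zU; have := fP 0 inU0; rewrite normr0 e0 mulg1 => /(_ r0)[_]; exact.
have H z z' : inU z -> inU z' -> lf z (lf z' f) u = lam z (lam z' f') u.
  move=> zU zU'; apply: derive1P; have := @Vel_mexp _ W u z 0 _ (lam_smooth z' sf).
  rewrite scale0r e0 mulg1; apply: (der_loc (d := r / (`|z| + 1))); first by rewrite divr_gt0 // ltr_wpDl.
  move=> s; rewrite subr0 ltr_pdivlMr ?ltr_wpDl // => sr. apply: (fP (s *: z) _ _).2 => //; first exact: inUZ.
  by rewrite normrZ; apply: le_lt_trans sr; rewrite ler_wpM2l // lerDl.
by rewrite !H // f0 ?ld_lam_bracket //; exact: inU_lie.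
Qed.
Lemma CUD f h : CUW f -> CUW h -> CUW (fun u => f u + h u).
by move=> Cf Ch u hu m x xU; apply: smoothD; [exact: openT|exact: Cf|exact: Ch]. Qed.
Lemma CUM f h : CUW f -> CUW h -> CUW (fun u => f u * h u).
by move=> Cf Ch u hu m x xU; apply: smoothM; [exact: openT|exact: Cf|exact: Ch]. Qed.
Lemma CU_cst (a : R) : CUW (fun=> a).
by move=> u hu m x xU; exact: smooth_cst. Qed.
Lemma CU_eq f h : (forall u, Ug u -> f u = h u) -> CUW f -> CUW h.
move=> E Cf u hu m x xU; apply: smooth_ext (Cf u hu m x xU); first exact: openT.
by move=> t _; apply: E; apply: UgM_e => //; apply: inU_sum => i; exact: inUZ.
Qed.
Lemma lfM f h u x : CUW f -> CUW h -> Ug u -> inU x -> lf x (fun v => f v * h v) u = f u * lf x h u + lf x f u * h u.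
move=> Cf Ch hu xU; apply: derive1P.
have := deriveM1 (lf_derive Cf hu xU) (lf_derive Ch hu xU); rewrite scale0r e0 mulg1.
by rewrite addrC.
Qed.
Lemma lf_lin (a : R) f h u x : CUW f -> CUW h -> Ug u -> inU x -> lf x (fun v => a * f v + h v) u = a * lf x f u + lf x h u.
move=> Cf Ch hu xU; apply: derive1P.
have D1 := is_deriveMl a (lf_derive Cf hu xU); have D2 := lf_derive Ch hu xU.
by have := is_deriveD D1 D2; rewrite [lf x f u * a]mulrC.
Qed.

Implicit Types (a b c : V).

(** The gradient in the left trivialization. Inserting [qu] restricts the derivatives to directions
    in u, where [lf] is controlled, and makes the gradient an element of u ([grd_in]). *)
Definition grd f u : V := \row_i lf (delta_mx 0 i *m qu) f u.

Lemma lf_suml f u x : CUW f -> Ug u -> lf (x *m qu) f u = dot (grd f u) x.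
move=> Cf hu; have [f' sf [_ fP]] := lf_at Cf hu; rewrite fP; last exact: qu_in.
rewrite dotE {1}(row_sum x) mulmx_suml.
have gE i : grd f u 0 i = lam (delta_mx 0 i *m qu) f' u by rewrite mxE fP //; exact: qu_in.
under [RHS]eq_bigr do rewrite gE.
elim: (index_enum _) => [|i s IH]; first by rewrite !big_nil lam0.
by rewrite !big_cons -scalemxAl ld_lamL // IH mulrC.
Qed.
Lemma lf_grd f u x : CUW f -> Ug u -> inU x -> lf x f u = dot (grd f u) x.
by move=> Cf hu xU; rewrite -{1}(qu_id xU) lf_suml. Qed.
Lemma grd_in f u : CUW f -> Ug u -> inU (grd f u).
move=> Cf hu; rewrite -[grd f u]mulmx1; suff -> : grd f u *m 1%:M = grd f u *m qu by exact: qu_in.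
apply: dot_inj => x; rewrite mulmx1 dot_mx qu_tr -!lf_suml // -mulmxA.
by have [-> _] := @qu_sub.
Qed.
Lemma grd_unique f u a : CUW f -> Ug u -> inU a -> (forall x, inU x -> lf x f u = dot a x) -> grd f u = a.
move=> Cf hu aU H; apply: dot_inj => x; have gU := grd_in Cf hu.
rewrite -(qu_id gU) -(qu_id aU) !dot_mx qu_tr -lf_grd ?H //; exact: qu_in.
Qed.
Lemma rf_lf f u x : Ug u -> rf x f u = lf (x *m Adm u) f u.
move=> /genT hu; rewrite /rf /lf; congr (derive1 _ 0); apply/funext => t.
by rewrite AdmP' // -scalemxAl.
Qed.

Definition piU f h u : R := 4^-1 * \sum_(j <- id_Dp W) (wedge (rf (id_X j)) (rf (id_Y j)) f h u - wedge (lf (id_X j)) (lf (id_Y j)) f h u).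

(** The r-matrix [a |-> u-part of i a], locked against unfolding. [Pop u] is its conjugate by
    [Ad u], and the difference [Rop u] is the matrix of the bracket ([piUE]). *)
Definition rr : 'M[R]_D := locked (ji *m pu).
Lemma rrE : rr = ji *m pu. Proof. by rewrite /rr -lock. Qed.
Definition Pop u : 'M[R]_D := (Adm u)^T *m rr *m Adm u.
Lemma PopE u a : a *m Pop u = a *m (Adm u)^T *m rr *m Adm u. Proof. by rewrite /Pop !mulmxA. Qed.
Definition Rop u := Pop u - rr.

Lemma rr_in a : inU (a *m rr).
by rewrite /inU rrE -!mulmxA pu_th. Qed.
Lemma rr_skew a b : inU a -> inU b -> dot (a *m rr) b = - dot a (b *m rr).
move=> aU bU; have h1 := sum_dot aU bU; have h2 := sum_dot bU aU.
have : \sum_(j <- id_Dp W) (dot a (id_X j) * dot b (id_Y j) - dot a (id_Y j) * dot b (id_X j)) =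
    - \sum_(j <- id_Dp W) (dot b (id_X j) * dot a (id_Y j) - dot b (id_Y j) * dot a (id_X j)).
  by rewrite -sumrN; apply: eq_bigr => j _; ring.
by rewrite h1 h2 rrE !mulmxA [dot a _]dotC => h; lra.
Qed.

Lemma trU u a : Ug u -> inU a -> inU (a *m (Adm u)^T).
move=> hu aU; have := Adm_th hu => /(congr1 trmx); rewrite !trmx_mul th_tr => E.
by rewrite /inU -mulmxA E mulmxA aU.
Qed.
Lemma AdmTK u : Ug u -> (Adm u)^T *m Adm u = 1%:M /\ Adm u *m (Adm u)^T = 1%:M.
by move=> hu; have h := Adm_orth hu; split=> //; exact: mulmx1C. Qed.
(** [sum_dot] contracts the sum over the roots twice: for the left invariant fields directly, for
    the right invariant ones after rotating the gradients by the transpose of [Ad u]. *)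
Lemma piUE f h u : CUW f -> CUW h -> Ug u -> piU f h u = - 2^-1 * dot (grd f u *m Rop u) (grd h u).
move=> Cf Ch hu; set a := grd f u; set b := grd h u.
have aU : inU a := grd_in Cf hu; have bU : inU b := grd_in Ch hu.
have L f' j : CUW f' -> (lf (id_X j) f' u = dot (grd f' u) (id_X j)) * (lf (id_Y j) f' u = dot (grd f' u) (id_Y j)) by move=> C'; split; apply: lf_grd => //; [exact: X_th|exact: Y_th].
have Lr f' j : CUW f' -> (rf (id_X j) f' u = dot (grd f' u *m (Adm u)^T) (id_X j)) *
    (rf (id_Y j) f' u = dot (grd f' u *m (Adm u)^T) (id_Y j)).
  move=> C'; split; rewrite rf_lf // lf_grd ?dot_mx ?trmxK //; apply: inU_Adm => //; [exact: X_th|exact: Y_th].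
have -> : piU f h u = 4^-1 * (- (2 * dot (a *m (Adm u)^T *m ji *m pu) (b *m (Adm u)^T)) + (2 * dot (a *m ji *m pu) b)).
  rewrite /piU -(sum_dot (trU hu aU) (trU hu bU)) -[2 * dot (a *m ji *m pu) b]opprK -(sum_dot aU bU) -sumrN -big_split /=.
  congr (_ * _); apply: eq_bigr => j _. by rewrite /wedge !(L _ _ Cf) !(L _ _ Ch) !(Lr _ _ Cf) !(Lr _ _ Ch); ring.
rewrite /Rop mulmxBr dotBl PopE rrE !mulmxA.
have -> : dot (a *m (Adm u)^T *m ji *m pu) (b *m (Adm u)^T) = dot (a *m (Adm u)^T *m ji *m pu *m Adm u) b by rewrite [RHS]dot_mx.
by field.
Qed.

Lemma Rop_in u a : Ug u -> inU a -> inU (a *m Rop u).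
move=> hu aU; rewrite /Rop mulmxBr -scaleN1r addrC; apply: inUL; first exact: rr_in.
by rewrite PopE; apply: inU_Adm => //; exact: rr_in.
Qed.
Lemma Pop_in u a : Ug u -> inU (a *m Pop u).
by move=> hu; rewrite PopE; apply: inU_Adm => //; exact: rr_in. Qed.
Lemma Pop_skew u a b : Ug u -> inU a -> inU b -> dot (a *m Pop u) b = - dot a (b *m Pop u).
move=> hu aU bU; rewrite PopE dot_mx (rr_skew (trU hu aU) (trU hu bU)).
by rewrite PopE [in RHS]dotC [in RHS]dot_mx dotC.
Qed.
Lemma Rop_skew u a b : Ug u -> inU a -> inU b -> dot (a *m Rop u) b = - dot a (b *m Rop u).
move=> hu aU bU; rewrite /Rop !mulmxBr dotBl (Pop_skew hu aU bU) (rr_skew aU bU).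
by rewrite dotDr dotNr; ring.
Qed.
Lemma s_lie x y : x *m pu = 0 -> y *m pu = 0 -> y *m adm x *m pu = 0.
have S z : z *m pu = 0 -> z = z *m pa + z *m pn by move=> z0; have := pu_sum W => /(congr1 (mulmx z)); rewrite !mulmxDr z0 add0r mulmx1.
have pnu z : z *m pn *m pu = 0.
  have := pu_sum W => /(congr1 (mulmx (z *m pn))); rewrite !mulmxDr mulmx1 -!mulmxA pn_pa pn_pn mulmx0 addr0.
  by move/eqP; rewrite -subr_eq0 addrK => /eqP.
have admD' : forall z w, adm (z + w) = adm z + adm w by move=> z w; have := @ld_admL _ W 1 z w; rewrite !scale1r.
have alt z w : w *m adm z = - (z *m adm w).
  have := ld_adm_alt (z + w); rewrite admD' mulmxDl !mulmxDr !ld_adm_alt add0r addr0.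
  by move/eqP; rewrite addr_eq0 => /eqP ->; rewrite opprK.
have aa z w : w *m pa *m adm (z *m pa) = 0 by rewrite -mulmxA pa_ad mulmx0.
have na z w : w *m pn *m adm (z *m pa) *m pu = 0 by rewrite -[w *m pn *m _]mulmxA -pn_ada !mulmxA pnu.
have nn z w : w *m pn *m adm (z *m pn) *m pu = 0 by rewrite -[w *m pn *m _]mulmxA -pn_adn !mulmxA pnu.
move=> /S -> /S ->; rewrite admD' mulmxDl !mulmxDr !mulmxDl aa na nn mul0mx.
by rewrite [_ *m pa *m adm (_ *m pn)]alt mulNmx na oppr0 !addr0.
Qed.
Lemma admD x y : adm (x + y) = adm x + adm y.
by have := @ld_admL _ W 1 x y; rewrite !scale1r. Qed.
Lemma adm_alt x y : y *m adm x = - (x *m adm y).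
have := ld_adm_alt (x + y); rewrite admD mulmxDl !mulmxDr !ld_adm_alt add0r addr0.
by move/eqP; rewrite addr_eq0 => /eqP ->; rewrite opprK.
Qed.
Lemma pu_pu : pu *m pu = pu.
by apply: row_ext => x; rewrite mulmxA pu_id // -mulmxA pu_th. Qed.

(* The modified classical Yang-Baxter equation: take the u-part of the bracket of
   [i a - rho a] and [i b - rho b], which lies in s. *)
Lemma rr_mcybe a b : inU a -> inU b -> (b *m rr) *m adm (a *m rr) - (b *m adm (a *m rr) + (b *m rr) *m adm a) *m rr = b *m adm a.
move=> aU bU; have S (z : V) : (z *m ji - z *m rr) *m pu = 0.
  by rewrite mulmxBl rrE !mulmxA -[z *m ji *m pu *m pu]mulmxA pu_pu subrr.
have := s_lie (S a) (S b); rewrite mulmxBl.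
have jj (z : V) : z *m ji *m ji = - z by rewrite -mulmxA ji_sq mulmxN mulmx1.
have ad1 z w : w *m adm (z *m ji - z *m rr) = w *m adm z *m ji - w *m adm (z *m rr) by rewrite -[- (z *m rr)]scaleN1r admD admZ scaleN1r ji_adl mulmxBr mulmxA.
rewrite !ad1 -!mulmxA; have cj z : ji *m (adm z *m (ji *m pu)) = adm z *m (ji *m (ji *m pu)).
  by rewrite mulmxA ji_adr -mulmxA.
rewrite !mulmxBl -!mulmxA; rewrite [b *m (ji *m (adm a *m _))](_ : _ = - (b *m adm a)).
  rewrite [b *m (ji *m (adm (a *m rr) *m pu))](_ : _ = b *m adm (a *m rr) *m rr); last first.
    by rewrite rrE !mulmxA -[b *m ji *m _]mulmxA ji_adr !mulmxA.
  move=> E; have pz z : inU z -> z *m pu = z by exact: pu_id.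
  have E1 : b *m (rr *m (adm (a *m rr) *m pu)) = b *m rr *m adm (a *m rr) by rewrite !mulmxA pz //; apply: inU_lie; exact: rr_in.
  have E2 : b *m (rr *m (adm a *m (ji *m pu))) = b *m rr *m adm a *m rr by rewrite rrE !mulmxA.
  rewrite E1 E2 in E; rewrite mulmxDl; apply/eqP; rewrite -subr_eq0 -E; apply/eqP.
  rewrite !mulmxA; move: (b *m rr *m adm (a *m rr)) (b *m adm (a *m rr) *m rr) (b *m rr *m adm a *m rr) (b *m adm a) => p q r s.
  by apply/rowP => i; rewrite !mxE; ring.
have jjp : ji *m (ji *m pu) = - pu by rewrite mulmxA ji_sq mulNmx mul1mx.
by rewrite cj jjp !mulmxN mulmxA pu_id //; exact: inU_lie.
Qed.

(** * The Jacobi identity *)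

Definition tri a b c : R := dot (b *m adm a) c.

Lemma tri12 a b c : tri a b c = - tri b a c.
by rewrite /tri adm_alt dotNl. Qed.
Lemma tri23 a b c : inU a -> tri a b c = - tri a c b.
by move=> aU; rewrite /tri dot_mx adm_tr aU mulmxN dotNr dotC. Qed.
Lemma tri_rot a b c : inU a -> tri a b c = tri c a b.
by move=> aU; rewrite tri23 // tri12 opprK. Qed.
Lemma triBl a a' b c : tri (a - a') b c = tri a b c - tri a' b c.
by rewrite /tri -[- a']scaleN1r admD admZ scaleN1r mulmxBr dotBl. Qed.
Lemma triBm a b b' c : tri a (b - b') c = tri a b c - tri a b' c.
by rewrite /tri mulmxBl dotBl. Qed.

Definition mcybe (P : 'M[R]_D) := forall a b, inU a -> inU b ->
  (b *m P) *m adm (a *m P) - (b *m adm (a *m P) + (b *m P) *m adm a) *m P = b *m adm a.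

Lemma Pop_mcybe u : Ug u -> mcybe (Pop u).
move=> hu a b aU bU; have [TM MT] := AdmTK hu; have gT := genT hu.
have L x y : (y *m Adm u) *m adm (x *m Adm u) = y *m adm x *m Adm u by rewrite -!mulmxA Adm_lie.
set a' := a *m (Adm u)^T; set b' := b *m (Adm u)^T.
have aE : a = a' *m Adm u by rewrite /a' -mulmxA TM mulmx1.
have bE : b = b' *m Adm u by rewrite /b' -mulmxA TM mulmx1.
have PE (z : V) : z *m Adm u *m Pop u = z *m rr *m Adm u by rewrite PopE -[z *m _ *m _^T]mulmxA MT mulmx1.
rewrite aE bE !PE !L -mulmxDl PE -mulmxBl; congr (_ *m _).
by apply: rr_mcybe; exact: trU.
Qed.

Lemma mcybe_tri (P : 'M[R]_D) a b c : mcybe P -> (forall x y, inU x -> inU y -> dot (x *m P) y = - dot x (y *m P)) ->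
  (forall x, inU x -> inU (x *m P)) -> inU a -> inU b -> inU c ->
  tri (a *m P) (b *m P) c + tri (b *m P) (c *m P) a + tri (c *m P) (a *m P) b = tri a b c.
move=> mP sP PU aU bU cU; rewrite [RHS]/tri -(mP _ _ aU bU) mulmxDl dotBl dotDl !sP //; last first.
- by apply: inU_lie => //; exact: PU.
- by apply: inU_lie => //; exact: PU.
rewrite -/(tri _ _ _) -/(tri (a *m P) b (c *m P)) -/(tri a (b *m P) (c *m P)).
have r1 := @tri_rot (a *m P) b (c *m P) (PU _ aU); have r2 := @tri_rot (b *m P) (c *m P) a (PU _ bU).
by rewrite r1 r2; ring.
Qed.

(** In the cyclic sum the mixed terms in [Pop u] and [rr] cancel; the Yang-Baxter expressions of the
    two matrices remain with opposite signs. By [mcybe_tri] both are equal to [tri a1 a2 a3], so the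
    inhomogeneous term of the modified equation drops out. *)
Lemma jac_alg u a1 a2 a3 : Ug u -> inU a1 -> inU a2 -> inU a3 ->
  let w a := a *m Rop u in let g a b c := tri (w a) (w b) c + dot (b *m adm (w a) *m Pop u - b *m Pop u *m adm (w a)) c in
  g a1 a2 a3 + g a2 a3 a1 + g a3 a1 a2 = 0.
move=> hu a1U a2U a3U w g; have RU a : inU a -> inU (a *m rr) by move=> _; exact: rr_in.
have PU a : inU a -> inU (a *m Pop u) by move=> _; exact: Pop_in.
have wE a : w a = a *m Pop u - a *m rr by rewrite /w /Rop mulmxBr.
have wU a : inU a -> inU (w a) by exact: Rop_in.
have gE a b c : inU a -> inU b -> inU c -> g a b c = tri (w a) (w b) c - tri (c *m Pop u) (w a) b - tri (w a) (b *m Pop u) c.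
  move=> aU bU cU; rewrite /g dotBl (Pop_skew hu _ cU); last by apply: inU_lie => //; exact: wU.
  by have r1 := @tri_rot (w a) b (c *m Pop u) (wU _ aU); rewrite -r1 /tri; lra.
rewrite !gE // !wE !(triBl, triBm).
have sk x y : inU x -> inU y -> dot (x *m Pop u) y = - dot x (y *m Pop u) by exact: Pop_skew.
have := mcybe_tri (Pop_mcybe hu) sk PU a1U a2U a3U.
have := mcybe_tri rr_mcybe rr_skew RU a1U a2U a3U.
lra.
Qed.

Implicit Types (z : V) (k : G) (F : G -> R).

Lemma grd_smooth f u m (x : 'I_m -> V) : CUW f -> Ug u -> (forall i, inU (x i)) ->
  smx [set: 'rV[R]_m] (fun t => grd f (u * e (\sum_i t 0 i *: x i))%g).
move=> Cf hu xU i j; fun_mxE.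
exact: (lf_CU Cf (qu_in _)).
Qed.
Lemma Adm_smooth u m (x : 'I_m -> V) : Ug u -> smx [set: 'rV[R]_m] (fun t => Adm (u * e (\sum_i t 0 i *: x i))%g).
move=> hu; apply: (@smx_ext _ _ _ _ _ (fun t : 'rV[R]_m => Adm u *m expm (- adm (\sum_i t 0 i *: x i)))).
- exact: openT.
- by move=> t _; rewrite AdmM ?Adm_exp //; [exact: genT hu|exact: gen_e].
have sX : smx setT (fun t : 'rV[R]_m => \sum_i t 0 i *: x i); last by msm.
apply: (@smx_ext _ _ _ _ _ (fun t : 'rV[R]_m => t *m \matrix_i x i)); [exact: openT| |msm].
by move=> t _; rewrite mulmx_sum_row; apply: eq_bigr => i _; rewrite rowK.
Qed.

Lemma piU_CU f h : CUW f -> CUW h -> CUW (piU f h).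
move=> Cf Ch u hu m x xU; have gf := grd_smooth Cf hu xU; have gh := grd_smooth Ch hu xU.
have sA := Adm_smooth x hu.
apply: (@smooth_ext _ _ _ _ (fun t : 'rV[R]_m => (((- 2^-1)%:M : 'M[R]_1) *m ((grd f (u * e (\sum_i t 0 i *: x i))%g
   *m Rop (u * e (\sum_i t 0 i *: x i))%g) *m (grd h (u * e (\sum_i t 0 i *: x i))%g)^T)) 0 0 : R^o)); first exact: openT.
  move=> t _; rewrite piUE //; last by apply: UgM_e => //; apply: inU_sum => i; exact: inUZ. by rewrite mul_scalar_mx mxE.
have H : smx [set: 'rV[R]_m] (fun t => ((- 2^-1)%:M : 'M[R]_1) *m ((grd f (u * e (\sum_i t 0 i *: x i))%g
   *m Rop (u * e (\sum_i t 0 i *: x i))%g) *m (grd h (u * e (\sum_i t 0 i *: x i))%g)^T)); last exact: H.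
by rewrite /Rop; msm.
Qed.

Definition dgrd z f u : V := \row_i lf z (lf (delta_mx 0 i *m qu) f) u.

Lemma grd_deriv z f u : CUW f -> Ug u -> inU z -> mder (fun s : R => grd f (u * e (s *: z))%g) 0 (dgrd z f u).
move=> Cf hu zU i j; rewrite mxE; fun_mxE.
by apply: lf_derive => //; apply: lf_CU => //; exact: qu_in.
Qed.
Lemma dgrdE z f u y : CUW f -> Ug u -> inU z -> inU y -> dot (dgrd z f u) y = lf z (lf y f) u.
move=> Cf hu zU yU; have h1 := mderMl y^T (grd_deriv Cf hu zU) 0 0.
have h2 := lf_derive (lf_CU Cf yU) hu zU; apply: der_uniq h1 _.
have E : (fun s : R => (grd f (u * e (s *: z))%g *m y^T) 0 0) = (fun s => lf y f (u * e (s *: z))%g) by apply/funext => s; rewrite lf_grd //; apply: UgM_e => //; exact: inUZ.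
by rewrite E.
Qed.

(** Moving [u] along [z] multiplies [Ad u] by [expm (- s adm z)]; as [adm z] is skew for [z] in u,
    the transposed factor contributes the other half of a commutator. *)
Lemma Rop_deriv z u : Ug u -> inU z -> mder (fun s : R => Rop (u * e (s *: z))%g) 0 (adm z *m Pop u - Pop u *m adm z).
move=> hu zU; have hN : mder (fun s : R => Adm (u * e (s *: z))%g) 0 (Adm u *m - adm z).
  have := mderMr (Adm u) (expm_line (- adm z) 0); rewrite scale0r expm0 mulmx1. move=> h i j; have := h i j.
  have E : (fun s : R => Adm u *m expm (s *: - adm z)) = (fun s : R => Adm (u * e (s *: z))%g) by apply/funext => s; rewrite AdmM ?Adm_exp ?admZ ?scalerN //; [exact: genT hu|exact: gen_e].
  by rewrite -[fun s : R => (Adm u *m expm (s *: - adm z)) i j]/(fun s : R => (fun s : R => Adm u *m expm (s *: - adm z)) s i j) E.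
have := mderD (mderM (mderMl (@rr) (mder_tr hN)) hN) (mder_cst (- @rr) 0).
move/mder_eq; apply; rewrite scale0r e0 mulg1 addr0 trmx_mul linearN /= adm_tr zU opprK /Pop !mulmxA.
by rewrite mulmxN.
Qed.

Lemma lf_piU z f h u : CUW f -> CUW h -> Ug u -> inU z -> lf z (piU f h) u =
  - 2^-1 * (dot (dgrd z f u *m Rop u) (grd h u) + dot (grd f u *m (adm z *m Pop u - Pop u *m adm z)) (grd h u)
     + dot (grd f u *m Rop u) (dgrd z h u)).
move=> Cf Ch hu zU; apply: derive1P.
have hu' s : Ug (u * e (s *: z))%g by apply: UgM_e => //; exact: inUZ.
under eq_fun do rewrite piUE //.
have D1 := mderM (mderM (grd_deriv Cf hu zU) (Rop_deriv hu zU)) (mder_tr (grd_deriv Ch hu zU)).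
have := is_deriveMl (- 2^-1) (D1 0 0); rewrite scale0r e0 mulg1 mulrC => D2.
have addE (B B' : 'M[R]_1) : (B + B') 0 0 = B 0 0 + B' 0 0 by rewrite mxE.
by move: D2; rewrite mulmxDl !addE.
Qed.

Lemma jac_lin (p q r t1 t2 t3 d1 d2 d3 : R) : t1 + d1 + (t2 + d2) + (t3 + d3) = 0 ->
  4^-1 * (- p + (q + t1) + d1) + 4^-1 * (- q + (r + t2) + d2) + 4^-1 * (- r + (p + t3) + d3) = 0.
lra. Qed.
(** Second derivatives of the functions occur in pairs taken in opposite orders along the fields
    [grd f u *m Rop u]; [lf_bracket] turns each pair into a [tri] term, and [jac_alg] disposes of
    what is left. *)
Lemma piU_jacobi f1 f2 f3 u : CUW f1 -> CUW f2 -> CUW f3 -> Ug u -> piU f1 (piU f2 f3) u + piU f2 (piU f3 f1) u + piU f3 (piU f1 f2) u = 0.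
move=> C1 C2 C3 hu.
have gU f : CUW f -> inU (grd f u) by move=> Cf; exact: grd_in.
have wU f : CUW f -> inU (grd f u *m Rop u) by move=> Cf; apply: Rop_in => //; exact: gU.
have H f f' f'' : CUW f -> CUW f' -> CUW f'' -> piU f (piU f' f'') u = 4^-1 *
   (- lf (grd f u *m Rop u) (lf (grd f'' u *m Rop u) f') u + lf (grd f u *m Rop u) (lf (grd f' u *m Rop u) f'') u
    + dot (grd f' u *m adm (grd f u *m Rop u) *m Pop u - grd f' u *m Pop u *m adm (grd f u *m Rop u)) (grd f'' u)).
  move=> Cf Cf' Cf''; rewrite piUE //; last exact: piU_CU.
  have wf := wU _ Cf; have Cp := piU_CU Cf' Cf''; set w := grd f u *m Rop u in wf *. rewrite dotC -(lf_grd Cp hu wf) lf_piU //.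
  have -> : grd f' u *m (adm w *m Pop u - Pop u *m adm w) = grd f' u *m adm w *m Pop u - grd f' u *m Pop u *m adm w by rewrite mulmxBr !mulmxA.
  have dU : inU (dgrd w f' u).
    have H0 : dgrd w f' u *m qu = dgrd w f' u.
      apply: dot_inj => y; rewrite dot_mx qu_tr (dgrdE Cf' hu wf (qu_in y)).
      have Cl i : CUW (lf (delta_mx 0 i *m qu) f') by apply: lf_CU => //; exact: qu_in.
      rewrite [RHS]dotE; have -> : y *m qu = \sum_i y 0 i *: (delta_mx 0 i *m qu).
        by rewrite {1}(row_sum y) mulmx_suml; apply: eq_bigr => i _; rewrite -scalemxAl.
      rewrite -(dgrdE Cf' hu wf); last by apply: inU_sum => i; apply: inUZ; exact: qu_in.
      rewrite (big_morph _ (fun p q => dotDr p q _) (_ : dot _ 0 = 0)); last by rewrite dotC /dot mul0mx mxE.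
      by apply: eq_bigr => i _; rewrite dotZr (dgrdE Cf' hu wf (qu_in _)) mxE mulrC.
    by rewrite -H0; exact: qu_in.
  rewrite (Rop_skew hu dU (gU _ Cf'')) (dgrdE Cf' hu wf (wU _ Cf'')). rewrite [dot _ (dgrd _ _ _)]dotC (dgrdE Cf'' hu wf (wU _ Cf')).
  move: (lf w (lf (grd f'' u *m Rop u) f') u) (lf w (lf (grd f' u *m Rop u) f'') u) (dot _ _) => p q r. by clear; field.
rewrite !H //.
have B f f' f'' : CUW f -> CUW f' -> CUW f'' -> lf (grd f u *m Rop u) (lf (grd f' u *m Rop u) f'') u =
    lf (grd f' u *m Rop u) (lf (grd f u *m Rop u) f'') u + tri (grd f u *m Rop u) (grd f' u *m Rop u) (grd f'' u).
  move=> Cf Cf' Cf''; apply/eqP; rewrite addrC -subr_eq; apply/eqP. have w1 := wU _ Cf; have w2 := wU _ Cf'.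
  by rewrite (lf_bracket Cf'' hu w1 w2) (lf_grd Cf'' hu (inU_lie w1 w2)) /tri dotC.
rewrite (B f1 f2 f3) // (B f2 f3 f1) // (B f3 f1 f2) //.
exact: (jac_lin _ _ _ (jac_alg hu (gU _ C1) (gU _ C2) (gU _ C3))).
Qed.

Lemma piU_skew f h u : CUW f -> CUW h -> Ug u -> piU f h u = - piU h f u.
move=> Cf Ch hu; rewrite !piUE // (Rop_skew hu (grd_in Cf hu) (grd_in Ch hu)) [dot (grd f u) _]dotC; ring.
Qed.
Lemma lf_eq f h u x : (forall v, Ug v -> f v = h v) -> Ug u -> inU x -> lf x f u = lf x h u.
move=> E hu xU; rewrite /lf; congr (derive1 _ 0); apply/funext => t; apply: E.
by apply: UgM_e => //; exact: inUZ.
Qed.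
Lemma grd_eq f h u : (forall v, Ug v -> f v = h v) -> Ug u -> grd f u = grd h u.
by move=> E hu; apply/rowP => i; rewrite !mxE; apply: lf_eq => //; exact: qu_in. Qed.
Lemma piU_lin (r : R) f1 f2 h u : CUW f1 -> CUW f2 -> CUW h -> Ug u -> piU (fun v => r * f1 v + f2 v) h u = r * piU f1 h u + piU f2 h u.
move=> C1 C2 Ch hu; have C12 : CUW (fun v => r * f1 v + f2 v) by apply: CUD => //; apply: CUM => //; exact: CU_cst.
have -> : piU (fun v => r * f1 v + f2 v) h u = - 2^-1 * dot ((r *: grd f1 u + grd f2 u) *m Rop u) (grd h u).
  rewrite piUE //; congr (_ * dot (_ *m _) _); apply/rowP => i; rewrite !mxE. by apply: lf_lin => //; exact: qu_in.
by rewrite !piUE // mulmxDl dotDl -scalemxAl dotZl; ring.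
Qed.

Lemma piU_leibniz f1 f2 h u : CUW f1 -> CUW f2 -> CUW h -> Ug u -> piU (fun v => f1 v * f2 v) h u = f1 u * piU f2 h u + piU f1 h u * f2 u.
move=> C1 C2 Ch hu; have C12 := CUM C1 C2.
have -> : piU (fun v => f1 v * f2 v) h u = - 2^-1 * dot ((f1 u *: grd f2 u + f2 u *: grd f1 u) *m Rop u) (grd h u).
  rewrite piUE //; congr (_ * dot (_ *m _) _); apply/rowP => i; rewrite !mxE. by rewrite lfM //; [ring|exact: qu_in].
by rewrite !piUE // mulmxDl dotDl -!scalemxAl !dotZl; ring.
Qed.

(** * The bracket on U / K0 *)

Definition inQ a := inU a /\ a *m ta = - a.
Definition Kinv F := CUW F /\ forall u k, Ug u -> K0g k -> F (u * k)%g = F u.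

Lemma Kinv_Q F u : Kinv F -> Ug u -> inQ (grd F u).
move=> [CF KF] hu; have aU := grd_in CF hu; set a := grd F u in aU *; split=> //.
have K0 x : inK x -> dot a x = 0.
  move=> [xU xt]; rewrite -lf_grd //; apply: derive1P.
  have E : (fun t : R => F (u * e (t *: x))%g : R^o) = (fun=> F u) by apply/funext => t; rewrite KF //; apply: gen_e; split; [exact: inUZ|rewrite /= -scalemxAl xt].
  by rewrite E; exact: is_derive_cst.
have sK : inK (a + a *m ta).
  split; first by rewrite /inU mulmxDl aU -mulmxA ta_th mulmxA aU. by rewrite mulmxDl -mulmxA ta_sq mulmx1 addrC.
apply/eqP; rewrite -addr_eq0 addrC; apply/eqP; apply: dot_eq0.
rewrite dotDl K0 // add0r dot_mx ta_tr mulmxDl -mulmxA ta_sq mulmx1 [_ + a]addrC; exact: K0.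
Qed.

(** For [a] in i p0 the vector [i a] is in [g0], so its u-part lies in [k0] by [pu_iwa]: [rr] maps i
    p0 into its orthogonal complement in u. *)
Lemma inQ_rr a b : inQ a -> inQ b -> dot (a *m rr) b = 0.
move=> [aU at_] [bU bt]; have r_ta : a *m rr *m ta = a *m rr.
  by rewrite rrE mulmxA; apply: pu_iwa; rewrite -mulmxA ji_ta mulmxN mulmxA at_ mulNmx opprK.
have : dot (a *m rr *m ta) (b *m ta) = dot (a *m rr) b by rewrite dot_mx ta_tr -mulmxA ta_sq mulmx1.
by rewrite r_ta bt dotNr => h; lra.
Qed.

Lemma piU_Kinv F H u : Kinv F -> Kinv H -> Ug u -> piU F H u = - 2^-1 * dot (grd F u *m Pop u) (grd H u).
move=> KF KH hu; rewrite piUE //; [|by case: KF|by case: KH].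
by rewrite /Rop mulmxBr dotBl (inQ_rr (Kinv_Q KF hu) (Kinv_Q KH hu)) subr0.
Qed.
Lemma grd_K F u k : Kinv F -> Ug u -> K0g k -> grd F (u * k)%g = grd F u *m Adm k.
move=> KF hu hk; have [CF Kf] := KF; have kU := K0_U hk; have huk := genM hu kU.
have gU := grd_in CF hu; apply: grd_unique => //; first exact: inU_Adm.
move=> x xU; have kT := genT hk.
have -> : lf x F (u * k)%g = lf (x *m Adm k^-1%g) F u.
  rewrite /lf; congr (derive1 _ 0); apply/funext => t.
  have -> : (u * k * e (t *: x) = u * e (t *: (x *m Adm k^-1%g)) * k)%g by rewrite -!mulgA AdmP' // -scalemxAl -mulmxA AdmVK' // mulmx1.
  rewrite Kf //; apply: UgM_e => //; apply: inUZ; apply: inU_Adm => //; exact: genV.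
rewrite lf_grd //; last by apply: inU_Adm => //; exact: genV.
have xE : x = x *m Adm k^-1%g *m Adm k by rewrite -mulmxA AdmVK' // mulmx1.
by rewrite [in RHS]xE Adm_dot.
Qed.

(** Right translation by [k] rotates both gradients by [Ad k] and conjugates [Pop] accordingly;
    [Ad k] is orthogonal. Hence [pi0] does not depend on the representative chosen by [crep]. *)
Lemma piU_K F H u k : Kinv F -> Kinv H -> Ug u -> K0g k -> piU F H (u * k)%g = piU F H u.
move=> KF KH hu hk; have kU := K0_U hk; rewrite !piU_Kinv //; last exact: genM.
rewrite !grd_K // PopE AdmM; [|exact: genT hu|exact: genT hk].
by have [_ MT] := AdmTK kU; rewrite trmx_mul !mulmxA -[grd F u *m _ *m _]mulmxA MT mulmx1 Adm_dot // PopE.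
Qed.

Notation P := (left_coset (@K0g)).

Lemma coset_eq u v : P u = P v -> exists2 k, K0g k & u = (v * k)%g.
move=> E; have : P u u by exists 1%g; [exact: gen1|rewrite mulg1].
by rewrite E => -[k hk <-]; exists k.
Qed.
Lemma cosetK u k : K0g k -> P (u * k)%g = P u.
move=> hk; apply/seteqP; split=> x [k' hk' <-].
  by exists (k * k')%g; [exact: genM|rewrite mulgA].
by exists (k^-1 * k')%g; [apply: genM => //; exact: genV|rewrite mulgA mulgK].
Qed.

Definition CMW : set (set G -> R) := [set f | CUW (fun u => f (P u))].
Definition MW : set (set G) := coset_space (@Ug) K0g.
Definition crep (X : set G) : G := xget 1%g [set u | Ug u /\ P u = X].
Definition pi0 (f h : set G -> R) (X : set G) : R := piU (f \o P) (h \o P) (crep X).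

Lemma Kinv_CM (f : set G -> R) : CMW f -> Kinv (f \o P).
by move=> Cf; split=> // u k hu hk /=; rewrite cosetK. Qed.
Lemma pi0E (f h : set G -> R) u : CMW f -> CMW h -> Ug u -> pi0 f h (P u) = piU (f \o P) (h \o P) u.
move=> Cf Ch hu; rewrite /pi0; have [hc cE] : Ug (crep (P u)) /\ P (crep (P u)) = P u.
  exact: (@xgetI _ 1%g [set w | Ug w /\ P w = P u] u (conj hu erefl)).
have [k hk ->] := coset_eq cE.
by rewrite piU_K //; exact: Kinv_CM.
Qed.
Lemma pi0_CM (f h : set G -> R) : CMW f -> CMW h -> CMW (pi0 f h).
by move=> Cf Ch; apply: CU_eq (piU_CU Cf Ch) => u hu; rewrite pi0E. Qed.
Lemma pi0_poisson : poisson_structure MW CMW pi0.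
have M_ind (Q : set G -> Prop) : (forall u, Ug u -> Q (P u)) -> {in MW, forall X : set G, Q X} by move=> h X; rewrite inE => -[u hu <-]; exact: h.
split; first split.
- exact: pi0_CM.
- move=> f f' h h' Cf Cf' Ch Ch' ff hh; apply: M_ind => u hu; rewrite !pi0E //.
  have mM v : Ug v -> P v \in MW by move=> hv; rewrite inE; exists v.
  by rewrite !piUE // (@grd_eq (f \o P) (f' \o P)) ?(@grd_eq (h \o P) (h' \o P)) // => v /mM; [exact: hh|exact: ff].
- move=> r f1 f2 h C1 C2 Ch; apply: M_ind => u hu; rewrite !pi0E //; first exact: piU_lin.
  by apply: CUD => //; apply: CUM => //; exact: CU_cst.
- by move=> f h Cf Ch; apply: M_ind => u hu; rewrite !pi0E //; exact: piU_skew.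
- move=> f1 f2 h C1 C2 Ch; apply: M_ind => u hu; rewrite !pi0E //; first exact: piU_leibniz. exact: CUM.
- move=> f1 f2 f3 C1 C2 C3; apply: M_ind => u hu. rewrite !pi0E //; try exact: pi0_CM.
  have N (f g h : set G -> R) : CMW f -> CMW g -> CMW h -> piU (f \o P) (pi0 g h \o P) u = piU (f \o P) (piU (g \o P) (h \o P)) u.
    move=> Cf Cg Ch; have C12 := piU_CU Cg Ch; have Cp := pi0_CM Cg Ch.
    rewrite (@piUE (f \o P) (pi0 g h \o P) u Cf Cp hu) (@piUE (f \o P) _ u Cf C12 hu).
    by rewrite (@grd_eq (pi0 g h \o P) (piU (g \o P) (h \o P)) u (fun v hv => pi0E Cg Ch hv) hu).
  by rewrite !N //; exact: piU_jacobi.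
Qed.

Lemma pi0_map : poisson_map Ug CUW piU MW CMW pi0 P.
split=> [u hu|f Cf //|f h Cf Ch u]; first by exists u.
by rewrite inE => hu; exact: pi0E.
Qed.
End Poisson.

Lemma expm_fix (R : realType) n (y : 'rV[R]_n) (B : 'M[R]_n) : y *m B = 0 -> y *m expm B = y /\ y *m phim B = y.
move=> yB; have h : y *m B = (0 : 'M[R]_1) *m y by rewrite yB mul0mx.
by split; [rewrite (expm_tw h) expm0 mul1mx|rewrite (phim_tw h) phim0 mul1mx].
Qed.

(** * The group AN and its intersection with U *)

Section IwasawaAN.
Context {R : realType} {W : iwaData R}.
Notation G := (ld_G W).
Notation D := (ld_D W).
Notation adm := (@ld_adm _ W).
Notation e := (@ld_e _ W).
Notation e0 := (ld_e0 W).
Notation pu := (id_pu W).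
Notation pa := (id_pa W).
Notation pn := (id_pn W).
Notation V := 'rV[R]_D.
Notation H := (id_H W).
Notation Q := (@id_Q _ W).
Notation w := (@id_w _ W).
Notation Dp := (id_Dp W).
Implicit Types (x y z : V) (u v : G).

Definition inA x := x *m pa = x.
Definition inN x := x *m pn = x.
Definition AN : set G := [set (u * v)%g | u in e @` inA & v in e @` inN].

Lemma an_pu x : (inA x -> x *m pu = 0) /\ (inN x -> x *m pu = 0).
have := pu_sum W; split=> h.
  have := pu_sum W => /(congr1 (mulmx x)); rewrite !mulmxDr mulmx1 h. have -> : x *m pn = 0 by rewrite -h -mulmxA pa_pn mulmx0.
  by rewrite addr0 => /eqP; rewrite -subr_eq0 addrK => /eqP.
have := pu_sum W => /(congr1 (mulmx x)); rewrite !mulmxDr mulmx1 h.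
have -> : x *m pa = 0 by rewrite -h -mulmxA pn_pa mulmx0.
by rewrite addr0 => /eqP; rewrite -subr_eq0 addrK => /eqP.
Qed.

Lemma n_ideal x y : x *m pu = 0 -> inN y -> inN (y *m adm x).
move=> x0 yN; have -> : x = x *m pa + x *m pn.
  by have := pu_sum W => /(congr1 (mulmx x)); rewrite !mulmxDr mulmx1 x0 add0r.
rewrite -yN /inN admD mulmxDr mulmxDl -!mulmxA; congr (_ + _).
  by rewrite [pn *m (_ *m pn)]mulmxA pn_ada.
by rewrite [pn *m (_ *m pn)]mulmxA pn_adn.
Qed.
Lemma pn_sub : subalg (Ld := W) pn.
by split=> [|x y xN yN]; [exact: pn_pn|apply: n_ideal => //; exact: (an_pu x).2]. Qed.
Lemma s_stable x : x *m pu = 0 -> pn *m adm x *m (1%:M - pn) = 0.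
move=> x0; rewrite mulmxBr mulmx1; apply/eqP; rewrite subr_eq0; apply/eqP/row_ext => z; rewrite !mulmxA.
by rewrite (n_ideal (y := z *m pn) x0) // /inN -mulmxA pn_pn.
Qed.
Lemma n_expm x y : x *m pu = 0 -> inN y -> inN (y *m expm (adm x)).
move=> /s_stable x0 /(inP_Q pn) yN; apply/(inP_Q pn).
exact: expm_stable (stable_factor (pn_pn W) x0) yN.
Qed.
Lemma inN_N y : inN y -> inN (- y). Proof. by rewrite /inN mulNmx => ->. Qed.
Lemma puN x : x *m pu = 0 -> (- x) *m pu = 0. Proof. by rewrite mulNmx => ->; rewrite oppr0. Qed.
Lemma H_in : inA H. Proof. exact: H_pa. Qed.
Lemma Q_expm j (x : V) : j \in Dp -> inA x -> Q j *m expm (adm x) = expR (w j x) *: Q j.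
move=> jD xA; have QA : Q j *m adm x = w j x *: Q j by have := Q_ad x jD; rewrite xA.
pose F (t : R) := (expR (- w j x * t)) *: (Q j *m expm (t *: adm x)).
have dF t : mder F t 0.
  move=> i k; rewrite mxE; have h1 := mderMr (Q j) (expm_line (adm x) t) i k.
  have h2 := @is_derive_scale _ (@expR R) t (- w j x) _ (is_derive_expR _).
  have -> : (fun s => F s i k : R^o) = (fun s => expR (- w j x * s) * (Q j *m expm (s *: adm x)) i k) by apply/funext => s; rewrite /F mxE.
  have := deriveM1 h2 h1.
  have -> : (Q j *m (adm x *m expm (t *: adm x))) i k = w j x * (Q j *m expm (t *: adm x)) i k by rewrite mulmxA QA -scalemxAl mxE.
  set a := (X in is_derive _ _ _ X -> _); have -> // : a = 0 by rewrite /a; ring.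
have := mder0_cst dF 1 0; rewrite /F mulr0 expR0 scale0r expm0 !scale1r mulr1 mulmx1 => E.
by rewrite -[in RHS]E scalerA -expRD subrr expR0 scale1r.
Qed.

(** Conjugation by [e (t H)] shrinks each root line at a rate at least [m], the smallest value of
    [w j H]. Elements of [N] can so be brought near 1, where local results hold. *)
Lemma ad_contraction y (eps : R) : inN y -> 0 < eps -> exists2 t0 : R, 0 <= t0 & forall t, t0 <= t -> `|y *m expm (- adm (t *: H))| < eps.
move=> yN eps0; have [m m0 mP] : exists+ m, forall j, j \in Dp -> m <= w j H.
  have : forall j, j \in Dp -> 0 < w j H by exact: H_gt0. elim: (Dp) => [|j s IH] h; first by exists 1.
  have [|m m0 mP] := IH; first by move=> k ks; apply: h; rewrite inE ks orbT.
  exists (Num.min m (w j H)); first by rewrite lt_min m0 h // inE eqxx.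
  by move=> k; rewrite inE => /orP[/eqP ->|/mP]; rewrite ge_min ?lexx ?orbT // => ->.
pose c := \sum_(j <- Dp) `|y *m Q j|; have c0 : 0 <= c by apply: sumr_ge0.
exists (c / (eps * m)); first by rewrite divr_ge0 // mulr_ge0 // ltW.
move=> t ht; have t0 : 0 <= t by apply: le_trans ht; rewrite divr_ge0 // mulr_ge0 // ltW.
have le : `|y *m expm (- adm (t *: H))| <= expR (- (t * m)) * c.
  rewrite -yN (pn_Q y) yN mulmx_suml; apply: le_trans (ler_norm_sum _ _ _) _.
  rewrite mulr_sumr big_seq [X in _ <= X]big_seq; apply: ler_sum => j jD. have tA : inA (- t *: H) by rewrite /inA -scalemxAl H_in.
  rewrite -admN -scaleNr -mulmxA Q_expm // -scalemxAr normrZ ger0_norm ?expR_ge0 // ler_wpM2r // ler_expR.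
  have -> : w j (- t *: H) = - t * w j H.
    have := Q_ad (- t *: H) jD; have := Q_ad H jD; rewrite tA H_in admZ -scalemxAr => ->; rewrite scalerA => /eqP.
    by rewrite -subr_eq0 -scalerBl scaler_eq0 (negbTE (Q_nz jD)) orbF subr_eq0 => /eqP.
  by rewrite mulNr lerN2 ler_wpM2l // mP.
apply: le_lt_trans le _; have e1 : 1 + t * m <= expR (t * m) by exact: expR_ge1Dx.
have p1 : 0 < 1 + t * m by rewrite ltr_pwDl // mulr_ge0 // ltW.
rewrite expRN mulrC ltr_pdivrMr ?expR_gt0 //; apply: lt_le_trans (_ : eps * (1 + t * m) <= _); last by rewrite ler_pM2l.
have : c <= eps * (t * m) by move: ht; rewrite ler_pdivrMr ?mulr_gt0 // mulrCA.
by move: eps0; lra.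
Qed.
Lemma n_conj y (x : V) : ((e x)^-1 * e y * e x)%g = e (y *m expm (- adm x)).
by rewrite -Adm_exp AdmP //; exact: gen_e. Qed.
Lemma n_conj' y (x : V) : (e x * e y * (e x)^-1)%g = e (y *m expm (adm x)).
by have := n_conj y (- x); rewrite expN invgK admN opprK. Qed.
Lemma Hpu (t : R) : (t *: H) *m pu = 0.
by rewrite -scalemxAl (an_pu H).1 ?scaler0 //; exact: H_in. Qed.
(** Contracted by [e (t H)], both factors fall within the range of the local group law; the product
    found there is expanded back by the inverse conjugation. *)
Lemma N_mul y z : inN y -> inN z -> exists2 x, inN x & (e y * e z = e x)%g.
move=> yN zN; have [r r0 [Z [_ _ rP]]] := exp_mul_sub pn_sub (ltr01 : 0 < (1 : R)).
have [t1 _ t1P] := ad_contraction yN r0; have [t2 _ t2P] := ad_contraction zN r0.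
pose t := Num.max t1 t2; have ht1 := t1P t; have ht2 := t2P t.
have K q : inN q -> inN (q *m expm (- adm (t *: H))) by move=> qN; rewrite -admN; apply: n_expm => //; apply: puN; exact: Hpu.
rewrite !le_max !lexx ?orbT in ht1 ht2.
have [_] := rP _ _ (K _ yN) (K _ zN) (ht1 isT) (ht2 isT); move: (Z _) => x xN _ E.
exists (x *m expm (adm (t *: H))); first by apply: n_expm => //; exact: Hpu.
by rewrite -(n_conj' x (t *: H)) -E -(n_conj y) -(n_conj z) !mulgA mulgV mul1g !mulgK.
Qed.

Lemma exp_commute (x y : V) : x *m adm y = 0 -> e (x + y) = (e x * e y)%g.
move=> xy; have H1 t : 0 <= t <= 1 -> Vel (Ld := W) (fun s => e (s *: x) * e (s *: y))%g (x + y) t.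
  move=> _; have := Vel_mul_exp (Vel_exp (Ld := W) x t) (mder_scale y t); rewrite /lin_sol !scale1r.
  have [-> _] : x *m expm (- adm (t *: y)) = x /\ x *m phim (- adm (t *: y)) = x by apply: expm_fix; rewrite admZ mulmxN -scalemxAr xy scaler0 oppr0.
  have [_ -> //] : y *m expm (- adm (t *: y)) = y /\ y *m phim (- adm (t *: y)) = y by apply: expm_fix; rewrite admZ mulmxN -scalemxAr ld_adm_alt scaler0 oppr0.
by have := Vel_cst_exp H1; rewrite !scale0r !scale1r e0 !mul1g.
Qed.

Lemma A_mul x y : inA x -> inA y -> (e x * e y)%g = e (x + y) /\ inA (x + y).
move=> xA yA; split; last by rewrite /inA mulmxDl xA yA.
by rewrite exp_commute // -xA -yA -mulmxA pa_ad mulmx0.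
Qed.
Lemma AN_mul u v : AN u -> AN v -> AN (u * v)%g.
move=> [_ [x xA <-]] [_ [y yN <-] <-] [_ [x' x'A <-]] [_ [y' y'N <-] <-].
have [E xA'] := A_mul xA x'A; have x'u := (an_pu x').1 x'A.
have cN : inN (y *m expm (- adm x')) by rewrite -admN; apply: n_expm => //; exact: puN.
have [z zN Ez] := N_mul cN y'N.
exists (e (x + x')); first by exists (x + x').
exists (e z); first by exists z.
by rewrite -E -Ez -n_conj !mulgA mulgK.
Qed.

Lemma AN_inv u : AN u -> AN u^-1%g.
move=> [_ [x xA <-]] [_ [y yN <-] <-]; exists (e (- x)); first by exists (- x); rewrite // /inA mulNmx xA.
exists (e ((- y) *m expm (adm x))).
  exists ((- y) *m expm (adm x)) => //; apply: n_expm; [exact: (an_pu x).1|exact: inN_N].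
by rewrite -n_conj' !expN invgM !mulgA mulVg mul1g.
Qed.

Lemma AN1 : AN 1%g.
exists 1%g; first by exists 0; rewrite ?e0 // /inA mul0mx.
by exists 1%g; rewrite ?mulg1 //; exists 0; rewrite ?e0 // /inN mul0mx.
Qed.
Lemma exp_inj_near : exists+ r, forall y z : V, `|y| < r -> `|z| < r -> e y = e z -> y = z.
have [w1 f1 w10] := @fam_lexp _ W 1%:M.
have F0 : lexp (Ld := W) 1%:M 0 = 1%g by rewrite /lexp mulmx1 e0.
have [r r0 [inj _ _]] := local_inverse f1 F0 w10; exists r => // y z yr zr E.
by apply: inj; rewrite ?Bo0 // /lexp !mulmx1.
Qed.

(** [ad y] sends [H] into the ideal [n] and preserves [n], so modulo [n] the exponential fixes
    [H]. *)
Lemma H_expn y : inN y -> exists2 z, inN z & H *m expm (- adm y) = H + z.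
move=> yN; set B := - adm y; set q := 1%:M - pn; have yu := (an_pu y).2 yN.
have st : pn *m B *m q = 0 by rewrite /B mulmxN mulNmx s_stable // oppr0.
have Bq := stable_factor (pn_pn W) st.
have Hq : H *m q = H by rewrite /q mulmxBr mulmx1 -{2}H_in -mulmxA pa_pn mulmx0 subr0.
have HB : H *m B *m q = 0.
  rewrite /B mulmxN adm_alt opprK; apply/(inP_Q pn); apply: n_ideal => //; exact: (an_pu H).1 H_in.
have HE : H *m expm B *m q = H.
  rewrite -mulmxA -(expm_tw (esym Bq)) mulmxA Hq. by have [] := @expm_fix _ _ H (q *m B *m q); rewrite // !mulmxA Hq HB.
exists (H *m expm B - H); last by rewrite addrC subrK.
by apply/(inP_Q pn); rewrite -/q mulmxBl HE Hq subrr.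
Qed.

(* [Ad u] is orthogonal and [H] is orthogonal to [n], so the [N]-part of [u] fixes [H];
   it is then constant along the contraction, hence trivial. *)
Lemma AN_U u : AN u -> Ug u -> u = 1%g.
move=> [_ [x xA <-]] [_ [y yN <-] <-] hu.
have Hx : H *m expm (- adm x) = H by have [] := @expm_fix _ _ H (- adm x); rewrite // mulmxN -H_in -xA -mulmxA pa_ad mulmx0 oppr0.
have AE : Adm (e x * e y)%g = expm (- adm x) *m expm (- adm y) by rewrite AdmM ?Adm_exp //; exact: gen_e.
have [z zN HE] := H_expn yN.
have z0 : z = 0.
  have := Adm_dot H H hu; rewrite AE mulmxA Hx HE dotDl !dotDr [dot z H]dotC -zN H_pn zN addr0 add0r.
  by move/eqP; rewrite -subr_eq0 addrC addKr => /eqP; exact: dot_eq0.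
rewrite z0 addr0 in HE.
have cst t : e (y *m expm (- adm (t *: H))) = e y.
  rewrite -n_conj; have E : ((e y)^-1 * e (t *: H) * e y)%g = e (t *: H) by rewrite n_conj -scalemxAl HE.
  have E2 : (e (t *: H) * e y = e y * e (t *: H))%g by rewrite -{2}E !mulgA mulgV mul1g. by rewrite -mulgA -E2 mulKg.
have [r r0 inj] := exp_inj_near; have [t0 _ t0P] := ad_contraction yN r0.
have y0 : y *m expm (- adm (t0 *: H)) = 0.
  apply/eqP; rewrite -normr_eq0 -[_ == 0]negbK; apply/negP => nz.
  have p0 : 0 < `|y *m expm (- adm (t0 *: H))| by rewrite lt_def nz normr_ge0.
  have [t1 _ t1P] := ad_contraction yN p0; pose t := Num.max t0 t1. have l1 := t1P t; have l2 := t0P t.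
  have E : y *m expm (- adm (t *: H)) = y *m expm (- adm (t0 *: H)) by apply: inj; [apply: l2; rewrite le_max lexx|exact: t0P|rewrite !cst].
  by have := l1; rewrite E le_max lexx orbT ltxx => /(_ isT).
have {}y0 : y = 0.
  have := congr1 (mulmx^~ (expm (adm (t0 *: H)))) y0; rewrite -mulmxA mul0mx. by have := expmK (adm (t0 *: H)) => ->; rewrite mulmx1.
rewrite y0 e0 mulg1 in hu *; suff -> : x = 0 by rewrite e0.
(* The A-part: [Ad (e x)] multiplies a nonzero row of [Q j] by [exp (- w j x)]; being orthogonal, it
   forces [w j x = 0] for every [j]. *)
rewrite -xA; apply: w_inj => j jD; rewrite xA.
have : exists i : 'I_D, row i (Q j) != 0.
  apply: contrapT => n; have := Q_nz jD; apply/negP/negPn/eqP/row_matrixP => i.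
  by rewrite row0; apply: contrapT => h; apply: n; exists i; exact/eqP.
case=> i Qi; have NA : inA (- x) by rewrite /inA mulNmx xA.
have qE : row i (Q j) *m Adm (e x) = expR (w j (- x)) *: row i (Q j) by rewrite Adm_exp -admN -row_mul Q_expm // linearZ.
have := Adm_dot (row i (Q j)) (row i (Q j)) hu; rewrite qE dotZl dotZr => /eqP.
have q0 : dot (row i (Q j)) (row i (Q j)) != 0 by apply: contra Qi => /eqP/dot_eq0 ->.
rewrite -subr_eq0 mulrA -{2}[dot _ _]mul1r -mulrBl mulf_eq0 (negbTE q0) orbF subr_eq0 -expRD -expR0.
move/eqP/expR_inj => w0; have wN : w j (- x) = - w j x.
  have := Q_ad (- x) jD; have := Q_ad x jD; rewrite NA xA admN mulmxN => ->; rewrite -scaleNr => /eqP.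
  by rewrite -subr_eq0 -scalerBl scaler_eq0 (negbTE (Q_nz jD)) orbF subr_eq0 => /eqP.
by move: w0; rewrite wN; lra.
Qed.

Lemma AN_uniq a b u v : AN a -> AN b -> Ug u -> Ug v -> (a * u = b * v)%g -> u = v.
move=> ha hb hu hv E; have E1 : (b^-1 * a = v * u^-1)%g.
  by apply: (mulgI b); apply: (mulIg u); rewrite !mulgA mulgV mul1g E mulgVK.
have : (v * u^-1)%g = 1%g.
  by apply: AN_U; [rewrite -E1; apply: AN_mul => //; exact: AN_inv|apply: genM => //; exact: genV].
by move=> E2; rewrite -[LHS]mul1g -E2 mulgVK.
Qed.
End IwasawaAN.

Lemma expm_phim (R : realType) n (B : 'M[R]_n) : expm B = phim B *m B + 1%:M.
have := @phim_expm R n B 1; rewrite !scale1r => E.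
have := expm_comm (block_mx B 0 1%:M 0 : 'M[R]_(n + n)); rewrite E !mulmx_block !mulmx0 !mul0mx !addr0 !mulmx1 !mul1mx.
by case/eq_block_mx.
Qed.

(** * Slices of U / K0 through exponentials of i p0 *)

Section Leaves.
Context {R : realType} {W : iwaData R}.
Notation G := (ld_G W).
Notation A := (@ld_A _ W).
Notation D := (ld_D W).
Notation adm := (@ld_adm _ W).
Notation e := (@ld_e _ W).
Notation e0 := (ld_e0 W).
Notation th := (id_th W).
Notation ta := (id_ta W).
Notation ji := (id_ji W).
Notation pu := (id_pu W).
Notation pa := (id_pa W).
Notation pn := (id_pn W).
Notation V := 'rV[R]_D.
Notation qu := (@qu _ W).
Notation P := (left_coset (@K0g _ W)).
Implicit Types (x y z : V) (u v k : G).

(** On u, [pk] and [pq] are the projections onto k0 and onto its orthogonal complement i p0, a model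
    of the tangent space of [U / K0]. *)
Definition pk : 'M[R]_D := 2^-1 *: (qu *m (1%:M + ta)).
Definition pq : 'M[R]_D := 2^-1 *: (qu *m (1%:M - ta)).

Lemma pkq : pq + pk = qu.
have E : 1%:M - ta + (1%:M + ta) = 2 *: (1%:M : 'M[R]_D) by rewrite addrACA addNr addr0 scaler_nat mulr2n.
by rewrite /pk /pq -scalerDr -mulmxDr E -scalemxAr mulmx1 scalerA mulVf ?scale1r // pnatr_eq0.
Qed.
Lemma qu_ta : qu *m ta = ta *m qu.
by rewrite /qu -scalemxAl -scalemxAr mulmxDl mulmxDr mul1mx mulmx1 ta_th. Qed.
Lemma pk_in x : inK (x *m pk).
have E : qu *m (1%:M + ta) = (1%:M + ta) *m qu by rewrite mulmxDr mulmxDl mul1mx mulmx1 qu_ta.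
split; first by rewrite /pk E /inU -scalemxAr -scalemxAl -!mulmxA qu_th.
by rewrite /pk -scalemxAr -scalemxAl -!mulmxA mulmxDl mul1mx ta_sq addrC.
Qed.
Lemma pq_in x : inQ (x *m pq).
have E : qu *m (1%:M - ta) = (1%:M - ta) *m qu by rewrite mulmxBr mulmxBl mul1mx mulmx1 qu_ta.
split; first by rewrite /pq E /inU -scalemxAr -scalemxAl -!mulmxA qu_th.
rewrite /pq -scalemxAr -scalemxAl -!mulmxA mulmxBl mul1mx ta_sq -scalerN; congr (_ *: _).
by rewrite -!mulmxN opprB.
Qed.
Lemma pq_id y : inQ y -> y *m pq = y.
by move=> [yU yt]; rewrite /pq -scalemxAr mulmxA qu_id // mulmxBr mulmx1 yt opprK half_double.
Qed.
Lemma pq_K x : inK x -> x *m pq = 0.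
by move=> [xU xt]; rewrite /pq -scalemxAr mulmxA qu_id // mulmxBr mulmx1 xt subrr scaler0. Qed.
(** [expm B - 1 = phim B *m B] with [phim] invertible near 0, so a trivial [Ad (e z)] gives
    [ad z = 0], and [adm] is injective. *)
Lemma Ad_small : exists+ r, forall z, `|z| < r -> expm (- adm z) = 1%:M -> z = 0.
have sN : smx setT (fun z : V => phim (- adm z)) by msm.
have [|a a0 aP] := unitmx_near (@openT V) sN (I : setT (0 : V)); first by rewrite adm0 oppr0 phim0.
exists a => // z za; rewrite expm_phim => /eqP; rewrite -subr_eq0 addrK => /eqP E.
have := aP z; rewrite subr0 => /(_ za) U; apply: (@adm_inj _ W).
by apply/eqP; rewrite -oppr_eq0; apply/eqP; rewrite -[LHS]mul1mx -(mulVmx U) -mulmxA E mulmx0.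
Qed.

Lemma ta_expm y : y *m ta = - y -> ta *m expm (- adm y) *m ta = expm (adm y).
move=> yt; have E : ta *m - adm y = adm y *m ta.
  by have := ta_ad y; rewrite yt admN => ->; rewrite !mulmxA ta_sq mul1mx.
by rewrite (expm_tw E) -mulmxA ta_sq mulmx1.
Qed.

(* Applying [ta] to [Ad (e y) = Ad (e y') Ad k] inverts the exponentials and fixes
   [Ad k], so that [e (2 y)] and [e (2 y')] have the same adjoint action. *)
Lemma slice_inj : exists+ r, forall v y y', inQ y -> inQ y' -> `|y| < r -> `|y'| < r -> P (v * e y)%g = P (v * e y')%g -> y = y'.
have [r1 r10 r1P] := Ad_small; have [r2 r20 [Z [_ _ r2P]]] := exp_mul_sub (@qu_sub _ W) r10.
have [r3 r30 r3P] := @exp_inj_near _ W.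
exists (Num.min r2 r3 / 2); first by rewrite divr_gt0 // lt_min r20.
move=> v y y' [yU yt] [y'U y't] yr y'r /coset_eq[k hk] /eqP; rewrite -mulgA.
move=> /eqP /mulgI E; have kT := genT hk.
have A1 : expm (- adm y) = expm (- adm y') *m Adm k by rewrite -!Adm_exp E AdmM //; exact: gen_e.
have A2 : expm (adm y) = expm (adm y') *m Adm k.
  rewrite -(ta_expm yt) A1 -mulmxA -[_ *m Adm k *m ta]mulmxA -(Adm_ta (K0_G0 hk)) !mulmxA. by rewrite (ta_expm y't).
have E2 : expm (- adm (2 *: y)) = expm (- adm (2 *: y')).
  have H q : expm (- adm (2 *: q)) = expm (- adm q) *m expm (- adm q) by have := expm_add (- adm q) 1 1; rewrite !scale1r admZ -scalerN => <-.
  have kE : Adm k = expm (adm y') *m expm (- adm y) by rewrite A1 mulmxA (expmVK (adm y')) mul1mx.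
  have kE2 : Adm k = expm (- adm y') *m expm (adm y) by rewrite A2 mulmxA (expmK (adm y')) mul1mx.
  have : expm (- adm y') *m Adm k *m expm (- adm y) = expm (- adm y') *m Adm k *m expm (- adm y) by [].
  rewrite {1}kE {1}kE2 !mulmxA expmK mul1mx -[_ *m expm (adm y) *m _]mulmxA expmVK mulmx1 -!H //.
have s2 (q : V) : `|q| < Num.min r2 r3 / 2 -> `|2 *: q| < r2 /\ `|2 *: q| < r3.
  move=> qr; have : `|2 *: q| < Num.min r2 r3 by rewrite normrZ ger0_norm // mulrC -ltr_pdivlMr. by rewrite lt_min => /andP.
have [s21 s22] := s2 _ yr; have [s21' s22'] := s2 _ y'r.
have sN : `|- (2 *: y)| < r2 by rewrite normrN.
have yi : inP qu (- (2 *: y)) by apply: inPN; apply/qu_inP; exact: inUZ.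
have y'i : inP qu (2 *: y') by apply/qu_inP; exact: inUZ.
have [_ _] := r2P _ _ yi y'i sN s21'; move: (Z _) => z zr Ez.
have z0 : z = 0.
  apply: r1P => //; rewrite -Adm_exp -Ez AdmM; [|exact: gen_e|exact: gen_e]. by rewrite !Adm_exp -E2 admN opprK expmVK.
have : (2 : R) *: y = 2 *: y' by apply: r3P => //; move: Ez; rewrite z0 e0 expN => h; rewrite -[LHS]mulg1 -h mulVKg.
by apply: scalerI; rewrite pnatr_eq0.
Qed.

(** The product of the three exponentials is tangent to [S], hence equal to some [e (Z z)], and [Z]
    has differential [L1 + L2 + L3 = S] at 0. The [Li] may be any matrices with this sum and image
    in [S], as the splitting of [trans_split] requires. *)
Lemma exp_split (S L1 L2 L3 : 'M[R]_D) : subalg (Ld := W) S -> L1 + L2 + L3 = S -> L1 *m S = L1 -> L2 *m S = L2 -> L3 *m S = L3 ->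
  exists+ s, exists gg : V -> V, [/\ smx (Bo 0 s) gg, gg 0 = 0 &
    forall z, inP S z -> `|z| < s -> e z = (e (gg z *m L1) * e (gg z *m L2) * e (gg z *m L3))%g].
move=> sS LS LS1 LS2 LS3; have [SS _] := sS.
have oT := @openT V; have sid := smx_id oT.
have U1 x : inP S (x *m L1) by rewrite /inP -mulmxA LS1.
have U2 x : inP S (x *m L2) by rewrite /inP -mulmxA LS2.
have U3 x : inP S (x *m L3) by rewrite /inP -mulmxA LS3.
have s1 := smx_mulr L1 oT sid; have s2 := smx_mulr L2 oT sid; have s3 := smx_mulr L3 oT sid.
have [w1 f1 w1P] := fam_exp_sub 1%g sS oT s1 U1.
have [w2 f2 w2P] := fam_mul_sub sS f1 w1P s2 U2.
have [w3 f3 w3P] := fam_mul_sub sS f2 w2P s3 U3.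
have [rho rho0 [Z [_ sZ Z0 ZP]]] := fam_subalg (t0 := 0) sS f3 w3P I ltr01.
have ob := @Bo_open _ _ (0 : V) rho.
have b0 : Bo 0 rho (0 : V) by exact: Bo_ctr.
have ZE z : Bo 0 rho z -> (e (z *m L1) * e (z *m L2) * e (z *m L3))%g = e (Z z) by move=> /ZP[E _ _]; move: E; rewrite !mul0mx e0 !mul1g.
have jZ : jac Z 0 = S.
  have fa := @fam_exp _ W _ (Bo 0 rho) 1%g Z ob sZ. have fb := fam_mul_exp (fam_mul_exp (@fam_exp _ W _ setT 1%g _ oT s1) s2) s3.
  have fc := fam_sub ob (fun _ _ => I) fb.
  have E : {in Bo 0 rho, (fun z => 1 * e (z *m L1) * e (z *m L2) * e (z *m L3))%g =1 (fun z => 1 * e (Z z))%g} by move=> t; rewrite inE !mul1g => /ZE.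
  have := fam_unique (fam_ext E fc) fa b0; rewrite Z0 !mul0mx adm0 oppr0 phim0 expm0 !mulmx1 => <-.
  by rewrite !(@jac_mulr _ _ _ _ setT) // jac_id !mul1mx.
(* [Z] alone has a degenerate differential; the identity on the complement of [S] makes it
   invertible, and for a target in [S] the complementary part of the solution is 0. *)
pose Psi x := Z x + x *m (1%:M - S).
have sPsi : smx (Bo 0 rho) Psi by apply: smxD => //; apply: smx_sub (smx_mulr (1%:M - S) oT sid).
have Psi0 : Psi 0 = 0 by rewrite /Psi Z0 mul0mx addr0.
have [//|x|r [s [gg [[r0 s0 rb] inj surj sg gg0]]]] := inverse_at0 rho0 sPsi.
  have := mderD (jac_mderiv x ob sZ b0) (mderMl (1%:M - S) (mder_line 0 x)). by rewrite jZ -mulmxDr [S + _]addrC subrK mulmx1.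
exists s => //; exists gg; split=> // z zU zs.
have [|h1 h2] := surj z; first by rewrite Bo0.
have [_ _ ZU] := ZP _ (rb _ h1).
have q0 : gg z *m (1%:M - S) = 0.
  have := congr1 (mulmx^~ (1%:M - S)) h2; rewrite /Psi mulmxDl -[Z _ *m _](_ : 0 = _); last first.
    by apply/esym/(inP_Q S).
  by rewrite add0r -mulmxA (compl_idem SS) => ->; apply/(inP_Q S).
have zE : Z (gg z) = z by move: h2; rewrite /Psi q0 addr0.
by rewrite ZE ?zE //; exact: rb.
Qed.

Lemma K_split : exists+ s, exists gg : V -> V, [/\ smx (Bo 0 s) gg, gg 0 = 0 &
  forall z, inU z -> `|z| < s -> e z = (e (gg z *m pq) * e (gg z *m pk))%g].
have [||||s s0 [gg [sg g0 gP]]] := @exp_split qu pq pk 0 (@qu_sub _ W); rewrite ?mul0mx ?addr0 ?pkq //.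
- by apply: row_ext => x; rewrite !mulmxA qu_id //; case: (pq_in x).
- by apply: row_ext => x; rewrite !mulmxA qu_id //; case: (pk_in x).
by exists s => //; exists gg; split=> // z /qu_inP zU zs; rewrite gP // mulmx0 e0 mulg1.
Qed.

(** A displaced point [e y * e x] is brought back to the slice by [K_split] applied to the local
    product; [Y] is its new slice coordinate, smooth in both arguments. *)
Lemma slice_coord (eps : R) : 0 < eps -> exists+ rho, exists2 Y : 'rV[R]_(D + D) -> V,
  smx (Bo 0 rho) Y & forall y x, inU y -> inU x -> `|y| < rho -> `|x| < rho -> [/\ inQ (Y (row_mx y x)), `|Y (row_mx y x)| < eps &
      exists2 k, K0g k & (e y * e x)%g = (e (Y (row_mx y x)) * k)%g].
move=> eps0; have [s s0 [gg [sg g0 gP]]] := K_split.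
have [r1 r10 r1P] := smx_near0 s0 (smx_mulr pq (@Bo_open _ _ _ _) sg) (divr_gt0 eps0 (ltr0n _ 2)).
have rs : 0 < Num.min s r1 by rewrite lt_min s0.
have [rho rho0 [Z [sZ Zs ZP]]] := exp_mul_sub (@qu_sub _ W) rs; exists rho => //; exists (fun t => gg (Z t) *m pq).
  apply: (@smx_comp _ _ _ _ _ (Bo 0 rho) (Bo 0 s) (fun z => gg z *m pq)); try by msm.
  by move=> t /Zs; rewrite Bo0 lt_min => /andP[].
move=> y x /qu_inP yU /qu_inP xU yr xr; have [_ /qu_inP] := ZP y x yU xU yr xr.
move: (Z _) => z zU; rewrite lt_min => /andP[zs zr] E; split; first exact: pq_in.
- by have := r1P z zr; rewrite g0 mul0mx subr0; move: eps0; lra.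
by exists (e (gg z *m pk)); [apply: gen_e; exact: pk_in|rewrite E; exact: gP].
Qed.

Lemma coset_move (G : groupType) (v u k z z' y y' k' : G) : u = (v * y * k)%g -> (k * z = z' * k)%g ->
  (y * z' = y' * k')%g -> (u * z = v * y' * (k' * k))%g.
by move=> -> E1 E2; rewrite -mulgA E1 !mulgA -[(v * y * z')%g]mulgA E2 !mulgA. Qed.
Lemma coset_move' (G : groupType) (v u k z z' y y' k' : G) : (u * z = v * y * k)%g -> (k * z = z' * k)%g ->
  (y * z'^-1 = y' * k')%g -> u = (v * y' * (k' * k))%g.
move=> E1 E2 E3; have kE : (k * z^-1 = z'^-1 * k)%g by apply: (mulgI z'); rewrite mulVKg mulgA -E2 mulgK.
by rewrite -[u](mulgK z) E1 -mulgA kE !mulgA -[(v * y * _)%g]mulgA E3 !mulgA.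
Qed.
Lemma inU_phim x y : inU x -> inU y -> inU (x *m phim (- adm y)).
move=> /qu_inP xU /qu_inP yU; apply/qu_inP; rewrite -admN.
by apply: inP_phim qu_sub _ xU; exact: inPN.
Qed.
Lemma QK_dot x y : inQ x -> inK y -> dot x y = 0.
move=> [_ xt] [_ yt]; have : dot (x *m ta) (y *m ta) = dot x y by rewrite dot_mx ta_tr -mulmxA ta_sq mulmx1.
by rewrite xt yt dotNl => h; lra.
Qed.
Lemma derive_CU_curve (f : G -> R) v (y : R -> V) y' t : CUW f -> Ug v -> (forall s, inU (y s)) -> mder y t y' ->
  is_D t (fun s => f (v * e (y s))%g : R^o) (dot (grd f (v * e (y t))%g) (y' *m phim (- adm (y t))) : R^o).
move=> Cf hv yU dy; have oT := @openT V; have squ := smx_mulr qu oT (smx_id oT).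
have [w fS wP] := fam_exp_sub v (@qu_sub _ W) oT squ (fun x => (qu_inP _).2 (qu_in x)).
have wU x : setT x -> w x *m th = w x by move=> /wP <-; apply: row_ext => q; rewrite !mulmxA; exact: qu_in.
have y'U : inU y'.
  have h : mder y t (y' *m qu) by have := mderMl qu dy; under eq_fun do rewrite qu_id //; exact.
  by rewrite -(mder_unique h dy); exact: qu_in.
have [|f' sf [rho rho0 fP]] := CU_near (t0 := y t) Cf fS wU I; first by apply: UgM_e => //; exact: qu_in.
have [_ hu _ D0] := fP (y t) (Bo_ctr _ rho0); rewrite (qu_id (yU t)) in hu D0.
have zU := inU_phim y'U (yU t); rewrite -lf_grd // /lf (derive1P (D0 _ zU)).
have /contP/(_ (rho / 2))[|r r0 rP] := mder_cont dy; first by rewrite divr_gt0.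
have := Vel_mul_exp (Vel_cst v t) dy sf; rewrite /lin_sol !scale1r mul0mx add0r.
apply: (der_loc r0) => s /rP h; have [|_ _ + _] := fP (y s); last by rewrite qu_id.
by rewrite /Bo /=; move: h rho0; lra.
Qed.

(** Near [v K0] the cosets are those of [v * e y] with [y] small in i p0, uniquely by [slice_inj]; a
    function of [y] with small support thus descends to [U / K0], extended by 0. The radii do not
    depend on [v]. *)
Lemma slice_fun : exists r r1 : R, [/\ 0 < r1, r1 <= r,
  forall v y y', inQ y -> inQ y' -> `|y| < r -> `|y'| < r -> P (v * e y)%g = P (v * e y')%g -> y = y' &
  forall v (phi : V -> R), Ug v -> smooth setT (phi : _ -> R^o) -> (forall y, r1 <= `|y| -> phi y = 0) ->
    exists f : set G -> R, [/\ CMW f, forall y, inQ y -> `|y| < r -> f (P (v * e y)%g) = phi y &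
      forall X, f X != 0 -> exists y, [/\ inQ y, `|y| < r1 & X = P (v * e y)%g]]].
have [r r0 inj] := @slice_inj.
have [r2 r20 [Y sY YP]] := @slice_coord r r0.
have m0 : 0 < Num.min r r2 by rewrite lt_min r0.
(* Smoothness is checked according to whether the base coset has a slice coordinate shorter than
   [r2]. If it has none, the function vanishes nearby: a nonzero value gives a coordinate shorter
   than [r3], and moving back gives one for the base point shorter than [Num.min r r2]. *)
have [r3 r30 [Y3 _ YP3]] := @slice_coord _ m0.
pose r1 := Num.min r r3; exists r, r1; split=> //; [by rewrite lt_min r0|by rewrite ge_min lexx|].
move=> v phi hv sphi phi0.
pose ff (X : set G) : R := if pselect (exists2 y, inQ y /\ `|y| < r & X = P (v * e y)%g) is left H then phi (sval (cid2 H)) else 0.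
have ffE y : inQ y -> `|y| < r -> ff (P (v * e y)%g) = phi y.
  move=> yQ yr; rewrite /ff; case: pselect => [H|[]]; last by exists y.
  by case: (cid2 H) => y' /= [y'Q y'r] E; congr (phi _); apply: (inj v) => //.
have ff0 X : ff X != 0 -> exists y, [/\ inQ y, `|y| < r1 & X = P (v * e y)%g].
  rewrite {1}/ff; case: pselect => [H|]; last by rewrite eqxx. case: (cid2 H) => y /= [yQ yr] E ph; exists y; split=> //.
  by rewrite ltNge; apply: contra ph => /phi0 ->.
exists ff; split=> // u hu m x xU; apply: smooth_local => t0 _.
have [w fS wU] := fam_U u xU.
have wP t : setT t -> w t *m qu = w t by move=> tO; apply: row_ext => q; rewrite mulmxA qu_id // /inU -mulmxA wU.
pose Dn : R := D%:R + 1; have Dn0 : 0 < Dn by rewrite ltr_wpDl.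
pose eps := Num.min r2 r3 / Dn; have eps0 : 0 < eps by rewrite divr_gt0 // lt_min r20.
have [rho rho0 [Z [_ sZ _ ZP]]] := fam_subalg (@qu_sub _ W) fS wP (I : setT t0) eps0.
set u1 := (u * e (\sum_i t0 0 i *: x i))%g in ZP.
have ob := @Bo_open _ _ t0 rho; have b0 : Bo t0 rho t0 by exact: Bo_ctr.
have hu1 : Ug u1 by apply: UgM_e => //; apply: inU_sum => i; exact: inUZ.
exists (Bo t0 rho) => //.
have small k z : Ug k -> `|z| < eps -> `|z *m Adm k| < r2 /\ `|z *m Adm k| < r3.
  move=> hk; rewrite ltr_pdivlMr // => zs. have : `|z *m Adm k| < Num.min r2 r3.
    apply: le_lt_trans (Adm_norm z hk) _; apply: le_lt_trans zs; rewrite mulrC ler_wpM2l // lerDl //.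
  by rewrite lt_min => /andP.
have kz k z : gen setT k -> (k * e z = e (z *m Adm k^-1%g) * k)%g by move=> kT; rewrite AdmP' // -mulmxA AdmVK' // mulmx1.
have [[y0 [y0Q y0r E0]]|n0] := pselect (exists y0, [/\ inQ y0, `|y0| < r2 & P u1 = P (v * e y0)%g]).
  have [k hk u1E] := coset_eq E0; have kU := K0_U hk; have kT := genT hk. pose Z' t := row_mx y0 (Z t *m Adm k^-1%g).
  have kV : Ug k^-1%g by exact: genV.
  have Z's t : Bo t0 rho t -> [/\ inU (Z t *m Adm k^-1%g), `|Z t *m Adm k^-1%g| < r2 & Bo 0 r2 (Z' t)].
    move=> /ZP[_ Zs /qu_inP ZU]; have [s1 _] := small _ _ kV Zs; split=> //; [exact: inU_Adm|exact: row_mx_Bo].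
  apply: (@smooth_ext _ _ _ _ (fun t => phi (Y (Z' t)) : R^o)) => // [t|].
    rewrite inE => tb; have [E Zs ZU] := ZP t tb; have [h1 h2 _] := Z's t tb. have [YQ Yr [k' hk' Ek]] := YP y0 _ y0Q.1 h1 y0r h2.
    rewrite E (_ : u1 * e (Z t) = v * e (Y (Z' t)) * (k' * k))%g; last first.
      exact: coset_move u1E (kz _ _ kT) Ek.
    by rewrite cosetK ?ffE //; exact: genM.
  apply: (@smooth_comp _ _ _ _ setT phi (fun t => Y (Z' t))) => // [|j]; first exact: openT.
  have sYZ : smx (Bo t0 rho) (fun t => Y (Z' t)); last exact: sYZ.
  apply: (@smx_comp _ _ _ _ _ (Bo t0 rho) (Bo 0 r2) Y) => //; first exact: Bo_open.
    by move=> t /Z's[].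
  move=> i l; rewrite /Z'; case: (split_ordP l) => q ->.
    by under eq_fun do rewrite row_mxEl; exact: smooth_cst.
  by under eq_fun do rewrite row_mxEr; apply: smx_mulr.
apply: (@smooth_ext _ _ _ _ (fun=> 0 : R^o)) => //; last exact: smooth_cst.
move=> t; rewrite inE => tb; have [E Zs /qu_inP ZU] := ZP t tb.
apply/esym/eqP; rewrite -[_ == 0]negbK; apply/negP => nz; apply: n0.
have [y [yQ yr EX]] := ff0 _ nz; rewrite E in EX; have [k hk Ek] := coset_eq EX.
have kU := K0_U hk; have kT := genT hk; have kV : Ug k^-1%g by exact: genV.
have [_ s3] := small _ _ kV Zs; have yr3 : `|y| < r3 by move: yr; rewrite lt_min => /andP[].
have zU : inU (- (Z t *m Adm k^-1%g)) by rewrite /inU mulNmx inU_Adm.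
have s3N : `|- (Z t *m Adm k^-1%g)| < r3 by rewrite normrN.
have [YQ Yr [k' hk' Ek']] := YP3 y _ yQ.1 zU yr3 s3N.
exists (Y3 (row_mx y (- (Z t *m Adm k^-1%g)))); split=> //; first by move: Yr; rewrite lt_min => /andP[].
have -> : u1 = (v * e (Y3 (row_mx y (- (Z t *m Adm k^-1%g)))) * (k' * k))%g by apply: coset_move' Ek (kz _ _ kT) _; rewrite -expN.
by rewrite cosetK //; exact: genM.
Qed.

(** The slice coordinates themselves, cut off, are functions on [U / K0]; their derivatives at the
    base point are the coordinates of the i p0 part of [z]. *)
Lemma grd_sep u z : Ug u -> inU z -> (forall f : set G -> R, CMW f -> dot (grd (f \o P) u) z = 0) -> z *m pq = 0.
move=> hu zU H; have [r [r1 [r10 r1r _ sl]]] := slice_fun.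
apply/rowP => j; rewrite [RHS]mxE.
pose phi (y : V) : R := bump 0 r1 y * y 0 j.
have sphi : smooth setT (phi : _ -> R^o) by apply: smoothM; [exact: openT|exact: smooth_bump|apply: smooth_coord; exact: openT].
have phi0 y : r1 <= `|y| -> phi y = 0 by move=> h; rewrite /phi bump0 ?mul0r ?subr0 //; move: h r10; lra.
have [f [Cf fE _]] := sl u phi hu sphi phi0; have KF := Kinv_CM Cf; have [CF _] := KF.
have [gU gt] := Kinv_Q KF hu; rewrite -(H f Cf) -lf_grd //.
have -> : lf z (f \o P) u = lf (z *m pq) (f \o P) u.
  rewrite !lf_grd //; last by case: (pq_in z). by rewrite -{1}(qu_id zU) -pkq mulmxDr dotDr [X in _ + X]QK_dot ?addr0 //; exact: pk_in.
set q := z *m pq; have qQ : inQ q by exact: pq_in.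
apply/esym/derive1P.
have c0 : 0 < r1 / 2 / (`|q| + 1) by rewrite !divr_gt0 // ltr_wpDl.
apply: (der_loc c0 _ (_ : is_D (0 : R) (fun t : R => (t *: q) 0 j : R^o) (q 0 j))).
  move=> t; rewrite subr0 ltr_pdivlMr ?ltr_wpDl // => ts.
  have ts' : `|t *: q| < r1 / 2 by rewrite normrZ; apply: le_lt_trans ts; rewrite ler_wpM2l // lerDl.
  rewrite /= fE /phi ?bump1 ?mul1r ?subr0 ?(ltW ts') //; last by move: ts' r1r r10; lra.
  by split; [exact: inUZ qQ.1|rewrite -scalemxAl qQ.2 scalerN].
exact: (mder_scale q 0 0 j).
Qed.

(** * Iwasawa factorization in the group and dressing orbits *)

Notation AN := (@AN _ W).

Lemma pu_panP x : x *m pu = 0 <-> inP (pa + pn) x.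
have E : 1%:M - (pa + pn) = pu by rewrite -[1%:M](@pu_sum _ W) -[pu + pa + pn]addrA addrK.
by rewrite inP_Q E.
Qed.
Lemma pan_sub : subalg (Ld := W) (pa + pn).
split=> [|x y /pu_panP x0 /pu_panP y0]; last by apply/pu_panP; exact: s_lie.
by rewrite mulmxDl !mulmxDr pa_pa pn_pn pa_pn pn_pa addr0 add0r.
Qed.
Lemma pan_id x : x *m (pa + pn) *m pu = 0.
by apply/pu_panP; rewrite /inP -mulmxA (proj1 pan_sub). Qed.
Lemma small_multiple x (eps : R) : 0 < eps -> exists n, exists2 y, x = n%:R *: y & `|y| < eps.
move=> eps0; set n := (Num.truncn (`|x| / eps)).+1; have n0 : (0 : R) < n%:R by rewrite ltr0n.
exists n; exists (n%:R^-1 *: x); first by rewrite scalerA mulfV ?scale1r // gt_eqF.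
by rewrite normrZ normfV normr_nat mulrC ltr_pdivrMr // mulrC -ltr_pdivrMr // truncnS_gt.
Qed.
(** [AN] is a group, so it suffices to factor the exponential of a small fraction of [x] and take a
    power. *)
Lemma exp_s_AN x : x *m pu = 0 -> AN (e x).
have [||||s s0 [gg [_ _ gP]]] := @exp_split (pa + pn) pa pn 0 pan_sub; rewrite ?addr0 ?mul0mx //.
- by rewrite mulmxDr pa_pa pa_pn addr0.
- by rewrite mulmxDr pn_pa pn_pn add0r.
move=> xs; have [n [y xE ys]] := small_multiple x s0; case: (posnP n) => [n0|n0].
  by rewrite xE n0 scale0r e0; exact: AN1.
have yS : inP (pa + pn) y.
  apply/pu_panP; have := xs; rewrite xE -scalemxAl => /eqP; rewrite scaler_eq0 pnatr_eq0 eqn0Ngt n0 /=. by move/eqP.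
rewrite xE expMn; elim: n {n0 xE} => [|n IH]; first by rewrite expg0; exact: AN1.
rewrite expgS; apply: AN_mul IH; rewrite gP // mulmx0 e0 mulg1.
exists (e (gg y *m pa)); first by exists (gg y *m pa) => //; rewrite /inA -mulmxA pa_pa.
by exists (e (gg y *m pn)) => //; exists (gg y *m pn) => //; rewrite /inN -mulmxA pn_pn.
Qed.

Lemma AN_pan x y : AN (e (x *m pa) * e (y *m pn))%g.
exists (e (x *m pa)); first by exists (x *m pa) => //; rewrite /inA -mulmxA pa_pa.
by exists (e (y *m pn)) => //; exists (y *m pn) => //; rewrite /inN -mulmxA pn_pn.
Qed.
Lemma AN_split_small : exists+ s, exists gg : V -> V, [/\ smx (Bo 0 s) gg, gg 0 = 0 &
  forall z, `|z| < s -> e z = (e (gg z *m pa) * e (gg z *m pn) * e (gg z *m pu))%g].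
have sT : subalg (Ld := W) 1%:M by split=> [|x y _ _]; rewrite /inP mulmx1.
have [||||s s0 [gg [sg g0 gP]]] := @exp_split 1%:M pa pn pu sT; rewrite ?mulmx1 //.
  by rewrite addrC addrA pu_sum.
by exists s => //; exists gg; split=> // z zs; apply: gP => //; rewrite /inP mulmx1.
Qed.
Lemma pu_in x : inU (x *m pu).
by rewrite /inU -mulmxA pu_th. Qed.
(** A small factor [e y] is moved to the left of [v] as [e (y *m Adm v^-1)] and factored there. [Ad]
    is bounded on [U], so the smallness required is the same for every [v], and longer exponentials
    are treated as powers. *)
Lemma U_mul_split v u : Ug v -> gen setT u -> exists2 a, AN a & exists2 w, Ug w & (v * u = a * w)%g.
move=> hv hu; pose Q1 u := forall v, Ug v -> exists2 a, AN a & exists2 w, Ug w & (v * u = a * w)%g.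
have Q1M u1 u2 : Q1 u1 -> Q1 u2 -> Q1 (u1 * u2)%g.
  move=> h1 h2 w /h1[a aAN [w1 /h2[a' a'AN [w2 hw2 E2]] E1]]; exists (a * a')%g; first exact: AN_mul.
  by exists w2 => //; rewrite mulgA E1 -mulgA E2 mulgA.
have Q11 : Q1 1%g by move=> w hw; exists 1%g; [exact: AN1|exists w; rewrite // mulg1 mul1g].
have [s s0 [gg [_ _ gP]]] := AN_split_small.
have Q1e x : Q1 (e x).
  have D0 : 0 < s / (D%:R + 1) by rewrite divr_gt0 // ltr_wpDl. have [n [y -> ys]] := small_multiple x D0; rewrite expMn.
  elim: n => [|n IH]; first by rewrite expg0. rewrite expgS; apply: Q1M IH => w hw; have hw' := genV hw; have hT := genT hw'.
  have wE : (w * e y = e (y *m Adm w^-1%g) * w)%g by rewrite -AdmP // invgK mulgVK. have ys' : `|y *m Adm w^-1%g| < s.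
    apply: le_lt_trans (Adm_norm y hw') _; move: ys; rewrite ltr_pdivlMr ?ltr_wpDl // => ys.
    by apply: le_lt_trans ys; rewrite mulrC ler_wpM2l // lerDl.
  have aE := gP _ ys'; set z := gg _ in aE; exists (e (z *m pa) * e (z *m pn))%g; first exact: AN_pan.
  exists (e (z *m pu) * w)%g; last by rewrite wE aE mulgA. by apply: genM => //; apply: gen_e; exact: pu_in.
suff : Q1 u /\ Q1 u^-1%g by case=> h _; exact: h.
apply: (gen_ind (Q := fun u => Q1 u /\ Q1 u^-1%g) _ _ _ _ hu) => [|u1 u2 [h1 h1'] [h2 h2']|u1 [h1 h1']|x _].
- by rewrite invg1.
- by split; rewrite ?invgM; exact: Q1M.
- by rewrite invgK.
by rewrite -expN.
Qed.

(** Being in the same dressing orbit, stated for arbitrary group elements; an equivalence relation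
    since [G0] and [AN] are groups. *)
Definition dorb u v := exists2 x, G0g x & exists2 a, AN a & (u * x = a * v)%g.
Lemma dorb_sym u v : dorb u v -> dorb v u.
move=> [x hx [a ha E]]; exists x^-1%g; first exact: genV.
by exists a^-1%g; [exact: AN_inv|apply: (mulgI a); rewrite mulgA -E mulgK mulVKg].
Qed.
Lemma dorb_trans u v w : dorb u v -> dorb v w -> dorb u w.
move=> [x hx [a ha E]] [y hy [b hb E']]; exists (x * y)%g; first exact: genM.
by exists (a * b)%g; [exact: AN_mul|rewrite mulgA E -mulgA E' mulgA].
Qed.
Lemma dorb_K u k : K0g k -> dorb u (u * k)%g.
by move=> hk; exists k; [exact: K0_G0|exists 1%g; [exact: AN1|rewrite mul1g]]. Qed.
(** Connectedness of the unit interval: the supremum of the points equivalent to 0 is itself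
    equivalent to 0, and a value below 1 could be exceeded. *)
Lemma local_equiv (E : R -> R -> Prop) : (forall t, E t t) -> (forall s t, E s t -> E t s) -> (forall r s t, E r s -> E s t -> E r t) ->
  (forall t : R, 0 <= t <= 1 -> exists+ r, forall s, 0 <= s <= 1 -> `|s - t| < r -> E t s) -> E 0 1.
move=> Er Es Et loc; pose S : set R := [set t | 0 <= t <= 1 /\ E 0 t].
have S0 : S 0 by split=> //; rewrite lexx ler01.
have hS : has_sup S by split; [exists 0|exists 1 => t [/andP[_ ?] _]].
have c01 : 0 <= sup S <= 1.
  apply/andP; split; first by apply: ub_le_sup => //; case: hS. by apply: ge_sup; [exists 0|move=> t [/andP[_ ?] _]].
have [r r0 rP] := loc _ c01; have [t St tr] := sup_adherent r0 hS; have [t01 E0t] := St.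
have tS : t <= sup S by apply: ub_le_sup => //; case: hS.
have E0c : E 0 (sup S) by apply: Et E0t (Es _ _ (rP _ t01 _)); rewrite ler0_norm ?subr_le0 //; move: tr; lra.
have [c1|c1] := eqVneq (sup S) 1; first by rewrite -c1.
have clt : sup S < 1 by rewrite lt_neqAle c1; case/andP: c01.
pose s := Num.min 1 (sup S + r / 2).
have s01 : 0 <= s <= 1 by rewrite /s le_min ler01 ge_min lexx; case/andP: c01 => h _; rewrite addr_ge0 // divr_ge0 // ltW.
have sc : sup S < s by rewrite /s lt_min clt; lra.
have sr : `|s - sup S| < r.
  have h : s <= sup S + r / 2 by rewrite /s ge_min lexx orbT. by rewrite gtr0_norm ?subr_gt0 //; move: h r0; clear; lra.
have : S s by split=> //; exact: Et E0c (rP _ s01 sr).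
by move=> /(ub_le_sup (proj2 hS)); rewrite leNgt sc.
Qed.

(** * Hamiltonian arcs stay in one dressing orbit *)

Lemma adm_norm : exists+ C, forall x, `|adm x| <= C * `|x|.
have sN := @smx_adm _ W _ setT _ (@openT V) (smx_id (@openT V)).
have /contP C := smx_cont sN (I : setT (0 : V)).
have [r r0 rP] := C 1 ltr01; exists (2 / r) => [|x]; first by rewrite divr_gt0.
have [->|x0] := eqVneq x 0; first by rewrite adm0 !normr0 mulr0.
have xp : 0 < `|x| by rewrite normr_gt0.
have := rP ((r / 2 / `|x|) *: x); rewrite adm0 !subr0 normrZ ger0_norm ?divfK ?gt_eqF //; last first.
  by rewrite !divr_ge0 // ltW.
have -> : r / 2 < r by move: r0; clear; lra.
move=> /(_ isT); rewrite admZ normrZ ger0_norm; last by rewrite !divr_ge0 // ltW.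
have cE : (r / 2 / `|x|)^-1 = 2 / r * `|x| by rewrite !invfM !invrK; ring.
by rewrite -ler_pdivlMl ?mulr1 ?cE // !divr_gt0.
Qed.

Lemma smx_bound0 m n p (r : R) (N : 'rV[R]_m -> 'M[R]_(n, p)) : 0 < r -> smx (Bo 0 r) N ->
  exists+ C, exists+ a, forall x : 'rV[R]_m, `|x| < a -> forall w : 'rV[R]_n, `|w *m N x| <= C * `|w|.
move=> r0 sN; have [a a0 aP] := smx_near0 r0 sN ltr01.
exists (n%:R * (`|N 0| + 1) + 1); first by rewrite ltr_wpDl // mulr_ge0 // addr_ge0.
exists a => // x /aP h w; have N1 : `|N x| <= `|N 0| + 1.
  by rewrite -[N x](subrK (N 0)) addrC; apply: le_trans (ler_normD _ _) _; rewrite lerD2l.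
apply: le_trans (mx_norm _ _) _; rewrite mulrAC ler_wpM2r //.
by apply: le_trans (_ : n%:R * (`|N 0| + 1) <= _); [rewrite ler_wpM2l|rewrite lerDl].
Qed.

(* [Lw] projects onto a complement of [Ad v^-1 (a + n) + g0]. *)
Lemma trans_split (M : 'M[R]_D) : exists U1 U2 Lw : 'M[R]_D, [/\ U1 *m (pa + pn) *m M + Lw + U2 *m (1%:M + ta) = 1%:M,
  (pa + pn) *m M *m Lw = 0, (1%:M + ta) *m Lw = 0 & Lw *m Lw = Lw].
set A0 := (pa + pn) *m M; set B0 := 1%:M + ta; pose T := (A0 + B0)%MS; pose T' := (T^C)%MS.
have TC : (T :&: T')%MS = 0 by exact: capmx_compl.
have CT : (T' :&: T)%MS = 0 by rewrite capmxC.
have full : (1%:M <= T + T')%MS by apply: submx_full; exact: addsmx_compl_full.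
have sT : (1%:M *m proj_mx T T' <= T)%MS by exact: proj_mx_sub.
have /sub_addsmxP[[U1 U2] /= E] := sT.
exists U1, U2, (proj_mx T' T); split.
- by have := add_proj_mx TC full; rewrite E !mul1mx -mulmxA => <-; rewrite addrAC.
- by apply: proj_mx_0 => //; exact: addsmxSl.
- by apply: proj_mx_0 => //; exact: addsmxSr.
by have h := @proj_mx_sub _ _ _ T' T 1%:M; rewrite mul1mx in h; exact: proj_mx_id CT h.
Qed.

Lemma ta_half x : x *m ta = x -> 2^-1 *: x *m (1%:M + ta) = x.
by move=> xt; rewrite -scalemxAl mulmxDr mulmx1 xt half_double.
Qed.
Lemma adm_ta x : x *m ta = x -> ta *m adm x = adm x *m ta.
by move=> xt; have := ta_ad x; rewrite xt => {2}->; rewrite -!mulmxA ta_sq mulmx1. Qed.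
Lemma vel_mul_exp c (X : R -> V) t w0 (X' : V) : Vel (Ld := W) c w0 t -> mder X t X' ->
  Vel (Ld := W) (fun s => c s * e (X s))%g (w0 *m expm (- adm (X t)) + X' *m phim (- adm (X t))) t.
by move=> h1 h2; have := Vel_mul_exp h1 h2; rewrite /lin_sol !scale1r. Qed.
Lemma vel_exp (X : R -> V) t (X' : V) : mder X t X' -> Vel (Ld := W) (fun s => e (X s)) (X' *m phim (- adm (X t))) t.
move=> dX; have := vel_mul_exp (@Vel_cst _ W 1%g t) dX; rewrite mul0mx add0r.
by under eq_fun do rewrite mul1g.
Qed.
Lemma slide_alg (g s y1 e1 w1 : V) (K1 K2 Ew Ee Ee' Nw Ne : 'M[R]_D) : Ee *m Ee' = 1%:M ->
  g + s *m (K2 *m Ew *m Ee) = (y1 *m K1 *m Ew + w1 *m Nw) *m Ee + e1 *m Ne -> (y1 *m K1 - s *m K2) *m Ew + w1 *m Nw = (g - e1 *m Ne) *m Ee'.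
move=> EE E; apply/esym; rewrite -[RHS]mulmx1 -EE [RHS]mulmxA; congr (_ *m _).
have -> : g = (y1 *m K1 *m Ew + w1 *m Nw) *m Ee + e1 *m Ne - s *m (K2 *m Ew *m Ee) by rewrite -E addrK.
by rewrite addrAC addrK !mulmxDl !mulNmx !mulmxA addrAC.
Qed.
Lemma slide_comm x : x *m ta = x -> ta *m adm x = adm x *m ta /\ ta *m - adm x = - adm x *m ta.
by move=> /adm_ta h; rewrite mulNmx mulmxN h. Qed.
(** Applying [Lw] to the velocity equation kills the [g0] term and the orbit direction [x]. What
    remains of [w1] is multiplied by [1 - phim (- adm w)], which is small, or is linear in [w]. *)
Lemma slide_est (x w w1 g : V) (Lw : 'M[R]_D) : x *m expm (- adm w) + w1 *m phim (- adm w) = g -> g *m ta = g ->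
  (1%:M + ta) *m Lw = 0 -> x *m Lw = 0 -> w1 *m Lw = w1 -> w1 = w1 *m (1%:M - phim (- adm w)) *m Lw - w *m adm (x *m phim (- adm w)) *m Lw.
move=> E gt tL xL wL; have := congr1 (mulmx^~ Lw) E.
have -> : g *m Lw = 0 by rewrite -(ta_half gt) -mulmxA tL mulmx0.
rewrite mulmxDl expm_phim mulmxDr mulmx1 mulmxDl xL addr0.
rewrite mulmxA mulmxN mulNmx adm_alt mulNmx opprK => {}E; rewrite mulmxBr mulmx1 mulmxBl wL.
by move/eqP: E; rewrite addrC subr_eq0 => /eqP ->; rewrite subrK.
Qed.
Lemma slide_norm (K C4 D1 eps a b : R) : 0 <= a -> C4 * (D1 * a * eps) <= a / 2 -> a <= C4 * (D1 * a * eps) + K / 2 * b -> a <= K * b.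
by move=> a0 h1 h2; lra. Qed.
Lemma slide_eps (C4 D1 a : R) : 0 < C4 -> 0 <= D1 -> 0 <= a -> C4 * (D1 * a * (2 * C4 * (D1 + 1))^-1) <= a / 2.
move=> c0 d0 a0; have d1 : 0 < D1 + 1 by rewrite ltr_wpDl.
have -> : C4 * (D1 * a * (2 * C4 * (D1 + 1))^-1) = a / 2 * (D1 / (D1 + 1)) by field; rewrite !gt_eqF.
by rewrite ler_piMr ?divr_ge0 // ler_pdivrMr // mul1r lerDl.
Qed.

(* A curve with velocity tangent to the dressing orbits stays in one of them: in the
   factorization [v e(y) = e(q) v e(w) e(eta)] with [q] in a + n, [eta] in g0 and [w] in
   a complement, one gets [w' = O(w)]. *)
Lemma slide v t0 (rho B : R) (y y' ga si : R -> V) : gen setT v -> 0 < rho -> y t0 = 0 -> (forall t, `|t - t0| < rho -> [/\ mder y t (y' t),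
     y' t *m phim (- adm (y t)) = ga t + si t *m Adm (v * e (y t))%g, ga t *m ta = ga t, si t *m pu = 0 & `|y' t| <= B /\ `|si t| <= B]) ->
  exists+ r, forall t, `|t - t0| < r -> dorb v (v * e (y t))%g.
move=> hv rho0 yt0 yP; have [U1 [U2 [Lw [LS SL tL LL]]]] := trans_split (Adm v).
pose M := Adm v; pose L1 := U1 *m (pa + pn) *m M; pose L3 := U2 *m (1%:M + ta).
have sT : subalg (Ld := W) 1%:M by split=> [|x z _ _]; rewrite /inP mulmx1.
have [|||s s0 [gg [sg g0 gP]]] := @exp_split 1%:M L1 Lw L3 sT LS; rewrite ?mulmx1 //.
have ob := @Bo_open _ _ (0 : V) s.
pose q x : V := gg x *m U1 *m (pa + pn); pose om x : V := gg x *m Lw.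
have qpu x : q x *m pu = 0 by rewrite pan_id.
have sq : smx (Bo 0 s) q by msm.
pose K1 x := jac gg x *m U1 *m (pa + pn) *m phim (- adm (q x)) *m M.
pose K2 x := expm (- adm (q x)) *m M.
pose N x := phim (- adm (om x)).
have sN : smx (Bo 0 s) N by msm.
have sK1 : smx (Bo 0 s) K1.
  have sj := smx_mulr (pa + pn) ob (smx_mulr U1 ob (jac_smooth sg)).
  have sp : smx (Bo 0 s) (fun x => phim (- adm (q x))) by apply: smx_phim => //; apply: smxN => //; exact: smx_adm.
  exact: smx_mulr M ob (smxM ob sj sp).
have sK2 : smx (Bo 0 s) K2 by msm.
have [C1 C10 [a1 a10 K1P]] := smx_bound0 s0 sK1.
have [C2 C20 [a2 a20 K2P]] := smx_bound0 s0 sK2.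
have [C3 C30 [a3 a30 NP]] := smx_bound0 s0 sN.
have [C4 C40 LwP] := mulmx_le Lw; have [C5 C50 admP] := adm_norm.
(* Chosen so that the term containing [1 - N (y t)] takes at most half of [|w' t|] ([slide_eps]) and
   can be absorbed into the left-hand side. *)
pose eps : R := (2 * C4 * (D%:R + 1))^-1.
have D1 : 0 < (D%:R + 1 : R) by rewrite ltr_wpDl.
have eps0 : 0 < eps by rewrite invr_gt0 !mulr_gt0.
have [a4 a40 N1P] := smx_near0 s0 sN eps0.
have N0 : N 0 = 1%:M by rewrite /N /om g0 mul0mx adm0 oppr0 phim0.
have [a a0 aP] : exists+ a, forall c : R, c < a -> [/\ c < a1, c < a2, c < a3, c < a4 & c < s].
  exists (Num.min (Num.min (Num.min a1 a2) (Num.min a3 a4)) s); first by rewrite !lt_min a10 a20 a30 a40.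
  by move=> c; rewrite !lt_min => /andP[/andP[/andP[-> ->] /andP[-> ->]] ->].
have [|d0 _ _ _ _] := yP t0; first by rewrite subrr normr0.
have [|rr0 rr00 rrP] := mder_lt (c := a) d0; first by rewrite yt0 normr0.
have [r r0 near] : exists+ r, forall t, `|t - t0| < r -> [/\ `|t - t0| < rho, `|y t| < a & `|t - t0| < 1].
  exists (Num.min (Num.min rho rr0) 1); first by rewrite !lt_min rho0 rr00 ltr01.
  by move=> t; rewrite !lt_min => /andP[/andP[h1 /rrP h2] h3].
pose w t := om (y t); pose w' t := y' t *m jac gg (y t) *m Lw.
pose K := 2 * (D%:R * (C3 * ((C1 + C2) * B)) * C5 * C4).
have B0 : 0 <= B by have [|_ _ _ _ [h _]] := yP t0; rewrite ?subrr ?normr0 //; apply: le_trans h.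
have K0 : 0 <= K by rewrite !mulr_ge0 ?addr_ge0 // ltW.
have wP t : `|t - t0| < r -> mder w t (w' t) /\ `|w' t| <= K * `|w t|.
  move=> tr; have [h1 ya h3] := near _ tr; have [dy vE gt sp [yB sB]] := yP t h1. have [ya1 ya2 ya3 ya4 ys] := aP _ ya.
  have yb : Bo 0 s (y t) by rewrite Bo0. have dg := jac_comp ob sg yb dy; have dw := mderMl Lw dg; split=> //.
  have dq := mderMl (pa + pn) (mderMl U1 dg); have de := mderMl L3 dg. have dqM := mderMl M dq.
  have V1 := vel_mul_exp (vel_mul_exp (vel_exp dqM) dw) de. have V2 := vel_exp dy. have [rr1 rr10 rr1P] := mder_lt dy ys.
  have H s' : `|s' - t| < rr1 -> (e (gg (y s') *m U1 *m (pa + pn) *m M) * e (gg (y s') *m Lw) * e (gg (y s') *m L3))%g = e (y s').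
    by move=> /rr1P ys'; rewrite (gP (y s')) ?/inP ?mulmx1 // /L1 !mulmxA.
  (* Two expressions for the velocity of [e (y s)]: directly, and through its factorization. *)
  have E := Vel_unique V2 (Vel_eq rr10 (fun s' h => esym (H s' h)) V1). move=> {V1 V2 H}.
  have kE : (v * e (y t) = e (q (y t)) * v * e (w t) * e (gg (y t) *m L3))%g.
    rewrite (gP (y t)); [|by rewrite /inP mulmx1|exact: ys]; rewrite !mulgA; congr (_ * _ * _)%g. by rewrite AdmP' // /q /L1 !mulmxA.
  have AE : Adm (v * e (y t))%g = K2 (y t) *m expm (- adm (w t)) *m expm (- adm (gg (y t) *m L3)) by rewrite kE !AdmM ?Adm_exp //; do ?apply: genM => //; exact: gen_e.
  have phM : M *m phim (- adm (gg (y t) *m U1 *m (pa + pn) *m M)) = phim (- adm (q (y t))) *m M by apply: phim_tw; rewrite mulmxN mulNmx Adm_lie.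
  have {}E : ga t + si t *m (K2 (y t) *m expm (- adm (w t)) *m expm (- adm (gg (y t) *m L3))) =
      (y' t *m K1 (y t) *m expm (- adm (w t)) + w' t *m N (y t)) *m expm (- adm (gg (y t) *m L3)) +
      y' t *m jac gg (y t) *m L3 *m phim (- adm (gg (y t) *m L3)).
    have K1E : y' t *m K1 (y t) = y' t *m jac gg (y t) *m U1 *m (pa + pn) *m M *m phim (- adm (gg (y t) *m U1 *m (pa + pn) *m M)).
      by rewrite -[RHS]mulmxA phM /K1 !mulmxA.
    by rewrite -AE K1E; exact: etrans (esym vE) E.
  have {}E := slide_alg (expmK _) E.
  have et_ta : gg (y t) *m L3 *m ta = gg (y t) *m L3 by rewrite /L3 -!mulmxA mulmxDl mul1mx ta_sq [ta + _]addrC.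
  have dt_ta : y' t *m jac gg (y t) *m L3 *m ta = y' t *m jac gg (y t) *m L3 by rewrite /L3 -!mulmxA mulmxDl mul1mx ta_sq [ta + _]addrC.
  have phC := phim_tw (slide_comm et_ta).2; have exC := expm_tw (slide_comm et_ta).1.
  have xL : (y' t *m K1 (y t) - si t *m K2 (y t)) *m Lw = 0.
    have zL z : inP (pa + pn) z -> z *m M *m Lw = 0 by move=> <-; rewrite -(mulmxA z) -mulmxA SL mulmx0.
    have qS : inP (pa + pn) (- q (y t)) by apply: inPN; apply/pu_panP.
    have -> : y' t *m K1 (y t) = y' t *m jac gg (y t) *m U1 *m (pa + pn) *m phim (adm (- q (y t))) *m M by rewrite /K1 admN !mulmxA.
    have -> : si t *m K2 (y t) = si t *m expm (adm (- q (y t))) *m M by rewrite /K2 admN mulmxA.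
    rewrite mulmxBl !zL ?subrr //; first by apply: inP_expm pan_sub qS _; apply/pu_panP.
    by apply: inP_phim pan_sub qS _; apply/pu_panP; exact: pan_id.
  have wL : w' t *m Lw = w' t by rewrite /w' -mulmxA LL. have {}E := slide_est E _ tL xL wL.
  have {}E : w' t = w' t *m (1%:M - N (y t)) *m Lw - w t *m adm ((y' t *m K1 (y t) - si t *m K2 (y t)) *m N (y t)) *m Lw.
    apply: E; rewrite -[LHS]mulmxA -exC mulmxA; congr (_ *m _); rewrite mulmxBl gt; congr (_ - _).
    by rewrite -[LHS]mulmxA -phC mulmxA dt_ta.
  set x := y' t *m K1 (y t) - si t *m K2 (y t) in E. have xB : `|x| <= (C1 + C2) * B.
    rewrite /x; apply: le_trans (ler_normB _ _) _; rewrite mulrDl; apply: lerD.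
      by apply: le_trans (K1P _ ya1 _) _; rewrite ler_wpM2l // ltW.
    by apply: le_trans (K2P _ ya2 _) _; rewrite ler_wpM2l // ltW.
  apply: (@slide_norm _ C4 D%:R eps) => //.
    exact: slide_eps.
  rewrite {1}E; apply: le_trans (ler_normB _ _) _; apply: lerD.
    apply: le_trans (LwP _) _; rewrite ler_wpM2l ?(ltW C40) //; apply: le_trans (mx_norm _ _) _.
    by rewrite ler_wpM2l ?mulr_ge0 // distrC -N0 N1P.
  apply: le_trans (LwP _) _. have h2 : `|w t *m adm (x *m N (y t))| <= D%:R * `|w t| * (C5 * (C3 * ((C1 + C2) * B))).
    apply: le_trans (mx_norm _ _) _; rewrite ler_wpM2l ?mulr_ge0 //; apply: le_trans (admP _) _.
    rewrite ler_wpM2l ?(ltW C50) //; apply: le_trans (NP _ ya3 _) _; by rewrite ler_wpM2l ?(ltW C30).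
  apply: le_trans (ler_wpM2l (ltW C40) h2) _; apply: le_of_eq. by rewrite /K; clear; field.
exists r => // t tr.
suff w0 : w t = 0.
  exists (e (gg (y t) *m L3)).
    apply: gen_e; rewrite /= /L3 mulmxA -mulmxA mulmxDl mul1mx ta_sq addrC //.
  exists (e (- q (y t))); first by apply: exp_s_AN; rewrite mulNmx qpu oppr0. have [h1 ya h3] := near _ tr; have [_ _ _ _ ys] := aP _ ya.
  rewrite (gP (y t)); [|by rewrite /inP mulmx1|exact: ys]. have -> : gg (y t) *m Lw = 0 by exact: w0.
  have kE : (v * e (gg (y t) *m L1) = e (q (y t)) * v)%g by rewrite AdmP' // /q /L1 !mulmxA.
  by rewrite e0 mulg1 [(v * (_ * _))%g]mulgA kE expN -mulgA mulKg.
have H1 s' : 0 <= s' <= 1 -> `|(s' * (t - t0) + t0) - t0| < r.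
  move=> /andP[s0' s1']; rewrite addrK normrM ger0_norm //; apply: le_lt_trans tr. by rewrite ler_piMl.
have := @gronwall R D (fun s' => w (s' * (t - t0) + t0)) (fun s' => (t - t0) *: w' (s' * (t - t0) + t0)) K 0 K0 (lexx 0) _ _ 1.
rewrite mul1r subrK mul0r add0r /w yt0 /om g0 mul0mx normr0 addr0 mul0r ler01 lexx.
move=> h; apply/eqP; rewrite -normr_le0; apply: h => // s' s01; have [dw wB] := wP _ (H1 s' s01).
  have := mder_scaled (F := fun s' => w (s' + t0)) (t := s') (a := t - t0) (mder_shift (a := t0) _).
  by move/(_ (w' ((t - t0) * s' + t0))); rewrite [(t - t0) * s']mulrC => /(_ dw); under eq_fun do rewrite [(t - t0) * _]mulrC.
rewrite normrZ addr0; apply: le_trans wB; rewrite ler_piMl //.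
by have [_ _ h3] := near _ tr; exact: ltW.
Qed.
Lemma dorb_P u v : P u = P v -> dorb u v.
by move=> /coset_eq[k hk ->]; apply: dorb_sym; exact: dorb_K. Qed.
(** Since [pu = 1 - (pa + pn)] and [ji] commutes with [Ad u], a Hamiltonian velocity is the sum of
    [i b / 2], which lies in [g0] for [b] in i p0 ([Pop_ga]), and of a vector of a + n carried by
    [Ad u]: it is tangent to the dressing orbit. *)
Lemma Pop_split u b : Ug u -> 2^-1 *: (b *m Pop u) = 2^-1 *: (b *m ji) + (- 2^-1 : R) *: (b *m (Adm u)^T *m ji *m (pa + pn) : V) *m Adm u.
move=> hu; have [Ad1 Ad2] := AdmTK hu; have jiT : b *m (Adm u)^T *m ji *m Adm u = b *m ji.
  by rewrite -mulmxA Adm_ji ?mulmxA -1?[b *m _ *m _]mulmxA ?Ad1 ?mulmx1 //; exact: genT hu.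
have E : pu = 1%:M - (pa + pn) by rewrite -[1%:M](@pu_sum _ W) -[pu + pa + pn]addrA addrK.
rewrite PopE rrE E mulmxBr mulmx1 mulmxBr mulmxBl jiT scalerBr scaleNr mulNmx -scalemxAl.
by rewrite !mulmxA.
Qed.
Lemma Pop_ga b : inQ b -> 2^-1 *: (b *m ji) *m ta = 2^-1 *: (b *m ji).
by move=> [_ bt]; rewrite -scalemxAl -mulmxA ji_ta mulmxN mulmxA bt mulNmx opprK. Qed.
Lemma mder_bound (F : R -> V) t L : mder F t L -> exists2 C : R, 0 <= C & exists+ r, forall s, `|s - t| < r -> `|F s| <= C.
move=> /mder_lt/(_ (_ : `|F t| < `|F t| + 1))[|r r0 rP]; first by rewrite ltrDl.
by exists (`|F t| + 1); [rewrite addr_ge0|exists r => // s /rP/ltW].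
Qed.
(** The slice coordinate [y t] of the arc is read off from smooth functions, hence differentiable.
    Testing against all functions fixes its velocity modulo [k0] ([grd_sep]); [Pop_split] then gives
    the form required by [slide], the [k0] error [z t] being added to the [g0] term. *)
Lemma arc_local h (c : R -> set G) (eps t0 : R) v : CMW h -> (forall t, - eps < t < 1 + eps -> MW (c t) /\
     forall f, CMW f -> is_D t (fun s => f (c s) : R^o) (pi0 f h (c t))) -> - eps < t0 < 1 + eps -> Ug v -> c t0 = P v ->
  exists+ r, forall t, `|t - t0| < r -> exists2 u, Ug u & c t = P u /\ dorb v u.
move=> Ch cP t0e hv ct0; have [r [r1 [r10 r1r inj sl]]] := @slice_fun.
have r00 : 0 < r by exact: lt_le_trans r1r.
have d0 : 0 < Num.min (t0 + eps) (1 + eps - t0) by rewrite lt_min; case/andP: t0e => h1 h2; apply/andP; split; lra.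
have [d1 d10 d1P] : exists+ d1, forall t, `|t - t0| < d1 -> - eps < t < 1 + eps.
  exists (Num.min (t0 + eps) (1 + eps - t0)) => // t; rewrite lt_min !ltr_norml => /andP[/andP[h1 h2] /andP[h3 h4]].
  by apply/andP; split; lra.
have sb (a : R) : 0 < a -> smooth setT (bump (0 : V) a : _ -> R^o) by move=> a0; exact: smooth_bump.
(* [f0] keeps the arc in the slice: where it is nonzero the slice coordinate is shorter than
   [r1 / 2], and there the cutoff in the functions [f j] equals 1. *)
have [||f0 [Cf0 f0E f0P]] := sl v (bump 0 (r1 / 2)) hv; first by apply: sb; rewrite divr_gt0.
  by move=> y hy; apply: bump0; rewrite ?divr_gt0 // subr0; move: hy r10; lra.
have /choice[f fP] : forall j, exists f : set G -> R, CMW f /\ forall y, inQ y -> `|y| < r -> f (P (v * e y)%g) = bump 0 r1 y * y 0 j.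
  move=> j; have [||f [Cf fE _]] := sl v (fun y => bump 0 r1 y * y 0 j) hv; last by exists f.
    by apply: smoothM; [exact: openT|exact: sb|apply: smooth_coord; exact: openT].
  by move=> y hy; rewrite bump0 ?mul0r // subr0; move: hy r10; lra.
pose y t : V := (\row_j f j (c t)) *m pq; pose y' t : V := (\row_j pi0 (f j) h (c t)) *m pq.
have yQ t : inQ (y t) by exact: pq_in.
have dy t : - eps < t < 1 + eps -> mder y t (y' t).
  move=> te; apply: mderMl => i j; rewrite mxE; fun_mxE. by have [_ h1] := cP t te; apply: h1; case: (fP j).
have z0 : inQ (0 : V) by split; rewrite /inU ?mul0mx ?oppr0.
have P0 : P (v * e 0)%g = P v by rewrite e0 mulg1.
have [d2 d20 d2P] : exists+ d2, forall t, `|t - t0| < d2 -> c t = P (v * e (y t))%g.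
  have [_ h1] := cP t0 t0e; have /contP/(_ 2^-1)[|d2 d20 d2P] := derive_cont (h1 f0 Cf0).
    by rewrite invr_gt0.
  exists d2 => // t /d2P; rewrite ct0 -P0 f0E ?normr0 // bump1 ?subr0 ?normr0 ?divr_gt0 //; last by rewrite !divr_ge0 // ltW. move=> ht.
  have nz : f0 (c t) != 0 by apply: contraTneq ht => ->; rewrite sub0r normrN normr1 -ltNge; lra.
  have [q [qQ qr cE]] := f0P _ nz; have qr' := lt_le_trans qr r1r. rewrite cE f0E // in nz; have q2 : `|q| < r1 / 2.
    by rewrite ltNge; apply: contra nz => hq; rewrite bump0 ?subr0 ?divr_gt0 //; move: hq r10; lra.
  have -> // : y t = q. rewrite /y -[RHS](pq_id qQ); congr (_ *m _); apply/rowP => j; rewrite mxE cE; have [_ ->] // := fP j.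
  by rewrite bump1 ?mul1r // subr0 ltW.
have yt0 : y t0 = 0.
  rewrite /y; have -> : \row_j f j (c t0) = 0; last by rewrite mul0mx.
  by apply/rowP => j; rewrite !mxE ct0 -P0; have [_ ->] := fP j; rewrite ?normr0 // mxE mulr0.
have KH := Kinv_CM Ch; have [CH _] := KH.
pose u t := (v * e (y t))%g; have hu t : Ug (u t) by apply: UgM_e => //; case: (yQ t).
pose b t := grd (h \o P) (u t).
pose w t := y' t *m phim (- adm (y t)).
have wK t : `|t - t0| < d1 -> `|t - t0| < d2 -> (w t - 2^-1 *: (b t *m Pop (u t))) *m pq = 0.
  move=> tr1 tr2; have te := d1P t tr1; have yU s : inU (y s) by case: (yQ s).
  have wU : inU (w t) by apply: inU_phim => //; case: (pq_in (\row_j pi0 (f j) h (c t))).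
  apply: (grd_sep (hu t)); first by rewrite -scaleN1r addrC; apply: inUL => //; apply: inUZ; exact: Pop_in.
  move=> g Cg; have KG := Kinv_CM Cg; have [CG _] := KG.
  have D1 := derive_CU_curve CG hv yU (dy t te); have [_ D2] := cP t te; have {}D2 := D2 g Cg.
  have dd : 0 < d2 - `|t - t0| by rewrite subr_gt0.
  have {}D2 : is_D t (fun s => (g \o P) (v * e (y s))%g : R^o) (pi0 g h (c t)).
    apply: (der_loc dd _ D2) => s sd; rewrite /= -d2P //. have -> : s - t0 = (s - t) + (t - t0) by ring.
    apply: le_lt_trans (ler_normD _ _) _. by rewrite -ltrBrDr.
  have E := der_uniq D1 D2; rewrite (d2P t tr2) (pi0E Cg Ch (hu t)) (piU_Kinv KG KH (hu t)) in E.
  have gU := grd_in CG (hu t); have bU := grd_in CH (hu t).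
  by rewrite (Pop_skew (hu t) gU bU) mulrNN in E; rewrite dotDr dotNr dotZr -E subrr.
have t00 : `|t0 - t0| = 0 by rewrite subrr normr0.
(* Differentiability of [y'] and [b] at [t0] supplies the bounds asked for by [slide]; for [y'] it
   holds because [pi0 (f j) h] is again a smooth function. *)
have dy' : mder y' t0 ((\row_j pi0 (pi0 (f j) h) h (c t0)) *m pq).
  apply: mderMl => i j; rewrite mxE; fun_mxE. by have [_ h1] := cP t0 t0e; apply: h1; apply: pi0_CM => //; case: (fP j).
have db : mder b t0 (\row_i dot (grd (lf (delta_mx 0 i *m qu) (h \o P)) (u t0)) (w t0)).
  move=> i j; rewrite mxE; fun_mxE. apply: derive_CU_curve => //; [|by move=> s; case: (yQ s)|exact: dy].
  by apply: lf_CU => //; exact: qu_in.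
have [C1 C10 [a1 a10 a1P]] := mder_bound dy'; have [C2 C20 [a2 a20 a2P]] := mder_bound db.
have [C3 C30 C3P] := mulmx_le (ji *m (pa + pn)).
pose z t := w t - 2^-1 *: (b t *m Pop (u t)).
pose si t : V := (- 2^-1 : R) *: (b t *m (Adm (u t))^T *m ji *m (pa + pn)).
pose ga t := 2^-1 *: (b t *m ji) + z t.
have [rho rho0 rhoP] : exists+ rho, forall t, `|t - t0| < rho ->
    [/\ `|t - t0| < d1, `|t - t0| < d2, `|t - t0| < a1 & `|t - t0| < a2].
  exists (Num.min (Num.min d1 d2) (Num.min a1 a2)); first by rewrite !lt_min d10 d20 a10 a20.
  by move=> t; rewrite !lt_min => /andP[/andP[-> ->] /andP[-> ->]].
have [|r2 r20 r2P] := @slide v t0 rho (C1 + C3 * (D%:R * C2)) y y' ga si (genT hv) rho0 yt0.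
  move=> t /rhoP[h1 h2 h3 h4]; have te := d1P t h1; split.
  - exact: dy.
  - have -> : y' t *m phim (- adm (y t)) = 2^-1 *: (b t *m Pop (u t)) + z t by rewrite /z addrC subrK. by rewrite Pop_split // addrAC.
  - rewrite mulmxDl (Pop_ga (Kinv_Q KH (hu t))); congr (_ + _). have zU : inU (z t).
      rewrite /z -scaleN1r addrC; apply: inUL; first by apply: inUZ; exact: Pop_in.
      by apply: inU_phim; [case: (pq_in (\row_j pi0 (f j) h (c t)))|case: (yQ t)].
    have [_] := pk_in (z t); have E : z t *m pk = z t.
      by rewrite -[RHS](qu_id zU) -pkq mulmxDr [z t *m pq]wK // add0r.
    by rewrite E.
  - by rewrite -scalemxAl pan_id scaler0.
  split; first by apply: le_trans (a1P t h3) _; rewrite lerDl !mulr_ge0 // ltW. have hT := genT (hu t); have hV := genV (hu t).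
  have AdE : (Adm (u t))^T = Adm (u t)^-1%g by rewrite -[LHS]mulmx1 -(AdmVK hT) mulmxA (AdmTK (hu t)).1 mul1mx.
  have b1 : `|b t *m (Adm (u t))^T *m (ji *m (pa + pn))| <= C3 * (D%:R * C2).
    apply: le_trans (C3P _) _; rewrite ler_wpM2l ?(ltW C30) // AdE; apply: le_trans (Adm_norm _ hV) _. by rewrite ler_wpM2l // a2P.
  rewrite /si normrZ normrN -[_ *m ji *m _]mulmxA ger0_norm ?invr_ge0 //.
  by move: b1 C10 (normr_ge0 (b t *m (Adm (u t))^T *m (ji *m (pa + pn)))); move: `|_| (C3 * _) => p1 p2; clear; lra.
exists (Num.min rho r2); first by rewrite lt_min rho0.
move=> t; rewrite lt_min => /andP[/rhoP[h1 h2 _ _] hr]; exists (u t) => //; split; first exact: d2P.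
exact: r2P.
Qed.

Lemma arc_dorb (x y : set G) u v : hamiltonian_arc (@MW _ W) CMW pi0 x y -> Ug u -> Ug v -> x = P u -> y = P v -> dorb u v.
move=> [h [c [eps [Ch e0' c0 c1 cP]]]] hu hv xE yE.
(* The alternative [s = t] makes the relation reflexive on all of [R], as [local_equiv] demands. *)
pose E s t := s = t \/ [/\ 0 <= s <= 1, 0 <= t <= 1 & forall u1 u2, Ug u1 -> Ug u2 -> c s = P u1 -> c t = P u2 -> dorb u1 u2].
have in01 t : 0 <= t <= 1 -> - eps < t < 1 + eps by move=> /andP[h1 h2]; apply/andP; split; lra.
suff E01 : E 0 1.
  case: E01 => [/eqP|[_ _ H]]; first by rewrite eq_sym oner_eq0. by apply: H; rewrite ?c0 ?c1.
apply: local_equiv => [t|s t|r s t|t t01].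
- by left.
- move=> [->|[s01 t01 H]]; first by left. by right; split=> // u1 u2 hu1 hu2 E1 E2; apply: dorb_sym; exact: H.
- move=> [->//|[r01 s01 H]] [<-|[_ t01 H']]; first by right. right; split=> // u1 u2 hu1 hu2 E1 E2; have [[w hw sE] _] := cP s (in01 s s01).
  by apply: (dorb_trans (v := w)); [exact: H|exact: H'].
have [[w hw wE] _] := cP t (in01 t t01).
have [r r0 rP] := arc_local Ch cP (in01 t t01) hw (esym wE); exists r => // s s01 sr.
right; split=> // u1 u2 hu1 hu2 E1 E2; have [w' hw' [sE wo]] := rP s sr.
apply: (dorb_trans (v := w)); first by apply: dorb_P; rewrite -E1.
by apply: dorb_trans wo _; apply: dorb_P; rewrite -sE.
Qed.

(** * Dressing curves project to Hamiltonian arcs *)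

Implicit Types (p q : V).

Lemma line_near p q (c : R) : `|p| < c -> exists+ dl, forall t : R, `|t - 0| < dl -> `|p + t *: q| < c.
move=> pc; have q1 : 0 < `|q| + 1 by rewrite ltr_wpDl.
exists ((c - `|p|) / (`|q| + 1)); first by rewrite divr_gt0 // subr_gt0.
move=> t; rewrite subr0 ltr_pdivlMr // => hs; apply: le_lt_trans (ler_normD _ _) _; rewrite addrC -ltrBrDr.
by apply: le_lt_trans hs; rewrite normrZ ler_wpM2l // lerDl.
Qed.

(** The orthogonal projection onto the line of [y0]. For [y0 = 0] it is 0, so a constant curve is
    treated like the others. *)
Definition line_proj y0 : 'M[R]_D := (dot y0 y0)^-1 *: (y0^T *m y0).

Lemma line_projE y0 p : p *m line_proj y0 = (dot p y0 / dot y0 y0) *: y0.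
rewrite /line_proj -scalemxAr mulmxA [p *m _]mx11_scalar mul_scalar_mx scalerA mulrC; congr (_ * _ *: _).
Qed.
Lemma line_proj_id y0 t : (t *: y0) *m line_proj y0 = t *: y0.
rewrite line_projE dotZl; have [->|y00] := eqVneq y0 0; first by rewrite !scaler0.
by rewrite mulfK //; apply: contra y00 => /eqP /dot_eq0 ->.
Qed.
Lemma line_proj_norm y0 p : `|p *m line_proj y0| <= D%:R * `|p|.
rewrite line_projE; have [->|y00] := eqVneq y0 0; first by rewrite scaler0 normr0 mulr_ge0.
have n0 : 0 < `|y0| by rewrite normr_gt0.
have d0 : 0 < dot y0 y0 by apply: lt_le_trans (sqr_norm_dot y0); rewrite exprn_gt0.
rewrite normrZ normrM normfV (gtr0_norm d0) mulrAC ler_pdivrMr //.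
apply: le_trans (_ : D%:R * `|p| * `|y0| * `|y0| <= _); first by rewrite ler_wpM2r // dot_le.
by rewrite -mulrA -expr2 ler_wpM2l ?mulr_ge0 // sqr_norm_dot.
Qed.

(* In the coordinates [Psi] straightening the curves [t |-> Y (t eta)], take
   [dot (Bf z) (p - z)] with [z] the projection of [p] to the line. *)
Lemma conormal_fun (Y : V -> V) (L : 'M[R]_D) (r0 eps : R) : 0 < r0 -> 0 < eps -> smx (Bo 0 r0) Y -> Y 0 = 0 ->
  (forall x, x *m L *m jac Y 0 = 0 -> x *m L = 0) -> exists+ rho, forall x (Bf : V -> V), `|x *m L| < rho -> smx (Bo 0 r0) Bf ->
    (forall t : R, `|t| < 2 -> `|t *: (x *m L)| < r0 -> dot (Bf (t *: (x *m L))) (x *m L *m jac Y (t *: (x *m L))) = 0) ->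
    exists2 phi : V -> R, smooth setT (phi : _ -> R^o) & (forall y, eps <= `|y| -> phi y = 0) /\
      forall t : R, `|t| < 2 -> [/\ `|t *: (x *m L)| < r0, `|Y (t *: (x *m L))| < eps &
        forall q, is_D (0 : R) (fun s => phi (Y (t *: (x *m L)) + s *: q) : R^o) (dot (Bf (t *: (x *m L))) q : R^o)].
(* [J] inverts the differential of [Y] on the image of [L], where it is injective ([LJ]). *)
move=> r00 eps0 sY Y0 inj0; pose B1 := jac Y 0; pose J := pinvmx (L *m B1) *m L.
have LJ : L *m B1 *m J = L.
  apply: row_ext => x; pose M := L *m B1; have := inj0 (x - x *m M *m pinvmx M).
  rewrite -[_ *m L *m jac Y 0]mulmxA -/B1 -/M mulmxBl -mulmxA -mulmxA mulmxKpV // mulmxA subrr => /(_ erefl)/eqP.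
  by rewrite mulmxBl subr_eq0 /J !mulmxA => /eqP.
have [C1 C10 C1P] := mulmx_le J; pose ra := r0 / C1; have ra0 : 0 < ra by rewrite divr_gt0.
have JB p : Bo 0 ra p -> Bo 0 r0 (p *m J).
  rewrite !Bo0 => pr; apply: le_lt_trans (C1P p) _; by rewrite mulrC -ltr_pdivlMr.
(* The second summand corrects the differential at 0 to the identity and vanishes on the line of
   [y0] ([y0Q]), so that [Psi] follows [Y] along the curve. *)
pose Psi p := Y (p *m J) + p *m (1%:M - J *m B1).
have o0 := @Bo_open _ _ (0 : V) r0.
have sPsi : smx (Bo 0 ra) Psi.
  apply: smxD; [msm| |msm]. by apply: (@smx_comp _ _ _ _ _ (Bo 0 ra) (Bo 0 r0) Y) => //; msm.
have Psi0 : Psi 0 = 0 by rewrite /Psi !mul0mx Y0 addr0.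
have [//|x|r [s [Phi [[r_0 s0 rb] inj surj sPhi Phi0]]]] := inverse_at0 ra0 sPsi.
  have dl := mder_line 0 x; have y0 : Bo 0 r0 ((0 + 0 *: x) *m J) by rewrite scale0r addr0; exact/JB/Bo_ctr.
  have := mderD (jac_comp o0 sY y0 (mderMl J dl)) (mderMl (1%:M - J *m B1) dl).
  by rewrite scale0r addr0 mul0mx -/B1 -[x *m J *m B1]mulmxA -mulmxDr [J *m B1 + _]addrC subrK mulmx1.
have os := @Bo_open _ _ (0 : V) s.
have D1 : 0 < (D%:R + 1 : R) by rewrite ltr_wpDl.
pose r2 := ra / (D%:R + 1); have r20 : 0 < r2 by rewrite divr_gt0.
have [r3 [r30 r3s r3P]] : exists r3 : R, [/\ 0 < r3, r3 <= s & forall y, `|y| < r3 -> `|Phi y| < r2].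
  have [a a0 aP] := smx_near0 s0 sPhi (divr_gt0 r20 (ltr0n _ 2)).
  exists (Num.min a s); split; rewrite ?lt_min ?a0 // ?ge_min ?lexx ?orbT // => y.
  rewrite lt_min => /andP[/aP h _]; rewrite Phi0 subr0 in h; apply: le_lt_trans h _. by move: r20; clear; lra.
pose r1 := Num.min eps r3; have r10 : 0 < r1 by rewrite lt_min eps0.
have r12 : 0 < r1 / 2 / 2 by rewrite !divr_gt0.
have [r4 r40 r4P] := smx_near0 r00 sY r12.
have [C2 C20 C2P] := mulmx_le B1.
have [rho rho0 rhoP] : exists+ rho, forall (t : R) z, `|t| < 2 -> `|z| < rho ->
    [/\ `|t *: z| < r0, `|Y (t *: z)| < r1 / 2 & `|t *: (z *m B1)| < r].
  exists (Num.min (Num.min r0 r4) (r / C2) / 2); first by rewrite divr_gt0 // !lt_min r00 r40 divr_gt0.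
  move=> t z t2; rewrite ltr_pdivlMr // !lt_min => /andP[/andP[h1 h2] h3].
  have tz c : `|z| * 2 < c -> `|t *: z| < c by apply: le_lt_trans; rewrite normrZ mulrC ler_wpM2l // ltW. split; first exact: tz.
    have := r4P _ (tz _ h2); rewrite Y0 subr0 => h; apply: le_lt_trans h _; move: r10; clear; lra.
  by rewrite scalemxAl; apply: le_lt_trans (C2P _) _; rewrite mulrC -ltr_pdivlMr // tz.
exists rho => // x Bf xr sB B0; set eta := x *m L in xr B0 *.
pose y0 := eta *m B1; pose Pi := line_proj y0.
have y0J t : (t *: y0) *m J = t *: eta by rewrite -scalemxAl /y0 /eta -2!mulmxA [L *m _]mulmxA LJ.
have y0Q t : (t *: y0) *m (1%:M - J *m B1) = 0 by rewrite mulmxBr mulmx1 mulmxA y0J /y0 -scalemxAl subrr.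
have PsiE t : Psi (t *: y0) = Y (t *: eta) by rewrite /Psi y0J y0Q addr0.
have PhiE t : `|t| < 2 -> Phi (Y (t *: eta)) = t *: y0.
  move=> t2; have [h1 h2 h3] := rhoP t _ t2 xr. have ys : Bo 0 s (Y (t *: eta)).
    rewrite Bo0; apply: lt_le_trans h2 (le_trans _ r3s); have : r1 <= r3 by rewrite ge_min lexx orbT. by move: r10; clear; lra.
  by have [h4 h5] := surj _ ys; apply: inj => //; rewrite ?h5 ?PsiE // Bo0.
pose PJ := Pi *m J; pose g1 y := Phi y *m PJ.
have PJE p : p *m PJ = (dot p y0 / dot y0 y0) *: eta by rewrite /PJ mulmxA line_projE y0J.
have r1r3 : r1 <= r3 by rewrite ge_min lexx orbT.
have g1B y : Bo 0 r1 y -> Bo 0 r0 (g1 y).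
  rewrite Bo0 => /lt_le_trans/(_ r1r3)/r3P; rewrite /r2 ltr_pdivlMr // => pr.
  rewrite /g1 /PJ mulmxA; apply: JB; rewrite Bo0; apply: le_lt_trans (line_proj_norm y0 _) _.
  by apply: le_lt_trans pr; rewrite mulrC ler_wpM2l // lerDl.
have o1 := @Bo_open _ _ (0 : V) r1.
have b1s : Bo 0 r1 `<=` Bo (0 : V) s by move=> y; rewrite /Bo /= => h; exact: lt_le_trans h (le_trans r1r3 r3s).
have sg1 : smx (Bo 0 r1) g1 := smx_mulr PJ o1 (smx_sub b1s sPhi).
(* At a point of the curve the second factor vanishes, so only its differential contributes; the
   part of it along the curve is killed by the hypothesis on [Bf]. *)
pose hz y : R := dot (Bf (g1 y)) (y - Y (g1 y)).
have shz : smooth (Bo 0 r1) (hz : _ -> R^o).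
  have s1 : smx (Bo 0 r1) (fun y : V => Bf (g1 y) *m (y - Y (g1 y))^T).
    have cmp Z : smx (Bo 0 r0) Z -> smx (Bo 0 r1) (fun y => Z (g1 y) : V) by move=> sZ; apply: (@smx_comp _ _ _ _ _ (Bo 0 r1) (Bo 0 r0) Z).
    by have h1 := cmp _ sB; have h2 := cmp _ sY; msm.
  exact: s1 0 0.
exists (bext 0 r1 hz); first exact: bext_smooth.
split=> [y ye|t t2].
  by rewrite /bext ifF //; apply/negbTE; rewrite -leNgt subr0; apply: le_trans ye; rewrite ge_min lexx.
have [h1 h2 _] := rhoP t _ t2 xr; split=> // [|q].
  have h : r1 <= eps by rewrite ge_min lexx. by apply: lt_le_trans h2 _; move: h eps0; clear; lra.
set y := Y (t *: eta) in h2 *; have [dl dl0 dlP] := line_near q h2.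
have ys : Bo 0 s y by apply: b1s; rewrite Bo0; move: h2 r10; clear; lra.
have g1y : g1 (y + 0 *: q) = t *: eta by rewrite scale0r addr0 /g1 PhiE // /PJ mulmxA line_proj_id y0J.
have O0 : Bo 0 r0 (g1 (y + 0 *: q)) by rewrite g1y Bo0.
have := mderMl PJ (jac_mderiv q os sPhi ys); rewrite PJE => dg.
have dd := mderD (mder_line y q) (mderN (jac_comp o0 sY O0 dg)).
have := mderM (jac_comp o0 sB O0 dg) (mder_tr dd) 0 0.
rewrite -/(g1 _) g1y scale0r addr0 subrr trmx0 mulmx0 add0r => dz.
have E : (Bf (t *: eta) *m (q - (dot (q *m jac Phi y) y0 / dot y0 y0) *: eta *m jac Y (t *: eta))^T) 0 0 = dot (Bf (t *: eta)) q.
  by rewrite -[LHS]/(dot _ _) dotDr dotNr -scalemxAl dotZr B0 // mulr0 subr0.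
rewrite E in dz; apply: (der_loc dl0 _ dz) => s' hs.
by rewrite bextE // subr0 ltW // dlP.
Qed.

Lemma vel_conj v (a1 n1 al nu : V) : gen setT v ->
  a1 *m Adm v *m phim (- adm (al *m Adm v)) *m expm (- adm (nu *m Adm v)) + n1 *m Adm v *m phim (- adm (nu *m Adm v)) =
  (a1 *m phim (- adm al) *m expm (- adm nu) + n1 *m phim (- adm nu)) *m Adm v.
move=> hv; have comm q : Adm v *m - adm (q *m Adm v) = - adm q *m Adm v by rewrite mulmxN mulNmx Adm_lie.
have phM q := phim_tw (comm q); have exM q := expm_tw (comm q).
have pure (A0 Pa Pn En Pa' Pn' En' : 'M[R]_D) : A0 *m Pa' = Pa *m A0 -> A0 *m Pn' = Pn *m A0 -> A0 *m En' = En *m A0 ->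
    a1 *m A0 *m Pa' *m En' + n1 *m A0 *m Pn' = (a1 *m Pa *m En + n1 *m Pn) *m A0.
  by move=> E1 E2 E3; rewrite mulmxDl -!mulmxA -E2 -E3 (mulmxA Pa) -E1 !mulmxA.
exact: pure.
Qed.
Lemma Adm_mul_exp x v y : gen setT v -> x *m Adm (v * e y)%g = x *m Adm v *m expm (- adm y).
by move=> hv; rewrite AdmM ?Adm_exp ?mulmxA //; exact: gen_e. Qed.
Lemma vel_s (a1 n1 al nu : V) : a1 *m pu = 0 -> n1 *m pu = 0 -> al *m pu = 0 -> nu *m pu = 0 ->
  (a1 *m phim (- adm al) *m expm (- adm nu) + n1 *m phim (- adm nu)) *m pu = 0.
move=> /pu_panP a1s /pu_panP n1s /pu_panP /inPN als /pu_panP /inPN nus.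
have h1 := inP_phim pan_sub als a1s; have h2 := inP_phim pan_sub nus n1s; have h3 := inP_expm pan_sub nus h1.
by rewrite !admN in h1 h2 h3; rewrite mulmxDl ((pu_panP _).2 h3) ((pu_panP _).2 h2) addr0.
Qed.

Lemma inK_phim x y : inK x -> inK y -> inK (x *m phim (- adm y)).
move=> [xU xt] [yU yt]; split; first exact: inU_phim.
by rewrite -mulmxA -(phim_tw (slide_comm yt).2) mulmxA xt.
Qed.

(* The dressing action near [v], [v e(z) = a v e(Y z) e(ka z)], and its velocity. *)
Lemma dress_chart v : Ug v -> exists+ s, exists Y ka : V -> V, [/\ smx (Bo 0 s) Y, smx (Bo 0 s) ka, Y 0 = 0 /\ ka 0 = 0,
    forall z, inQ (Y z) /\ inK (ka z) & forall z, `|z| < s -> (exists2 a, AN a & (v * e z = a * (v * e (Y z) * e (ka z)))%g) /\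
      forall x, exists sg ka', [/\ sg *m pu = 0, inK ka' &
        x *m phim (- adm z) *m expm (adm (ka z)) + ka' = sg *m Adm (v * e (Y z))%g + x *m jac Y z *m phim (- adm (Y z))]].
move=> hv; have hT := genT hv; have hV := genV hv; pose M := Adm v; pose M' := Adm v^-1%g.
have [s2 s20 [g2 [sg2 g20 g2P]]] := @AN_split_small; have [s3 s30 [g3 [sg3 g30 g3P]]] := @K_split.
have o2 := @Bo_open _ _ (0 : V) s2; have o3 := @Bo_open _ _ (0 : V) s3.
(* [v * e z] is [e (z *m M') * v]. After factoring [e (z *m M')], the AN factors stay on the left of
   [v], and the u-factor returns to its right as [e (mu z)]. *)
pose mu z := g2 (z *m M') *m pu *m M.
have [C1 C10 C1P] := mulmx_le M'.
have sa0 : 0 < s2 / C1 by rewrite divr_gt0.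
have MB z : Bo 0 (s2 / C1) z -> Bo 0 s2 (z *m M').
  rewrite !Bo0 => zr; apply: le_lt_trans (C1P z) _; by rewrite mulrC -ltr_pdivlMr.
have oa := @Bo_open _ _ (0 : V) (s2 / C1).
have sg2' : smx (Bo 0 (s2 / C1)) (fun z => g2 (z *m M')) by apply: (@smx_comp _ _ _ _ _ _ (Bo 0 s2) g2) => //; msm.
have smu : smx (Bo 0 (s2 / C1)) mu by msm.
have mu0 : mu 0 = 0 by rewrite /mu mul0mx g20 !mul0mx.
have [s4 s40 mu4] := smx_near0 sa0 smu (divr_gt0 s30 (ltr0n _ 2)).
pose s := Num.min (s2 / C1) s4; have s0 : 0 < s by rewrite lt_min sa0.
have os := @Bo_open _ _ (0 : V) s.
have sub1 : Bo 0 s `<=` Bo (0 : V) (s2 / C1) by move=> z; rewrite /Bo /= lt_min => /andP[].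
have mu3 z : Bo 0 s z -> Bo 0 s3 (mu z).
  rewrite !Bo0 lt_min => /andP[_ /mu4]; rewrite mu0 subr0 => h; apply: le_lt_trans h _. by move: s30; clear; lra.
have sg3' : smx (Bo 0 s) (fun z => g3 (mu z)).
  apply: (@smx_comp _ _ _ _ _ _ (Bo 0 s3) g3) => //; exact: smx_sub smu.
pose Y z := g3 (mu z) *m pq; pose ka z := g3 (mu z) *m pk.
have sY : smx (Bo 0 s) Y := smx_mulr pq os sg3'.
have ska : smx (Bo 0 s) ka := smx_mulr pk os sg3'.
pose al z := g2 (z *m M') *m pa; pose nu z := g2 (z *m M') *m pn.
have sal : smx (Bo 0 s) al := smx_sub sub1 (smx_mulr pa oa sg2').
have snu : smx (Bo 0 s) nu := smx_sub sub1 (smx_mulr pn oa sg2').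
have MM : M' *m M = 1%:M by exact: AdmVK'.
have muU z : inU (mu z) by apply: inU_Adm => //; exact: pu_in.
have vE z : Bo 0 s z -> (v * e z = e (al z) * e (nu z) * (v * e (Y z) * e (ka z)))%g.
  move=> zs; have := sub1 _ zs => /MB; rewrite Bo0 => /g2P E.
  have vz : (v * e z = e (z *m M') * v)%g by rewrite AdmP' // -mulmxA MM mulmx1.
  have E3 : e (mu z) = (e (Y z) * e (ka z))%g by apply: g3P => //; have := mu3 _ zs; rewrite Bo0.
  have AE : (e (g2 (z *m M') *m pu) * v = v * e (mu z))%g by rewrite AdmP'. by rewrite vz E -[LHS]mulgA AE E3 !mulgA.
exists s => //; exists Y, ka; split=> //.
- by rewrite /Y /ka mu0 g30 !mul0mx.
- by move=> z; split; [exact: pq_in|exact: pk_in].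
move=> z zs0; have zs : Bo 0 s z by rewrite Bo0.
split; first by exists (e (al z) * e (nu z))%g; [exact: AN_pan|exact: vE].
move=> x; have dz := mder_line z x.
have z0 : z + 0 *: x = z by rewrite scale0r addr0.
have Oz : Bo 0 s (z + 0 *: x) by rewrite z0.
have dY := jac_comp os sY Oz dz; have dk := jac_comp os ska Oz dz.
have da := mderMl M (jac_comp os sal Oz dz); have dn := mderMl M (jac_comp os snu Oz dz).
have V1 := vel_mul_exp (vel_mul_exp (vel_exp da) dn) dY.
have V2 := vel_mul_exp (vel_exp dz) (mderN dk).
have [dl dl0 dlP] := line_near x zs0.
(* The factor in [K0] is moved to the left-hand side, so that the velocities compared are those at
   the slice point [v * e (Y z)]. *)
have H t : `|t - 0| < dl -> (e (z + t *: x) * e (- ka (z + t *: x)))%g =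
    (e (al (z + t *: x) *m M) * e (nu (z + t *: x) *m M) * e (Y (z + t *: x)))%g.
  move=> /dlP ht; have /vE E : Bo 0 s (z + t *: x) by rewrite Bo0. rewrite expN; apply: (mulgI v); rewrite mulgA E.
  by rewrite !mulgA mulgK -AdmP' // -[(_ * v * e (nu _ *m M))%g]mulgA -AdmP' // !mulgA.
have := Vel_unique V2 (Vel_eq dl0 H V1); rewrite z0.
rewrite (vel_conj _ _ _ _ hT) => E.
have kK : inK (ka z) by exact: pk_in.
exists (x *m jac al z *m phim (- adm (al z)) *m expm (- adm (nu z)) + x *m jac nu z *m phim (- adm (nu z))).
have En : - adm (- ka z) = adm (ka z) by rewrite admN opprK.
exists (- (x *m jac ka z) *m phim (adm (ka z))); split.
- have sgs := smx_sub sub1 sg2'; apply: vel_s.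
  + by rewrite (jac_mulr pa os sgs zs) mulmxA; apply: (an_pu _).1; rewrite /inA -mulmxA pa_pa.
  + by rewrite (jac_mulr pn os sgs zs) mulmxA; apply: (an_pu _).2; rewrite /inN -mulmxA pn_pn.
  + by apply: (an_pu _).1; rewrite /inA -mulmxA pa_pa.
  by apply: (an_pu _).2; rewrite /inN -mulmxA pn_pn.
- rewrite -En; apply: inK_phim; first by rewrite (jac_mulr pk os sg3' zs) mulmxA -mulNmx; exact: pk_in.
  by rewrite /ka -mulNmx; exact: pk_in.
by rewrite (Adm_mul_exp _ (Y z) hT); rewrite !En in E; exact: E.
Qed.

(** [x |-> - i (x - theta x)], twice the i p0 part of [- i x] when [x] is in [g0]. It is the
    covector whose Hamiltonian vector is the dressing vector of [x] modulo [k0] ([dress_pop]). *)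
Definition bm : 'M[R]_D := - ((1%:M - th) *m ji).

Lemma bm_ji x : x *m bm *m ji = x *m (1%:M - th).
by rewrite /bm mulmxN mulNmx -!mulmxA ji_sq mulmxN mulmx1 mulmxN opprK. Qed.
Lemma bm_Q x : x *m ta = x -> inQ (x *m bm).
move=> xt; rewrite /bm mulmxN mulmxA; split; rewrite /inU mulNmx; congr (- _).
  rewrite -[LHS]mulmxA ji_th mulmxN mulmxA -mulNmx; congr (_ *m _).
  by rewrite mulmxBr mulmx1 mulmxBl -[x *m th *m th]mulmxA th_sq mulmx1 opprB.
rewrite -[LHS]mulmxA ji_ta mulmxN mulmxA; congr (- (_ *m _)).
by rewrite mulmxBr mulmx1 mulmxBl -[x *m th *m ta]mulmxA -ta_th mulmxA xt.
Qed.

Lemma half_K x : x *m ta = x -> inK (2^-1 *: (x *m (1%:M + th))).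
move=> xt; split; rewrite /inU -scalemxAl; congr (_ *: _); rewrite mulmxDr mulmx1 mulmxDl.
  by rewrite -mulmxA th_sq mulmx1 addrC.
by rewrite -mulmxA -ta_th mulmxA xt.
Qed.
Lemma inUB x y : inU x -> inU y -> inU (x - y).
by rewrite /inU mulmxBl => -> ->. Qed.
Lemma inKD x y : inK x -> inK y -> inK (x + y).
by move=> [xU xt] [yU yt]; split; rewrite /inU mulmxDl ?xU ?yU ?xt ?yt. Qed.

(* Dressing fields are the Hamiltonian ones modulo [k0]. *)
Lemma dress_pop u (x k sg w : V) : Ug u -> x *m ta = x -> inK k -> sg *m pu = 0 -> inU w -> x + k = sg *m Adm u + w ->
  inK (w - 2^-1 *: (x *m bm *m Pop u)).
move=> hu xt kK sg0 wU E; have hT := genT hu; have hV := genV hu.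
set b := x *m bm; set si : V := (- 2^-1 : R) *: (b *m (Adm u)^T *m ji *m (pa + pn)).
have bU : inU b by case: (bm_Q xt).
have PE : 2^-1 *: (b *m Pop u) = 2^-1 *: (b *m ji) + si *m Adm u by rewrite Pop_split.
have xE : x = 2^-1 *: (b *m ji) + 2^-1 *: (x *m (1%:M + th)) by rewrite bm_ji addrC mulmxDr mulmxBr mulmx1 half_parts.
have KK := inKD (half_K xt) kK; set kk := _ + k in KK.
have dE : w - 2^-1 *: (b *m Pop u) - kk = - ((sg + si) *m Adm u).
  have -> : w = x + k - sg *m Adm u by rewrite E addrC addKr.
  rewrite PE mulmxDl {1}xE /kk; move: (2^-1 *: (b *m ji)) (2^-1 *: (x *m _)) (sg *m _) (si *m _) => p q p' q'.
  by apply/rowP => i; rewrite !mxE; ring.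
have dU : inU ((sg + si) *m Adm u).
  have -> : (sg + si) *m Adm u = (-1) *: (w - 2^-1 *: (b *m Pop u) - kk) by rewrite dE scaleN1r opprK.
  apply: inUZ; apply: inUB; last by case: KK. by apply: inUB => //; apply: inUZ; exact: Pop_in.
have z0 : sg + si = 0.
  have : inU (sg + si) by have := inU_Adm hV dU; rewrite -mulmxA AdmVK // mulmx1.
  by move=> /pu_id <-; rewrite mulmxDl sg0 add0r -scalemxAl pan_id scaler0.
by have := KK; rewrite z0 mul0mx oppr0 in dE; rewrite -(subrK kk (w - _)) dE add0r.
Qed.

(** Adding [1 - Q] expresses the invertibility of [F] compressed to the image of [Q] as that of a
    full square matrix, an open condition. *)
Lemma slice_solve (Q F : 'M[R]_D) (d0 : V) : Q *m Q = Q -> d0 *m Q = d0 -> Q *m F *m Q + (1%:M - Q) \in unitmx ->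
  exists2 q, q *m Q = q & q *m F *m Q = d0.
move=> QQ dQ uN; set N := _ + _ in uN; pose q := d0 *m invmx N.
have qN : q *m N = d0 by rewrite mulmxKV.
have Q1 : Q *m (1%:M - Q) = 0 by rewrite mulmxBr mulmx1 QQ subrr.
have Q2 := compl_idem QQ.
have NQ : N *m (1%:M - Q) = 1%:M - Q by rewrite /N mulmxDl -mulmxA Q1 mulmx0 add0r Q2.
have q1 : q *m (1%:M - Q) = 0 by rewrite -NQ mulmxA qN mulmxBr mulmx1 dQ subrr.
have qQ : q *m Q = q by move/eqP: q1; rewrite mulmxBr mulmx1 subr_eq0 eq_sym => /eqP.
by exists q => //; rewrite -[RHS]qN /N mulmxDr q1 addr0 !mulmxA qQ.
Qed.

(** At each time the dressing velocity is Hamiltonian for the covector [b (t *: eta)];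
    [conormal_fun] provides a single function with these differentials along the whole curve. That
    requires the covector to vanish on the velocity, which follows from the skewness of [Pop]. The
    second hypothesis on [L] makes the slice coordinate move with nonzero speed. *)
Lemma dressing_arc v (L : 'M[R]_D) : Ug v -> (forall x, x *m L *m ta = x *m L) ->
  (forall x (sg k : V), sg *m pu = 0 -> inK k -> x *m L = sg *m Adm v + k -> x *m L = 0) ->
  exists+ rho, forall x (a w : G), `|x *m L| < rho -> AN a -> Ug w -> (v * e (x *m L) = a * w)%g ->
    hamiltonian_arc (@MW _ W) CMW pi0 (P v) (P w).
move=> hv Lt Linj; have [r [r1 [r10 r1r _ sl]]] := @slice_fun.
have [s s0 [Y [ka [sY ska [Y0 ka0] YK dP]]]] := dress_chart hv.
have os := @Bo_open _ _ (0 : V) s.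
have pqq : pq *m pq = pq by apply: row_ext => x; rewrite mulmxA pq_id //; exact: pq_in.
have sN : smx setT (fun y : V => pq *m phim (- adm y) *m pq + (1%:M - pq)) by msm.
have [|a5 a50 a5P] := unitmx_near (@openT V) sN (I : setT (0 : V)).
  by rewrite adm0 oppr0 phim0 mulmx1 pqq addrC subrK.
have e10 : 0 < Num.min r1 a5 by rewrite lt_min r10.
have [|rho rho0 rhoP] := conormal_fun (L := L) s0 e10 sY Y0.
  move=> x xY; have [|_ /(_ (x *m L))[sg [k [sg0 kK]]]] := dP 0; first by rewrite normr0.
  rewrite adm0 oppr0 phim0 mulmx1 ka0 adm0 expm0 mulmx1 Y0 e0 mulg1 xY mul0mx addr0 => E.
  apply: (Linj x sg (- k)) => //; last by rewrite -E addrK. by case: kK => kU kt; split; rewrite /inU mulNmx ?kU ?kt.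
exists rho => // x a w xr aAN hw E; have etas := fun Bf => rhoP x Bf xr.
have [eta etaE] : exists eta, eta = x *m L by exists (x *m L).
have et := Lt x; rewrite -etaE in et etas E.
pose xi z := eta *m expm (adm (ka z)); pose b z := xi z *m bm.
(* [b] is paired with left velocities; the transposed [phim] transfers it to slice coordinates. *)
pose Bf z := b z *m (phim (- adm (Y z)))^T.
have xit z : xi z *m ta = xi z.
  have [_ [_ kt]] := YK z; have := expm_tw (slide_comm kt).1. by rewrite /xi -mulmxA => <-; rewrite mulmxA et.
have bQ z : inQ (b z) by exact: bm_Q.
have sBf : smx (Bo 0 s) Bf by msm.
have BfE z q : dot (Bf z) q = dot (b z) (q *m phim (- adm (Y z))) by rewrite /Bf dot_mx trmxK.
pose u t := (v * e (Y (t *: eta)))%g.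
have YU z : inU (Y z) by have [[]] := YK z.
have hu t : Ug (u t) by apply: UgM_e.
pose w' t := eta *m jac Y (t *: eta) *m phim (- adm (Y (t *: eta))).
have w'K t : `|t *: eta| < s -> inK (w' t - 2^-1 *: (b (t *: eta) *m Pop (u t))).
  move=> ts; have [_ /(_ eta)[sg [k [sg0 kK Ek]]]] := dP _ ts.
  have [_ eph] : eta *m expm (- adm (t *: eta)) = eta /\ eta *m phim (- adm (t *: eta)) = eta by apply: expm_fix; rewrite admZ mulmxN -scalemxAr ld_adm_alt scaler0 oppr0.
  rewrite eph in Ek; apply: (dress_pop (hu t) (xit _) kK sg0 _ Ek). apply: inU_phim => //.
  have Y_pq : eta *m jac Y (t *: eta) *m pq = eta *m jac Y (t *: eta).
    have ts' : Bo 0 s (t *: eta) by rewrite Bo0.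
    have YE : (fun z : V => Y z *m pq) = Y by apply/funext => z; rewrite pq_id //; case: (YK z).
    by have h := jac_mulr pq os sY ts'; rewrite YE in h; rewrite -mulmxA -h.
  by rewrite -Y_pq; case: (pq_in (eta *m jac Y (t *: eta))).
have wQ z q : inQ z -> inU q -> dot z (q *m pq) = dot z q.
  move=> zQ qU; rewrite -[in RHS](qu_id qU) -pkq mulmxDr dotDr [X in _ + X](QK_dot zQ) ?addr0 //; exact: pk_in.
have {}etas := etas Bf sBf.
have B0 t : `|t *: eta| < s -> dot (b (t *: eta)) (w' t) = 0.
  move=> ts; have := QK_dot (bQ (t *: eta)) (w'K t ts); rewrite dotDr dotNr dotZr. have bU : inU (b (t *: eta)) by case: (bQ (t *: eta)).
  have := Pop_skew (hu t) bU bU; rewrite dotC => h; have -> : dot (b (t *: eta)) (b (t *: eta) *m Pop (u t)) = 0 by lra.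
  by rewrite mulr0 subr0.
have [|phi sphi [phi0 phiP]] := etas; first by move=> t _ ts; rewrite BfE; exact: B0.
have [|h [Ch hE _]] := sl v phi hv sphi.
  by move=> y hy; apply: phi0; apply: le_trans hy; rewrite ge_min lexx.
have KH := Kinv_CM Ch; have [CH _] := KH.
have gb t : `|t| < 2 -> grd (h \o P) (u t) = b (t *: eta).
  move=> t2; have [ts Yr dphi] := phiP t t2; move: Yr; rewrite lt_min => /andP[Yr1 Yr5].
  have gQ := Kinv_Q KH (hu t); have bQt := bQ (t *: eta).
  have key q : inQ q -> dot (grd (h \o P) (u t)) (q *m phim (- adm (Y (t *: eta)))) = dot (b (t *: eta)) (q *m phim (- adm (Y (t *: eta)))).
    move=> [qU qt]; have [dl dl0 dlP] := line_near q (lt_le_trans Yr1 r1r).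
    have yU s' : inU (Y (t *: eta) + s' *: q) by rewrite addrC; exact: inUL.
    have D1 := derive_CU_curve CH hv yU (mder_line (Y (t *: eta)) q); rewrite scale0r addr0 in D1.
    have D2 : is_D (0 : R) (fun s' => (h \o P) (v * e (Y (t *: eta) + s' *: q))%g : R^o) (dot (Bf (t *: eta)) q).
      apply: (der_loc dl0 _ (dphi q)) => s' /dlP hs; rewrite /= hE //; split; first exact: yU.
      by have [[_ Yt] _] := YK (t *: eta); rewrite mulmxDl Yt -scalemxAl qt scalerN opprD.
    by rewrite -BfE; exact: der_uniq D1 D2.
  (* The test directions are [q *m phim _] with [q] in i p0; as [Y] is small, [slice_solve] shows
     that their i p0 parts fill i p0. *)
  apply/eqP; rewrite -subr_eq0; apply/eqP; apply: dot_eq0. set d0 := grd _ _ - _; have dQ : inQ d0.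
    by case: gQ bQt => gU gt [bU bt]; split; [exact: inUB|rewrite mulmxBl gt bt opprD].
  have := a5P (Y (t *: eta)); rewrite subr0 => /(_ Yr5) uN. have [q qq qE] := slice_solve pqq (pq_id dQ) uN.
  have qQ : inQ q by rewrite -qq; exact: pq_in. have qU : inU q by case: qQ. rewrite -{2}qE wQ //; last exact: inU_phim.
  by rewrite /d0 dotBl (key q qQ) subrr.
have bd1 (c : R) : c < 2 -> - c < 2 -> `|c| < 2 by rewrite ltr_norml ltrNl => -> ->.
have h10 : (1 : R) < 2 by rewrite ltr1n.
(* The arc has to be defined on an open interval around [0, 1]; the one from -1/2 to 3/2 lies within
   [|t| < 2]. *)
exists h, (fun t => P (u t)), 2^-1; split=> //.
- by rewrite /u scale0r Y0 e0 mulg1.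
- have [|es _ _] := phiP 1; first by rewrite normr1. rewrite /u !scale1r in es *; have [[a' a'AN Ea] _] := dP eta es; rewrite E in Ea.
  have kK : K0g (e (ka eta)) by apply: gen_e; case: (YK eta).
  have hw1 : Ug (v * e (Y eta) * e (ka eta))%g by apply: genM; [exact: UgM_e|exact: K0_U].
  by rewrite (AN_uniq aAN a'AN hw hw1 Ea) (cosetK _ kK).
move=> t /andP[tl tr]; have t2 : `|t| < 2 by apply: bd1; move: tl tr; clear; lra.
split=> [|f Cf]; first by exists (u t).
have KF := Kinv_CM Cf; have [CF _] := KF; have [ts _ _] := phiP t t2.
have Ot : Bo 0 s (t *: eta) by rewrite Bo0.
have dy := jac_comp os sY Ot (mder_scale eta t).
have D1 := derive_CU_curve CF hv (fun s' => YU (s' *: eta)) dy.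
have E1 : dot (grd (f \o P) (u t)) (w' t) = pi0 f h (P (u t)).
  rewrite (pi0E Cf Ch (hu t)) (piU_Kinv KF KH (hu t)) (gb t t2).
  have gU := grd_in CF (hu t); have bU : inU (b (t *: eta)) by case: (bQ (t *: eta)).
  rewrite (Pop_skew (hu t) gU bU) mulrNN; have := QK_dot (Kinv_Q KF (hu t)) (w'K t ts).
  by rewrite dotDr dotNr dotZr => /eqP; rewrite subr_eq0 => /eqP.
by rewrite -E1; exact: D1.
Qed.

(** Linear algebra writes [g0] as the sum of the directions whose dressing fixes [v] (image of
    [Lm]), of directions in [k0], which do not move the coset ([Lk]), and of a complement on which
    the action on [U / K0] is infinitesimally free ([LC]). *)
Lemma orbit_matrices v : Ug v -> exists Lm LC Lk : 'M[R]_D, [/\ Lm + LC + Lk = 2^-1 *: (1%:M + ta),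
  forall x, x *m Lm *m ta = x *m Lm /\ x *m Lm *m Adm v^-1%g *m pu = 0, forall x, x *m LC *m ta = x *m LC, forall x, inK (x *m Lk) &
  forall x (sg k : V), sg *m pu = 0 -> inK k -> x *m LC = sg *m Adm v + k -> x *m LC = 0].
move=> hv; have hT := genT hv; set G2 : 'M[R]_D := 2^-1 *: _.
have G2t : G2 *m ta = G2 by rewrite /G2 -scalemxAl mulmxDl mul1mx ta_sq addrC.
have inG2 (z : V) : z *m ta = z -> (z <= G2)%MS by move=> zt; rewrite -(ta_half zt) -scalemxAl scalemxAr; exact: submxMl.
set S0 := (pa + pn) *m Adm v; pose A0 := (S0 :&: G2)%MS; pose T := (A0 + pk)%MS; pose T' := (T^C)%MS.
have TC : (T :&: T')%MS = 0 by exact: capmx_compl.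
have CT : (T' :&: T)%MS = 0 by rewrite capmxC.
have full : (G2 <= T + T')%MS by apply: submx_full; exact: addsmx_compl_full.
have /sub_addsmxP[[X1 X2] /= XE] : (G2 *m proj_mx T T' <= T)%MS by exact: proj_mx_sub.
have /submxP[Z1 Z1E] : (A0 <= S0)%MS by exact: capmxSl.
have /submxP[Z2 Z2E] : (A0 <= G2)%MS by exact: capmxSr.
have At : A0 *m ta = A0 by rewrite Z2E -mulmxA G2t.
have kt : pk *m ta = pk by apply: row_ext => z; rewrite mulmxA; case: (pk_in z).
have sumE : X1 *m A0 + G2 *m proj_mx T' T + X2 *m pk = G2 by rewrite addrAC -XE; exact: add_proj_mx TC full.
have LCt : G2 *m proj_mx T' T *m ta = G2 *m proj_mx T' T.
  have -> : G2 *m proj_mx T' T = G2 - X1 *m A0 - X2 *m pk.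
    rewrite -[X in _ = X - _ - _]sumE.
    by move: (X1 *m A0) (X2 *m pk) (G2 *m proj_mx T' T) => p q r; apply/matrixP => i j; rewrite !mxE; ring.
  by rewrite !mulmxBl G2t -!mulmxA At kt.
exists (X1 *m A0), (G2 *m proj_mx T' T), (X2 *m pk); split=> //.
- move=> x; split; first by rewrite -!mulmxA At. rewrite Z1E /S0 !mulmxA -[_ *m Adm v *m Adm _]mulmxA AdmVK // mulmx1; exact: pan_id.
- by move=> x; rewrite -mulmxA LCt.
- by move=> x; rewrite mulmxA; exact: pk_in.
move=> x sg k sg0 kK E; set c := x *m _ in E *.
have ct : c *m ta = c by rewrite /c -mulmxA LCt.
have cT' : (c <= T')%MS by rewrite /c mulmxA; exact: proj_mx_sub.
have cT : (c <= T)%MS.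
  rewrite E; apply: addmx_sub; last first.
    apply: submx_trans (addsmxSr _ _); case: kK => kU ktt. have -> : k = k *m pk by rewrite -[LHS](qu_id kU) -pkq mulmxDr pq_K // add0r.
    exact: submxMl.
  apply: submx_trans (addsmxSl _ _); rewrite sub_capmx; apply/andP; split.
    by move/pu_panP: sg0 => <-; rewrite -mulmxA; exact: submxMl.
  apply: inG2; have -> : sg *m Adm v = c - k by rewrite E addrK. by case: kK => kU ktt; rewrite mulmxBl ct ktt.
by apply/eqP; rewrite -submx0 -TC sub_capmx cT.
Qed.

Definition leafrel := clos_refl_sym_trans (set G) (hamiltonian_arc (@MW _ W) CMW pi0).

Lemma ta_sub : subalg (Ld := W) (2^-1 *: (1%:M + ta)) /\ forall x, inP (2^-1 *: (1%:M + ta)) x <-> x *m ta = x.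
have inT x : inP (2^-1 *: (1%:M + ta)) x <-> x *m ta = x.
  split=> [<-|xt]; last by rewrite /inP -scalemxAr scalemxAl ta_half. by rewrite -mulmxA -scalemxAl mulmxDl mul1mx ta_sq addrC.
split=> //; split=> [|x y /inT xt /inT yt].
  apply: row_ext => x; rewrite mulmxA; apply/inT. by rewrite -mulmxA -scalemxAl mulmxDl mul1mx ta_sq addrC.
by apply/inT; rewrite -mulmxA -(adm_ta xt) mulmxA yt.
Qed.

(** A small exponential of [g0] is factored along [orbit_matrices]: the first factor only changes
    the AN part, the middle one gives a Hamiltonian arc, and the last one stays in the coset. *)
Lemma orbit_local v : Ug v -> exists+ eps, forall x, x *m ta = x -> `|x| < eps ->
  forall a w : G, AN a -> Ug w -> (v * e x = a * w)%g -> leafrel (P v) (P w).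
move=> hv; have [Lm [LC [Lk [LE Lmt LCt LkK Linj]]]] := orbit_matrices hv.
have [rho rho0 rhoP] := dressing_arc hv LCt Linj; have [tS tP] := ta_sub.
have sub (L : 'M[R]_D) : (forall x, x *m L *m ta = x *m L) -> L *m (2^-1 *: (1%:M + ta)) = L by move=> h; apply: row_ext => x; rewrite mulmxA; apply/tP.
have [s s0 [gg [sg g0 gP]]] := exp_split tS LE (sub _ (fun x => (Lmt x).1)) (sub _ LCt) (sub _ (fun x => (LkK x).2)).
have sLC := smx_mulr LC (@Bo_open _ _ (0 : V) s) sg.
have [eps eps0 epsP] := smx_near0 s0 sLC (divr_gt0 rho0 (ltr0n _ 2)).
exists (Num.min s eps); first by rewrite lt_min s0.
move=> x xt; rewrite lt_min => /andP[xs xe] a w aAN hw E.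
have := epsP x xe; rewrite g0 mul0mx subr0 => hr.
have {}hr : `|gg x *m LC| < rho by apply: le_lt_trans hr _; move: rho0; clear; lra.
have hT := genT hv.
have [b bAN [w1 hw1 E1]] := U_mul_split hv (gen_e (I : setT (gg x *m LC))).
apply: rst_trans (rst_step _ _ _ _ (rhoP _ _ _ hr bAN hw1 E1)) _.
have mE : (v * e (gg x *m Lm) = e (gg x *m Lm *m Adm v^-1%g) * v)%g by rewrite AdmP' // -mulmxA AdmVK' // mulmx1.
have kK : K0g (e (gg x *m Lk)) by apply: gen_e; exact: LkK.
have := E; rewrite gP; [|by apply/tP|by []].
rewrite !mulgA mE -[(_ * v * _)%g]mulgA E1 !mulgA -[(_ * w1 * _)%g]mulgA => E2.
have hw2 : Ug (w1 * e (gg x *m Lk))%g by apply: genM => //; exact: K0_U.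
have bb : AN (e (gg x *m Lm *m Adm v^-1%g) * b)%g by apply: AN_mul => //; apply: exp_s_AN; case: (Lmt (gg x)).
by rewrite -(AN_uniq bb aAN hw2 hw E2) cosetK //; exact: rst_refl.
Qed.

(** Induction over the generators of [G0]. The radius in [orbit_local] depends on the point, so an
    exponential [e z] is crossed in small steps by [local_equiv]; quantifying over all
    factorizations in [F] makes the relation independent of choices. *)
Lemma orbit_leaf v (x a w : G) : Ug v -> G0g x -> AN a -> Ug w -> (v * x = a * w)%g -> leafrel (P v) (P w).
move=> hv hx; pose Q (x : G) := gen setT x /\ forall v (a w : G), Ug v -> AN a -> Ug w -> (v * x = a * w)%g -> leafrel (P v) (P w).
suff [_ H] : Q x by move=> ha hw; exact: H.
have triv (u b w1 : G) : Ug u -> AN b -> Ug w1 -> (u = b * w1)%g -> leafrel (P u) (P w1).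
  move=> hu bAN hw1 E; have := AN_uniq AN1 bAN hu hw1; rewrite mul1g => ->; rewrite ?E //. exact: rst_refl.
apply: (gen_ind (Q := Q) _ _ _ _ hx) => [|x1 x2 [T1 H1] [T2 H2]|x1 [T1 H1]|z /= zt].
- by split=> [|u b w1 hu hb hw1]; [exact: gen1|rewrite mulg1; exact: triv].
- split=> [|u b w1 hu hb hw1 E]; first exact: genM. have [b' hb' [w' hw' E']] := U_mul_split hu T1.
  apply: rst_trans (H1 _ _ _ hu hb' hw' E') _. apply: (H2 _ (b'^-1 * b)%g) => //; first by apply: AN_mul => //; exact: AN_inv.
  by apply: (mulgI b'); rewrite [LHS]mulgA -E' -mulgA E -[(b'^-1 * b * w1)%g]mulgA mulVKg.
- split=> [|u b w1 hu hb hw1 E]; first exact: genV. apply: rst_sym; apply: (H1 _ b^-1%g) => //; first exact: AN_inv.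
  by apply: (mulgI b); rewrite mulVKg mulgA -E mulgVK.
split=> [|u b w1 hu hb hw1 E]; first exact: gen_e.
pose F s t := forall (a1 a2 u1 u2 : G), AN a1 -> AN a2 -> Ug u1 -> Ug u2 ->
  (u * e (s *: z) = a1 * u1)%g -> (u * e (t *: z) = a2 * u2)%g -> leafrel (P u1) (P u2).
suff F01 : F 0 1.
  by apply: (F01 1%g b) => //; [exact: AN1|rewrite scale0r e0 mulg1 mul1g|rewrite scale1r].
have dec t : exists2 a1, AN a1 & exists2 u1, Ug u1 & (u * e (t *: z) = a1 * u1)%g by apply: U_mul_split => //; exact: gen_e.
apply: local_equiv => [t a1 a2 u1 u2 A1 A2 B1 B2 E1 E2|s t Fst a1 a2 u1 u2 A1 A2 B1 B2 E1 E2|r s t Frs Fst a1 a2 u1 u2 A1 A2 B1 B2 E1 E2|t _].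
- by rewrite (AN_uniq A1 A2 B1 B2 _) -?E1 //; exact: rst_refl.
- by apply: rst_sym; exact: (Fst a2 a1).
- have [a3 A3 [u3 B3 E3]] := dec s. by apply: rst_trans (Frs a1 a3 u1 u3 A1 A3 B1 B3 E1 E3) (Fst a3 a2 u3 u2 A3 A2 B3 B2 E3 E2).
have [a1 A1 [u1 B1 E1]] := dec t; have [eps eps0 epsP] := orbit_local B1.
have z1 : 0 < `|z| + 1 by rewrite ltr_wpDl.
exists (eps / (`|z| + 1)) => [|s _]; first by rewrite divr_gt0.
rewrite ltr_pdivlMr // => hs a1' a2 u1' u2 A1' A2 B1' B2 E1' E2.
have -> : u1' = u1 by apply: (AN_uniq A1' A1 B1' B1); rewrite -E1' -E1.
apply: (epsP ((s - t) *: z) _ _ (a1^-1 * a2)%g) => //.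
- by rewrite -scalemxAl zt.
- by rewrite normrZ; apply: le_lt_trans hs; rewrite ler_wpM2l // lerDl.
- by apply: AN_mul => //; exact: AN_inv.
apply: (mulgI a1); rewrite [LHS]mulgA -E1 -[(a1^-1 * a2 * u2)%g]mulgA mulVKg -E2 -mulgA; congr (_ * _)%g.
by rewrite -exp_add addrC subrK.
Qed.

Notation arc := (hamiltonian_arc (@MW _ W) CMW pi0).

Lemma arc_MW (x y : set G) : arc x y -> MW x /\ MW y.
move=> [h [c [eps [_ e0 <- <- cP]]]]; split; first by case: (cP 0) => //; apply/andP; split; lra.
by case: (cP 1) => //; apply/andP; split; lra.
Qed.
(** The chain of arcs passes through intermediate points of the ambient type; carrying membership in
    [MW] along provides the representatives in [U] that transitivity of [dorb] needs. *)
Lemma leaf_dorb (x y : set G) : clos_refl_sym_trans _ arc x y ->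
  (MW x <-> MW y) /\ forall u v, Ug u -> Ug v -> x = P u -> y = P v -> dorb u v.
elim=> {x y} [x y xy|x|x y _ [xy H]|x y z _ [xy H] _ [yz H']].
- split=> [|u v hu hv]; first by have [] := arc_MW xy. exact: arc_dorb xy hu hv.
- by split=> // u v _ _ -> /dorb_P.
- by split=> [|u v hu hv E1 E2]; [case: xy|apply: dorb_sym; exact: H].
split=> [|u v hu hv E1 E2]; first by split=> [/xy/yz|/yz/xy].
have /xy[w hw wE] : MW x by exists u.
by apply: (dorb_trans (v := w)); [exact: H|exact: H'].
Qed.

Lemma leaves_orbits : symplectic_leaves (@MW _ W) CMW pi0 = (fun O => P @` O) @` (dressing_orbit AN (@Ug _ W) (@G0g _ W) @` (@Ug _ W)).
have E u : Ug u -> symplectic_leaf (@MW _ W) CMW pi0 (P u) = P @` dressing_orbit AN (@Ug _ W) (@G0g _ W) u.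
  move=> hu; apply/seteqP; split=> [y uy|_ [v [x hx [hv [a ha Ex]]] <-]]; last exact: (orbit_leaf hu hx ha hv Ex).
  have [[h _] H] := leaf_dorb uy; have [|v hv vE] := h; first by exists u. have [x hx [a ha Ex]] := H u v hu hv erefl (esym vE).
  by exists v => //; exists x => //; split=> //; exists a.
apply/seteqP; split=> [_ [_ [u hu <-] <-]|_ [_ [u hu <-] <-]].
  by exists (dressing_orbit AN (@Ug _ W) (@G0g _ W) u); [exists u|rewrite E].
by exists (P u); [exists u|rewrite E].
Qed.
End Leaves.

(** * Transfer of the real coordinate model to the objects of the theorem *)

Section Translation.
Context {R : realType} {g0 : lieAlgType R} {g : lieAlgType R[i]}.
Variable iota : g0 -> g.
Hypothesis cx : complexification iota.
Variables (k0 p0 : {vspace g0}).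
Hypothesis cd0 : cartan_decomposition k0 p0.
Notation T := (theta_inv cx cd0).
Variable rd : rootDatum T.
Hypothesis b_iwasawa : iwasawa_borel iota (rd_b rd).
Variables (G : topGroupType) (d : nat) (A : set (chart R G d)).
Hypothesis G_lie : lie_group A.
Variable lam : g -> (G -> R) -> G -> R.
Hypothesis lamP : lie_algebra_iso A lam.
Variable ex : g -> G.
Hypothesis exP : exponential_map A lam ex.
Notation W := (iwa b_iwasawa G_lie lamP exP).
Notation rho := (rho T).
Notation crr := (crr T).
Notation V := 'rV[R]_(ld_D W).

Lemma rthW (v : V) : rho (v *m id_th W) = T (rho v). Proof. exact: (rth cx cd0 v). Qed.
Lemma rtaW (v : V) : rho (v *m id_ta W) = cjg cx (rho v). Proof. exact: (rta cx cd0 v). Qed.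
Lemma rhoZ_crr (a : R) (x : g) : rho (a *: (crr x : V)) = (a%:C)%C *: x.
by have := @rhoZ R g T a (crr x); rewrite crrK. Qed.
Lemma gen_analytic (S' : set V) (S : set g) : (forall v : V, S (rho v) <-> S' v) -> analytic_subgroup ex S = @gen _ W S'.
move=> SS; congr (smallest _ _); apply/seteqP; split=> [_ [x Sx <-]|_ [v Sv <-]].
  by exists (crr x); [apply/SS; rewrite crrK|rewrite /= crrK].
by exists (rho v) => //; apply/SS.
Qed.
Lemma rho_U (v : V) : compact_form iota k0 p0 (rho v) <-> @inU _ W v.
split=> [/(compact_formP cx cd0) h|h]; first by apply: (rho_inj (T := T)); exact: etrans (rthW v) h.
by apply/(compact_formP cx cd0); rewrite -[in RHS]h; apply/esym; exact: rthW.
Qed.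
Lemma rho_G0 (v : V) : range iota (rho v) <-> v *m id_ta W = v.
split=> [[x _ xE]|h]; last first.
  by have [x ->] := cjg_fix (etrans (esym (rtaW v)) (congr1 rho h)); exists x.
by apply: (rho_inj (T := T)); apply: etrans (rtaW v) _; rewrite -xE cjg_iota.
Qed.
Lemma rho_K0 (v : V) : (iota @` [set` k0]) (rho v) <-> @inK _ W v.
split=> [[x xk xE]|[/rho_U vU /rho_G0[x _ xE]]].
  split; last by apply/rho_G0; exists x. by apply/rho_U; exists x, 0; rewrite -xE (iota0 cx) scaler0 addr0 rpred0.
exists x => //; apply: (sig_k cd0); move/(compact_formP cx cd0): vU; rewrite -xE theta_iota.
move=> xs; apply/eqP; rewrite -subr_eq0; apply/eqP/(iota_inj cx).
by rewrite (iotaD cx) (iotaN cx) xs subrr.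
Qed.

Lemma U_eq : analytic_subgroup ex (compact_form iota k0 p0) = @Ug _ W.
exact: gen_analytic rho_U. Qed.
Lemma G0_eq : analytic_subgroup ex (range iota) = @G0g _ W.
exact: gen_analytic rho_G0. Qed.
Lemma K0_eq : analytic_subgroup ex (iota @` [set` k0]) = @K0g _ W.
exact: gen_analytic rho_K0. Qed.
Lemma AN_eq : [set (x * y)%g | x in ex @` [set x | x \in rd_h rd /\ T x = - x] & y in ex @` [set` rd_n rd]] = @AN _ W.
have ext (S' : set V) (S : set g) : (forall v : V, S (rho v) <-> S' v) -> ex @` S = (@ld_e _ W) @` S'.
  move=> SS; apply/seteqP; split=> [_ [x Sx <-]|_ [v Sv <-]].
    by exists (crr x); [apply/SS; rewrite crrK|rewrite /= crrK].
  by exists (rho v) => //; apply/SS.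
rewrite /AN (ext (@inA _ W)) ?(ext (@inN _ W)) // => v.
  split=> [h|h]; last by rewrite -h (_ : rho _ = dec_n rd (rho v)); [case: (decP rd (rho v))|exact: rpn].
  by apply: (rho_inj (T := T)); apply: etrans (rpn _ _) _; case: (dn h).
split=> [h|h]; last by rewrite -h (_ : rho _ = dec_a rd (rho v)); [case: (decP rd (rho v))|exact: rpa].
by apply: (rho_inj (T := T)); apply: etrans (rpa _ _) _; case: (da h).
Qed.

Lemma CU_eqW : smooth_on_subgroup ex (compact_form iota k0 p0) = @CUW _ W.
apply/seteqP; split=> f Cf u hu m x xU.
  rewrite -U_eq in hu; have := Cf u hu m (fun i => rho (x i)) (fun i => (rho_U _).2 (xU i)).
  by congr (smooth _ _); apply/funext => t /=; rewrite rho_sum; under [in RHS]eq_bigr do rewrite rhoZ.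
rewrite U_eq in hu; have := Cf u hu m (fun i => crr (x i)).
have xU' i : @inU _ W (crr (x i)) by apply/rho_U; rewrite crrK.
move/(_ xU'); congr (smooth _ _); apply/funext => t /=; rewrite rho_sum.
by congr (f (_ * ex _)%g); apply: eq_bigr => i _; rewrite rhoZ_crr.
Qed.
Lemma CM_eqW : smooth_on_cosets ex (compact_form iota k0 p0) (analytic_subgroup ex (iota @` [set` k0])) = @CMW _ W.
by rewrite /smooth_on_cosets /CMW CU_eqW K0_eq. Qed.
Lemma piU_eq : pi_U ex T (rd_Dp rd) (@rd_E _ _ _ rd) = @piU _ W.
apply/funext => f; apply/funext => h; apply/funext => u; rewrite /pi_U /piU; congr (_ * _); apply: eq_bigr => al _.
have eE (t : R) x : @ld_e _ W (t *: (crr x : V)) = ex ((t%:C)%C *: x) by exact: (congr1 ex (rhoZ_crr t x)).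
have rE x f' u' : right_inv_field ex x f' u' = @rf _ W (crr x) f' u'.
  apply: (congr1 (fun F : R -> R^o => derive1 F 0)); apply/funext => t. by rewrite eE.
have lE x f' u' : left_inv_field ex x f' u' = @lf _ W (crr x) f' u'.
  apply: (congr1 (fun F : R -> R^o => derive1 F 0)); apply/funext => t. by rewrite eE.
by rewrite /wedge !rE !lE.
Qed.
End Translation.

Theorem proposition1p1 (R : realType)
  (g0 : lieAlgType R) (g : lieAlgType R[i]) (iota : g0 -> g)
  (g0_semisimple : semisimple g0)
  (g_complexification : complexification iota)
  (k0 p0 : {vspace g0})
  (k0_p0_cartan : cartan_decomposition k0 p0)
  (tau theta : g -> g)
  (tau_conj : conjugation (range iota) tau)
  (theta_conj : conjugation (compact_form iota k0 p0) theta)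
  (G : topGroupType) (d : nat) (atlas : set (chart R G d))
  (G_lie : lie_group atlas)
  (G_connected : connected [set: G])
  (G_simply_connected : simply_connected R G)
  (lam : g -> (G -> R) -> G -> R)
  (G_lie_algebra : lie_algebra_iso atlas lam)
  (ex : g -> G)
  (ex_exponential : exponential_map atlas lam ex)
  (b h : {vspace g})
  (b_iwasawa : iwasawa_borel iota b)
  (h_cartan : cartan_subalgebra h)
  (h_sub_b : (h <= b)%VS)
  (h_tau : forall x, x \in h -> tau x \in h)
  (h_theta : forall x, x \in h -> theta x \in h)
  (Dp : seq (functional h))
  (Dp_uniq : uniq Dp)
  (Dp_roots : forall al : functional h, al \in Dp <-> borel_roots b al)
  (n : {vspace g})
  (n_span : is_root_span [set` Dp] n)
  (E : functional h -> g)
  (E_root : forall al, al \in Dp -> root_space al (E al))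
  (E_normalized : forall al, al \in Dp -> killing (E al) (theta (E al)) = -1) :
  let u := compact_form iota k0 p0 in
  let U := analytic_subgroup ex u in
  let G0 := analytic_subgroup ex (range iota) in
  let K0 := analytic_subgroup ex (iota @` [set` k0]) in
  let a := [set x | x \in h /\ theta x = - x] in
  let AN := [set (x * y)%g | x in ex @` a & y in ex @` [set` n]] in
  let p := left_coset K0 in
  let M := coset_space U K0 in
  let CU := smooth_on_subgroup ex u in
  let CM := smooth_on_cosets ex u K0 in
  exists pi_0 : (set G -> R) -> (set G -> R) -> set G -> R,
    [/\ poisson_structure M CM pi_0,
        poisson_map U CU (pi_U ex theta Dp E) M CM pi_0 p &
        symplectic_leaves M CM pi_0 =
        (fun O => p @` O) @` (dressing_orbit AN U G0 @` U)].
(* A conjugation with respect to the compact form is determined by it, so [theta] can be replaced by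
   the constructed one, which carries the structure of [cptInv]. *)
have thE : theta = theta_inv g_complexification k0_p0_cartan :> (g -> g) by apply/funext => z; exact: theta_conjE.
subst theta.
pose rd := @RootDatum _ _ (theta_inv g_complexification k0_p0_cartan) _ _ _ _ _ h_cartan h_theta b_iwasawa.1 h_sub_b
  Dp_uniq Dp_roots n_span E_root E_normalized.
move: (b_iwasawa : iwasawa_borel iota (rd_b rd)) G_lie_algebra ex_exponential => bI lA xE.
pose W := iwa bI G_lie lA xE.
exists (@pi0 R W).
have UE := U_eq bI G_lie lA xE.
have G0E := G0_eq bI G_lie lA xE.
have K0E := K0_eq bI G_lie lA xE.
have ANE := AN_eq bI G_lie lA xE.
have CUE := CU_eqW bI G_lie lA xE.
have CME := CM_eqW bI G_lie lA xE.
have piE := piU_eq bI G_lie lA xE.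
have PP := @pi0_poisson R W; have PM := @pi0_map R W; have LO := @leaves_orbits R W.
rewrite /MW -CME -UE -K0E in PP.
rewrite /MW -CME -CUE -piE -UE -K0E in PM.
rewrite /MW -CME -ANE -UE -K0E -G0E in LO.
split; [exact: PP|exact: PM|exact: LO].
Qed.
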